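(* Let $z>0$, let $f\in L^2((0,1))$ and let $f_\varepsilon\in L^2(\Omega_\varepsilon)$ be a family with $\|f_\varepsilon-U_\varepsilon f\|_{L^2(\Omega_\varepsilon)}\to 0$ as $\varepsilon\to 0$. For each $\varepsilon>0$ let $u_\varepsilon$ be the unique (weak) solution of $$\begin{cases}(-\Delta+z)u_\varepsilon=f_\varepsilon & \text{in }\Omega_\varepsilon^{\mathrm p},\\ u_\varepsilon=0&\text{on }\partial T_\varepsilon,\\ \partial_\nu u_\varepsilon=0&\text{on }\partial\Omega_\varepsilon.\end{cases}$$ Then the $u_\varepsilon$ converge to a function $u\in H^1((0,1))$ in the sense that $$\|u_\varepsilon-U_\varepsilon u\|_{L^2(\Omega_\varepsilon)}\to 0\quad\text{as }\varepsilon\to 0,$$ and $u$ solves the ordinary differential equation $$\begin{cases}\left(-\frac{d^2}{dt^2}+z+\mu\right)u=f&\text{in }(0,1),\\ u'=0&\text{on }\partial(0,1),\end{cases}$$ where $\mu=2^{-N}S_N(N-2)$ and $S_N$ is the surface area of the unit sphere in $\mathbb R^N$.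
   Context: Let $N\ge 3$ and let $\Omega_0\subset\mathbb R^{N-1}$ be a bounded open set with boundary of class $C^2$. For $\varepsilon>0$ let $\Omega_\varepsilon:=\varepsilon\Omega_0\times(0,1)\subset\mathbb R^N$ (a domain), let $\delta_\varepsilon\in(0,\varepsilon)$ and $r_\varepsilon:=\delta_\varepsilon^{N/(N-2)}$. Let $L_\varepsilon:=\{i\in 2\delta_\varepsilon\mathbb Z^N:\operatorname{dist}(i,\partial\Omega_\varepsilon)>\delta_\varepsilon\}$, $T_\varepsilon:=\bigcup_{i\in L_\varepsilon}B_{r_\varepsilon}(i)$ (the holes) and $\Omega_\varepsilon^{\mathrm p}:=\Omega_\varepsilon\setminus T_\varepsilon$. Here $B_r(i)$ is the ball of radius $r$ centred at $i$. Points of $\Omega_\varepsilon$ are written $x=(\bar x,x_N)$ with $\bar x\in\varepsilon\Omega_0$, $x_N\in(0,1)$. For a function $\phi$ on $(0,1)$ set $\phi^*(\bar x,x_N):=\phi(x_N)$ and $U_\varepsilon\phi:=|\varepsilon\Omega_0|^{-1/2}\phi^*$, a function on $\Omega_\varepsilon$, where $|\varepsilon\Omega_0|$ is the $(N-1)$-dimensional Lebesgue measure. Weak solutions of the problem on $\Omega_\varepsilon^{\mathrm p}$ are sought in $\mathcal H^0_\varepsilon$, the closure in $H^1(\Omega_\varepsilon)$ of $\{\phi|_{\Omega_\varepsilon}:\phi\in C_0^\infty(\mathbb R^N\setminus T_\varepsilon)\}$; elements of $\mathcal H^0_\varepsilon$ are identified with their extension by zero to $\Omega_\varepsilon$.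
   Formalization: The assumption δ_ε/ε → 0 is added; with only δ_ε ∈ (0,ε) the claim fails, e.g. for Ω_0 a ball of radius 1/2, δ_ε = ε/2 and f = 1: for small ε no hole meets Ω_ε, so the limit is 1/z, which does not solve the equation with μ. *)

(* Defs.v *)
From HB Require Import structures.
From mathcomp Require Import all_boot all_order all_algebra.
From mathcomp Require Import all_classical all_reals all_analysis.

Set Implicit Arguments.
Unset Strict Implicit.
Unset Printing Implicit Defensive.
Import Order.TTheory GRing.Theory Num.Theory.
Import numFieldNormedType.Exports.
Local Open Scope classical_set_scope.
Local Open Scope ring_scope.

Section rV_measurable.
Context {R : realType} (n : nat).

Let coords (i : 'I_n) (x : 'rV[R]_n) : measurableTypeR R := x 0 i.

Let rV_set0 : g_sigma_preimage coords set0.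
Proof. exact: sigma_algebra0. Qed.

Let rV_setC A : g_sigma_preimage coords A -> g_sigma_preimage coords (~` A).
Proof. exact: sigma_algebraC. Qed.

Let rV_bigcup (F : _^nat) : (forall i, g_sigma_preimage coords (F i)) ->
  g_sigma_preimage coords (\bigcup_i (F i)).
Proof. exact: sigma_algebra_bigcup. Qed.

(* The product sigma-algebra, generated by the coordinates. *)
HB.instance Definition _ :=
  @isMeasurable.Build (measure_tuple_display default_measure_display)
    'rV[R]_n (g_sigma_preimage coords) rV_set0 rV_setC rV_bigcup.

Lemma measurable_coord (i : 'I_n) :
  measurable_fun setT (fun x : 'rV[R]_n => x 0 i : measurableTypeR R).
Proof.
move=> _ Y mY; rewrite setTI; apply: sub_sigma_algebra => /=.
rewrite -bigcup_seq/=; exists i => /=; first by rewrite mem_index_enum.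
by exists Y => //; rewrite setTI.
Qed.

Lemma measurable_rVP d (T : measurableType d) (f : T -> 'rV[R]_n) :
  (forall i, measurable_fun setT (fun t => f t 0 i : measurableTypeR R)) ->
  measurable_fun setT f.
Proof.
move=> mf _ A; rewrite setTI => mA.
suff : g_sigma_preimage coords `<=` [set B | measurable (f @^-1` B)] by exact.
apply: smallest_sub.
  split => [|B|F] /=.
  - by rewrite preimage_set0.
  - by rewrite setTD -preimage_setC => ?; exact: measurableC.
  - by rewrite preimage_bigcup => ?; exact: bigcupT_measurable.
rewrite -bigcup_seq/=; apply: bigcup_sub => i _ B [C mC <-] /=.
rewrite setTI -[X in measurable X]setTI.
exact: mf.
Qed.

End rV_measurable.

Section lebesgue_rV.
Context {R : realType}.

Definition rV_cons n (p : measurableTypeR R * 'rV[R]_n) : 'rV[R]_n.+1 :=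
  \row_i oapp (p.2 0) p.1 (unlift ord0 i).

Definition rV_uncons n (x : 'rV[R]_n.+1) : measurableTypeR R * 'rV[R]_n :=
  (x 0 ord0, \row_i x 0 (lift ord0 i)).

Lemma rV_consK n : cancel (@rV_cons n) (@rV_uncons n).
Proof.
move=> [a x]; rewrite /rV_uncons mxE unlift_none /=; congr pair.
by apply/rowP => i; rewrite !mxE liftK.
Qed.

Lemma rV_unconsK n : cancel (@rV_uncons n) (@rV_cons n).
Proof.
move=> x; apply/rowP => i; rewrite mxE.
by case: unliftP => [j|] -> //=; rewrite mxE.
Qed.

Lemma measurable_rV_cons n : measurable_fun setT (@rV_cons n).
Proof.
apply: measurable_rVP => i.
under eq_fun do rewrite mxE.
case: (unlift ord0 i) => [j|] /=; last exact: measurable_fst.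
exact: (measurableT_comp (measurable_coord j)).
Qed.

Lemma measurable_rV_uncons n : measurable_fun setT (@rV_uncons n).
Proof.
apply/measurable_fun_pairP; split; first exact: measurable_coord.
apply: measurable_rVP => i /=.
under eq_fun do rewrite mxE.
exact: measurable_coord.
Qed.

HB.instance Definition _ n :=
  isMeasurableFun.Build _ _ _ _ (@rV_cons n) (@measurable_rV_cons n).

Section step.
Variables (n : nat) (m : {sigma_finite_measure set 'rV[R]_n -> \bar R}).

Definition lebesgue_rV_step : set 'rV[R]_n.+1 -> \bar R :=
  pushforward (lebesgue_measure \x m)%E (@rV_cons n).

Let step0 : lebesgue_rV_step set0 = 0%E. Proof. exact: measure0. Qed.

Let step_ge0 A : (0 <= lebesgue_rV_step A)%E. Proof. exact: measure_ge0. Qed.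

Let step_sigma_additive : semi_sigma_additive lebesgue_rV_step.
Proof. exact: measure_semi_sigma_additive. Qed.

HB.instance Definition _ := isMeasure.Build _ _ _ lebesgue_rV_step
  step0 step_ge0 step_sigma_additive.

Lemma lebesgue_rV_step_sigma_finite : sigma_finite setT lebesgue_rV_step.
Proof.
have /sigma_finiteP[F [FT ndF Foo]] := sigma_finiteT (@lebesgue_measure R).
have /sigma_finiteP[G [GT ndG Goo]] := sigma_finiteT m.
exists (fun k => @rV_uncons n @^-1` (F k `*` G k)).
  apply/seteqP; split=> // x _ /=.
  have : setT (rV_uncons x).1 by [].
  rewrite FT => -[i _ Fi].
  have : setT (rV_uncons x).2 by [].
  rewrite GT => -[j _ Gj].
  exists (maxn i j) => //=; split.
    by move: Fi; exact/subsetPset/ndF/leq_maxl.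
  by move: Gj; exact/subsetPset/ndG/leq_maxr.
move=> k; have [mFk Fkoo] := Foo k; have [mGk Gkoo] := Goo k; split.
  rewrite -[X in measurable X]setTI; apply: measurable_rV_uncons => //.
  exact: measurableX.
rewrite /lebesgue_rV_step /pushforward -comp_preimage.
rewrite (_ : @rV_uncons n \o @rV_cons n = id); last exact/funext/rV_consK.
by rewrite product_measure1E// lte_mul_pinfty// ge0_fin_numE.
Qed.

HB.instance Definition _ := Measure_isSigmaFinite.Build _ _ _ lebesgue_rV_step
  lebesgue_rV_step_sigma_finite.

End step.

Fixpoint lebesgue_rV n : {sigma_finite_measure set 'rV[R]_n -> \bar R} :=
  if n is k.+1 then lebesgue_rV_step (lebesgue_rV k) else dirac (0 : 'rV[R]_0).

Lemma lebesgue_rV_box n (A : 'I_n -> set (measurableTypeR R)) :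
  (forall i, measurable (A i)) ->
  lebesgue_rV n [set x | forall i, A i (x 0 i)] =
  (\prod_(i < n) lebesgue_measure (A i))%E.
Proof.
elim: n A => [|n IH] A mA /=.
  by rewrite big_ord0 diracE mem_set//= => -[].
pose B := [set x : 'rV[R]_n | forall i, A (lift ord0 i) (x 0 i)].
have mB : measurable B.
  rewrite (_ : B = \bigcap_(i in [set: 'I_n])
      ((fun x : 'rV[R]_n => x 0 i : measurableTypeR R) @^-1` A (lift ord0 i))).
    apply: fin_bigcap_measurable => // i _.
    by rewrite -[X in measurable X]setTI; exact: measurable_coord.
  by apply/seteqP; split => x /= Bx => [i _|i]; exact: Bx.
rewrite big_ord_recl -IH// -/B /lebesgue_rV_step /pushforward.
rewrite -product_measure1E//.
congr (_ _); apply/seteqP; split => [p Ap|p [p1 p2] i] /=.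
  split=> /= [|i]; first by have := Ap ord0; rewrite mxE unlift_none.
  by have := Ap (lift ord0 i); rewrite mxE liftK.
by rewrite mxE; case: unliftP => [j|] ->.
Qed.

End lebesgue_rV.

Section geometry.
Context {R : realType}.

(* The library norm on 'rV[R]_n is the sup norm. *)
Definition enorm n (x : 'rV[R]_n) : R := Num.sqrt (\sum_i x 0 i ^+ 2).

Definition eball n (p : 'rV[R]_n) (r : R) : set 'rV[R]_n :=
  [set x | enorm (x - p) < r].

Definition closed_eball n (p : 'rV[R]_n) (r : R) : set 'rV[R]_n :=
  [set x | enorm (x - p) <= r].

Definition edist n (x : 'rV[R]_n) (A : set 'rV[R]_n) : R :=
  inf [set enorm (x - y) | y in A].

Definition bdry (T : topologicalType) (A : set T) : set T :=
  closure A `\` interior A.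

Definition domain (T : topologicalType) (A : set T) : Prop :=
  [/\ open A, A !=set0 & connected A].

(* Surface measure on the unit sphere, in polar coordinates: n times the volume
   of the cone with base A and apex 0. *)
Definition sphere_measure n (A : set 'rV[R]_n) : \bar R :=
  let cone := [set x | 0 < enorm x < 1 /\ A ((enorm x)^-1 *: x)] in
  (n%:R%:E * lebesgue_rV n cone)%E.

Definition sphere_area n : R :=
  fine (sphere_measure [set x : 'rV[R]_n | enorm x = 1]).

End geometry.

Section regularity.
Context {R : realType} {V : normedModType R}.

Definition iter_derive (s : seq V) (f : V -> R) : V -> R :=
  foldr (fun v g => 'D_v g) f s.

Definition Ck (k : nat) (f : V -> R) : Prop :=
  forall s : seq V, (size s <= k)%N ->
    continuous (iter_derive s f) /\
    ((size s < k)%N -> forall x v, derivable (iter_derive s f) x v).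

Definition Cinfty (f : V -> R) : Prop := forall k, Ck k f.

Definition test_fun (A : set V) : set (V -> R) :=
  [set phi | [/\ Cinfty phi, compact (closure [set x | phi x != 0])
                & closure [set x | phi x != 0] `<=` A]].

End regularity.

(* Near each boundary point, after relabelling and reorienting the coordinate
   axes, A is the region above the graph of a C^2 function. *)
Definition C2_boundary {R : realType} n (A : set 'rV[R]_n) : Prop :=
  forall p, bdry A p ->
    exists (k : 'I_n) (b : bool) (r : R) (gamma : 'rV[R]_n.-1 -> R),
      [/\ 0 < r, Ck 2 gamma &
          forall x, eball p r x ->
            (A x <-> gamma (col' k x) < (-1) ^+ b * x 0 k)].

Definition L2norm {R : realType} d (T : measurableType d)
    (mu : {measure set T -> \bar R}) (D : set T) (f : T -> R) : \bar R :=
  'N[mu]_2%:E[EFin \o (f \_ D)]%E.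

Definition in_L2 {R : realType} d (T : measurableType d)
    (mu : {measure set T -> \bar R}) (D : set T) (f : T -> R) : Prop :=
  (f \_ D) \in Lfun mu 2%:E.

Section sobolev_rV.
Context {R : realType} {n : nat}.
Implicit Types (Omega T : set 'rV[R]_n) (u phi : 'rV[R]_n -> R)
  (Du Dphi : 'I_n -> 'rV[R]_n -> R).

Local Notation mu := (lebesgue_rV n : {measure set 'rV[R]_n -> \bar R}).

Definition partial (i : 'I_n) phi : 'rV[R]_n -> R :=
  'D_(delta_mx 0 i : 'rV[R]_n) phi.

(* u is in H^1(Omega), with weak gradient Du. *)
Definition in_H1 Omega u Du : Prop :=
  in_L2 mu Omega u /\
  forall i, in_L2 mu Omega (Du i) /\
    forall psi, test_fun Omega psi ->
      (\int[mu]_(x in Omega) (u x * partial i psi x) =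
       - \int[mu]_(x in Omega) (Du i x * psi x))%R.

Definition H1norm Omega u Du : \bar R :=
  ((L2norm mu Omega u `^ 2 + \sum_i L2norm mu Omega (Du i) `^ 2) `^ 2^-1)%E.

(* The closure in H^1(Omega) of the restrictions to Omega of the functions in
   C_0^oo(R^n \ T). *)
Definition in_H0 Omega T u Du : Prop :=
  in_H1 Omega u Du /\
  forall eta : R, 0 < eta -> exists2 phi, test_fun (~` T) phi &
    (H1norm Omega (u \- phi)%R (fun i => Du i \- partial i phi)%R < eta%:E)%E.

Definition weak_solution Omega T (z : R) (f u : 'rV[R]_n -> R) : Prop :=
  exists2 Du, in_H0 Omega T u Du &
    forall phi Dphi, in_H0 Omega T phi Dphi ->
      (\int[mu]_(x in Omega `\` T)
          (\sum_i Du i x * Dphi i x + z * u x * phi x) =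
       \int[mu]_(x in Omega `\` T) (f x * phi x))%R.

End sobolev_rV.

Section interval.
Context {R : realType}.
Local Notation mu :=
  (lebesgue_measure : {measure set (measurableTypeR R) -> \bar R}).
Local Notation I01 := (`]0, 1[%classic : set R).

(* u is in H^1((0,1)), with weak derivative u'. *)
Definition in_H1_01 (u u' : R -> R) : Prop :=
  [/\ in_L2 mu I01 u, in_L2 mu I01 u' &
    forall psi, test_fun I01 psi ->
      (\int[mu]_(t in I01) (u t * derive1 psi t) =
       - \int[mu]_(t in I01) (u' t * psi t))%R].

(* - u'' + c u = f in (0,1), u' = 0 on the boundary; u' denotes the
   representative of the weak derivative that is continuous on [0,1]. *)
Definition neumann_solution (c : R) (f u : R -> R) : Prop :=
  exists u' u'' : R -> R,
    [/\ in_H1_01 u u', in_H1_01 u' u'',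
        {within `[0, 1], continuous u'},
        (forall t, bdry I01 t -> u' t = 0) &
        {ae mu, forall t, I01 t -> - u'' t + c * u t = f t}].

End interval.

Section thin_domain.
Context {R : realType} {n : nat}.
Implicit Types (Omega : set 'rV[R]_n.+1).

Definition xbar (x : 'rV[R]_n.+1) : 'rV[R]_n :=
  \row_j x 0 (widen_ord (leqnSn n) j).

Definition xlast (x : 'rV[R]_n.+1) : R := x 0 ord_max.

Definition scaled (e : R) (Omega0 : set 'rV[R]_n) : set 'rV[R]_n := [set e *: y | y in Omega0].

Definition thin (Omega0 : set 'rV[R]_n) (e : R) : set 'rV[R]_n.+1 :=
  [set x | scaled e Omega0 (xbar x) /\ 0 < xlast x < 1].

Definition hole_radius (delta : R) : R := delta `^ (n.+1%:R / (n.+1%:R - 2)).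

Definition centers Omega (delta : R) : set 'rV[R]_n.+1 :=
  [set i : 'rV[R]_n.+1 | (forall k, exists m : int, i 0 k = 2 * delta * m%:~R) /\
           delta < edist i (bdry Omega)].

Definition holes Omega (delta : R) : set 'rV[R]_n.+1 :=
  \bigcup_(i in centers Omega delta) closed_eball i (hole_radius delta).

Definition U_eps (Omega0 : set 'rV[R]_n) (e : R) (phi : R -> R)
    (x : 'rV[R]_n.+1) : R :=
  fine (lebesgue_rV n (scaled e Omega0)) `^ (- 2^-1) * phi (xlast x).

End thin_domain.

Definition strange_mu {R : realType} (N : nat) : R :=
  2 ^- N * sphere_area N * (N%:R - 2).

(* Main.v *)
(* Idea: Tartar's oscillating test functions, with explicit error bounds on smooth functions.
   Let [w = 1 - bumps], where [bumps] sums over the holes the truncated capacitary potentials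
   [delta^N |x - c|^(2-N)], and let [W = w v] with [v = U_eps q], [q] a polynomial C^1-close to the
   solution [u] of the limit equation. Integrating by parts the terms in which [w - 1] multiplies
   [dv/dx_N], the energy form satisfies
     B(W, phi) = int (v' d_N phi + z v phi) + int grad w . grad (v phi) + small
   for every test function [phi] vanishing on the holes. On each ball of radius [delta] around a
   hole [grad w] is, up to a small error, the field [(N-2)(delta^N |x|^(-N) - 1) x], and for [g]
   vanishing near the centre
     N int_(B_delta) g = int_(B_delta) ((delta/|x|)^N - 1) x . grad g.
   Replacing balls by the cubes of side [2 delta] that tile the domain, up to a boundary layer of
   small relative volume since [delta / eps -> 0], turns the second integral into [mu int v phi].
   The weak form of the limit equation gives [B(W, phi) = (U_eps f, phi) + small], and testing
   with [phi = psi - W], [psi] close to [u_eps], bounds [u_eps - W]. *)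
Require Import Defs.
From HB Require Import structures.
From mathcomp Require Import all_boot all_order all_algebra.
From mathcomp Require Import all_classical all_reals all_analysis.
From mathcomp Require Import measurable_realfun.
From mathcomp Require Import ring lra.
Import Order.TTheory GRing.Theory Num.Theory.
Import numFieldNormedType.Exports.
Local Open Scope classical_set_scope.
Local Open Scope ring_scope.
Set Implicit Arguments.
Unset Strict Implicit.
Unset Printing Implicit Defensive.

(** * Lebesgue measure on row vectors *)

(** The domain changes with epsilon, so the constants of extension, trace or Poincare inequalities
    would change with it and are avoided: volumes are taken relative to that of the thin domain,
    through the normalisation alpha^2 |Omega| = 1, and cells are compared by translations along
    segments inside the domain. The obstacle is the smoothing of the corrector. A test function must
    vanish near the holes, so the potential is bent on a thin annulus r <= |y| <= r/(1 - 2 eta),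
    where the gradient error is of order 1/r. Since r^(N-2) = delta^N, all annuli together have
    relative volume r^2 times a quantity vanishing with eta. The two powers of r cancel: this L^2
    cost does not decrease with delta and is made small by eta alone. The constant mu comes out as
    (N-2) N |B_1| / 2^N, the last factor being the density of a ball in its cube. The parameters are
    fixed in the order tau, the C^1 distance from q to u, which determines the bound Q of q and its
    derivatives, then eta and kappa, and last epsilon. *)

Section box.
Context {R : realType} (n : nat).

Definition box (A : 'I_n -> set (measurableTypeR R)) : set 'rV[R]_n :=
  [set x | forall i, A i (x 0 i)].

Lemma measurable_box A : (forall i, measurable (A i)) -> measurable (box A).
Proof.
move=> mA; rewrite (_ : box A = \bigcap_(i in [set: 'I_n])
    ((fun x : 'rV[R]_n => x 0 i : measurableTypeR R) @^-1` A i)).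
  apply: fin_bigcap_measurable => // i _.
  by rewrite -[X in measurable X]setTI; exact: measurable_coord.
by apply/seteqP; split => x /= Bx => [i _|i]; exact: Bx.
Qed.

(** Translation, dilation and the splitting of the last coordinate are all verified through this
    lemma, on boxes only. Boxes form a pi-system generating the product sigma-algebra, and the boxes
    over an exhaustion of the line by sets of finite measure exhaust the space. *)
Lemma rV_measure_unique (m : {measure set 'rV[R]_n -> \bar R}) :
  (forall A, (forall i, measurable (A i)) ->
     m (box A) = (\prod_(i < n) lebesgue_measure (A i))%E) ->
  forall S, measurable S -> lebesgue_rV n S = m S.
Proof.
move=> mE S mS.
have /sigma_finiteP[F [TF ndF Foo]] := sigma_finiteT (@lebesgue_measure R).
pose C := [set box A | A in [set A : 'I_n -> set (measurableTypeR R) |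
   forall i, measurable (A i)]].
have CE : @measurable _ 'rV[R]_n = <<s C >>.
  apply/seteqP; split.
    apply: smallest_sub; first exact: smallest_sigma_algebra.
    rewrite -bigcup_seq/=; apply: bigcup_sub => i _ B [D mD <-].
    (* A cylinder over the coordinate [i] is the box whose other sides are the whole line. *)
    apply: sub_sigma_algebra; exists (fun j => if j == i then D else setT).
      by move=> j /=; case: ifP.
    rewrite setTI; apply/seteqP; split => x /=.
      by move=> /(_ i); rewrite eqxx.
    by move=> Dx j; case: eqP => // ->.
  apply: smallest_sub; first exact: sigma_algebra_measurable.
  by move=> _ [A mA <-]; exact: measurable_box.
apply: (measure_unique C (fun k => box (fun=> F k))) => //.
- move=> _ _ [A mA <-] [B mB <-]; exists (fun i => A i `&` B i).
    by move=> i; exact: measurableI.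
  apply/seteqP; split => x /=.
    by move=> ABx; split => i; have [] := ABx i.
  by move=> [Ax Bx] i; split; [exact: Ax|exact: Bx].
- by move=> k; exists (fun=> F k) => // i; have [] := Foo k.
- apply/seteqP; split => // x _.
  have /choice[k Hk] : forall i, exists k, F k (x 0 i).
    move=> i; have : setT (x 0 i) by [].
    by rewrite TF => -[k _ Fk]; exists k.
  (* The exhaustion is increasing, so the largest index serves every coordinate. *)
  exists (\max_i k i) => // i /=.
  by move: (Hk i); exact/subsetPset/ndF/leq_bigmax.
- by move=> _ [A mA <-]; rewrite mE//; exact: lebesgue_rV_box.
- move=> k; suff : (lebesgue_rV n (box (fun=> F k)) < +oo)%E by [].
  rewrite lebesgue_rV_box; last by move=> i; have [] := Foo k.
  rewrite ltey_eq; apply/orP; left.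
  elim/big_ind : _ => //; first exact: fin_numM.
  by move=> i _; rewrite ge0_fin_numE//; have [] := Foo k.
Qed.

End box.

(** * Translations, dilations and the last coordinate *)

Section affine.
Context {R : realType}.
Local Notation mu := (@lebesgue_measure R).

Lemma lebesgue_measure_shift (a : R) (A : set (measurableTypeR R)) :
  measurable A -> mu ((fun x => x + a) @^-1` A) = mu A.
Proof.
move=> mA.
have mf : measurable_fun setT ((fun x => x + a) : measurableTypeR R -> measurableTypeR R).
  exact: measurable_funD.
pose F : {mfun _ >-> _} := HB.pack ((fun x => x + a) : measurableTypeR R -> measurableTypeR R)
  (isMeasurableFun.Build _ _ _ _ _ mf).
apply/esym/(@lebesgue_measure_unique R (pushforward mu F)) => //.
move=> _ [[b c]] _ <-.
rewrite -[RHS]/(mu (F @^-1` _)) (_ : F @^-1` _ = `]b - a, c - a]%classic).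
  rewrite !lebesgue_measure_itv/= !lte_fin ltrD2r.
  by case: ifP => // _; congr (_%:E); ring.
by apply/seteqP; split => x /=; rewrite !in_itv/= ltrBlDr lerBrDr.
Qed.

Lemma lebesgue_measure_dilate (c : R) (A : set (measurableTypeR R)) : 0 < c ->
  measurable A -> mu ((fun x => c * x) @^-1` A) = ((c^-1)%:E * mu A)%E.
Proof.
move=> c0 mA.
have mf : measurable_fun setT ((fun x => c * x) : measurableTypeR R -> measurableTypeR R).
  exact: measurable_funM.
pose F : {mfun _ >-> _} := HB.pack ((fun x => c * x) : measurableTypeR R -> measurableTypeR R)
  (isMeasurableFun.Build _ _ _ _ _ mf).
pose m0 : {measure set (measurableTypeR R) -> \bar R} :=
  mscale (NngNum (ltW c0)) (pushforward mu F).
pose m := m0 mf.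
have mE B : m B = (c%:E * mu ((fun x => c * x)%R @^-1` B))%E by [].
rewrite (_ : mu A = m A).
  by rewrite mE muleA -EFinM mulVf ?mul1e// gt_eqF.
move: A mA; apply: (@lebesgue_measure_unique R m).
move=> _ [[a b]] _ <-.
rewrite mE (_ : _ @^-1` _ = `]c^-1 * a, c^-1 * b]%classic).
  rewrite !lebesgue_measure_itv/= !lte_fin ltr_pM2l ?invr_gt0//.
  by case: ifP => _; rewrite ?mule0// -EFinM -mulrBr mulrA mulfV ?mul1r// gt_eqF.
by apply/seteqP; split => x /=; rewrite !in_itv/= ltr_pdivrMl// ler_pdivlMl.
Qed.

End affine.

Section affine_rV.
Context {R : realType} (n : nat).

Lemma measurable_shift (a : 'rV[R]_n) :
  measurable_fun setT (fun x : 'rV[R]_n => x + a).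
Proof.
apply: measurable_rVP => i; under eq_fun do rewrite mxE.
by apply: measurable_funD => //; exact: measurable_coord.
Qed.

Lemma measurable_dilate (c : R) :
  measurable_fun setT (fun x : 'rV[R]_n => c *: x).
Proof.
apply: measurable_rVP => i; under eq_fun do rewrite mxE.
by apply: measurable_funM => //; exact: measurable_coord.
Qed.

Lemma lebesgue_rV_shift (a : 'rV[R]_n) (S : set 'rV[R]_n) : measurable S ->
  lebesgue_rV n ((fun x => x + a) @^-1` S) = lebesgue_rV n S.
Proof.
move=> mS.
apply/esym; move: S mS.
pose m0 : {measure set 'rV[R]_n -> \bar R} :=
  pushforward (lebesgue_rV n) (fun x : 'rV[R]_n => x + a).
apply: (@rV_measure_unique R n (m0 (measurable_shift a))).
move=> A mA.
rewrite -[LHS]/(lebesgue_rV n ((fun x : 'rV[R]_n => x + a) @^-1` box A)).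
have -> : (fun x : 'rV[R]_n => x + a) @^-1` box A =
    box (fun i => (fun x => x + a 0 i) @^-1` A i).
  by apply/seteqP; split => x /= H i; have := H i; rewrite ?mxE.
rewrite lebesgue_rV_box; first by apply: eq_bigr => i _; rewrite lebesgue_measure_shift.
move=> i; rewrite -[X in measurable X]setTI.
suff : measurable_fun setT ((fun x => x + a 0 i) : measurableTypeR R -> measurableTypeR R).
  by apply.
exact: measurable_funD.
Qed.

Lemma lebesgue_rV_dilate (c : R) (S : set 'rV[R]_n) : 0 < c -> measurable S ->
  lebesgue_rV n ((fun x => c *: x) @^-1` S) = ((c ^- n)%:E * lebesgue_rV n S)%E.
Proof.
move=> c0 mS.
have cn0 : 0 <= c ^+ n by rewrite exprn_ge0// ltW.
pose m0 : {measure set 'rV[R]_n -> \bar R} := mscale (NngNum cn0)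
  (pushforward (lebesgue_rV n) (fun x : 'rV[R]_n => c *: x)).
pose m := m0 (measurable_dilate c).
have mE A : m A = ((c ^+ n)%:E * lebesgue_rV n ((fun x => c *: x) @^-1` A))%E by [].
rewrite (_ : lebesgue_rV n S = m S).
  by rewrite mE muleA -EFinM mulVf ?mul1e// expf_neq0// gt_eqF.
move: S mS; apply: (@rV_measure_unique R n m).
move=> A mA; rewrite mE.
have -> : (fun x : 'rV[R]_n => c *: x) @^-1` box A =
    box (fun i => (fun x => c * x) @^-1` A i).
  by apply/seteqP; split => x /= H i; have := H i; rewrite ?mxE.
rewrite lebesgue_rV_box.
  rewrite (eq_bigr (fun i => (c^-1)%:E * lebesgue_measure (A i))%E); last first.
    by move=> i _; rewrite lebesgue_measure_dilate.
  rewrite big_split/= muleA.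
  rewrite (_ : (\prod_(i < n) _)%E = (c ^- n)%:E).
    by rewrite -EFinM mulfV ?mul1e// expf_neq0// gt_eqF.
  rewrite -exprVn; elim: (n) => [|k IH]; first by rewrite big_ord0.
  by rewrite big_ord_recl IH -EFinM exprS.
move=> i; rewrite -[X in measurable X]setTI.
suff : measurable_fun setT ((fun x => c * x) : measurableTypeR R -> measurableTypeR R).
  by apply.
exact: measurable_funM.
Qed.

End affine_rV.

Section snoc.
Context {R : realType} (n : nat).

(** [lebesgue_rV] is built by adding a first coordinate, whereas the thin domain singles out the
    last one. This map carries Fubini in the long direction. *)
Definition rV_snoc (p : 'rV[R]_n * measurableTypeR R) : 'rV[R]_n.+1 :=
  \row_i oapp (p.1 0) p.2 (unlift ord_max i).

Lemma xlast_snoc p : xlast (rV_snoc p) = p.2.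
Proof. by rewrite /xlast mxE unlift_none. Qed.

Lemma xbar_snoc p : xbar (rV_snoc p) = p.1.
Proof.
apply/rowP => i; rewrite !mxE.
have -> : widen_ord (leqnSn n) i = lift ord_max i.
  by apply: val_inj => /=; rewrite /bump leqNgt ltn_ord.
by rewrite liftK.
Qed.

Lemma snoc_xbar_xlast x : rV_snoc (xbar x, xlast x) = x.
Proof.
apply/rowP => i; rewrite !mxE; case: unliftP => [j|] -> //=; rewrite mxE.
by congr (x 0 _); apply: val_inj => /=; rewrite /bump leqNgt ltn_ord.
Qed.

Lemma measurable_rV_snoc : measurable_fun setT rV_snoc.
Proof.
apply: measurable_rVP => i.
under eq_fun do rewrite mxE.
case: (unlift ord_max i) => [j|] /=; last exact: measurable_snd.
exact: (measurableT_comp (measurable_coord j)).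
Qed.

Lemma measurable_xbar : measurable_fun setT (@xbar R n).
Proof.
apply: measurable_rVP => i; under eq_fun do rewrite mxE.
exact: measurable_coord.
Qed.

Lemma measurable_xlast : measurable_fun setT (@xlast R n : _ -> measurableTypeR R).
Proof. exact: measurable_coord. Qed.

HB.instance Definition _ :=
  isMeasurableFun.Build _ _ _ _ _ measurable_rV_snoc.

Lemma lebesgue_rV_snoc (S : set 'rV[R]_n.+1) : measurable S ->
  lebesgue_rV n.+1 S = pushforward (lebesgue_rV n \x lebesgue_measure)%E rV_snoc S.
Proof.
move: S; apply: rV_measure_unique => A mA.
rewrite -[LHS]/((lebesgue_rV n \x lebesgue_measure)%E (rV_snoc @^-1` box A)).
have -> : rV_snoc @^-1` box A =
    (box (fun i => A (lift ord_max i))) `*` A ord_max.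
  apply/seteqP; split => [p Ap|p [p1 p2] i] /=.
    split=> /= [i|]; last by have := Ap ord_max; rewrite mxE unlift_none.
    by have := Ap (lift ord_max i); rewrite mxE liftK.
  by rewrite mxE; case: unliftP => [j|] -> //=; exact: p1.
rewrite product_measure1E//; last exact: measurable_box.
rewrite big_ord_recr/=; congr (_ * _)%E.
rewrite [LHS](_ : _ = (\prod_(i < n) lebesgue_measure (A (lift ord_max i)))%E); last first.
  exact: lebesgue_rV_box.
apply: eq_bigr => i _; congr (lebesgue_measure (A _)).
by apply: val_inj => /=; rewrite /bump leqNgt ltn_ord.
Qed.

Local Open Scope ereal_scope.

Lemma ge0_integral_snoc (F : 'rV[R]_n.+1 -> \bar R) :
  measurable_fun setT F -> (forall x, 0 <= F x) ->
  \int[lebesgue_rV n.+1]_x F x =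
  \int[lebesgue_rV n]_y \int[lebesgue_measure]_t F (rV_snoc (y, t)).
Proof.
move=> mF F0.
rewrite (eq_measure_integral (pushforward (lebesgue_rV n \x lebesgue_measure) rV_snoc)).
  rewrite ge0_integral_pushforward//= ?preimage_setT.
  by rewrite fubini_tonelli1//; exact: measurableT_comp.
by move=> A mA _; exact: lebesgue_rV_snoc.
Qed.

Lemma integrable_snoc (F : 'rV[R]_n.+1 -> \bar R) :
  measurable_fun setT F -> (lebesgue_rV n.+1).-integrable setT F ->
  (lebesgue_rV n \x lebesgue_measure).-integrable setT (F \o rV_snoc).
Proof.
move=> mF iF; apply/integrable12ltyP; first exact: measurableT_comp.
have maF : measurable_fun setT (abse \o F) by exact: measurableT_comp.
have := ge0_integral_snoc maF (fun=> abse_ge0 _) => /= <-.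
by case/integrableP : iF.
Qed.

Lemma integral_snoc (F : 'rV[R]_n.+1 -> \bar R) :
  measurable_fun setT F -> (lebesgue_rV n.+1).-integrable setT F ->
  \int[lebesgue_rV n.+1]_x F x =
  \int[lebesgue_rV n]_y \int[lebesgue_measure]_t F (rV_snoc (y, t)).
Proof.
move=> mF iF.
rewrite (eq_measure_integral (pushforward (lebesgue_rV n \x lebesgue_measure) rV_snoc)).
  rewrite integral_pushforward//= ?preimage_setT; last exact: integrable_snoc.
  by rewrite -integral12_prod_meas1//; exact: integrable_snoc.
by move=> A mA _; exact: lebesgue_rV_snoc.
Qed.

End snoc.

Section change_of_variables.
Context {R : realType} (n : nat).
Local Open Scope ereal_scope.
Implicit Type F : 'rV[R]_n -> \bar R.

Lemma ge0_integral_shift F a : measurable_fun setT F -> (forall x, 0 <= F x) ->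
  \int[lebesgue_rV n]_x F (x + a)%R = \int[lebesgue_rV n]_x F x.
Proof.
move=> mF F0; have mS := measurable_shift a.
rewrite [RHS](eq_measure_integral
  (pushforward (lebesgue_rV n) (fun x : 'rV[R]_n => (x + a)%R))).
  by rewrite ge0_integral_pushforward//= ?preimage_setT.
by move=> A mA _; exact/esym/lebesgue_rV_shift.
Qed.

Lemma integral_shift F a : measurable_fun setT F ->
  \int[lebesgue_rV n]_x F (x + a)%R = \int[lebesgue_rV n]_x F x.
Proof.
move=> mF; rewrite integralE [RHS]integralE.
congr (_ - _).
- rewrite -[RHS](ge0_integral_shift a (measurable_funepos mF) (funepos_ge0 F)).
  by apply: eq_integral => x _; rewrite !funeposE.
- rewrite -[RHS](ge0_integral_shift a (measurable_funeneg mF) (funeneg_ge0 F)).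
  by apply: eq_integral => x _; rewrite !funenegE.
Qed.

Lemma ge0_integral_dilate F (c : R) : (0 < c)%R ->
  measurable_fun setT F -> (forall x, 0 <= F x) ->
  \int[lebesgue_rV n]_x F (c *: x)%R = (c ^- n)%:E * \int[lebesgue_rV n]_x F x.
Proof.
move=> c0 mF F0; have mS := @measurable_dilate R n c.
have cn0 : (0 <= c ^- n)%R by rewrite invr_ge0 exprn_ge0// ltW.
transitivity (\int[pushforward (lebesgue_rV n) (fun x : 'rV[R]_n => (c *: x)%R)]_x F x).
  by rewrite ge0_integral_pushforward//= ?preimage_setT.
transitivity (\int[mscale (NngNum cn0) (lebesgue_rV n)]_x F x); last first.
  by rewrite ge0_integral_mscale.
by apply: eq_measure_integral => A mA _; exact: lebesgue_rV_dilate.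
Qed.

Lemma integral_dilate F (c : R) : (0 < c)%R ->
  (lebesgue_rV n).-integrable setT F ->
  \int[lebesgue_rV n]_x F (c *: x)%R = (c ^- n)%:E * \int[lebesgue_rV n]_x F x.
Proof.
move=> c0 iF; have mF := measurable_int _ iF.
(* Unlike for translations, a factor has to be distributed over the difference of the positive and
   negative parts; integrability makes this legitimate. *)
rewrite integralE [in RHS]integralE muleBr//; last first.
  by rewrite fin_num_adde_defl// fin_numN integrable_neg_fin_num.
congr (_ - _).
- rewrite -[RHS](ge0_integral_dilate c0 (measurable_funepos mF) (funepos_ge0 F)).
  by apply: eq_integral => x _; rewrite !funeposE.
- rewrite -[RHS](ge0_integral_dilate c0 (measurable_funeneg mF) (funeneg_ge0 F)).
  by apply: eq_integral => x _; rewrite !funenegE.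
Qed.

End change_of_variables.

Section topology.
Context {R : realType} (n : nat).

Lemma ball_rVE (x : 'rV[R]_n) (r : R) : 0 < r ->
  ball x r = [set y | forall i, `|x 0 i - y 0 i| < r].
Proof.
move=> r0; rewrite /ball/=; apply/seteqP; split => y /=.
  by move=> [_ H] i; exact: (H 0 i).
by move=> H; split=> // i j; rewrite (ord1 i); exact: H.
Qed.

(** The sigma-algebra is generated by the coordinates, not by open sets. An open set is the union of
    the cubes it contains that have a rational centre and a radius 1/(k+1), and there are countably
    many of these. *)
Lemma measurable_open_rV (O : set 'rV[R]_n) : open O -> measurable O.
Proof.
move=> oO.
pose B (qk : 'rV[rat]_n * nat) : set 'rV[R]_n :=
  box (fun i => [set t | `|ratr (qk.1 0 i) - t| < qk.2.+1%:R^-1]).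
have mB qk : measurable (B qk).
  apply: measurable_box => i.
  rewrite (_ : [set t | _] = ball (ratr (qk.1 0 i) : R) qk.2.+1%:R^-1)//.
  exact: measurable_ball.
rewrite (_ : O = \bigcup_(qk in [set qk | B qk `<=` O]) B qk).
  rewrite bigcup_mkcond; apply: countable_bigcupT_measurable => // qk.
  by case: ifP.
apply/seteqP; split => [x Ox|x [qk qkO]]; last exact: qkO.
have /nbhs_ballP[e /= e0 xeO] : nbhs x O by move: oO; rewrite openE => /(_ _ Ox).
have [k ke] : exists k, k.+1%:R^-1 < e / 2.
  have e20 : 0 < e / 2 by rewrite divr_gt0.
  have [k _ /(_ k (leqnn k)) ?] := near_infty_natSinv_lt (PosNum e20).
  by exists k.
have k0 : 0 < k.+1%:R^-1 :> R by rewrite invr_gt0.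
have /choice[q qx] : forall i : 'I_n, exists q : rat, `|ratr q - x 0 i| < k.+1%:R^-1.
  move=> i.
  have : x 0 i - k.+1%:R^-1 < x 0 i + k.+1%:R^-1.
    by rewrite ltrBlDr -addrA ltrDl addr_gt0.
  move=> /rat_in_itvoo[q]; rewrite in_itv/= => /andP[q1 q2].
  by exists q; rewrite ltr_norml; apply/andP; split; rewrite ?ltrBrDl// ltrBlDl.
exists (\row_i q i, k) => /=; last by move=> i /=; rewrite mxE; exact: qx.
move=> y /= By; apply: xeO; rewrite ball_rVE//= => i.
rewrite (le_lt_trans (ler_distD (ratr (q i)) _ _))// (splitr e) ltrD//.
  by rewrite distrC (lt_trans (qx i)).
by have := By i; rewrite /= mxE => /lt_trans; exact.
Qed.

Lemma continuous_measurable_rV (f : 'rV[R]_n -> R) : continuous f ->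
  measurable_fun setT f.
Proof.
move=> cf; apply: (measurability _ (RGenOpens.measurableE R)) => //.
move=> _ [_ [a [b ->]] <-]; rewrite setTI; apply: measurable_open_rV.
by apply: open_comp => // x _; exact: cf.
Qed.

End topology.

Local Arguments lebesgue_rV : simpl never.

(** * Functions of class C^k *)

Section line_derivative.
Context {R : realType} {V : normedModType R}.
Implicit Types (f g : V -> R) (x v : V).

(** The two difference quotients coincide. Directional derivatives thus inherit the chain rule, the
    mean value theorem and the fundamental theorem from one real variable. *)
Lemma is_derive_line f x v (t : R) df : is_derive (t *: v + x) v f df ->
  is_derive t 1 (fun s : R => f (s *: v + x)) df.
Proof.
have E : (fun h : R => h^-1 *: (((fun s : R => f (s *: v + x)) \o shift t) (h *: 1)
      - f (t *: v + x))) =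
    (fun h : R => h^-1 *: ((f \o shift (t *: v + x)) (h *: v) - f (t *: v + x))).
  apply/funext => h /=; congr (_ *: (f _ - _)).
  by rewrite scalerDl -addrA -scalerA scale1r.
by case=> d e; split; [rewrite /derivable E|rewrite /derive E].
Qed.

Lemma line_is_derive f x v df :
  is_derive (0 : R) 1 (fun s : R => f (s *: v + x)) df -> is_derive x v f df.
Proof.
have E : (fun h : R => h^-1 *: (((fun s : R => f (s *: v + x)) \o shift 0) (h *: 1)
      - f (0 *: v + x))) =
    (fun h : R => h^-1 *: ((f \o shift x) (h *: v) - f x)).
  apply/funext => h /=; rewrite scale0r add0r addr0.
  by congr (_ *: (f _ - _)); rewrite -scalerA scale1r.
by case=> d e; split; [rewrite /derivable -E|rewrite /derive -E].
Qed.

Lemma is_derive_comp_dir (h : R -> R) f x v b df :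
  is_derive (f x) 1 h b -> is_derive x v f df ->
  is_derive x v (fun y => h (f y)) (b * df).
Proof.
move=> dh d; apply: line_is_derive.
have d' : is_derive (0 : R) 1 (fun s : R => f (s *: v + x)) df.
  by apply: is_derive_line; rewrite scale0r add0r.
apply: (@is_derive1_comp _ h (fun s : R => f (s *: v + x))).
by rewrite scale0r add0r.
Qed.

Lemma is_deriveZdir f x v df (c : R) :
  is_derive x v f df -> is_derive x (c *: v) f (c * df).
Proof.
move=> d; apply: line_is_derive.
have d' : is_derive (c * 0 : R) 1 (fun s : R => f (s *: v + x)) df.
  by apply: is_derive_line; rewrite mulr0 scale0r add0r.
rewrite (_ : (fun s : R => _) = (fun s : R => f (s *: v + x)) \o (fun s => c * s)); last first.
  by apply/funext => s /=; rewrite scalerA mulrC.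
rewrite mulrC; apply: is_derive1_comp.
have : is_derive (0 : R) (1 : R) (c *: (id : R -> R)) (c *: (1 : R)).
  exact: is_deriveZ.
by rewrite /GRing.scale/= mulr1.
Qed.

End line_derivative.

Section Ck_on.
Context {R : realType} {V : normedModType R}.
Implicit Types (f g : V -> R) (x v : V) (U : set V).

(** Recursive and local counterpart of [Ck]. The recursion turns closure under products and
    compositions into an induction on k, and the set [U] admits functions such as real powers, which
    are smooth only away from 0. *)
Fixpoint Ck_on (k : nat) U f : Prop :=
  (forall x, U x -> {for x, continuous f}) /\
  if k is k'.+1 then
    (forall x v, U x -> derivable f x v) /\ forall v, Ck_on k' U ('D_v f)
  else True.

Lemma Ck_on_cont k U f : Ck_on k U f -> forall x, U x -> {for x, continuous f}.
Proof. by case: k => [|k] []. Qed.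

Lemma Ck_onSS k U f : Ck_on k.+1 U f -> Ck_on k U f.
Proof.
elim: k f => [|k IH] f; first by case=> ? _.
move=> [cf [df Df]]; split => //; split=> // v; apply: IH; exact: Df.
Qed.

Lemma Ck_on_sub k U U' f : U' `<=` U -> Ck_on k U f -> Ck_on k U' f.
Proof.
move=> UU; elim: k f => [|k IH] f.
  by move=> [cf _]; split=> // x /UU/cf.
move=> [cf [df Df]]; split; first by move=> x /UU/cf.
by split=> [x v /UU/df//|v]; exact/IH/Df.
Qed.

Lemma Ck_on_eq k U f g : open U -> (forall x, U x -> f x = g x) ->
  Ck_on k U f -> Ck_on k U g.
Proof.
move=> oU; have nE (f' g' : V -> R) x : (forall x, U x -> f' x = g' x) -> U x ->
    \near x, f' x = g' x.
  move=> fg Ux; have : nbhs x U by apply: open_nbhs_nbhs.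
  by apply: filterS => y; exact: fg.
have cE f' g' : (forall x, U x -> f' x = g' x) ->
    (forall x, U x -> {for x, continuous f'}) ->
    forall x, U x -> {for x, continuous g'}.
  move=> fg cf x Ux; have := cf x Ux.
  rewrite /continuous_at /prop_for /= -(fg x Ux); apply: cvg_trans.
  by apply: near_eq_cvg; exact: nE.
elim: k f g => [|k IH] f g fg; first by move=> [cf _]; split => //; exact: cE cf.
move=> [cf [df Df]]; split; first exact: cE cf.
split=> [x v Ux|v]; first by apply: near_eq_derivable (df _ _ Ux); exact: nE.
by apply: IH (Df v) => x Ux; apply: near_eq_derive; exact: nE.
Qed.

(** All conditions are pointwise. The radial profile is glued this way from a formula valid for s >
    0 and a constant near 0. *)
Lemma Ck_on_cup k (U1 U2 : set V) f :
  Ck_on k U1 f -> Ck_on k U2 f -> Ck_on k (U1 `|` U2) f.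
Proof.
elim: k f => [|k IH] f.
  by move=> [c1 _] [c2 _]; split=> // x [/c1|/c2].
move=> [c1 [d1 D1]] [c2 [d2 D2]]; split; first by move=> x [/c1|/c2].
split; first by move=> x v [?|?]; [exact: d1|exact: d2].
by move=> v; apply: IH; [exact: D1|exact: D2].
Qed.

Lemma Ck_on_cst k U (c : R) : Ck_on k U (fun=> c).
Proof.
elim: k c => [|k IH] c; first by split=> // x _; exact: cst_continuous.
split; first by move=> x _; exact: cst_continuous.
split; first by move=> x v _; exact: derivable_cst.
move=> v; rewrite (_ : 'D_v _ = fun=> 0); first exact: IH.
by apply/funext => x; exact: derive_cst.
Qed.

Lemma Ck_onD k U f g : open U -> Ck_on k U f -> Ck_on k U g ->
  Ck_on k U (fun x => f x + g x).
Proof.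
move=> oU; elim: k f g => [|k IH] f g.
  move=> [cf _] [cg _]; split=> // x Ux.
  by apply: (@continuousD _ _ _ f g); [exact: cf|exact: cg].
move=> [cf [df Df]] [cg [dg Dg]]; split.
  by move=> x Ux; apply: (@continuousD _ _ _ f g); [exact: cf|exact: cg].
split=> [x v Ux|v]; first by apply: (@derivableD _ _ _ f g); [exact: df|exact: dg].
apply: Ck_on_eq (IH _ _ (Df v) (Dg v)) => // x Ux.
by apply/esym/(@deriveD _ _ _ f g); [exact: df|exact: dg].
Qed.

Lemma Ck_onM k U f g : open U -> Ck_on k U f -> Ck_on k U g ->
  Ck_on k U (fun x => f x * g x).
Proof.
move=> oU; elim: k f g => [|k IH] f g.
  move=> [cf _] [cg _]; split=> // x Ux.
  by apply: (@continuousM _ _ f g); [exact: cf|exact: cg].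
move=> Cf Cg; have Cf' := Ck_onSS Cf; have Cg' := Ck_onSS Cg.
move: Cf Cg => [cf [df Df]] [cg [dg Dg]]; split.
  by move=> x Ux; apply: (@continuousM _ _ f g); [exact: cf|exact: cg].
split=> [x v Ux|v]; first by apply: (@derivableM _ _ f g); [exact: df|exact: dg].
apply: (Ck_on_eq (f := fun x => f x * 'D_v g x + g x * 'D_v f x)) => //.
  move=> x Ux.
  by apply/esym/(@deriveM _ _ f g); [exact: df|exact: dg].
by apply: Ck_onD => //; apply: IH => //; [exact: Dg|exact: Df].
Qed.

Lemma Ck_on_sum k U (I : Type) (s : seq I) (F : I -> V -> R) : open U ->
  (forall i, Ck_on k U (F i)) -> Ck_on k U (fun x => \sum_(i <- s) F i x).
Proof.
move=> oU HF; elim: s => [|a s IH].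
  by under eq_fun do rewrite big_nil; exact: Ck_on_cst.
by under eq_fun do rewrite big_cons; exact: Ck_onD.
Qed.

Lemma Ck_onZ k U f (c : R) : open U -> Ck_on k U f -> Ck_on k U (fun x => c * f x).
Proof. by move=> oU Cf; apply: Ck_onM => //; exact: Ck_on_cst. Qed.

Lemma Ck_onB k U f g : open U -> Ck_on k U f -> Ck_on k U g ->
  Ck_on k U (fun x => f x - g x).
Proof.
move=> oU Cf Cg; apply: Ck_onD => //.
by under eq_fun do rewrite -mulN1r; exact: Ck_onZ.
Qed.

Lemma Ck_onX k U f m : open U -> Ck_on k U f -> Ck_on k U (fun x => f x ^+ m).
Proof.
move=> oU Cf; elim: m => [|m IH].
  by under eq_fun do rewrite expr0; exact: Ck_on_cst.
by under eq_fun do rewrite exprS; exact: Ck_onM.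
Qed.

(** [iter_derive] applies the last vector of the list first, so the induction peels lists from the
    right. *)
Lemma Ck_Ck_on k f : Ck k f <-> Ck_on k setT f.
Proof.
have iterE s v : iter_derive (rcons s v) f = iter_derive s ('D_v f).
  by rewrite /iter_derive foldr_rcons.
split.
  elim: k f {iterE} => [|k IH] f Cf.
    by split=> // x _; have [c _] := Cf [::] isT; exact: c.
  have [c d] := Cf [::] isT; split; first by move=> x _; exact: c.
  split; first by move=> x v _; exact: d.
  move=> v; apply: IH => s sk.
  have := Cf (rcons s v); rewrite size_rcons => /(_ sk).
  by rewrite /iter_derive foldr_rcons => -[c' d']; split=> // sk'; exact: d'.
elim: k f {iterE} => [|k IH] f.
  by move=> [cf _] [|//] _; split=> // x; exact: cf.
move=> [cf [df Df]] s; case/lastP: s => [_|s v].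
  by split=> [x|_ x v]; [exact: cf|exact: df].
rewrite size_rcons => sk; have [c d] := IH _ (Df v) s sk.
by rewrite /iter_derive foldr_rcons; split=> // sk'; exact: d.
Qed.

Lemma Cinfty_Ck_on f : Cinfty f <-> forall k, Ck_on k setT f.
Proof. by split=> H k; exact/Ck_Ck_on. Qed.

End Ck_on.

Section Ck_comp.
Context {R : realType} {V : normedModType R}.

Lemma Ck_on_comp k (A : set R) (U : set V) (h : R -> R) (f : V -> R) :
  open A -> open U -> (forall x, U x -> A (f x)) ->
  Ck_on k A h -> Ck_on k U f -> Ck_on k U (fun x => h (f x)).
Proof.
move=> oA oU UA; elim: k h => [|k IH] h.
  move=> [ch _] [cf _]; split=> // x Ux.
  by apply: (@continuous_comp _ _ _ f h); [exact: cf|exact/ch/UA].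
move=> [ch [dh Dh]] Cf; have Cf' := Ck_onSS Cf; case: Cf => [cf [df Df]].
split.
  by move=> x Ux; apply: (@continuous_comp _ _ _ f h); [exact: cf|exact/ch/UA].
have D x v : U x -> is_derive x v (fun y => h (f y)) ('D_1 h (f x) * 'D_v f x).
  move=> Ux; apply: is_derive_comp_dir; apply/derivableP; [exact/dh/UA|exact: df].
split=> [x v Ux|v]; first by have [] := D x v Ux.
apply: (Ck_on_eq (f := fun x => 'D_1 h (f x) * 'D_v f x)) => //.
  by move=> x Ux; have [_ ->] := D x v Ux.
by apply: Ck_onM => //; [exact: (IH ('D_1 h) (Dh 1) Cf')|exact: Df].
Qed.

End Ck_comp.

Section Ck_elementary.
Context {R : realType}.
Implicit Types (U : set R) (f df : R -> R).

Lemma Ck_on_id k U : Ck_on k U (fun x : R => x).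
Proof.
case: k => [|k]; first by split=> // x _.
split; first by move=> x _.
split; first by move=> x v _; exact: derivable_id.
move=> v; rewrite (_ : 'D_v _ = fun=> v); first exact: Ck_on_cst.
by apply/funext => x; exact: derive_id.
Qed.

Lemma Ck_on_step k U f df : open U ->
  (forall x, U x -> is_derive x 1 f (df x)) -> Ck_on k U df -> Ck_on k.+1 U f.
Proof.
move=> oU d Cdf; split.
  move=> x /d [dx _]; apply/differentiable_continuous/derivable1_diffP.
  exact: dx.
have D x v : U x -> is_derive x v f (v * df x).
  move=> /d dx; have := @is_deriveZdir R R f x 1 (df x) v dx.
  by rewrite /GRing.scale/= mulr1.
split=> [x v Ux|v]; first by have [] := D x v Ux.
apply: (Ck_on_eq (f := fun x => v * df x)) => //; last exact: Ck_onZ.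
by move=> x Ux; have [_ ->] := D x v Ux.
Qed.

Lemma open_neq0 : open [set x : R | x != 0].
Proof.
rewrite (_ : [set x : R | x != 0] = ~` [set 0]).
  by rewrite openC; exact: closed_eq.
by apply/seteqP; split => x /= /eqP.
Qed.

Lemma Ck_on_inv k : Ck_on k [set x : R | x != 0] (fun x => x^-1).
Proof.
have oU := open_neq0.
elim: k => [|k IH].
  by split=> // x x0; exact: inv_continuous.
apply: (Ck_on_step (df := fun x => -1 * (x^-1 ^+ 2))) => //.
  move=> x x0.
  have := @is_deriveV R id x 1 1 x0 (is_derive_id _ _).
  by rewrite exprVn mulN1r /GRing.scale/= mulr1.
by apply: Ck_onZ => //; apply: Ck_onX.
Qed.

Lemma Ck_on_expR k : Ck_on k [set: R] (@expR R).
Proof.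
elim: k => [|k IH]; first by split => // x _; exact: continuous_expR.
by apply: Ck_on_step IH => //; exact: openT.
Qed.

Lemma Ck_on_ln k : Ck_on k [set x : R | 0 < x] (@ln R).
Proof.
case: k => [|k]; first by split => // x x0; exact: continuous_ln.
apply: (Ck_on_step (df := fun x => x^-1)).
- exact: open_gt.
- by apply: (Ck_on_sub _ (@Ck_on_inv k)) => x /= x0; rewrite gt_eqF.
Qed.

Lemma Ck_on_powR k (a : R) : Ck_on k [set x : R | 0 < x] (fun x => x `^ a).
Proof.
have oU : open [set x : R | 0 < x] by exact: open_gt.
apply: (Ck_on_eq (f := fun x => expR (a * ln x))) => //.
  by move=> x /= x0; rewrite /powR gt_eqF.
apply: (Ck_on_comp (A := setT)) => //; first exact: openT.
- exact: Ck_on_expR.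
- by apply: Ck_onZ => //; exact: Ck_on_ln.
Qed.

Lemma Ck_on_horner k U (p : {poly R}) : Ck_on k U (fun x => p.[x]).
Proof.
apply: (@Ck_on_sub _ _ k setT) => //.
elim: k p => [|k IH] p; first by split => // x _; exact: continuous_horner.
apply: (@Ck_on_step k setT (fun x => p.[x]) (fun x => p^`().[x]) openT _ (IH _)) => x _; exact: is_derive_poly.
Qed.

End Ck_elementary.

(** * A smooth step function *)

Section flat.
Context {R : realType}.
Implicit Type p : {poly R}.

(* Polynomials [p] in [1 / s] are allowed so that the class is closed under derivation. *)
Definition flat p (s : R) : R := if 0 < s then p.[s^-1] * expR (- s^-1) else 0.

Lemma flat_bound p : exists2 C : R, 0 <= C & forall s, `|flat p s| <= C * `|s|.
Proof.
(* From exp(y/(k+1)) >= y/(k+1), raised to the power k+1. *)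
have mono k (y : R) : 0 < y -> y ^+ k * expR (- y) <= (k.+1%:R ^+ k.+1) * y^-1.
  move=> y0; rewrite expRN ler_pdivrMr ?expR_gt0// mulrAC ler_pdivlMr// -exprSr.
  have -> : expR y = expR (y / k.+1%:R) ^+ k.+1.
    by rewrite -expRM_natr -mulrA mulVf ?mulr1// pnatr_eq0.
  rewrite -exprMn lerXn2r// ?nnegrE ?mulr_ge0 ?expR_ge0 ?(ltW y0)//.
  rewrite mulrC -ler_pdivrMr ?ltr0n//.
  by rewrite (le_trans _ (expR_ge1Dx _))// lerDr.
exists (\sum_(k < size p) `|p`_k| * (k.+1%:R ^+ k.+1)).
  by apply: sumr_ge0 => k _; rewrite mulr_ge0.
move=> s; rewrite /flat; case: ifPn => [s0|_]; last first.
  by rewrite normr0 mulr_ge0// sumr_ge0// => k _; rewrite mulr_ge0.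
have y0 : 0 < s^-1 by rewrite invr_gt0.
rewrite horner_coef !mulr_suml (le_trans (ler_norm_sum _ _ _))// ler_sum// => k _.
rewrite -mulrA normrM -mulrA ler_wpM2l// (gtr0_norm s0).
by rewrite ger0_norm ?mulr_ge0 ?exprn_ge0 ?expR_ge0 ?(ltW y0)// -[s in leRHS]invrK mono.
Qed.

Lemma flat_cont0 p : {for 0, continuous (flat p)}.
Proof.
have [C C0 HC] := flat_bound p.
rewrite /prop_for /continuous_at {2}/flat ltxx.
apply/cvgr0Pnorm_lt => e e0; near=> s.
rewrite (le_lt_trans (HC s))// (@le_lt_trans _ _ ((C + 1) * `|s|))//.
  by rewrite ler_wpM2r// lerDl.
rewrite -ltr_pdivlMl ?ltr_wpDl//; near: s.
by apply: (cvgr0_norm_lt (fun s : R => s)) => //; rewrite mulr_gt0 ?invr_gt0 ?ltr_wpDl.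
Unshelve. all: by end_near. Qed.

(** With y = 1/s, the derivative of p(y) exp(-y) is y^2 (p(y) - p'(y)) exp(-y). *)
Lemma is_derive_flat p (s : R) : is_derive s 1 (flat p) (flat ('X^2 * (p - p^`())) s).
Proof.
have [s0|s0|->] := ltgtP s 0.
- have -> : flat ('X^2 * (p - p^`())) s = 0 by rewrite /flat ltNge (ltW s0).
  apply: near_eq_is_derive (is_derive_cst 0 s 1).
  near=> x; rewrite /flat ifF//; apply/negbTE; rewrite -leNgt ltW//.
  by near: x; exact: lt_nbhsl.
- have e : \near s, p.[s^-1] * expR (- s^-1) = flat p s.
    near=> x; rewrite /flat ifT//; near: x; exact: lt_nbhsr.
  apply: near_eq_is_derive e _.
  have sN0 : s != 0 by rewrite gt_eqF.
  have dV : is_derive s 1 (fun x => x^-1) (- s ^- 2).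
    by have := @is_deriveV R id s 1 1 sN0 (is_derive_id _ _); rewrite /GRing.scale/= mulr1.
  have dp : is_derive s 1 (fun x => p.[x^-1]) (p^`().[s^-1] * - s ^- 2).
    exact: (@is_derive1_comp _ (horner p) (fun x => x^-1)).
  have de : is_derive s 1 (fun x => expR (- x^-1)) (expR (- s^-1) * (s ^- 2)).
    have dN : is_derive s 1 (fun x => - x^-1) (s ^- 2).
      by have := is_deriveN dV; rewrite opprK.
    exact: (@is_derive1_comp _ expR (fun x => - x^-1)).
  have := is_deriveM dp de.
  rewrite /flat s0 /GRing.scale/= !hornerE/= exprVn.
  by congr (is_derive _ _ _ _); ring.
- rewrite [X in is_derive _ _ _ X]/flat ltxx.
  have E : (fun h : R => h^-1 *: ((flat p \o shift 0) (h *: 1) - flat p 0)) @ 0^' --> (0 : R).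
    have c0 : flat (p * 'X) x @[x --> 0^'] --> (0 : R).
      apply: cvg_within_filter; have := @flat_cont0 (p * 'X).
      by rewrite /prop_for /continuous_at {2}/flat ltxx.
    apply: cvg_trans c0; apply: near_eq_cvg; near=> h.
    have h0 : h != 0 by near: h; exact: nbhs_dnbhs_neq.
    rewrite /= addr0 /GRing.scale/= mulr1 /flat ltxx subr0.
    by case: ifP => _; rewrite ?mulr0// hornerMX mulrCA mulrA.
  split; first by apply/cvg_ex; exists 0.
  by apply/cvg_lim.
Unshelve. all: by end_near. Qed.

Lemma Ck_on_flat k p : Ck_on k [set: R] (flat p).
Proof.
elim: k p => [|k IH] p; last first.
  by apply: Ck_on_step (IH _); [exact: openT|move=> s _; exact: is_derive_flat].
split => // s _; apply/differentiable_continuous/derivable1_diffP.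
by have [] := is_derive_flat p s.
Qed.

End flat.

Section step.
Context {R : realType}.

Definition smooth_step (t : R) : R :=
  flat 1 (t - 1) / (flat 1 (t - 1) + flat 1 (2 - t)).

Lemma flat1_ge0 (t : R) : 0 <= flat 1 t.
Proof. by rewrite /flat; case: ifP => // _; rewrite hornerE mul1r expR_ge0. Qed.

Lemma flat1_gt0 (t : R) : 0 < t -> 0 < flat 1 t.
Proof. by rewrite /flat => ->; rewrite hornerE mul1r expR_gt0. Qed.

Lemma smooth_step_den (t : R) : 0 < flat 1 (t - 1) + flat 1 (2 - t).
Proof.
have [t1|t1] := ltP 1 t; first by rewrite ltr_pwDl ?flat1_ge0// flat1_gt0// subr_gt0.
by rewrite ltr_wpDl ?flat1_ge0// flat1_gt0//; lra.
Qed.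

Lemma smooth_step_ge0 t : 0 <= smooth_step t.
Proof. by rewrite divr_ge0 ?flat1_ge0// ltW// smooth_step_den. Qed.

Lemma smooth_step_le1 t : smooth_step t <= 1.
Proof. by rewrite ler_pdivrMr ?smooth_step_den// mul1r lerDl flat1_ge0. Qed.

Lemma smooth_step0 t : t <= 1 -> smooth_step t = 0.
Proof. by move=> t1; rewrite /smooth_step {1}/flat ltNge subr_le0 t1 mul0r. Qed.

Lemma smooth_step1 t : 2 <= t -> smooth_step t = 1.
Proof.
move=> t2; have := smooth_step_den t; rewrite /smooth_step.
have -> : flat 1 (2 - t) = 0 by rewrite /flat ltNge subr_le0 t2.
by rewrite addr0 => /lt0r_neq0/divff.
Qed.

Lemma Ck_on_smooth_step k : Ck_on k [set: R] smooth_step.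
Proof.
have o := @openT R.
have C1 : Ck_on k [set: R] (fun t => flat 1 (t - 1)).
  apply: (Ck_on_comp (A := setT)) => //; first exact: Ck_on_flat.
  by apply: Ck_onB => //; [exact: Ck_on_id|exact: Ck_on_cst].
have C2 : Ck_on k [set: R] (fun t => flat 1 (2 - t)).
  apply: (Ck_on_comp (A := setT)) => //; first exact: Ck_on_flat.
  by apply: Ck_onB => //; [exact: Ck_on_cst|exact: Ck_on_id].
apply: Ck_onM => //.
apply: (@Ck_on_comp _ _ k [set x | x != 0] setT (fun x => x^-1) _
  open_neq0 o _ (Ck_on_inv k) (Ck_onD o C1 C2)) => t _ /=.
by rewrite gt_eqF// smooth_step_den.
Qed.

(** The derivative vanishes off the compact interval [1, 2]. This bound is the constant [C] of all
    later gradient estimates. *)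
Lemma smooth_step_derive_bound :
  exists2 C : R, 0 <= C & forall t, `|'D_1 smooth_step t| <= C.
Proof.
have [_ [_ /(_ 1)[C0 _]]] := Ck_on_smooth_step 1.
have cD : continuous ('D_1 smooth_step) by move=> t; exact: C0.
have [c c12 cmax] : exists2 c, c \in `[1, 2]%R & forall t, t \in `[1, 2]%R ->
    `|'D_1 smooth_step t| <= `|'D_1 smooth_step c|.
  apply: (@EVT_max R (fun t => `|'D_1 smooth_step t|)); first by rewrite ler1n.
  apply: continuous_subspaceT => t.
  by apply: (@continuous_comp _ _ _ ('D_1 smooth_step) Num.norm); [exact: cD|exact: norm_continuous].
exists `|'D_1 smooth_step c| => // t.
have z (a : R) : (\near t, a = smooth_step t) -> 'D_1 smooth_step t = 0.
  by move=> h; rewrite -(@near_eq_derive R _ _ (cst a) smooth_step t 1 h) derive_cst.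
have [t1|t1] := ltP t 1.
  rewrite (z 0) ?normr0//; near=> x; rewrite smooth_step0// ltW//.
  by near: x; exact: lt_nbhsl.
have [t2|t2] := ltP 2 t.
  rewrite (z 1) ?normr0//; near=> x; rewrite smooth_step1// ltW//.
  by near: x; exact: lt_nbhsr.
by apply: cmax; rewrite in_itv/= t1.
Unshelve. all: by end_near. Qed.

End step.

(** * Directional derivatives and translates of C^1 functions *)

Section C1_calculus.
Context {R : realType} {V : normedModType R}.
Implicit Types (f : V -> R) (x v w : V).

Definition C1 f := Ck_on 1 [set: V] f.

Lemma C1_continuous f : C1 f -> continuous f.
Proof. by move=> [c _] x; exact: c. Qed.

Lemma C1_derive f x v : C1 f -> is_derive x v f ('D_v f x).
Proof. by move=> [_ [d _]]; apply/derivableP/d. Qed.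

Lemma C1_derive_continuous f v : C1 f -> continuous ('D_v f).
Proof. by move=> [_ [_ D]] x; have [c _] := D v; exact: c. Qed.

Lemma C1_line f x v (t : R) : C1 f ->
  is_derive t 1 (fun s : R => f (s *: v + x)) ('D_v f (t *: v + x)).
Proof. by move=> f1; apply: is_derive_line; exact: C1_derive. Qed.

Lemma C1_line_continuous f x v : C1 f -> continuous (fun s : R => f (s *: v + x)).
Proof.
move=> f1 t; apply/differentiable_continuous/derivable1_diffP.
by have [] := C1_line x v t f1.
Qed.

Lemma continuous_line (g : V -> R) x v : continuous g ->
  continuous (fun s : R => g (s *: v + x)).
Proof.
move=> cg t; apply: (@continuous_comp _ _ _ (fun s : R => s *: v + x) g); last exact: cg.
apply: continuousD; last exact: cst_continuous.
by apply: continuousZl => //; exact: cvg_id.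
Qed.

Lemma derive_scale f x v (c : R) : C1 f -> 'D_(c *: v) f x = c * 'D_v f x.
Proof. by move=> f1; have [] := is_deriveZdir c (C1_derive x v f1). Qed.

(** [Ck_on] provides directional derivatives only, so linearity in the direction has to come from
    their continuity. The increment is split at x + h v; the second piece is, by the mean value
    theorem, h times ['D_w f] at a point that tends to x. *)
Lemma derive_add f x v w : C1 f -> 'D_(v + w) f x = 'D_v f x + 'D_w f x.
Proof.
move=> f1; have [dvw _] := C1_derive x (v + w) f1.
have [dv _] := C1_derive x v f1.
apply/cvg_lim => //.
have cv : h^-1 *: ((f \o shift x) (h *: v) - f x) @[h --> 0^'] --> 'D_v f x by exact: dv.
have cw : h^-1 *: (f (h *: (v + w) + x) - f (h *: v + x)) @[h --> 0^'] --> 'D_w f x.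
  apply/cvgrPdist_lt => e e0.
  have /cvgrPdist_lt/(_ e e0) := @C1_derive_continuous f w f1 x.
  move=> /nbhs_ballP[d /= d0 xd].
  have M0 : 0 < `|v| + `|w| + 1 by rewrite ltr_wpDl ?addr_ge0.
  near=> h.
  have h0 : h != 0 by near: h; exact: nbhs_dnbhs_neq.
  have [c] : exists2 c, c \in `[0, 1]%R & f (1 *: (h *: w) + (h *: v + x)) -
      f (0 *: (h *: w) + (h *: v + x)) =
      'D_(h *: w) f (c *: (h *: w) + (h *: v + x)) * (1 - 0).
    apply: (@MVT_segment R (fun s => f (s *: (h *: w) + (h *: v + x)))
      (fun s => 'D_(h *: w) f (s *: (h *: w) + (h *: v + x)))) => //.
      by move=> t _; exact: C1_line.
    exact/continuous_subspaceT/C1_line_continuous.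
  rewrite scale1r scale0r add0r subr0 mulr1 derive_scale// addrA -scalerDr (addrC w).
  move=> c01 ->; rewrite /GRing.scale/= mulKf//; apply: xd.
  rewrite -ball_normE /ball_/= (_ : x - _ = - (c *: (h *: w) + h *: v)); last first.
    by rewrite addrA opprD addrCA subrr addr0.
  rewrite normrN (le_lt_trans (ler_normD _ _))// !normrZ.
  have hd : `|h| * (`|v| + `|w| + 1) < d.
    rewrite -ltr_pdivlMr//; near: h.
    by apply: dnbhs0_lt; rewrite divr_gt0.
  apply: le_lt_trans hd; rewrite mulrDr mulr1 mulrDr addrC -[leLHS]addr0 lerD//.
  rewrite lerD// ler_piMl ?mulr_ge0//.
  by move: c01; rewrite in_itv/= => /andP[c0 c1]; rewrite ger0_norm.
rewrite (_ : (fun h : R => h^-1 *: ((f \o shift x) (h *: (v + w)) - f x)) =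
    (fun h : R => h^-1 *: ((f \o shift x) (h *: v) - f x)) \+
    (fun h : R => h^-1 *: (f (h *: (v + w) + x) - f (h *: v + x)))).
  exact: cvgD.
by apply/funext => h /=; rewrite -scalerDr; congr (_ *: _); rewrite [RHS]addrC addrA subrK.
Unshelve. all: by end_near. Qed.

Lemma derive_sum_dir (I : Type) (s : seq I) (F : I -> V) f x : C1 f ->
  'D_(\sum_(i <- s) F i) f x = \sum_(i <- s) 'D_(F i) f x.
Proof.
move=> f1; elim: s => [|a s IH]; first by rewrite !big_nil derive0.
by rewrite !big_cons derive_add// IH.
Qed.

Lemma C1_FTC f x v (a b : R) : C1 f -> a < b ->
  (\int[lebesgue_measure]_(s in `[a, b]) ('D_v f (s *: v + x))%:E)%E =
  (f (b *: v + x) - f (a *: v + x))%:E.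
Proof.
move=> f1 ab.
rewrite (@continuous_FTC2 R _ (fun s => f (s *: v + x)))//.
- apply: continuous_subspaceT; apply: (@continuous_line ('D_v f)).
  exact: C1_derive_continuous.
- split.
  + by move=> t _; have [] := C1_line x v t f1.
  + by apply: cvg_at_right_filter; exact: C1_line_continuous.
  + by apply: cvg_at_left_filter; exact: C1_line_continuous.
- by move=> t _; rewrite derive1E; have [_ ->] := C1_line x v t f1.
Qed.

End C1_calculus.

Section C1_rV.
Context {R : realType} {n : nat}.
Implicit Types (f : 'rV[R]_n -> R) (x v : 'rV[R]_n).
Local Notation mu := (lebesgue_rV n).

Lemma derive_partial f x v : C1 f ->
  'D_v f x = \sum_i v 0 i * partial i f x.
Proof.
move=> f1; rewrite {1}(row_sum_delta v) derive_sum_dir//.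
by apply: eq_bigr => i _; rewrite derive_scale.
Qed.

Lemma measurable_line (g : 'rV[R]_n -> R) v : continuous g ->
  measurable_fun setT (fun xs : 'rV[R]_n * measurableTypeR R => g (xs.2 *: v + xs.1)).
Proof.
move=> cg.
apply: (measurableT_comp (continuous_measurable_rV cg)).
apply: measurable_rVP => i; under eq_fun do rewrite !mxE.
apply: measurable_funD; first by apply: measurable_funM.
exact: (measurableT_comp (measurable_coord i)).
Qed.

Lemma measurable_ray (g : 'rV[R]_n -> R) : continuous g ->
  measurable_fun setT (fun xs : 'rV[R]_n * measurableTypeR R => g (xs.2 *: xs.1)).
Proof.
move=> cg.
apply: (measurableT_comp (continuous_measurable_rV cg)).
apply: measurable_rVP => i; under eq_fun do rewrite !mxE.
apply: measurable_funM => //.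
exact: (measurableT_comp (measurable_coord i)).
Qed.

Lemma measurable_shift_set (A : set 'rV[R]_n) v : measurable A ->
  measurable [set x | A (x + v)].
Proof.
by move=> mA; rewrite -[X in measurable X]setTI; exact: (measurable_shift v).
Qed.

Local Open Scope ereal_scope.

(** The fundamental theorem along segments, then Tonelli: for fixed s the translate of [A] by s v
    lies in [Omega] and translation preserves the integral. The constant is 1 whatever the shape of
    the domain, which is what a domain depending on epsilon requires. *)
Lemma shift_diff_le f v (A Omega : set 'rV[R]_n) : C1 f ->
  measurable A -> measurable Omega ->
  (forall x (s : R), A x -> (0 <= s <= 1)%R -> Omega (s *: v + x)%R) ->
  \int[mu]_(x in A) `|(f (x + v) - f x)%:E| <=
  \int[mu]_(x in Omega) `|('D_v f x)%:E|.
Proof.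
move=> f1 mA mO AO.
have cD := C1_derive_continuous (v := v) f1.
have mf : measurable_fun setT f := continuous_measurable_rV (C1_continuous f1).
have mDf : measurable_fun setT ('D_v f) := continuous_measurable_rV cD.
have mline x : measurable_fun setT
    ((fun s : R => 'D_v f (s *: v + x)%R) : measurableTypeR R -> R).
  apply: continuous_measurable_fun; exact: (@continuous_line _ _ _ x v cD).
pose I := `[0%R, 1%R]%classic : set (measurableTypeR R).
pose G (xs : 'rV[R]_n * measurableTypeR R) : \bar R :=
  `|('D_v f (xs.2 *: v + xs.1))%:E| * (\1_A xs.1)%:E * (\1_I xs.2)%:E.
have mIA : measurable_fun setT (\1_A : 'rV[R]_n -> R) by exact: measurable_indic.
have mII : measurable_fun setT (\1_I : measurableTypeR R -> R).
  by apply: measurable_indic; exact: measurable_itv.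
have mG : measurable_fun setT G.
  apply: emeasurable_funM.
    apply: emeasurable_funM.
      apply: measurableT_comp => //; apply/measurable_EFinP.
      exact: (measurable_line v cD).
    apply/measurable_EFinP; exact: (measurableT_comp mIA measurable_fst).
  apply/measurable_EFinP; exact: (measurableT_comp mII measurable_snd).
have G0 xs : 0 <= G xs by rewrite /G !mule_ge0.
apply: (@le_trans _ _ (\int[mu]_x \int[lebesgue_measure]_s G (x, s))).
  rewrite integral_mkcond ge0_le_integral//.
  - by move=> x _; exact: erestrict_ge0.
  - apply/(measurable_restrictT _ mA)/measurable_funTS/measurableT_comp => //.
    apply/measurable_EFinP; apply: measurable_funB => //.
    exact: (measurableT_comp mf (measurable_shift v)).
  - exact: measurable_fun_fubini_tonelli_F.
  - move=> x _; rewrite patchE; case: ifPn => [/set_mem Ax|_]; last exact: integral_ge0.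
    have := C1_FTC x v f1 (@ltr01 R).
    rewrite scale1r scale0r add0r (addrC v x) => <-.
    apply: (le_trans (le_abse_integral _ _ _)) => //.
      by apply/measurable_EFinP; apply: measurable_funTS; exact: mline.
    rewrite integral_mkcond; apply: ge0_le_integral => //.
    + by move=> s _; exact: erestrict_ge0.
    + apply/(measurable_restrictT _ (measurable_itv _)).
      apply: measurableT_comp => //.
      by apply/measurable_EFinP; apply: measurable_funTS; exact: mline.
    + exact: (measurableT_comp mG (pair1_measurable x)).
    + move=> s _.
      have -> : G (x, s) = `|('D_v f (s *: v + x))%:E| * (\1_I s)%:E.
        by rewrite /G indicE mem_set// mule1.
      by rewrite patchE indicE; case: ifP => _; rewrite ?mule1 ?mule0.
rewrite fubini_tonelli//.
set K := \int[mu]_(x in Omega) _.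
have mI : measurable I by exact: measurable_itv.
(* The parameter interval has length 1, so the bound may be compared with the integrand at each
   fixed s. *)
have -> : K = \int[lebesgue_measure]_(s in I) cst K s.
  rewrite integral_cst// -[LHS]mule1; congr (_ * _); apply/esym.
  have := @lebesgue_measure_itv R `[0%R, 1%R].
  by rewrite /= lte_fin ltr01 -EFinB subr0.
have K0 : 0 <= K by exact: integral_ge0.
rewrite [X in _ <= X]integral_mkcond; apply: ge0_le_integral => //.
- by move=> s _; exact: integral_ge0.
- exact: measurable_fun_fubini_tonelli_G.
- by apply/(measurable_restrictT _ (measurable_itv _)); exact: measurable_cst.
- move=> s _; rewrite patchE; case: ifPn => [/set_mem sI|sI]; last first.
    rewrite (eq_integral (fun=> 0)) ?integral0// => x _.
    by rewrite /G [\1_I _]indicE (negbTE sI) mule0.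
  pose H x := (`|('D_v f x)%:E| * (\1_A (x - s *: v)%R)%:E).
  have mH : measurable_fun setT H.
    apply: emeasurable_funM.
      by apply: measurableT_comp => //; exact/measurable_EFinP.
    apply/measurable_EFinP; apply: (measurableT_comp mIA).
    exact: measurable_shift.
  rewrite (eq_integral (fun x => H (x + s *: v)%R)); last first.
    by move=> x _; rewrite /G /H [\1_I _]indicE mem_set// mule1 addrK addrC.
  rewrite ge0_integral_shift//; last by move=> x; rewrite /H mule_ge0.
  rewrite /K [X in _ <= X]integral_mkcond; apply: ge0_le_integral => //.
  + by move=> x _; rewrite /H mule_ge0.
  + apply/(measurable_restrictT _ mO)/measurable_funTS/measurableT_comp => //.
    exact/measurable_EFinP.
  + move=> x _; rewrite patchE /H indicE; case: ifPn => [_|/negP xO].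
      by case: (_ \in A); rewrite ?mule1// mule0.
    case: (boolP (_ \in A)) => [/set_mem Ax|]; last by rewrite mule0.
    exfalso; apply: xO; apply/mem_set.
    have := AO _ s Ax; rewrite addrC subrK; apply.
    by move: sI; rewrite /I/= in_itv.
Qed.

End C1_rV.

(** * L^2 estimates *)

Section L2.
Context d (T : measurableType d) {R : realType}.
Variables (mu : {measure set T -> \bar R}) (D : set T).
Hypothesis mD : measurable D.
Implicit Types f g : T -> R.

Definition L2 f := measurable_fun D f /\ mu.-integrable D (fun x => (f x ^+ 2)%:E).

Definition nrm f : R := Num.sqrt (\int[mu]_(x in D) (f x ^+ 2))%R.

Lemma L2normE f : L2norm mu D f = ((\int[mu]_(x in D) (f x ^+ 2)%:E) `^ 2^-1)%E.
Proof.
rewrite /L2norm unlock; congr (_ `^ _)%E; rewrite [RHS]integral_mkcond.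
apply: eq_integral => x _; rewrite !patchE /= powR_mulrn// patchE.
by case: ifPn => _; [rewrite real_normK ?num_real|rewrite normr0 expr0n].
Qed.

Lemma in_L2P f : in_L2 mu D f <-> L2 f.
Proof.
split=> [f2|[mf f2]].
  have := Lfun2_integrable_sqr f2 => i2.
  move: f2; rewrite /in_L2 inE => /andP[/[!inE]/= mf _]; split.
    exact/(measurable_restrictT _ mD).
  apply/(integrable_mkcond _ mD); apply: eq_integrable i2 => // x _.
  by rewrite /= !patchE; case: ifP => //; rewrite expr0n.
rewrite /in_L2 inE; apply/andP; split; rewrite inE/=.
  exact/(measurable_restrictT _ mD).
rewrite /finite_norm -/(L2norm mu D f) L2normE poweR_lty//.
by move/integrableP : f2 => [_]; under eq_integral do rewrite gee0_abs ?lee_fin ?sqr_ge0//.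
Qed.

Lemma L2norm_nrm f : L2 f -> L2norm mu D f = (nrm f)%:E.
Proof.
move=> [mf f2]; rewrite L2normE /nrm -powR12_sqrt; last first.
  by apply: Rintegral_ge0 => x _; exact: sqr_ge0.
by rewrite -poweR_EFin /Rintegral fineK// integrable_fin_num.
Qed.

Lemma L2M f g : L2 f -> L2 g -> mu.-integrable D (fun x => (f x * g x)%:E).
Proof.
move=> [mf f2] [mg g2].
apply: (le_integrable mD _ _ (integrableD mD f2 g2)).
  by apply/measurable_EFinP; exact: measurable_funM.
move=> x _ /=; rewrite lee_fin [leRHS]ger0_norm ?addr_ge0 ?sqr_ge0//.
rewrite ler_norml; apply/andP; split; nra.
Qed.

Lemma L2_sum f g : L2 f -> L2 g -> L2 (fun x => f x + g x).
Proof.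
move=> f2 g2; split; first by apply: measurable_funD; [case: f2|case: g2].
apply: (@eq_integrable _ _ _ mu D mD ((fun x => (f x ^+ 2)%:E) \+ (fun x => (g x ^+ 2)%:E)
  \+ (fun x => 2%:E * (f x * g x)%:E))%E).
  by move=> x _ /=; congr (_%:E); ring.
apply: integrableD => //; first by apply: integrableD => //; [case: f2|case: g2].
by apply: integrableZl => //; exact: L2M.
Qed.

Lemma L2_scale f (c : R) : L2 f -> L2 (fun x => c * f x).
Proof.
move=> [mf f2]; split; first exact: measurable_funM.
apply: (@eq_integrable _ _ _ mu D mD (fun x => (c ^+ 2)%:E * (f x ^+ 2)%:E)%E).
  by move=> x _; rewrite -EFinM exprMn.
exact: integrableZl.
Qed.

Lemma L2_sub f g : L2 f -> L2 g -> L2 (fun x => f x - g x).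
Proof.
move=> f2 g2; have := L2_sum f2 (L2_scale (-1) g2).
by under eq_fun do rewrite mulN1r.
Qed.

Lemma nrm_ge0 f : 0 <= nrm f. Proof. exact: sqrtr_ge0. Qed.

Lemma sqr_nrm f : nrm f ^+ 2 = (\int[mu]_(x in D) (f x ^+ 2))%R.
Proof. by rewrite sqr_sqrtr//; apply: Rintegral_ge0 => x _; exact: sqr_ge0. Qed.

Lemma nrm_scale f (c : R) : L2 f -> nrm (fun x => c * f x) = `|c| * nrm f.
Proof.
move=> [mf f2]; rewrite /nrm -sqrtr_sqr -sqrtrM ?sqr_ge0//; congr Num.sqrt.
by rewrite -RintegralZl//; apply: eq_Rintegral => x _; rewrite exprMn.
Qed.

Lemma nrm_sum_sq f g : L2 f -> L2 g ->
  nrm (fun x => f x + g x) ^+ 2 =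
  nrm f ^+ 2 + 2 * (\int[mu]_(x in D) (f x * g x))%R + nrm g ^+ 2.
Proof.
move=> f2 g2; rewrite !sqr_nrm.
have i1 : mu.-integrable D (EFin \o (fun x => f x ^+ 2)) by case: f2.
have i2 : mu.-integrable D (EFin \o (fun x => g x ^+ 2)) by case: g2.
have i3 : mu.-integrable D (EFin \o (fun x => f x * g x)) by exact: L2M.
have i4 : mu.-integrable D (EFin \o (fun x => 2 * (f x * g x))).
  by apply: (integrableZl mD (2 : R) i3).
rewrite -RintegralZl// -RintegralD// -RintegralD//.
  by apply: eq_Rintegral => x _; ring.
exact: (integrableD mD i1 i4).
Qed.

Lemma L2_CauchySchwarz f g : L2 f -> L2 g ->
  `|(\int[mu]_(x in D) (f x * g x))%R| <= nrm f * nrm g.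
Proof.
move=> f2 g2; set I := (X in `|X|).
have key (t : R) : 0 <= nrm f ^+ 2 + 2 * (t * I) + t ^+ 2 * nrm g ^+ 2.
  have := nrm_sum_sq f2 (L2_scale t g2).
  rewrite nrm_scale// exprMn real_normK ?num_real//.
  rewrite (_ : (\int[mu]_(x in D) (f x * (t * g x)))%R = t * I).
    by move=> <-; exact: sqr_ge0.
  by rewrite -RintegralZl//; [apply: eq_Rintegral => x _; ring|exact: L2M].
have F0 := nrm_ge0 f; have G0 := nrm_ge0 g.
move: (nrm f) (nrm g) F0 G0 key => a b a0 b0 key.
have [b00|b00] := eqVneq b 0.
  rewrite b00 mulr0; case: (eqVneq I 0) => [->|I0]; first by rewrite normr0.
  (* With b = 0 the expression is affine in t; this t gives it the value -1. *)
  have := key (- (a ^+ 2 + 1) / (2 * I)); rewrite b00 expr0n mulr0 addr0.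
  rewrite (_ : 2 * _ = - (a ^+ 2 + 1)); last by field.
  by move=> ?; exfalso; lra.
(* The minimiser of the quadratic in t. *)
have := key (- I / b ^+ 2).
rewrite (_ : _ + _ + _ = a ^+ 2 - I ^+ 2 / b ^+ 2); last by field.
rewrite subr_ge0 ler_pdivrMr ?exprn_gt0 ?lt_def ?b00// -exprMn.
by move=> h; rewrite -(@ler_pXn2r _ 2) ?nnegrE ?mulr_ge0// real_normK ?num_real.
Qed.

Lemma nrm_triangle f g : L2 f -> L2 g ->
  nrm (fun x => f x + g x) <= nrm f + nrm g.
Proof.
move=> f2 g2; rewrite -(@ler_pXn2r _ 2) ?nnegrE ?addr_ge0 ?nrm_ge0// nrm_sum_sq//.
have := le_trans (ler_norm _) (L2_CauchySchwarz f2 g2).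
by rewrite sqrrD; lra.
Qed.

Lemma eq_nrm f g : {in D, f =1 g} -> nrm f = nrm g.
Proof. by move=> fg; congr Num.sqrt; apply: eq_Rintegral => x xD; rewrite fg. Qed.

Lemma eq_L2 f g : {in D, f =1 g} -> L2 f -> L2 g.
Proof.
move=> fg [mf f2]; split; first exact: eq_measurable_fun mf.
by apply: eq_integrable f2 => // x xD; rewrite fg.
Qed.

Lemma bounded_L2 f (M : R) : (mu D < +oo)%E -> measurable_fun D f ->
  (forall x, D x -> `|f x| <= M) -> L2 f.
Proof.
move=> muD mf fM; split=> //.
apply: measurable_bounded_integrable => //; first exact: measurable_funX.
exists (M ^+ 2); split; first exact: num_real.
move=> y My x Dx; rewrite /= normrX (le_trans _ (ltW My))//.
by rewrite lerXn2r ?nnegrE ?fM// (le_trans (normr_ge0 (f x)))// fM.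
Qed.

End L2.

Lemma nrm_subset d (T : measurableType d) {R : realType}
    (mu : {measure set T -> \bar R}) (D D' : set T) (f : T -> R) :
  measurable D -> measurable D' -> D `<=` D' -> L2 mu D' f ->
  L2 mu D f /\ nrm mu D f <= nrm mu D' f.
Proof.
move=> mD mD' DD' [mf f2].
have f2' : mu.-integrable D (fun x => (f x ^+ 2)%:E) by exact: integrableS f2.
split; first by split=> //; exact: measurable_funS mf.
rewrite ler_wsqrtr// /Rintegral fine_le//; [exact: integrable_fin_num|exact: integrable_fin_num|].
apply: ge0_subset_integral => //; first exact: measurable_int f2.
by move=> x _; rewrite lee_fin sqr_ge0.
Qed.

(** * Fubini for bounded integrands and integrals of derivatives *)

Section Fubini_bounded.
Context d1 d2 (T1 : measurableType d1) (T2 : measurableType d2) {R : realType}.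
Variables (m1 : {sigma_finite_measure set T1 -> \bar R})
          (m2 : {sigma_finite_measure set T2 -> \bar R}).
Variables (A : set T1) (B : set T2) (g : T1 * T2 -> R) (M : R).
Hypotheses (mA : measurable A) (mB : measurable B).
Hypotheses (fA : (m1 A < +oo)%E) (fB : (m2 B < +oo)%E).
Hypothesis (mg : measurable_fun setT g).
Hypothesis gM : forall x y, A x -> B y -> `|g (x, y)| <= M.

Let h := (EFin \o g) \_ (A `*` B).

Let mAB : measurable (A `*` B). Proof. exact: measurableX. Qed.

Let mh : measurable_fun setT h.
Proof.
apply/(measurable_restrictT _ mAB); apply: measurable_funTS.
exact/measurable_EFinP.
Qed.

Let ih : ((m1 \x m2)%E).-integrable setT h.
Proof.
apply/(integrable_mkcond _ mAB); apply: measurable_bounded_integrable => //.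
- rewrite [X in (X < _)%E](_ : _ = (m1 A * m2 B)%E); last exact: product_measure1E.
  by rewrite lte_mul_pinfty// ge0_fin_numE.
- exact: measurable_funTS.
- exists M; split; first exact: num_real.
  by move=> y My [x1 x2] [/= Ax Bx]; exact: le_trans (gM Ax Bx) (ltW My).
Qed.

Let inner1 x : (\int[m2]_y h (x, y))%E =
  ((fun x => (\int[m2]_(y in B) g (x, y))%R%:E) \_ A) x.
Proof.
rewrite patchE; case: ifPn => [/set_mem Ax|xA].
  rewrite /Rintegral fineK.
    rewrite [RHS]integral_mkcond; apply: eq_integral => y _.
    by rewrite /h !patchE in_setX mem_set//= .
  apply: integrable_fin_num => //; apply: measurable_bounded_integrable => //.
    by apply: measurable_funTS; exact: (measurableT_comp mg (pair1_measurable x)).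
  exists M; split; first exact: num_real.
  by move=> y My z Bz; exact: le_trans (gM Ax Bz) (ltW My).
rewrite (eq_integral (fun=> 0%E)) ?integral0// => y _.
by rewrite /h patchE in_setX (negbTE xA).
Qed.

Let inner2 y : (\int[m1]_x h (x, y))%E =
  ((fun y => (\int[m1]_(x in A) g (x, y))%R%:E) \_ B) y.
Proof.
rewrite patchE; case: ifPn => [/set_mem By|yB].
  rewrite /Rintegral fineK.
    rewrite [RHS]integral_mkcond; apply: eq_integral => x _.
    by rewrite /h !patchE in_setX (mem_set By) andbT.
  apply: integrable_fin_num => //; apply: measurable_bounded_integrable => //.
    by apply: measurable_funTS; exact: (measurableT_comp mg (pair2_measurable y)).
  exists M; split; first exact: num_real.
  by move=> z Mz x Ax; exact: le_trans (gM Ax By) (ltW Mz).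
rewrite (eq_integral (fun=> 0%E)) ?integral0// => x _.
by rewrite /h patchE in_setX (negbTE yB) andbF.
Qed.

(** Boundedness on a product of sets of finite measure makes every inner integral finite, not merely
    almost every one, so nothing is lost when inner integrals are taken with real values. *)
Lemma bounded_Fubini :
  (\int[m1]_(x in A) (\int[m2]_(y in B) g (x, y)) =
   \int[m2]_(y in B) (\int[m1]_(x in A) g (x, y)))%R.
Proof.
rewrite /Rintegral; congr fine.
rewrite integral_mkcond [RHS]integral_mkcond.
rewrite -(eq_integral _ _ (fun x _ => inner1 x)).
rewrite -(eq_integral _ _ (fun x _ => inner2 x)).
exact: Fubini.
Qed.

Lemma integrable_inner1 :
  m1.-integrable A (fun x => (\int[m2]_(y in B) g (x, y))%R%:E).
Proof.
apply/(integrable_mkcond _ mA).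
rewrite -(funext inner1).
exact: integrable_fubini_F.
Qed.

End Fubini_bounded.

Section bounded_integrals.
Context {R : realType} {n : nat}.
Local Notation mu := (lebesgue_rV n).
Implicit Types (x v : 'rV[R]_n) (F : 'rV[R]_n -> R).

Lemma coord_le_norm x i : `|x 0 i| <= `|x|.
Proof.
rewrite [leRHS]/Num.norm /= mx_normrE; apply/bigmax_geP; right => /=.
by exists (ord0, i).
Qed.

Lemma norm_ltP x (M : R) : 0 < M -> (`|x| < M) <-> forall i, `|x 0 i| < M.
Proof.
move=> M0; split=> [xM i|H]; first exact: le_lt_trans (coord_le_norm x i) xM.
have : ball 0 M x by rewrite ball_rVE// => i; rewrite mxE sub0r normrN; exact: H.
by rewrite -ball_normE /ball_/= sub0r normrN.
Qed.

Definition nball (M : R) : set 'rV[R]_n := [set x | `|x| < M].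

Lemma open_nball M : open (nball M).
Proof.
apply: (@open_comp _ _ (fun x : 'rV[R]_n => `|x|) [set t | t < M]); last exact: open_lt.
by move=> x _; exact: norm_continuous.
Qed.

Lemma measurable_nball M : measurable (nball M).
Proof. by apply: measurable_open_rV; exact: open_nball. Qed.

Lemma bounded_measure_finite (A : set 'rV[R]_n) M : measurable A ->
  (forall x, A x -> `|x| <= M) -> (mu A < +oo)%E.
Proof.
move=> mA AM.
pose B : set 'rV[R]_n := box (fun=> `[- M, M]%classic).
have mB : measurable B by apply: measurable_box => i; exact: measurable_itv.
apply: (@le_lt_trans _ _ (mu B)).
  apply: le_measure; rewrite ?inE// => x /AM xM i /=.
  by rewrite in_itv/= -ler_norml (le_trans (coord_le_norm x i)).
rewrite ltey_eq; apply/orP; left.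
rewrite (_ : mu B = (\prod_(i < n) lebesgue_measure (`[(- M)%R, M]%classic : set (measurableTypeR R)))%E); last first.
  by apply: lebesgue_rV_box => i; exact: measurable_itv.
elim/big_ind : _ => //; first exact: fin_numM.
by move=> i _; rewrite lebesgue_measure_itv/=; case: ifP.
Qed.

Lemma nball_finite M : (mu (nball M) < +oo)%E.
Proof.
apply: (@bounded_measure_finite _ M) => [|x /ltW//]; exact: measurable_nball.
Qed.

Definition bsupp M F := forall x, M <= `|x| -> F x = 0.

Lemma bsupp_bounded M F : continuous F -> bsupp M F ->
  exists2 C, 0 <= C & forall x, `|F x| <= C.
Proof.
move=> cF F0.
have cpt : compact [set x : 'rV[R]_n | `|x| <= M].
  apply: bounded_closed_compact.
    exists M; split; first exact: num_real.
    by move=> y My x /= xM; exact: le_trans xM (ltW My).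
  apply: (@closed_comp _ _ (fun x : 'rV[R]_n => `|x|) [set t | t <= M]).
    by move=> x _; exact: norm_continuous.
  exact: closed_le.
have [x0|/nonemptyPn E] := pselect ([set x : 'rV[R]_n | `|x| <= M] !=set0); last first.
  exists 0 => // x; rewrite F0 ?normr0// leNgt; apply/negP => xM.
  by have : [set x : 'rV[R]_n | `|x| <= M] x; [exact: ltW|rewrite E].
have [c _ Hc] := @EVT_max_rV R n (fun x => `|F x|) _ x0 cpt
  (continuous_subspaceT (fun x => @continuous_comp _ _ _ F Num.norm x (cF x) (@norm_continuous _ _ (F x)))).
exists `|F c| => // x; have [xM|/ltW Mx] := leP `|x| M.
  by apply: Hc; rewrite inE.
by rewrite F0// normr0.
Qed.

Lemma bounded_integrable (A : set 'rV[R]_n) F C : measurable A -> (mu A < +oo)%E ->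
  measurable_fun A F -> (forall x, A x -> `|F x| <= C) ->
  mu.-integrable A (EFin \o F).
Proof.
move=> mA fA mF FC; apply: measurable_bounded_integrable => //.
exists C; split; first exact: num_real.
by move=> y My x Ax; exact: le_trans (FC x Ax) (ltW My).
Qed.

Lemma bsupp_integrable M F : continuous F -> bsupp M F ->
  mu.-integrable setT (EFin \o F).
Proof.
move=> cF F0; have [C C0 FC] := bsupp_bounded cF F0.
rewrite (_ : EFin \o F = (EFin \o F) \_ (nball M)).
  apply/(integrable_mkcond _ (measurable_nball M)).
  apply: (@bounded_integrable _ _ C) => //.
  - exact: measurable_nball.
  - exact: nball_finite.
  - by apply: measurable_funTS; exact: continuous_measurable_rV.
apply/funext => x; rewrite patchE; case: ifPn => // /negP xM /=.
by rewrite F0// leNgt; apply/negP => ?; apply: xM; rewrite inE.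
Qed.

Lemma bsupp_Rintegral M F (A : set 'rV[R]_n) : measurable A -> bsupp M F ->
  nball M `<=` A -> (\int[mu]_(x in A) F x = \int[mu]_x F x)%R.
Proof.
move=> mA F0 MA; rewrite [LHS]Rintegral_mkcond; apply: eq_Rintegral => x _.
rewrite patchE; case: ifPn => // /negP xA; rewrite F0// leNgt; apply/negP => xM.
by apply: xA; rewrite inE; exact: MA.
Qed.

(** The margin 1 leaves a whole neighbourhood on which [F] vanishes; on the sphere of radius [M]
    itself it is known to vanish on one side only. *)
Lemma bsupp_derive M F v : bsupp M F -> bsupp (M + 1) ('D_v F).
Proof.
move=> F0 x xM.
rewrite -(@near_eq_derive _ _ _ (cst 0) F x v) ?derive_cst//.
have : nbhs x [set y : 'rV[R]_n | M < `|y|].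
  apply: open_nbhs_nbhs; split.
    apply: (@open_comp _ _ (fun x : 'rV[R]_n => `|x|) [set t | M < t]); last exact: open_gt.
    by move=> y _; exact: norm_continuous.
  by rewrite /= (lt_le_trans _ xM)// ltrDl.
by apply: filterS => y /ltW/F0.
Qed.

Lemma Rintegral_shift F v : continuous F ->
  (\int[mu]_x F (x + v) = \int[mu]_x F x)%R.
Proof.
move=> cF; rewrite /Rintegral; congr fine.
have := @integral_shift R n (EFin \o F) v; apply.
by apply/measurable_EFinP; exact: continuous_measurable_rV.
Qed.

(** The integral of F(x + v) - F(x) is 0 by translation invariance. By the fundamental theorem and
    Fubini it is also the mean over s in [0, 1] of the integrals of ['D_v F] translated by s v, all
    of which are equal. *)
Lemma integral_derive0 M F v : C1 F -> bsupp M F -> (\int[mu]_x 'D_v F x = 0)%R.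
Proof.
move=> F1 F0; pose I := `[0, 1]%classic : set (measurableTypeR R).
have cD := C1_derive_continuous (v := v) F1; have cF := C1_continuous F1.
have D0 : bsupp (M + 1) ('D_v F) by exact: bsupp_derive.
have [C C0 DC] := bsupp_bounded cD D0.
(* This ball contains the supports of all translates of ['D_v F] by s v with 0 <= s <= 1. *)
pose K := M + 1 + `|v|.
have shiftK (G : 'rV[R]_n -> R) s : bsupp (M + 1) G -> 0 <= s <= 1 ->
    bsupp K (fun x => G (s *: v + x)).
  move=> G0 /andP[s0 s1] x xK; apply: G0.
  have := lerB_normD x (s *: v); rewrite normrZ ger0_norm// (addrC x).
  by apply: le_trans; rewrite lerBrDr (le_trans _ xK)// lerD2l ler_piMl.
have mI : measurable I by exact: measurable_itv.
have lI : lebesgue_measure I = 1%E.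
  have := @lebesgue_measure_itv R `[0, 1]%R.
  by rewrite /= lte_fin ltr01 -EFinB subr0.
have := @bounded_Fubini _ _ _ _ R mu lebesgue_measure (nball K) I
  (fun xs => 'D_v F (xs.2 *: v + xs.1)) C (measurable_nball K) mI (nball_finite K) _
  (measurable_line v cD) (fun _ _ _ _ => DC _).
have fI : (lebesgue_measure I < +oo)%E by rewrite lI ltry.
move=> /(_ fI).
rewrite (@eq_Rintegral _ _ _ _ (nball K) (fun x => F (x + v) - F x)); last first.
  move=> x _; rewrite /= /Rintegral C1_FTC//= scale1r scale0r add0r.
  by rewrite (addrC v).
rewrite (@eq_Rintegral _ _ _ _ I (fun=> \int[mu]_x 'D_v F x)%R); last first.
  move=> s /set_mem; rewrite /I/= in_itv/= => s01.
  have -> := @bsupp_Rintegral K (fun x => 'D_v F (s *: v + x)) (nball K)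
    (measurable_nball K) (shiftK _ _ D0 s01) (fun _ h => h).
  rewrite -[RHS](Rintegral_shift (s *: v) cD).
  by apply: eq_Rintegral => x _; rewrite addrC.
rewrite Rintegral_cst// (_ : fine _ = 1); last exact: (congr1 fine lI).
rewrite mulr1 => <-.
have F0' : bsupp (M + 1) F by move=> x xM; apply: F0; rewrite (le_trans _ xM)// lerDl.
have Fv : bsupp K (fun x => F (x + v)).
  have := shiftK F 1 F0'; rewrite scale1r lexx ler01 => /(_ isT) h x xK.
  by rewrite addrC; exact: h.
have FvF : bsupp K (fun x => F (x + v) - F x).
  by move=> x xK; rewrite Fv// F0' ?subrr// (le_trans _ xK)// lerDl.
have cFv : continuous (fun x => F (x + v)).
  move=> x; apply: (@continuous_comp _ _ _ (fun x => x + v) F); last exact: cF.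
  by apply: (@continuousD _ _ _ id (cst v)); [exact: cvg_id|exact: cst_continuous].
have -> := @bsupp_Rintegral K (fun x => F (x + v) - F x) (nball K)
    (measurable_nball K) FvF (fun _ h => h).
rewrite RintegralB//; [|exact: (bsupp_integrable cFv Fv)|exact: (bsupp_integrable cF F0)].
by rewrite (Rintegral_shift v cF) subrr.
Qed.

End bounded_integrals.

(** * The flux identity *)

Lemma continuous_sumr {R : realType} {V : normedModType R} (I : Type) (s : seq I)
    (F : I -> V -> R) : (forall i, continuous (F i)) ->
  continuous (fun x => \sum_(i <- s) F i x).
Proof.
move=> cF; elim: s => [|a s IH].
  by under eq_fun do rewrite big_nil; exact: cst_continuous.
under eq_fun do rewrite big_cons.
by move=> x; apply: (@continuousD _ _ _ (F a)); [exact: cF|exact: IH].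
Qed.

Lemma measurable_inv {R : realType} :
  measurable_fun setT ((fun x : R => x^-1) : measurableTypeR R -> R).
Proof.
rewrite (_ : (fun x : R => x^-1) = fun x => if 0 <= x then x `^ (-1) else - ((- x) `^ (-1))).
  apply: measurable_fun_ifT; first exact: measurable_fun_ler.
    exact: measurable_powR.
  apply: measurable_funN.
  apply: (measurableT_comp (f := (@powR R)^~ (-1))); first exact: measurable_powR.
  exact: measurable_funN.
apply/funext => x; have [x0|x0] := leP 0 x; first by rewrite powR_inv1.
by rewrite powR_inv1 ?oppr_ge0 ?(ltW x0)// invrN opprK.
Qed.

Section enorm.
Context {R : realType} {n : nat}.
Implicit Types x y : 'rV[R]_n.

Lemma enorm_ge0 x : 0 <= enorm x. Proof. exact: sqrtr_ge0. Qed.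

Lemma sqr_enorm x : enorm x ^+ 2 = \sum_i x 0 i ^+ 2.
Proof. by rewrite sqr_sqrtr// sumr_ge0// => i _; exact: sqr_ge0. Qed.

Lemma coord_le_enorm x i : `|x 0 i| <= enorm x.
Proof.
rewrite -sqrtr_sqr ler_sqrt; last by rewrite sumr_ge0// => j _; exact: sqr_ge0.
by rewrite (bigD1 i)//= lerDl sumr_ge0// => j _; exact: sqr_ge0.
Qed.

Lemma enormZ (c : R) x : enorm (c *: x) = `|c| * enorm x.
Proof.
rewrite /enorm -sqrtr_sqr -sqrtrM ?sqr_ge0//; congr Num.sqrt.
by rewrite mulr_sumr; apply: eq_bigr => i _; rewrite mxE exprMn.
Qed.

Lemma enormN x : enorm (- x) = enorm x.
Proof. by rewrite -scaleN1r enormZ normrN1 mul1r. Qed.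

Lemma enorm_le x : enorm x <= n%:R * `|x|.
Proof.
rewrite -(@ler_pXn2r _ 2) ?nnegrE ?enorm_ge0 ?mulr_ge0// sqr_enorm.
apply: (@le_trans _ _ (n%:R * `|x| ^+ 2)).
  rewrite mulr_natl -[X in _ *+ X]card_ord -sumr_const ler_sum// => i _.
  by rewrite -[x 0 i ^+ 2]real_normK ?num_real// lerXn2r ?nnegrE ?coord_le_norm.
rewrite exprMn ler_wpM2r ?sqr_ge0//; case: (n) => [|m]; first by rewrite expr0n.
by rewrite expr2 ler_peMl// ler1n.
Qed.

Lemma norm_le_enorm x : `|x| <= enorm x.
Proof.
have [x0|x0] := leP `|x| 0; first exact: le_trans x0 (enorm_ge0 x).
rewrite leNgt; apply/negP => h.
have e0 := le_lt_trans (enorm_ge0 x) h.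
suff : `|x| < `|x| by rewrite ltxx.
by apply/norm_ltP => // i; exact: le_lt_trans (coord_le_enorm x i) h.
Qed.

Lemma enorm_continuous : continuous (@enorm R n).
Proof.
move=> x; apply: (@continuous_comp _ _ _ (fun x : 'rV[R]_n => \sum_i x 0 i ^+ 2) Num.sqrt);
  last exact: sqrt_continuous.
apply: continuous_sumr => i y; apply: (@continuous_comp _ _ _ (fun x : 'rV[R]_n => x 0 i) (fun t => t ^+ 2)).
  exact: coord_continuous.
exact: exprn_continuous.
Qed.

Lemma measurable_enorm : measurable_fun setT (@enorm R n).
Proof. by apply: continuous_measurable_rV; exact: enorm_continuous. Qed.

Lemma open_eball (p : 'rV[R]_n) (r : R) : open (eball p r).
Proof.
apply: (@open_comp _ _ (fun x : 'rV[R]_n => enorm (x - p)) [set t | t < r]); last exact: open_lt.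
move=> x _; apply: (@continuous_comp _ _ _ (fun x => x - p) (@enorm R n)); last exact: enorm_continuous.
by apply: (@continuousD _ _ _ id (cst (- p))); [exact: cvg_id|exact: cst_continuous].
Qed.

Lemma measurable_eball (p : 'rV[R]_n) r : measurable (eball p r).
Proof. by apply: measurable_open_rV; exact: open_eball. Qed.

Lemma eball0E r : eball 0 r = [set x : 'rV[R]_n | enorm x < r].
Proof. by apply/seteqP; split => x; rewrite /eball/= subr0. Qed.

Lemma eball0_finite r : (lebesgue_rV n (eball (0 : 'rV[R]_n) r) < +oo)%E.
Proof.
apply: (@bounded_measure_finite _ _ _ r); first exact: measurable_eball.
by move=> x; rewrite eball0E => /ltW; exact: le_trans (norm_le_enorm x).
Qed.

End enorm.

Section shifted_sets.
Context {R : realType} {n : nat}.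
Local Notation mu := (lebesgue_rV n).

Lemma Rintegral_shift_set (B : set 'rV[R]_n) (c : 'rV[R]_n) f : measurable B ->
  measurable_fun setT f ->
  (\int[mu]_(x in [set x | B (x - c)]) f x = \int[mu]_(y in B) f (y + c))%R.
Proof.
move=> mB mf; rewrite /Rintegral; congr fine.
rewrite integral_mkcond [RHS]integral_mkcond.
have mg : measurable_fun setT ((fun x => (f x)%:E) \_ [set x | B (x - c)]).
  apply/(measurable_restrictT _ (measurable_shift_set (- c) mB)).
  by apply: measurable_funTS; exact/measurable_EFinP.
rewrite -(integral_shift c mg); apply: eq_integral => x _.
rewrite !patchE (_ : (x + c \in _) = (x \in B))//.
by apply/idP/idP; rewrite !inE/= addrK.
Qed.

Lemma measure_shift_set (B : set 'rV[R]_n) (c : 'rV[R]_n) : measurable B ->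
  mu [set x | B (x - c)] = mu B.
Proof. exact: (lebesgue_rV_shift (- c)). Qed.

Lemma Rintegral_dilate (F : 'rV[R]_n -> R) (c : R) : 0 < c ->
  mu.-integrable setT (EFin \o F) ->
  (\int[mu]_x F (c *: x) = c ^- n * \int[mu]_x F x)%R.
Proof.
move=> c0 iF; have := integral_dilate c0 iF.
by rewrite /Rintegral => ->; rewrite fineM// integrable_fin_num.
Qed.

Lemma measure_eball (r : R) : 0 < r ->
  mu (eball (0 : 'rV[R]_n) r) = ((r ^+ n)%:E * mu (eball (0 : 'rV[R]_n) 1%R))%E.
Proof.
move=> r0; rewrite -[in RHS](invrK r) exprVn.
rewrite -lebesgue_rV_dilate ?invr_gt0//; last exact: measurable_eball.
congr (mu _); apply/seteqP; split => x; rewrite /eball/= !subr0 enormZ;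
  by rewrite gtr0_norm ?invr_gt0// ltr_pdivrMl// mulr1.
Qed.

End shifted_sets.

Section flux.
Context {R : realType} {n : nat}.
Local Notation mu := (lebesgue_rV n.+1).
Variables (g : 'rV[R]_n.+1 -> R) (r delta C : R).
Hypotheses (g1 : C1 g) (r0 : 0 < r) (rd : r < delta).
Hypothesis g0 : forall x, enorm x < r -> g x = 0.
Hypothesis DC : forall i x, `|partial i g x| <= C.

Let d0 : 0 < delta. Proof. exact: lt_trans rd. Qed.
Let s0 := r / delta.
Let s0_gt0 : 0 < s0. Proof. exact: divr_gt0. Qed.
Let s0_lt1 : s0 < 1. Proof. by rewrite ltr_pdivrMr// mul1r. Qed.
Let I := `[s0, 1]%classic : set (measurableTypeR R).
Let mI : measurable I. Proof. exact: measurable_itv. Qed.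
Let fI : (lebesgue_measure I < +oo)%E.
Proof.
have := @lebesgue_measure_itv R `[s0, 1]%R.
by rewrite /= lte_fin s0_lt1 => ->; rewrite -EFinB ltry.
Qed.
Let B : set 'rV[R]_n.+1 := eball 0 delta.
Let mB : measurable B. Proof. exact: measurable_eball. Qed.
Let fB : (mu B < +oo)%E. Proof. exact: eball0_finite. Qed.
Let F y := 'D_y g y.
Let M := n.+1%:R * (delta * C).
Let C0 : 0 <= C. Proof. exact: le_trans (DC 0 0). Qed.

Let BE x : B x = (enorm x < delta). Proof. by rewrite /B eball0E. Qed.

Let D_bound x y : enorm x < delta -> `|'D_x g y| <= M.
Proof.
move=> xd; rewrite derive_partial// (le_trans (ler_norm_sum _ _ _))//.
rewrite /M mulr_natl -[X in _ *+ X]card_ord -sumr_const ler_sum// => i _.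
by rewrite normrM ler_pM// (le_trans (coord_le_enorm x i)) ?ltW.
Qed.

Let FE x : F x = \sum_i x 0 i * partial i g x. Proof. exact: derive_partial. Qed.

Let continuous_F : continuous F.
Proof.
rewrite (_ : F = fun x => \sum_i x 0 i * partial i g x); last exact/funext/FE.
apply: continuous_sumr => i x.
have c1 : {for x, continuous (fun x : 'rV[R]_n.+1 => x 0 i : R)}.
  exact: coord_continuous.
have c2 : {for x, continuous (partial i g : 'rV[R]_n.+1 -> R)}.
  exact: C1_derive_continuous.
exact: (continuousM c1 c2).
Qed.

Let measurable_F D : measurable_fun D F.
Proof. by apply: measurable_funTS; apply: continuous_measurable_rV. Qed.

Let F0 x : enorm x < r -> F x = 0.
Proof.
move=> xr; rewrite /F -(@near_eq_derive _ _ _ (cst 0) g x x) ?derive_cst//.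
have : nbhs x (eball (0 : 'rV[R]_n.+1) r).
  apply: open_nbhs_nbhs; split; first exact: open_eball.
  by rewrite eball0E.
by apply: filterS => y; rewrite eball0E => /g0.
Qed.

(** The weight produced by the dilation y = s x. The dimension is [n.+1]: the volume element gives
    the power -(n+1) of s, and the direction x = y / s one more factor. *)
Let wt (y : 'rV[R]_n.+1) (s : R) : R := if enorm y < s * delta then s^-1 ^+ n.+2 else 0.

(** The lower endpoint r / delta brings every point of the ball of radius [delta] into the ball of
    radius [r], where [g] vanishes; so no boundary term appears at that end. *)
Let FTC x : B x -> g x = (\int[lebesgue_measure]_(s in I) 'D_x g (s *: x))%R.
Proof.
rewrite BE => xB; have := C1_FTC 0 x g1 s0_lt1; rewrite !addr0 scale1r (g0 (x := s0 *: x)).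
  rewrite subr0 => H; rewrite /Rintegral.
  apply: etrans (congr1 fine (esym H)) _; apply: (f_equal fine).
  by apply: eq_integral => s _; rewrite addr0.
by rewrite enormZ gtr0_norm// /s0 mulrAC ltr_pdivrMr// ltr_pM2l.
Qed.

Let slice s : I s -> (\int[mu]_(x in B) 'D_x g (s *: x) = \int[mu]_(y in B) (wt y s * F y))%R.
Proof.
rewrite /I/= in_itv/= => /andP[s0s s1]; have sgt0 := lt_le_trans s0_gt0 s0s.
pose H y := (F \_ (eball 0 (s * delta))) y.
have mH : measurable (eball (0 : 'rV[R]_n.+1) (s * delta)) by exact: measurable_eball.
have iH : mu.-integrable setT (EFin \o H).
  rewrite (_ : EFin \o H = (EFin \o F) \_ (eball 0 (s * delta))); last first.
    by apply/funext => y; rewrite /H /= !patchE; case: ifP.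
  apply/(integrable_mkcond _ mH).
  apply: (@bounded_integrable _ _ _ _ M) => //; first exact: eball0_finite.
  move=> x; rewrite eball0E/= => xs; apply: D_bound.
  by rewrite (lt_le_trans xs)// ler_piMl// ltW.
transitivity (s^-1 * \int[mu]_x H (s *: x))%R.
  rewrite -RintegralZl//; last first.
    apply: (@eq_integrable _ _ _ mu setT measurableT
      ((EFin \o (fun x => F (s *: x))) \_ B)).
      move=> x _; rewrite /H /= !patchE eball0E.
      have -> : (x \in B) = (s *: x \in [set x : 'rV[R]_n.+1 | enorm x < s * delta]).
        by apply/idP/idP; rewrite !in_setE BE/= enormZ gtr0_norm// ltr_pM2l.
      by case: ifP.
    apply/(integrable_mkcond _ mB); apply: (@bounded_integrable _ _ _ _ M) => //.
      apply: measurable_funTS; apply: (measurableT_comp (continuous_measurable_rV continuous_F)).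
      exact: measurable_dilate.
    move=> x; rewrite BE => xB; apply: D_bound.
    by rewrite enormZ gtr0_norm// (le_lt_trans _ xB)// ler_piMl// enorm_ge0.
  rewrite [LHS]Rintegral_mkcond; apply: eq_Rintegral => x _.
  rewrite /H !patchE eball0E.
  have -> : (x \in B) = (s *: x \in [set x : 'rV[R]_n.+1 | enorm x < s * delta]).
    by apply/idP/idP; rewrite !in_setE BE/= enormZ gtr0_norm// ltr_pM2l.
  case: ifP => _; last by rewrite mulr0.
  by rewrite /F derive_scale// mulKf// gt_eqF.
rewrite Rintegral_dilate// mulrA -exprVn -exprS [RHS]Rintegral_mkcond -RintegralZl//.
apply: eq_Rintegral => y _; rewrite /H !patchE eball0E /wt.
have [ys|ys] := boolP (y \in [set x : 'rV[R]_n.+1 | enorm x < s * delta]).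
  have ys' : enorm y < s * delta by move: ys; rewrite in_setE.
  rewrite ifT; first by rewrite ys'.
  by rewrite in_setE BE (lt_le_trans ys')// ler_piMl// ltW.
rewrite mulr0; case: ifP => // _; rewrite ifF ?mul0r//.
by apply/negbTE/negP => h; move: ys; rewrite notin_setE.
Qed.

(** With N = n + 1 and t = |y| / delta, the integral of s^(-N-1) from t to 1 is (t^(-N) - 1) / N.
    For |y| < r, where t falls below the range of s, [F] vanishes. *)
Let inner y : B y -> (\int[lebesgue_measure]_(s in I) (wt y s * F y) =
  n.+1%:R^-1 * ((delta / enorm y) ^+ n.+1 - 1) * F y)%R.
Proof.
rewrite BE => yd; have [yr|yr] := ltP (enorm y) r.
  rewrite F0// mulr0 (@eq_Rintegral _ _ _ _ I (fun=> 0)) ?Rintegral_cst ?mul0r//.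
  by move=> s _; rewrite mulr0.
have e0 := lt_le_trans r0 yr.
set t := enorm y / delta.
have t0 : 0 < t by exact: divr_gt0.
have t1 : t < 1 by rewrite ltr_pdivrMr// mul1r.
have st : s0 <= t by rewrite ler_pM2r// invr_gt0.
rewrite (@eq_Rintegral _ _ _ _ I (fun s => F y * ((fun s => s^-1 ^+ n.+2) \_ `]t, 1]) s)); last first.
  move=> s /set_mem; rewrite /I/= in_itv/= => /andP[s0s s1].
  rewrite mulrC /wt patchE; congr (_ * _).
  by rewrite mem_setE in_itv/= s1 andbT /t ltr_pdivrMr.
have cV : {within `[t, 1], continuous (fun s : R => s^-1 ^+ n.+2)}.
  apply: derivable_within_continuous => s; rewrite in_itv/= => /andP[ts s1].
  have sN0 : s != 0 by rewrite gt_eqF// (lt_le_trans t0).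
  have [_ [d _]] := Ck_onX n.+2 open_neq0 (@Ck_on_inv R 1).
  exact: d.
have iV : lebesgue_measure.-integrable `[t, 1] (EFin \o (fun s : R => s^-1 ^+ n.+2)).
  by apply: continuous_compact_integrable => //; exact: segment_compact.
rewrite RintegralZl//; last first.
  rewrite (_ : EFin \o _ = (EFin \o (fun s : R => s^-1 ^+ n.+2)) \_ `]t, 1]); last first.
    by apply/funext => s /=; rewrite !patchE; case: ifP.
  apply/integrable_restrict => //.
  rewrite (_ : I `&` _ = `]t, 1]%classic).
    apply: (integrableS _ _ _ iV) => // s /=; rewrite !in_itv/= => /andP[/ltW-> ->]//.
  apply/seteqP; split => s; rewrite /I/= !in_itv/=; first by case.
  by move=> /andP[ts ->]; rewrite ts (le_trans st (ltW ts)).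
rewrite mulrC; congr (_ * _).
rewrite -Rintegral_mkcondr.
rewrite (_ : I `&` _ = `]t, 1]%classic); last first.
  apply/seteqP; split => s; rewrite /I/= !in_itv/=; first by case.
  by move=> /andP[ts ->]; rewrite ts (le_trans st (ltW ts)).
rewrite Rintegral_itv_obnd_cbnd; last first.
  by apply: (integrableS _ _ _ iV) => // s /=; rewrite !in_itv/= => /andP[/ltW-> ->].
pose G (s : R) : R := - n.+1%:R^-1 * s^-1 ^+ n.+1.
have dG (s : R) : 0 < s -> is_derive s (1 : R) G (s^-1 ^+ n.+2).
  move=> sgt0; have sN0 : s != 0 by rewrite gt_eqF.
  have dV := @is_deriveV R id s 1 1 sN0 (is_derive_id _ _).
  have dP : is_derive (s^-1) 1 (fun x : R => x ^+ n.+1) (n.+1%:R * s^-1 ^+ n).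
    split; first exact: exprn_derivable.
    by rewrite exp_derive /GRing.scale/= mulr1.
  have dX := @is_derive1_comp _ (fun x => x ^+ n.+1) (fun s => s^-1) s _ _ dP dV.
  have := @is_deriveZ _ _ _ _ (- n.+1%:R^-1) s 1 _ dX.
  rewrite /GRing.scale/= mulr1.
  suff -> : - n.+1%:R^-1 * (n.+1%:R * s^-1 ^+ n * - s ^- 2) = s^-1 ^+ n.+2 by [].
  by rewrite mulrN mulrNN -mulrA mulKf ?pnatr_eq0// -exprVn -exprD addn2.
rewrite /Rintegral (@continuous_FTC2 R (fun s => s^-1 ^+ n.+2) G)//.
- rewrite /G !invr1 expr1n mulr1 /= /t invf_div.
  by move: ((delta / enorm y) ^+ n.+1) => X; ring.
- split.
  + by move=> s; rewrite in_itv/= => /andP[ts _]; have [] := dG s (lt_trans t0 ts).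
  + apply: cvg_at_right_filter; apply/differentiable_continuous/derivable1_diffP.
    by have [] := dG t t0.
  + apply: cvg_at_left_filter; apply/differentiable_continuous/derivable1_diffP.
    by have [] := dG 1 ltr01.
- by move=> s; rewrite in_itv/= => /andP[ts _]; rewrite derive1E; have [_ ->] := dG s (lt_trans t0 ts).
Qed.

(* With [g x = \int_(r/delta)^1 'D_x g (s x) ds], swap the integrals and dilate by [s]. *)
Lemma flux_identity :
  (n.+1%:R * \int[mu]_(x in eball 0 delta) g x =
   \int[mu]_(x in eball 0 delta) (((delta / enorm x) ^+ n.+1 - 1) * 'D_x g x))%R.
Proof.
rewrite -/B (@eq_Rintegral _ _ _ _ B (fun x => \int[lebesgue_measure]_(s in I) 'D_x g (s *: x))%R); last first.
  by move=> x /set_mem; exact: FTC.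
rewrite (@bounded_Fubini _ _ _ _ R mu lebesgue_measure B I
  (fun xs => 'D_xs.1 g (xs.2 *: xs.1)) M)//; last first.
- by move=> x s; rewrite BE => xB _; exact: D_bound.
- rewrite (_ : (fun _ => _) = fun xs : 'rV[R]_n.+1 * measurableTypeR R => \sum_i xs.1 0 i * partial i g (xs.2 *: xs.1)); last first.
    by apply/funext => xs; exact: derive_partial.
  apply: measurable_sum => i; apply: measurable_funM.
    exact: (measurableT_comp (measurable_coord i)).
  by apply: measurable_ray; exact: C1_derive_continuous.
rewrite (@eq_Rintegral _ _ _ _ I (fun s => \int[mu]_(y in B) (wt y s * F y))%R); last first.
  by move=> s /set_mem; exact: slice.
have mwt : measurable_fun setT (fun ys : 'rV[R]_n.+1 * measurableTypeR R => wt ys.1 ys.2 * F ys.1).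
  apply: measurable_funM; last first.
    exact: (measurableT_comp (continuous_measurable_rV continuous_F)).
  apply: measurable_fun_ifT => //.
    apply: measurable_fun_ltr; first exact: (measurableT_comp measurable_enorm).
    exact: measurable_funM.
  by apply: measurable_funX; exact: (measurableT_comp measurable_inv).
rewrite -(@bounded_Fubini _ _ _ _ R mu lebesgue_measure B I
  (fun ys => wt ys.1 ys.2 * F ys.1) (s0^-1 ^+ n.+2 * M))//; last first.
  move=> y s; rewrite BE /I/= in_itv/= => yB /andP[s0s s1].
  rewrite normrM ler_pM//; last exact: D_bound.
  have sp := lt_le_trans s0_gt0 s0s.
  rewrite /wt; case: ifP => _; last by rewrite normr0 exprn_ge0// invr_ge0 ltW.
  rewrite ger0_norm ?exprn_ge0 ?invr_ge0 ?(ltW sp)//.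
  by rewrite lerXn2r ?nnegrE ?invr_ge0 ?(ltW sp) ?(ltW s0_gt0)// lef_pV2.
rewrite (@eq_Rintegral _ _ _ _ B (fun y => n.+1%:R^-1 * (((delta / enorm y) ^+ n.+1 - 1) * F y))); last first.
  by move=> y /set_mem yB; rewrite /= inner// mulrA.
rewrite RintegralZl//; first by rewrite mulrA mulfV ?mul1r// pnatr_eq0.
apply: (@bounded_integrable _ _ _ _ (((delta / r) ^+ n.+1 + 1) * M)) => //.
  apply: measurable_funM => //; apply: measurable_funTS.
  apply: measurable_funB => //; apply: measurable_funX; apply: measurable_funM => //.
  exact: (measurableT_comp measurable_inv measurable_enorm).
move=> y; rewrite BE => yB; have [yr|yr] := ltP (enorm y) r.
  rewrite F0// mulr0 normr0 mulr_ge0//; last by rewrite /M !mulr_ge0// ltW.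
  by rewrite addr_ge0// exprn_ge0// divr_ge0// ltW.
rewrite normrM ler_pM//; last exact: D_bound.
rewrite (le_trans (ler_normB _ _))// normr1 lerD2r ger0_norm; last first.
  by rewrite exprn_ge0// divr_ge0 ?enorm_ge0// ltW.
have e0 := lt_le_trans r0 yr.
rewrite lerXn2r ?nnegrE ?divr_ge0 ?enorm_ge0 ?(ltW d0) ?(ltW r0)//.
by rewrite ler_pM2l// lef_pV2.
Qed.

End flux.

(** * Tilings by cubes and balls *)

Lemma Rintegral_sum d (T : measurableType d) {R : realType}
    (mu : {measure set T -> \bar R}) (D : set T) (I : Type) (s : seq I)
    (F : I -> T -> R) : measurable D ->
  (forall i, mu.-integrable D (EFin \o F i)) ->
  mu.-integrable D (EFin \o (fun x => \sum_(i <- s) F i x)) /\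
  (\int[mu]_(x in D) (\sum_(i <- s) F i x) = \sum_(i <- s) \int[mu]_(x in D) F i x)%R.
Proof.
move=> mD iF; elim: s => [|a s [IH1 IH2]].
  rewrite big_nil; split.
    by rewrite (_ : _ \o _ = cst 0%E); [exact: integrable0|apply/funext => x /=; rewrite big_nil].
  by under eq_Rintegral do rewrite big_nil; rewrite Rintegral_cst// mul0r.
rewrite big_cons -IH2 -RintegralD//; split; last first.
  by apply: eq_Rintegral => x _; rewrite big_cons.
rewrite (_ : _ \o _ = (fun x => (F a x)%:E + (\sum_(i <- s) F i x)%R%:E)%E).
  exact: (integrableD mD (iF a) IH1).
by apply/funext => x /=; rewrite big_cons.
Qed.

Section tiling.
Context {R : realType} {n : nat}.
Local Notation mu := (lebesgue_rV n).
Variables (delta C : R) (ctr : seq 'rV[R]_n) (Omega : set 'rV[R]_n)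
  (f : 'rV[R]_n -> R).

(** Half-open, so that the translates by 2 h times integer vectors partition the space. *)
Definition cube (h : R) : set 'rV[R]_n := box (fun=> `[- h, h[%classic).

Lemma measurable_cube h : measurable (cube h).
Proof. by apply: measurable_box => i; exact: measurable_itv. Qed.

Lemma cubeP h x : cube h x <-> forall i, - h <= x 0 i < h.
Proof. by split=> H i; have := H i; rewrite /= in_itv. Qed.

Lemma cube_norm_le h x : 0 <= h -> cube h x -> `|x| <= h.
Proof.
move=> h0 /cubeP xh; apply/ler_addgt0Pl => e e0; apply/ltW.
apply/norm_ltP; first exact: ltr_pwDl.
move=> i; have /andP[a b] := xh i.
by rewrite ltr_norml; apply/andP; split; lra.
Qed.

Lemma cube_finite h : 0 <= h -> (mu (cube h) < +oo)%E.
Proof.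
move=> h0; apply: (@bounded_measure_finite _ _ _ h); first exact: measurable_cube.
by move=> x; exact: cube_norm_le.
Qed.

Lemma measure_cube h : 0 < h -> mu (cube h) = ((2 * h) ^+ n)%:E.
Proof.
move=> h0; have -> : mu (cube h) =
    (\prod_(i < n) lebesgue_measure (`[(- h)%R, h[%classic : set (measurableTypeR R)))%E.
  by apply: lebesgue_rV_box => i; exact: measurable_itv.
have -> : lebesgue_measure (`[(- h)%R, h[%classic : set (measurableTypeR R)) = (2 * h)%:E.
  rewrite lebesgue_measure_itv/= lte_fin ifT; last by lra.
  by rewrite -EFinB; congr (_%:E); ring.
elim: (n) => [|k IH]; first by rewrite big_ord0 expr0.
by rewrite big_ord_recl IH -EFinM exprS.
Qed.

Lemma eball_sub_cube h : eball (0 : 'rV[R]_n) h `<=` cube h.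
Proof.
move=> x; rewrite eball0E/= => xh; apply/cubeP => i.
have := le_lt_trans (coord_le_enorm x i) xh.
by rewrite ltr_norml => /andP[/ltW-> ->].
Qed.

Definition tiles (S : set 'rV[R]_n) : set 'rV[R]_n :=
  \big[setU/set0]_(c <- ctr) [set x | S (x - c)].

Hypotheses (d0 : 0 < delta) (uctr : uniq ctr) (mO : measurable Omega).
Hypothesis fO : (mu Omega < +oo)%E.
Hypothesis disj : forall c c' x, c \in ctr -> c' \in ctr ->
  cube delta (x - c) -> cube delta (x - c') -> c = c'.

Lemma measurable_tiles S : measurable S -> measurable (tiles S).
Proof. by move=> mS; apply: bigsetU_measurable => c _; exact: measurable_shift_set. Qed.

Lemma tilesP S x : tiles S x <-> exists2 c, c \in ctr & S (x - c).
Proof.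
rewrite /tiles -bigcup_seq; split=> [[c /= cc Sx]|[c cc Sx]]; by exists c.
Qed.

Lemma Rintegral_tiles S g : measurable S -> S `<=` cube delta ->
  measurable_fun setT g -> mu.-integrable (tiles S) (EFin \o g) ->
  (\int[mu]_(x in tiles S) g x = \sum_(c <- ctr) \int[mu]_(y in S) g (y + c))%R.
Proof.
move=> mS SQ mg ig.
rewrite (_ : (\int[mu]_(x in tiles S) g x)%R =
    (\sum_(c <- ctr) \int[mu]_(x in [set x | S (x - c)]) g x)%R); last first.
  rewrite /Rintegral integral_bigsetU_EFin//.
  - rewrite big_seq [RHS]big_seq sum_fine//= => c cc; apply: integrable_fin_num.
      exact: measurable_shift_set.
    apply: integrableS ig; [exact: measurable_tiles|exact: measurable_shift_set|].
    by move=> x /= Sx; apply/tilesP; exists c.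
  - by move=> c; exact: measurable_shift_set.
  - apply/trivIsetP => c c' /= cc cc' cc'N; rewrite -subset0 => x [/= /SQ Sc /SQ Sc'].
    by move/eqP : cc'N; apply; exact: disj Sc Sc'.
  - by apply: measurable_funTS; exact/measurable_EFinP.
by apply: eq_bigr => c _; rewrite Rintegral_shift_set.
Qed.

Hypotheses (f1 : C1 f) (fC : forall x, `|f x| <= C)
  (DC : forall i x, `|partial i f x| <= C).
Hypothesis inO : forall c y, c \in ctr -> `|y - c| <= 2 * delta -> Omega y.

Let C0 : 0 <= C. Proof. exact: le_trans (fC 0). Qed.
Let mf : measurable_fun setT f.
Proof. by apply: continuous_measurable_rV; exact: C1_continuous. Qed.

Let E := \sum_k (\int[mu]_(x in Omega) `|partial k f x|)%R.

Let ip k : mu.-integrable Omega (EFin \o (fun x => `|partial k f x|)).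
Proof.
apply: (@bounded_integrable _ _ _ _ C) => //; last by move=> x _; rewrite normr_id.
apply: measurable_funTS; apply: measurableT_comp => //.
by apply: continuous_measurable_rV; exact: C1_derive_continuous.
Qed.

Let sub_tiles S : S `<=` cube delta -> tiles S `<=` Omega.
Proof.
move=> SQ x /tilesP[c cc /SQ/(cube_norm_le (ltW d0)) xc].
apply: (inO cc); by rewrite (le_trans xc)// ler_peMl ?ler1n// ltW.
Qed.

Let fin_tiles S : measurable S -> S `<=` cube delta -> (mu (tiles S) < +oo)%E.
Proof.
move=> mS SQ; apply: le_lt_trans fO; apply: le_measure; rewrite ?inE//.
  exact: measurable_tiles.
exact: sub_tiles.
Qed.

(** The entries of [v] are at most [delta], so |D_v f| is at most [delta] times the sum of the
    |partial derivatives|. A segment from a point of a tile in direction [v] stays within 2 delta of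
    the centre, hence in [Omega] by [inO]. *)
Let shift_tiles S v : measurable S -> S `<=` cube delta -> cube delta v ->
  `|(\int[mu]_(x in tiles S) f (x + v) - \int[mu]_(x in tiles S) f x)%R| <= delta * E.
Proof.
move=> mS SQ vQ.
have mT := measurable_tiles mS; have fT := fin_tiles mS SQ.
have vd i : `|v 0 i| <= delta.
  exact: le_trans (coord_le_norm v i) (cube_norm_le (ltW d0) vQ).
have i1 : mu.-integrable (tiles S) (EFin \o f).
  by apply: (@bounded_integrable _ _ _ _ C) => //; exact: measurable_funTS.
have mfv : measurable_fun setT (fun x : 'rV[R]_n => f (x + v)).
  exact: (measurableT_comp mf (measurable_shift v)).
have i2 : mu.-integrable (tiles S) (EFin \o (fun x => f (x + v))).
  by apply: (@bounded_integrable _ _ _ _ C) => //; exact: measurable_funTS.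
rewrite -RintegralB// -lee_fin.
have i3 : mu.-integrable (tiles S) (EFin \o (fun x => f (x + v) - f x)).
  exact: (integrableB mT i2 i1).
have -> : (`|(\int[mu]_(x in tiles S) (f (x + v) - f x))%R|)%:E =
    (`|\int[mu]_(x in tiles S) (f (x + v) - f x)%:E|)%E.
  by rewrite /Rintegral -[in RHS](fineK (integrable_fin_num mT i3)).
apply: le_trans (le_abse_integral _ _ _) _ => //; first exact: measurable_int i3.
apply: (le_trans (shift_diff_le (Omega := Omega) f1 mT mO _)).
  move=> x s /tilesP[c cc /SQ/(cube_norm_le (ltW d0)) xc] /andP[s0 s1].
  apply: (inO cc); rewrite -addrA (le_trans (ler_normD _ _))// normrZ ger0_norm//.
  have := cube_norm_le (ltW d0) vQ => vn.
  have : s * `|v| <= delta by rewrite (le_trans _ vn)// ler_piMl.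
  by lra.
have iD : mu.-integrable Omega (EFin \o (fun x => \sum_k delta * `|partial k f x|)).
  rewrite (_ : EFin \o _ = (fun x => \sum_k (delta * `|partial k f x|)%:E)%E); last first.
    by apply/funext => x /=; rewrite -sumEFin.
  by apply: integrable_sum => // k _; exact: (integrableZl mO delta (ip k)).
apply: (@le_trans _ _ (\int[mu]_(x in Omega) (\sum_k delta * `|partial k f x|)%:E)%E).
  apply: ge0_le_integral => //.
  - apply: measurableT_comp => //; apply/measurable_EFinP; apply: measurable_funTS.
    by apply: continuous_measurable_rV; exact: C1_derive_continuous.
  - exact: measurable_int iD.
  - move=> x _; rewrite lee_fin derive_partial// (le_trans (ler_norm_sum _ _ _))//.
    by apply: ler_sum => k _; rewrite normrM ler_wpM2r.
have iDk k : mu.-integrable Omega (EFin \o (fun x => delta * `|partial k f x|)).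
  exact: (integrableZl mO delta (ip k)).
rewrite -(fineK (integrable_fin_num mO iD)) lee_fin le_eqVlt; apply/orP; left.
apply/eqP; rewrite /E mulr_sumr.
have [_] := Rintegral_sum (index_enum 'I_n) mO iDk; rewrite /Rintegral => ->.
apply: eq_bigr => k _; rewrite -[LHS]/(\int[mu]_(x in Omega) (delta * `|partial k f x|))%R.
by rewrite RintegralZl.
Qed.

(** Symmetric in y and v: Fubini then lets the ball and the cube exchange the roles of integration
    domain and set of translations. *)
Let P y v := \sum_(c <- ctr) f (y + v + c).

Let mP : measurable_fun setT (fun p : 'rV[R]_n * 'rV[R]_n => P p.1 p.2).
Proof.
apply: measurable_sum => c; apply: (measurableT_comp mf).
apply: measurable_rVP => i; under eq_fun do rewrite !mxE.
apply: measurable_funD => //; apply: measurable_funD.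
  exact: (measurableT_comp (measurable_coord i)).
exact: (measurableT_comp (measurable_coord i)).
Qed.

Let PC y v : `|P y v| <= \sum_(c <- ctr) C.
Proof. by rewrite (le_trans (ler_norm_sum _ _ _))// ler_sum. Qed.

Let PJ S v : measurable S -> S `<=` cube delta ->
  (\int[mu]_(y in S) P y v = \int[mu]_(x in tiles S) f (x + v))%R.
Proof.
move=> mS SQ.
have mfv : measurable_fun setT (fun x : 'rV[R]_n => f (x + v)).
  exact: (measurableT_comp mf (measurable_shift v)).
have fS : (mu S < +oo)%E.
  apply: le_lt_trans (cube_finite (ltW d0)); apply: le_measure; rewrite ?inE//.
  exact: measurable_cube.
rewrite Rintegral_tiles//; last first.
  apply: (@bounded_integrable _ _ _ _ C) => //; first exact: measurable_tiles.
    exact: fin_tiles.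
  exact: measurable_funTS.
have ic c : mu.-integrable S (fun y => (f (y + c + v))%:E).
  apply: (@bounded_integrable _ _ S (fun y => f (y + c + v)) C) => //.
  apply: measurable_funTS; apply: (measurableT_comp mfv).
  exact: measurable_shift.
have [_ <-] := Rintegral_sum ctr mS ic.
by apply: eq_Rintegral => y _; apply: eq_bigr => c _; rewrite addrAC.
Qed.

Let avg S S' : measurable S -> S `<=` cube delta -> measurable S' -> S' `<=` cube delta ->
  `|(fine (mu S') * \int[mu]_(x in tiles S) f x -
     \int[mu]_(v in S') \int[mu]_(y in S) P y v)%R| <= fine (mu S') * (delta * E).
Proof.
move=> mS SQ mS' SQ'.
have fS (T : set 'rV[R]_n) : measurable T -> T `<=` cube delta -> (mu T < +oo)%E.
  move=> mT TQ; apply: le_lt_trans (cube_finite (ltW d0)); apply: le_measure; rewrite ?inE//.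
  exact: measurable_cube.
have iJ : mu.-integrable S' (fun v => (\int[mu]_(y in S) P y v)%R%:E).
  apply: (@integrable_inner1 _ _ _ _ R mu mu S' S (fun p => P p.2 p.1)
    (\sum_(c <- ctr) C)) => //; try exact: fS.
  have msw : measurable_fun setT (fun p : 'rV[R]_n * 'rV[R]_n => (p.2, p.1)).
    by apply/measurable_fun_pairP; split; [exact: measurable_snd|exact: measurable_fst].
  exact: (measurableT_comp mP msw).
have ic (a : R) : mu.-integrable S' (EFin \o (fun=> a)).
  by apply: (@bounded_integrable _ _ _ _ `|a|) => //; exact: fS.
rewrite [X in `|X - _|]mulrC -Rintegral_cst// -RintegralB//.
rewrite -lee_fin; have iB := integrableB mS' (ic (\int[mu]_(x in tiles S) f x)%R) iJ.
apply: (@le_trans _ _ (`|\int[mu]_(v in S') ((\int[mu]_(x in tiles S) f x)%R - (\int[mu]_(y in S) P y v)%R)%:E|)%E).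
  by rewrite /Rintegral -[in leRHS](fineK (integrable_fin_num mS' iB)).
apply: le_trans (le_abse_integral _ _ _) _ => //; first exact: measurable_int iB.
apply: (@le_trans _ _ (\int[mu]_(v in S') (delta * E)%:E)%E).
  apply: ge0_le_integral => //.
  - by apply: measurableT_comp => //; exact: measurable_int iB.
  - by move=> v vS'; rewrite lee_fin PJ// distrC; apply: shift_tiles => //; exact: SQ'.
rewrite -[X in (X <= _)%E]/(\int[mu]_(v in S') (cst (delta * E)%:E v))%E.
rewrite integral_cst// [X in (_ <= X)%E]EFinM muleC fineK// ge0_fin_numE//; exact: fS.
Qed.

(* Both sides are compared with the double integral of [f (c + y + v)] over
   the ball and the cube, which only costs translations inside [Omega]. *)
Lemma tiling_estimate :
  `|fine (mu (cube delta)) * (\int[mu]_(x in tiles (eball 0 delta)) f x)%R -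
    fine (mu (eball 0 delta)) * (\int[mu]_(x in tiles (cube delta)) f x)%R| <=
  (fine (mu (cube delta)) + fine (mu (eball 0 delta))) *
    (delta * \sum_k (\int[mu]_(x in Omega) `|partial k f x|)%R).
Proof.
have mB : measurable (eball (0 : 'rV[R]_n) delta) by exact: measurable_eball.
have mQ := measurable_cube delta; have BQ := @eball_sub_cube delta.
have a1 := avg mB BQ mQ (@subset_refl _ _).
have a2 := avg mQ (@subset_refl _ _) mB BQ.
have fB : (mu (eball (0 : 'rV[R]_n) delta) < +oo)%E by exact: eball0_finite.
have fQ := cube_finite (ltW d0).
have E12 : (\int[mu]_(v in cube delta) \int[mu]_(y in eball 0 delta) P y v =
    \int[mu]_(v in eball 0 delta) \int[mu]_(y in cube delta) P y v)%R.
  have H := @bounded_Fubini _ _ _ _ R mu mu (eball 0 delta) (cube delta)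
    (fun p => P p.1 p.2) (\sum_(c <- ctr) C) mB mQ fB fQ mP (fun y v _ _ => PC y v).
  apply: etrans (esym H) _.
  apply: eq_Rintegral => y _; apply: eq_Rintegral => v _.
  by apply: eq_bigr => c _; rewrite (addrC v).
rewrite mulrDl -/E.
apply: le_trans (ler_distD (\int[mu]_(v in eball 0 delta) \int[mu]_(y in cube delta) P y v)%R _ _) _.
apply: lerD; first by rewrite -E12.
by rewrite distrC.
Qed.

End tiling.

(** * The limit equation *)

Section integration_by_parts_L1.
Context {R : realType}.
Local Notation lam := (@lebesgue_measure R).

(** Integrability of every slice is assumed because [fine] sends an infinite inner integral to 0. *)
Lemma Rintegral_Fubini d1 d2 (T1 : measurableType d1) (T2 : measurableType d2)
    (m1 : {sigma_finite_measure set T1 -> \bar R})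
    (m2 : {sigma_finite_measure set T2 -> \bar R}) (h : T1 * T2 -> R) :
  ((m1 \x m2)%E).-integrable setT (EFin \o h) ->
  (forall x, m2.-integrable setT (fun y => (h (x, y))%:E)) ->
  (forall y, m1.-integrable setT (fun x => (h (x, y))%:E)) ->
  (\int[m1]_x (\int[m2]_y h (x, y)) = \int[m2]_y (\int[m1]_x h (x, y)))%R.
Proof.
move=> ih i1 i2; have F := Fubini ih.
rewrite {1 3}/Rintegral; congr fine; apply: etrans (etrans F _).
  by apply: eq_integral => x _; rewrite /Rintegral fineK// integrable_fin_num.
by apply: eq_integral => y _; rewrite /Rintegral fineK// integrable_fin_num.
Qed.

Lemma itv_integrableS (G : R -> R) (t : R) : t <= 1 ->
  lam.-integrable `[0, 1] (EFin \o G) -> lam.-integrable `[0, t] (EFin \o G).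
Proof.
move=> t1 iG; apply: integrableS iG => // x /=; rewrite !in_itv/= => /andP[-> xt].
exact: le_trans xt t1.
Qed.

Lemma itv_RintegralZl (G : R -> R) (k : R) (i : interval R) :
  lam.-integrable [set` i] (EFin \o G) ->
  (\int[lam]_(s in [set` i]) (k * G s) = k * \int[lam]_(s in [set` i]) G s)%R.
Proof. by move=> iG; rewrite RintegralZl. Qed.

Lemma C1_bounded01 (a : R -> R) : C1 a ->
  exists2 C, 0 <= C & forall s, 0 <= s <= 1 -> `|'D_1 a s| <= C /\ `|a s| <= C.
Proof.
move=> a1.
have bd (g : R -> R) : continuous g -> exists2 C, 0 <= C & forall s, 0 <= s <= 1 -> `|g s| <= C.
  move=> cg; have [c _ cmax] : exists2 c, c \in `[0, 1]%R & forall t, t \in `[0, 1]%R -> `|g t| <= `|g c|.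
    apply: (@EVT_max R (fun t => `|g t|)) => //.
    apply: continuous_subspaceT => t.
    by apply: (@continuous_comp _ _ _ g Num.norm); [exact: cg|exact: norm_continuous].
  by exists `|g c| => // s s01; apply: cmax; rewrite in_itv.
have [c1 c10 H1] := bd _ (@C1_derive_continuous R R a 1 a1).
have [c2 c20 H2] := bd _ (C1_continuous a1).
exists (Num.max c1 c2) => [|s s01]; first by rewrite le_max c10.
by rewrite !le_max H1// H2// orbT.
Qed.

Lemma C1_FTC_R (a : R -> R) (b c : R) : C1 a -> b <= c ->
  (\int[lam]_(s in `[b, c]) 'D_1 a s = a c - a b)%R.
Proof.
move=> a1; rewrite le_eqVlt => /predU1P[->|bc].
  by rewrite set_itv1 Rintegral_set1 subrr.
have E (t : R) : t *: (1 : R) + 0 = t by rewrite addr0 /GRing.scale/= mulr1.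
have := C1_FTC (0 : R) (1 : R) a1 bc; rewrite !E => H.
rewrite /Rintegral -[RHS]/(fine (a c - a b)%:E) -H; apply: (f_equal fine).
by apply: eq_integral => s _; rewrite E.
Qed.

(** [G] is only integrable, so its primitive need not be C^1. Instead a'(s) G(r) is integrated over
    the triangle r <= s <= t in both orders, the integral of a' from r to t being a(t) - a(r). *)
Lemma integration_by_parts_L1 (G a : R -> R) (t : R) : 0 <= t <= 1 ->
  lam.-integrable `[0, 1] (EFin \o G) -> C1 a ->
  (\int[lam]_(s in `[0, t]) ('D_1 a s * (\int[lam]_(r in `[0, s]) G r)) =
   a t * (\int[lam]_(s in `[0, t]) G s) - \int[lam]_(s in `[0, t]) (a s * G s))%R.
Proof.
move=> /andP[t0 t1] iG a1.
have [C C0 aC] := C1_bounded01 a1.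
pose I := `[0, t]%classic : set (measurableTypeR R).
have mI : measurable I by exact: measurable_itv.
have iGt := itv_integrableS t1 iG.
have mG : measurable_fun I G by apply/measurable_EFinP; exact: measurable_int iGt.
pose G0 := G \_ I.
have mG0 : measurable_fun setT (G0 : measurableTypeR R -> R) by exact/(measurable_restrictT _ mI).
have iG0 : lam.-integrable setT (EFin \o G0).
  rewrite (_ : _ \o _ = (EFin \o G) \_ I); first exact/(integrable_mkcond _ mI).
  by apply/funext => s /=; rewrite /G0 !patchE; case: ifP.
pose A := 'D_1 a \_ I.
have cD := @C1_derive_continuous R R a 1 a1.
have mA : measurable_fun setT (A : measurableTypeR R -> R).
  apply/(measurable_restrictT _ mI); apply: measurable_funTS.
  exact: continuous_measurable_fun.
have AC s : `|A s| <= C.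
  rewrite /A patchE; case: ifPn => [/set_mem|_]; last by rewrite normr0.
  rewrite /I/= in_itv/= => /andP[s0 st].
  by have [] := aC s _ => //; rewrite s0 (le_trans st).
pose k (p : measurableTypeR R * measurableTypeR R) : R := if p.2 <= p.1 then 1 else 0.
have mk : measurable_fun setT k.
  apply: measurable_fun_ifT => //; apply: measurable_fun_ler.
    exact: measurable_snd.
  exact: measurable_fst.
have k1 p : `|k p| <= 1 by rewrite /k; case: ifP; rewrite ?normr1 ?normr0.
pose h (p : measurableTypeR R * measurableTypeR R) : R := A p.1 * G0 p.2 * k p.
have mh : measurable_fun setT h.
  apply: measurable_funM => //; apply: measurable_funM.
    exact: (measurableT_comp mA measurable_fst).
  exact: (measurableT_comp mG0 measurable_snd).
have hle p : `|h p| <= C * `|G0 p.2|.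
  rewrite /h !normrM -[leRHS]mulr1 ler_pM ?mulr_ge0// ler_pM//.
have h0 p : p.1 \notin I -> h p = 0.
  by move=> pI; rewrite /h /A patchE (negbTE pI) !mul0r.
have iC : lam.-integrable setT (fun y => (C * `|G0 y|)%:E).
  by have := integrableZl measurableT C (integrable_abse iG0).
have i1 x : lam.-integrable setT (fun y => (h (x, y))%:E).
  apply: le_integrable iC => //.
    by apply/measurable_EFinP; exact: (measurableT_comp mh (pair1_measurable x)).
  by move=> y _; rewrite lee_fin (le_trans (hle _))// ler_norm.
have fI : (lam I < +oo)%E.
  by rewrite /I lebesgue_measure_itv/=; case: ifP => //; rewrite -EFinB ltry.
have iI (c : R) : lam.-integrable setT (fun y => ((fun=> c) \_ I y)%:E).
  rewrite (_ : (fun y => _) = (EFin \o (fun=> c)) \_ I).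
    apply/(integrable_mkcond _ mI); apply: measurable_bounded_integrable => //.
    by exists `|c|; split; [exact: num_real|move=> y cy x _; exact: ltW].
  by apply/funext => y /=; rewrite !patchE; case: ifP.
have i2 y : lam.-integrable setT (fun x => (h (x, y))%:E).
  apply: le_integrable (iI (C * `|G0 y|)) => //.
    by apply/measurable_EFinP; exact: (measurableT_comp mh (pair2_measurable y)).
  move=> x _; rewrite lee_fin patchE; case: ifPn => [_|xI].
    exact: le_trans (hle _) (ler_norm _).
  by rewrite h0// normr0.
have ih : ((lam \x lam)%E).-integrable setT (EFin \o h).
  apply/integrable12ltyP; first exact/measurable_EFinP.
  pose ah (p : measurableTypeR R * measurableTypeR R) := `|(h p)%:E|%E.
  have ah0 p : (0 <= ah p)%E by exact: abse_ge0.
  have mah : measurable_fun setT ah.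
    by apply: measurableT_comp => //; exact/measurable_EFinP.
  pose K := fine (\int[lam]_y (C * `|G0 y|)%:E)%E.
  apply: (@le_lt_trans _ _ (\int[lam]_x ((fun=> K) \_ I x)%:E)%E); last first.
    have iK := iI K; rewrite -ge0_fin_numE; first exact: integrable_fin_num.
    apply: integral_ge0 => x _; rewrite lee_fin patchE; case: ifP => // _.
    by rewrite fine_ge0// integral_ge0// => y _; rewrite lee_fin mulr_ge0.
  apply: ge0_le_integral => //.
  - by move=> x _; exact: integral_ge0.
  - rewrite -[X in measurable_fun _ X]/(fun x => \int[lam]_y ah (x, y))%E.
    exact: measurable_fun_fubini_tonelli_F.
  - exact: measurable_int (iI K).
  - move=> x _; rewrite patchE; case: ifPn => [_|xI].
      rewrite /K fineK; last exact: integrable_fin_num.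
      apply: ge0_le_integral => //.
      + apply: measurableT_comp => //; exact: measurable_int (i1 x).
      + exact: measurable_int iC.
      + by move=> y _; rewrite lee_fin.
    rewrite (eq_integral (fun=> 0%E)) ?integral0// => y _.
    by rewrite /= h0// normr0.
have F := Rintegral_Fubini ih i1 i2.
have L : (\int[lam]_x (\int[lam]_y h (x, y)) =
    \int[lam]_(s in I) ('D_1 a s * (\int[lam]_(r in `[0, s]) G r)))%R.
  rewrite [RHS]Rintegral_mkcond; apply: eq_Rintegral => s _.
  rewrite patchE; case: ifPn => [sI|sI]; last first.
    rewrite (@eq_Rintegral _ _ _ _ _ (fun=> 0)) ?Rintegral_cst ?mul0r//.
    by move=> y _; exact: h0.
  have sI' : 0 <= s <= t by move/set_mem : (sI); rewrite /I/= in_itv.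
  case/andP : sI' => s0 st.
  rewrite -(itv_RintegralZl _ (itv_integrableS (le_trans st t1) iG)).
  rewrite [RHS]Rintegral_mkcond.
  apply: eq_Rintegral => r _; rewrite /h /A /G0 /k/= !patchE sI.
  have -> : (r \in I) = (0 <= r <= t) by rewrite /I mem_setE in_itv.
  have -> : (r \in `[0, s]%classic) = (0 <= r <= s) by rewrite mem_setE in_itv.
  have [r0|r0] := leP 0 r; rewrite /= ?mulr0 ?mul0r//.
  have [rs|rs] := leP r s; rewrite ?mulr0//.
  by rewrite (le_trans rs st) mulr1.
have RR : (\int[lam]_y (\int[lam]_x h (x, y)) =
    \int[lam]_(r in I) ((a t - a r) * G r))%R.
  rewrite [RHS]Rintegral_mkcond; apply: eq_Rintegral => r _.
  rewrite patchE; case: ifPn => [rI|rI]; last first.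
    rewrite (@eq_Rintegral _ _ _ _ _ (fun=> 0)) ?Rintegral_cst ?mul0r// => x _.
    by rewrite /h /G0 patchE (negbTE rI) mulr0 mul0r.
  have /andP[r0 rt] : 0 <= r <= t by move/set_mem : (rI); rewrite /I/= in_itv.
  have iD : lam.-integrable `[r, t] (EFin \o 'D_1 a).
    apply: continuous_compact_integrable; first exact: segment_compact.
    exact: continuous_subspaceT.
  rewrite -(C1_FTC_R a1 rt) mulrC -(itv_RintegralZl _ iD).
  rewrite [RHS]Rintegral_mkcond.
  apply: eq_Rintegral => s _; rewrite /h /A /G0 /k/= !patchE rI.
  have -> : (s \in I) = (0 <= s <= t) by rewrite /I mem_setE in_itv.
  have -> : (s \in `[r, t]%classic) = (r <= s <= t) by rewrite mem_setE in_itv.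
  have [rs|rs] := leP r s; rewrite ?mulr0//=.
  rewrite (le_trans r0 rs)/= mulr1; case: ifP => _; first by rewrite mulrC.
  by rewrite mul0r.
rewrite -[LHS]L F RR.
have ia : lam.-integrable I (EFin \o (fun s => a s * G s)).
  apply: (le_integrable mI _ _ (integrableZl mI C (integrable_abse iGt))).
    apply/measurable_EFinP; apply: measurable_funM => //; apply: measurable_funTS.
    by apply: continuous_measurable_fun; exact: C1_continuous.
  move=> s Is /=; rewrite lee_fin normrM [leRHS]ger0_norm ?mulr_ge0// ler_wpM2r//.
  move: Is; rewrite /I/= in_itv/= => /andP[s0 st].
  by have [] := aC s _ => //; rewrite s0 (le_trans st).
have iat : lam.-integrable I (EFin \o (fun s => a t * G s)).
  exact: (integrableZl mI (a t) iGt).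
rewrite -RintegralZl// -RintegralB//.
by apply: eq_Rintegral => s _; rewrite mulrBl.
Qed.

End integration_by_parts_L1.

(** * Bernstein polynomials *)

Section Bernstein.
Context {R : realType}.
Implicit Types (phi psi : nat -> R) (x : R).

(* The expectation of [phi] under the binomial law, by recursion on the number of trials. *)
Fixpoint binE (m : nat) phi : {poly R} :=
  if m is k.+1 then (1 - 'X) * binE k phi + 'X * binE k (fun i => phi i.+1)
  else (phi 0%N)%:P.

Lemma binE_lin m phi psi (c : R) x :
  (binE m (fun i => phi i + c * psi i)).[x] = (binE m phi).[x] + c * (binE m psi).[x].
Proof.
elim: m phi psi => [|m IH] phi psi /=; first by rewrite !hornerC.
by rewrite !hornerE (IH phi psi) (IH (fun i => phi i.+1) (fun i => psi i.+1)); ring.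
Qed.

Lemma binE_cst m (c : R) x : (binE m (fun=> c)).[x] = c.
Proof. by elim: m => [|m IH] /=; rewrite !hornerE// IH; ring. Qed.

Lemma binE_le m phi psi x : 0 <= x <= 1 ->
  (forall i, (i <= m)%N -> phi i <= psi i) -> (binE m phi).[x] <= (binE m psi).[x].
Proof.
move=> /andP[x0 x1]; elim: m phi psi => [|m IH] phi psi H /=.
  by rewrite !hornerC H.
rewrite !hornerE lerD// ler_wpM2l ?subr_ge0//; apply: IH => i im; apply: H => //.
exact: leqW.
Qed.

(** For b = m x this is the variance of the binomial law. A general b is needed because the
    recursion replaces b by b - 1. *)
Lemma binE_sqr m (b : R) x :
  (binE m (fun i => (i%:R - b) ^+ 2)).[x] = (m%:R * x - b) ^+ 2 + m%:R * x * (1 - x).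
Proof.
elim: m b => [|m IH] b /=; first by rewrite hornerC; ring.
rewrite !hornerE IH.
have -> : (fun i : nat => (i.+1%:R - b) ^+ 2) = (fun i : nat => (i%:R - (b - 1)) ^+ 2).
  by apply/funext => i; rewrite -natr1; ring.
by rewrite IH -natr1; ring.
Qed.

Lemma binE0 m phi : (binE m phi).[0] = phi 0%N.
Proof. by elim: m phi => [|m IH] phi /=; rewrite !hornerE ?IH//; ring. Qed.

Lemma binE1 m phi : (binE m phi).[1] = phi m.
Proof. by elim: m phi => [|m IH] phi /=; rewrite !hornerE ?IH//; ring. Qed.

(** A modulus of continuity of the form constant plus quadratic can be averaged directly: the
    quadratic part becomes the variance, and no splitting of the sum into near and far nodes is
    required. *)
Lemma Bernstein_approx (g : R -> R) (eta C : R) : 0 < eta -> 0 <= C ->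
  (forall s t, 0 <= s <= 1 -> 0 <= t <= 1 -> `|g t - g s| <= eta + C * (t - s) ^+ 2) ->
  exists p : {poly R}, [/\ p.[0] = g 0, p.[1] = g 1 &
    forall t, 0 <= t <= 1 -> `|g t - p.[t]| <= eta *+ 2].
Proof.
move=> e0 C0 gH; have mC := archi_boundP (divr_ge0 C0 (ltW e0)).
(* [m] exceeds C / eta; with m + 1 trials the variance term C t (1 - t) / (m + 1) is then at most
   eta. *)
set m := Num.bound _ in mC.
have m0 : (0 < m.+1%:R :> R) by rewrite ltr0n.
pose phi (i : nat) := g (i%:R / m.+1%:R).
exists (binE m.+1 phi); split.
- by rewrite binE0 /phi mul0r.
- by rewrite binE1 /phi divff// gt_eqF.
move=> t t01.
have phi01 i : (i <= m.+1)%N -> 0 <= (i%:R / m.+1%:R : R) <= 1.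
  by move=> im; rewrite divr_ge0//= ler_pdivrMr// mul1r ler_nat.
pose q (i : nat) : R := eta + (C / m.+1%:R ^+ 2) * (i%:R - m.+1%:R * t) ^+ 2.
have qE : (binE m.+1 q).[t] <= eta *+ 2.
  rewrite /q (binE_lin _ (fun=> eta)) binE_cst binE_sqr subrr expr0n add0r mulr2n lerD2l//.
  case/andP : t01 => t0 t1.
  have -> : C / m.+1%:R ^+ 2 * (m.+1%:R * t * (1 - t)) = (C / m.+1%:R) * (t * (1 - t)).
    by field; rewrite gt_eqF.
  have h1 : C / m.+1%:R <= eta.
    rewrite ler_pdivrMr// mulrC -ler_pdivrMr// (le_trans (ltW mC))// ler_nat//.
  have h2 : t * (1 - t) <= 1 by nra.
  have h3 : 0 <= t * (1 - t) by rewrite mulr_ge0// subr_ge0.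
  by rewrite -[leRHS]mulr1 ler_pM// divr_ge0.
have b i : (i <= m.+1)%N -> `|g t - phi i| <= q i.
  move=> im; rewrite (le_trans (gH _ _ (phi01 _ im) t01))// lerD2l -mulrA ler_wpM2l//.
  rewrite le_eqVlt; apply/orP; left; apply/eqP.
  by field; rewrite gt_eqF.
have lin : (binE m.+1 phi).[t] - g t = (binE m.+1 (fun i => phi i + -1 * (fun=> g t) i)).[t].
  by rewrite (binE_lin _ phi) binE_cst mulN1r.
rewrite distrC lin ler_norml; apply/andP; split.
  have : (binE m.+1 (fun i => (fun=> 0) i + -1 * q i)).[t] <=
      (binE m.+1 (fun i => phi i + -1 * g t)).[t].
    apply: binE_le => // i im.
    by have := b i im; rewrite ler_norml => /andP[? ?]; lra.
  by rewrite (binE_lin _ (fun=> 0)) binE_cst; move: qE; rewrite mulr2n; lra.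
apply: le_trans qE; apply: binE_le => // i im.
by have := b i im; rewrite ler_norml => /andP[? ?]; lra.
Qed.

Lemma poly_antiderivative (p : {poly R}) : exists P : {poly R}, P^`() = p.
Proof.
exists (\poly_(i < (size p).+1) (if i is j.+1 then p`_j / j.+1%:R else 0)).
apply/polyP => i; rewrite coef_deriv coef_poly ltnS.
case: ltnP => [_|ip]; last by rewrite mul0rn nth_default.
by rewrite -[X in X = _]mulr_natr divfK// pnatr_eq0.
Qed.

End Bernstein.

Section Rintegral_linear.
Context d (T : measurableType d) {R : realType}.
Variables (mu : {measure set T -> \bar R}) (D : set T).
Hypothesis mD : measurable D.

Lemma Rintegral_lin (a b : R) (f g : T -> R) :
  mu.-integrable D (EFin \o f) -> mu.-integrable D (EFin \o g) ->
  mu.-integrable D (EFin \o (fun x => a * f x + b * g x)) /\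
  (\int[mu]_(x in D) (a * f x + b * g x) =
   a * (\int[mu]_(x in D) f x) + b * (\int[mu]_(x in D) g x))%R.
Proof.
move=> fi gi.
have i1 : mu.-integrable D (EFin \o (fun x => a * f x)) by exact: (integrableZl mD a fi).
have i2 : mu.-integrable D (EFin \o (fun x => b * g x)) by exact: (integrableZl mD b gi).
split; first exact: (integrableD mD i1 i2).
by rewrite RintegralD// !RintegralZl.
Qed.

End Rintegral_linear.

Section interval_tools.
Context {R : realType}.
Local Notation lam := (@lebesgue_measure R).

Lemma eq_lebesgue_Rintegral (D : set R) (g f : R -> R) : {in D, f =1 g} ->
  (\int[lam]_(x in D) f x = \int[lam]_(x in D) g x)%R.
Proof. by move=> fg; apply: (f_equal fine); apply: eq_integral => x xD; rewrite fg. Qed.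

Lemma measurable_I01 : measurable (`]0, 1[%classic : set (measurableTypeR R)).
Proof. exact: measurable_itv. Qed.

Lemma measurable_J01 : measurable (`[0, 1]%classic : set (measurableTypeR R)).
Proof. exact: measurable_itv. Qed.

Lemma within_continuousM (A : set R) (g h : R -> R) : {within A, continuous g} ->
  {within A, continuous h} -> {within A, continuous (fun t => g t * h t)}.
Proof. by move=> cg ch t; exact: (@continuousM R (subspace A) g h t (cg t) (ch t)). Qed.

Lemma within_continuous_lin (A : set R) (k l : R) (g h : R -> R) : {within A, continuous g} ->
  {within A, continuous h} -> {within A, continuous (fun t => k * g t + l * h t)}.
Proof.
move=> cg ch; have cc (x : R) : {within A, continuous (fun _ : R => x)}.
  by apply: continuous_subspaceT => t; exact: cst_continuous.
have c1 := within_continuousM (cc k) cg; have c2 := within_continuousM (cc l) ch.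
by move=> t; exact: (@continuousD R R (subspace A) (fun t => k * g t) (fun t => l * h t) t (c1 t) (c2 t)).
Qed.

Lemma itv_Rintegral_lin (i : interval R) (a b : R) (f g : R -> R) :
  lam.-integrable [set` i] (EFin \o f) -> lam.-integrable [set` i] (EFin \o g) ->
  lam.-integrable [set` i] (EFin \o (fun x => a * f x + b * g x)) /\
  (\int[lam]_(x in [set` i]) (a * f x + b * g x) =
   a * (\int[lam]_(x in [set` i]) f x) + b * (\int[lam]_(x in [set` i]) g x))%R.
Proof. by move=> fi gi; apply: Rintegral_lin. Qed.

(** The common shape of the solution of the limit equation and of its derivative, so that both are
    handled by the same continuity and integration lemmas. *)
Definition comb (T : Type) (k e l : R) (f1 f2 f3 f4 : T -> R) (x : T) : R :=
  k * (f1 x + e * f2 x) + l * (f3 x - e * f4 x).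

Lemma itv_Rintegral_comb (i : interval R) (k e l : R) (f1 f2 f3 f4 : R -> R) :
  lam.-integrable [set` i] (EFin \o f1) -> lam.-integrable [set` i] (EFin \o f2) ->
  lam.-integrable [set` i] (EFin \o f3) -> lam.-integrable [set` i] (EFin \o f4) ->
  (\int[lam]_(x in [set` i]) comb k e l f1 f2 f3 f4 x =
   k * ((\int[lam]_(x in [set` i]) f1 x) + e * (\int[lam]_(x in [set` i]) f2 x)) +
   l * ((\int[lam]_(x in [set` i]) f3 x) - e * (\int[lam]_(x in [set` i]) f4 x)))%R.
Proof.
move=> i1 i2 i3 i4; have [j1 e1] := itv_Rintegral_lin 1 e i1 i2.
have [j2 e2] := itv_Rintegral_lin 1 (- e) i3 i4.
have [_ e3] := itv_Rintegral_lin k l j1 j2; rewrite e1 e2 in e3.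
rewrite (eq_lebesgue_Rintegral
  (g := fun x => k * (1 * f1 x + e * f2 x) + l * (1 * f3 x + - e * f4 x))).
  by rewrite e3 !mul1r mulNr.
by move=> x _; rewrite /comb !mul1r mulNr.
Qed.

Lemma within_continuous_comb (A : set R) (k e l : R) (f1 f2 f3 f4 : R -> R) :
  {within A, continuous f1} -> {within A, continuous f2} ->
  {within A, continuous f3} -> {within A, continuous f4} ->
  {within A, continuous (comb k e l f1 f2 f3 f4)}.
Proof.
move=> c1 c2 c3 c4; have d1 := @within_continuous_lin _ 1 e _ _ c1 c2.
have d2 := @within_continuous_lin _ 1 (- e) _ _ c3 c4.
have := @within_continuous_lin _ k l _ _ d1 d2.
rewrite (_ : (fun t : R => _) = comb k e l f1 f2 f3 f4)//.
by apply/funext => t; rewrite /comb !mul1r mulNr.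
Qed.

End interval_tools.

Section primitive.
Context {R : realType}.
Local Notation lam := (@lebesgue_measure R).
Local Notation I01 := (`]0, 1[%classic : set R).

Lemma measure_itvoo (a b : R) : a <= b -> lam (`]a, b[%classic : set R) = (b - a)%:E.
Proof.
rewrite lebesgue_measure_itv/= lte_fin => ab.
by case: ltP => [_|ba]; rewrite ?EFinB//; congr (_%:E); apply/eqP; rewrite eq_sym subr_eq0 eq_le ab ba.
Qed.

Lemma I01_finite : (lam I01 < +oo)%E.
Proof. by rewrite measure_itvoo ?ler01// ltry. Qed.

Lemma integral_I01 (g : R -> R) : lam.-integrable `[0, 1] (EFin \o g) ->
  (\int[lam]_(t in `]0, 1[) g t = \int[lam]_(t in `[0, 1]) g t)%R.
Proof.
move=> ig; have i1 : lam.-integrable `]0, 1[ (EFin \o g).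
  by apply: integrableS ig => // t /=; rewrite !in_itv/= => /andP[/ltW-> /ltW->].
rewrite Rintegral_itv_obnd_cbnd//.
rewrite Rintegral_itv_bndo_bndc//.
by apply: integrableS ig => // t /=; rewrite !in_itv/= => /andP[-> /ltW->].
Qed.

Lemma within_continuous_bounded (g : R -> R) : {within `[0, 1], continuous g} ->
  exists2 C, 0 <= C & forall t, 0 <= t <= 1 -> `|g t| <= C.
Proof.
move=> cg; have [c _ cmax] : exists2 c, c \in `[0, 1]%R & forall t, t \in `[0, 1]%R -> `|g t| <= `|g c|.
  apply: (@EVT_max R (fun t => `|g t|)) => //.
  move=> t; apply: (@continuous_comp _ _ _ (g : subspace `[0, 1] -> R) Num.norm t (cg t)).
  exact: norm_continuous.
by exists `|g c| => // s s01; apply: cmax; rewrite in_itv.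
Qed.

Lemma within_continuous_integrable (g : R -> R) (t : R) : t <= 1 ->
  {within `[0, 1], continuous g} -> lam.-integrable `[0, t] (EFin \o g).
Proof.
move=> t1 cg; apply: itv_integrableS t1 _.
by apply: continuous_compact_integrable => //; exact: segment_compact.
Qed.

Lemma within_continuous_L2 (g : R -> R) : {within `[0, 1], continuous g} ->
  L2 lam I01 g.
Proof.
move=> cg; have [C C0 gC] := within_continuous_bounded cg.
have i1 := within_continuous_integrable (lexx 1) cg.
apply: (@bounded_L2 _ _ _ lam I01 (measurable_itv _) g C).
- exact: I01_finite.
- have : measurable_fun (`[0, 1] : set (measurableTypeR R)) g.
    by apply/measurable_EFinP; exact: measurable_int i1.
  by apply: measurable_funS => // t /=; rewrite !in_itv/= => /andP[/ltW-> /ltW->].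
- by move=> t /=; rewrite in_itv/= => /andP[t0 t1]; apply: gC; rewrite !ltW.
Qed.

Lemma test_fun_C1 (psi : R -> R) : test_fun I01 psi ->
  [/\ C1 psi, psi 0 = 0 & psi 1 = 0].
Proof.
move=> [cinf _ supp].
have out t : ~ I01 t -> psi t = 0.
  move=> tN; apply/eqP/negP => /negP pt; apply: tN; apply: supp.
  exact: subset_closure.
split; first exact: ((Cinfty_Ck_on psi).1 cinf 1%N).
- by apply: out; rewrite /= in_itv/= ltxx.
- by apply: out; rewrite /= in_itv/= ltxx andbF.
Qed.

Variables (w dw : R -> R).
Hypotheses (cw : {within `[0, 1], continuous w})
  (idw : lam.-integrable `[0, 1] (EFin \o dw))
  (wE : forall t, 0 <= t <= 1 -> w t = w 0 + (\int[lam]_(s in `[0, t]) dw s)%R).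

Lemma primitive_parts (psi : R -> R) : C1 psi ->
  (\int[lam]_(t in `[0, 1]) (w t * 'D_1 psi t) =
   w 1 * psi 1 - w 0 * psi 0 - \int[lam]_(t in `[0, 1]) (dw t * psi t))%R.
Proof.
move=> p1; have H := integration_by_parts_L1 (t := 1) _ idw p1.
rewrite lexx ler01 in H; have {}H := H isT.
have cD : {within `[0, 1], continuous ('D_1 psi)}.
  by apply: continuous_subspaceT; exact: C1_derive_continuous.
have iD := within_continuous_integrable (lexx 1) cD.
have cF : {within `[0, 1], continuous (fun t => 'D_1 psi t * (w t - w 0))}.
  apply: within_continuousM => //.
  have c1 : {within `[0, 1], continuous (fun _ : R => w 0)}.
    by apply: continuous_subspaceT => t; exact: cst_continuous.
  have := @within_continuous_lin R _ 1 (-1) _ _ cw c1.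
  rewrite (_ : (fun t : R => 1 * w t + -1 * w 0) = (fun t => w t - w 0))//.
  by apply/funext => t; rewrite mul1r mulN1r.
have iF := within_continuous_integrable (lexx 1) cF.
rewrite (eq_lebesgue_Rintegral (g := fun t => 1 * ('D_1 psi t * (w t - w 0)) + w 0 * 'D_1 psi t)); last first.
  by move=> t _; ring.
have [_ ->] := itv_Rintegral_lin 1 (w 0) iF iD.
rewrite C1_FTC_R// (eq_lebesgue_Rintegral (g := fun t => 'D_1 psi t * \int[lam]_(r in `[0, t]) dw r)%R); last first.
  move=> t; rewrite inE/= in_itv/= => t01.
  by rewrite wE// [w 0 + _]addrC addrK.
rewrite H [w 1]wE ?lexx ?ler01//.
have -> : (\int[lam]_(s in `[0, 1]) (psi s * dw s) = \int[lam]_(s in `[0, 1]) (dw s * psi s))%R.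
  by apply: eq_lebesgue_Rintegral => s _; rewrite mulrC.
by ring.
Qed.

Lemma primitive_H1 : L2 lam I01 dw -> in_H1_01 w dw.
Proof.
move=> dw2; split; first by apply/in_L2P => //; exact: within_continuous_L2.
  exact/in_L2P.
move=> psi /test_fun_C1[p1 psi0 psi1].
have cp : {within `[0, 1], continuous psi} by apply: continuous_subspaceT; exact: C1_continuous.
have cD : {within `[0, 1], continuous ('D_1 psi)}.
  by apply: continuous_subspaceT; exact: C1_derive_continuous.
have i1 : lam.-integrable `[0, 1] (EFin \o (fun t => w t * 'D_1 psi t)).
  by apply: within_continuous_integrable => //; exact: within_continuousM.
have [C C0 pC] := within_continuous_bounded cp.
have i2 : lam.-integrable `[0, 1] (EFin \o (fun t => dw t * psi t)).
  apply: (le_integrable _ _ _ (integrableZl _ C (integrable_abse idw))) => //.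
    apply/measurable_EFinP; apply: measurable_funM.
      by apply/measurable_EFinP; exact: measurable_int idw.
    by apply/measurable_EFinP; exact: measurable_int (within_continuous_integrable (lexx 1) cp).
  move=> t /=; rewrite in_itv/= => t01; rewrite lee_fin normrM [leRHS]ger0_norm ?mulr_ge0//.
  by rewrite mulrC ler_wpM2r// pC.
rewrite (eq_lebesgue_Rintegral (g := fun t => w t * 'D_1 psi t)); last by move=> t _; rewrite derive1E.
by rewrite !integral_I01// primitive_parts// psi0 psi1 !mulr0 !sub0r oppr0 add0r.
Qed.

End primitive.

(** * The Neumann problem by variation of constants *)

Section Neumann_algebra.
Context {R : realType}.

(** [F], [A1], [A2], [S1], [S2] stand for the integrals over [0, t] of the datum, of [P a], of
    [P (- a)], and of the exponentials with rates a and -a. The identity expresses that u is a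
    primitive of [du]; the next one, that [du] is a primitive of c u - f. *)
Lemma Neumann_algebra_u (a K F A1 A2 S1 S2 : R) : a != 0 ->
  (2 * a)^-1 * (F - a * A1 + -1 * (F + a * A2)) + K * (1 + a * S1 - -1 * (1 - a * S2)) =
  2 * K + (- 2^-1 * (A1 + 1 * A2) + K * a * (S1 - 1 * S2)).
Proof. by move=> a0; field; rewrite a0. Qed.

Lemma Neumann_algebra_du (a K F A1 A2 S1 S2 : R) : a != 0 ->
  - 2^-1 * (F - a * A1 + 1 * (F + a * A2)) + K * a * (1 + a * S1 - 1 * (1 - a * S2)) =
  a ^+ 2 * ((2 * a)^-1 * (A1 + -1 * A2) + K * (S1 - -1 * S2)) + -1 * F.
Proof. by move=> a0; field; rewrite a0. Qed.

Lemma Neumann_algebra_du1 (a e1 e2 q1 q2 : R) : a != 0 -> e1 - e2 != 0 ->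
  - 2^-1 * (e2 * q1 + 1 * (e1 * q2)) +
    (e2 * q1 + e1 * q2) / (2 * a * (e1 - e2)) * a * (e1 - 1 * e2) = 0.
Proof. by move=> a0 e0; field; rewrite a0 e0. Qed.

Lemma Neumann_algebra_u0 (a K : R) : (2 * a)^-1 * (1 * 0 + -1 * (1 * 0)) + K * (1 - -1 * 1) = 2 * K.
Proof. by rewrite !mulr0 addr0 mulr0 add0r mulN1r opprK mulrC; congr (_ * _); ring. Qed.

End Neumann_algebra.

Section Neumann_problem.
Context {R : realType}.
Local Notation lam := (@lebesgue_measure R).
Local Notation I01 := (`]0, 1[%classic : set R).
Variables (c : R) (f : R -> R).
Hypotheses (c0 : 0 < c) (f2 : in_L2 lam I01 f).

(** The datum is given on the open interval; extension by zero makes it integrable on [0, 1], where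
    the primitives are taken. *)
Let f0 := f \_ I01.

Let L2f0 : L2 lam I01 f0.
Proof.
have := (in_L2P lam (measurable_itv _) f).1 f2.
by apply: (eq_L2 measurable_I01) => t tI; rewrite /f0 patchE; case: ifPn => // /negP;
  rewrite inE; move: tI; rewrite inE => tI [].
Qed.

Let if0 : lam.-integrable `[0, 1] (EFin \o f0).
Proof.
have h1 : L2 lam I01 (fun=> 1 : R).
  by apply: (@bounded_L2 _ _ _ lam I01 (measurable_itv _) _ 1) => //; [exact: I01_finite|move=> t _; rewrite normr1].
have i1 := @L2M _ _ _ lam I01 (measurable_itv _) _ _ L2f0 h1.
apply/(integrable_mkcond _ measurable_J01).
rewrite (_ : _ \_ _ = (fun t => (f0 t * 1)%:E) \_ I01); last first.
  apply/funext => t; rewrite !patchE /= mulr1.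
  have [tI|tI] := boolP (t \in I01).
    by rewrite ifT//; move: tI; rewrite !mem_setE !in_itv/= => /andP[/ltW-> /ltW->].
  by case: ifP => // _; rewrite /f0 patchE (negbTE tI).
exact/(integrable_mkcond _ measurable_I01).
Qed.

Let a := Num.sqrt c.
Let a0 : 0 < a. Proof. by rewrite sqrtr_gt0. Qed.
Let a2 : a ^+ 2 = c. Proof. by rewrite sqr_sqrtr// ltW. Qed.

Let E (k t : R) := expR (k * t).

Let dE (k t : R) : is_derive t (1 : R) (E k) (k * E k t).
Proof.
have d1 : is_derive t (1 : R) (fun t => k * t) k.
  have := is_deriveZ k (is_derive_id t (1 : R)).
  by rewrite /GRing.scale/= mulr1.
by have := @is_derive1_comp _ expR (fun t => k * t) t _ _ (is_derive_expR _) d1; rewrite mulrC.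
Qed.

Let C1E k : C1 (E k).
Proof.
apply: (@Ck_on_comp _ _ 1 setT setT expR (fun t => k * t)) => //; try exact: openT.
  exact: Ck_on_expR.
by apply: Ck_onZ; [exact: openT|exact: Ck_on_id].
Qed.

Let DE k t : 'D_1 (E k) t = k * E k t.
Proof. by have [_ ->] := dE k t. Qed.

Let EN (k t : R) : E (- k) t * E k t = 1.
Proof. by rewrite /E -expRD mulNr addNr expR0. Qed.

Let cE (k : R) : {within `[0, 1], continuous (E k)}.
Proof. by apply: continuous_subspaceT; exact: C1_continuous. Qed.

Let iG k : lam.-integrable `[0, 1] (EFin \o (fun s => E k s * f0 s)).
Proof.
have [C C0 EC] := within_continuous_bounded (@cE k).
apply: (le_integrable _ _ _ (integrableZl _ C (integrable_abse if0))) => //.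
  apply/measurable_EFinP; apply: measurable_funM.
    by apply/measurable_EFinP; exact: measurable_int (within_continuous_integrable (lexx 1) (@cE k)).
  by apply/measurable_EFinP; exact: measurable_int if0.
move=> t /=; rewrite in_itv/= => t01; rewrite lee_fin normrM [leRHS]ger0_norm ?mulr_ge0//.
by rewrite ler_wpM2r// EC.
Qed.

Let Q k t := (\int[lam]_(s in `[0, t]) (E k s * f0 s))%R.

Let cQ k : {within `[0, 1], continuous (Q k)}.
Proof. exact: parameterized_integral_continuous ler01 (iG k). Qed.

Let cEQ k l : {within `[0, 1], continuous (fun t => E k t * Q l t)}.
Proof.
apply: within_continuousM; [exact: cE|exact: cQ].
Qed.

Let Q0 k : Q k 0 = 0.
Proof. by rewrite /Q set_itv1 Rintegral_set1. Qed.

Let Phi t := (\int[lam]_(s in `[0, t]) f0 s)%R.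
Let A k t := (\int[lam]_(s in `[0, t]) (E (- k) s * Q k s))%R.
Let S k t := (\int[lam]_(s in `[0, t]) E k s)%R.

(** Integration by parts, the exponentials with rates k and -k cancelling in the remaining
    integral. *)
Let AE k t : k = a \/ k = - a -> 0 <= t <= 1 -> - k * A k t = E (- k) t * Q k t - Phi t.
Proof.
move=> ka t01; have := integration_by_parts_L1 t01 (iG k) (C1E (- k)).
have t1 : t <= 1 by case/andP : t01.
rewrite (eq_lebesgue_Rintegral (g := fun s => - k * (E (- k) s * Q k s))); last first.
  by move=> s _; rewrite DE mulrA.
rewrite RintegralZl//; last by apply: within_continuous_integrable.
move=> ->; congr (_ - _); apply: eq_lebesgue_Rintegral => s _; rewrite mulrA.
by rewrite EN mul1r.
Qed.

Let SE k t : 0 <= t <= 1 -> k * S k t = E k t - 1.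
Proof.
move=> /andP[t0 t1]; have := C1_FTC_R (C1E k) t0.
rewrite (eq_lebesgue_Rintegral (g := fun s => k * E k s)); last by move=> s _; rewrite DE.
rewrite RintegralZl//; last by apply: within_continuous_integrable.
by move=> ->; rewrite [E k 0]/E mulr0 expR0.
Qed.

(* Variation of constants, with [K] chosen so that [du 1 = 0]. *)
Let K := (E (- a) 1 * Q a 1 + E a 1 * Q (- a) 1) / (2 * a * (E a 1 - E (- a) 1)).

Let P k t := E (- k) t * Q k t.
(** In exponentials: u(t) = 2 K cosh(a t) - (1/a) int_0^t sinh(a (t - s)) f0(s) ds. Both terms have
    derivative 0 at 0, whatever [K]. *)
Let u := comb (2 * a)^-1 (-1) K (P a) (P (- a)) (E a) (E (- a)).
Let du := comb (- 2^-1) 1 (K * a) (P a) (P (- a)) (E a) (E (- a)).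

Let cu : {within `[0, 1], continuous u}.
Proof.
exact (@within_continuous_comb R _ (2 * a)^-1 (-1) K (P a) (P (- a)) (E a) (E (- a))
  (@cEQ (- a) a) (@cEQ (- - a) (- a)) (@cE a) (@cE (- a))).
Qed.

Let cdu : {within `[0, 1], continuous du}.
Proof.
exact (@within_continuous_comb R _ (- 2^-1) 1 (K * a) (P a) (P (- a)) (E a) (E (- a))
  (@cEQ (- a) a) (@cEQ (- - a) (- a)) (@cE a) (@cE (- a))).
Qed.

Let ints t : 0 <= t <= 1 ->
  [/\ (\int[lam]_(s in `[0, t]) du s =
      - 2^-1 * (A a t + 1 * A (- a) t) + K * a * (S a t - 1 * S (- a) t))%R
    & (\int[lam]_(s in `[0, t]) u s =
      (2 * a)^-1 * (A a t + -1 * A (- a) t) + K * (S a t - -1 * S (- a) t))%R].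
Proof.
move=> /andP[t0 t1].
have i1 k := within_continuous_integrable t1 (@cEQ (- k) k).
have i2 k := within_continuous_integrable t1 (@cE k).
by split; apply: itv_Rintegral_comb; first [exact: i1|exact: i2].
Qed.

Let eqs t : 0 <= t <= 1 ->
  [/\ P a t = Phi t - a * A a t, P (- a) t = Phi t + a * A (- a) t,
      E a t = 1 + a * S a t & E (- a) t = 1 - a * S (- a) t].
Proof.
move=> t01; have h1 := AE (or_introl (erefl a)) t01; have h2 := AE (or_intror (erefl (- a))) t01.
have h3 := SE a t01; have h4 := SE (- a) t01.
rewrite -/(P a t) in h1; rewrite -/(P (- a) t) opprK in h2.
by split; [rewrite -mulNr h1|rewrite h2|rewrite h3|rewrite -mulNr h4]; rewrite addrC subrK.
Qed.

Let uE t : 0 <= t <= 1 -> u t = u 0 + (\int[lam]_(s in `[0, t]) du s)%R.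
Proof.
move=> t01; have [-> _] := ints t01; have [h1 h2 h3 h4] := eqs t01.
have aN0 : a != 0 by rewrite gt_eqF.
have E0 k : E k 0 = 1 by rewrite /E mulr0 expR0.
have -> : u 0 = 2 * K by rewrite /u /comb /P !Q0 !E0 Neumann_algebra_u0.
by rewrite /u /comb h1 h2 h3 h4 Neumann_algebra_u.
Qed.

Let duE t : 0 <= t <= 1 -> du t = (\int[lam]_(s in `[0, t]) (c * u s - f0 s))%R.
Proof.
move=> t01; have t1 : t <= 1 by case/andP : t01.
rewrite (eq_lebesgue_Rintegral (g := fun s => c * u s + -1 * f0 s)); last by move=> s _; rewrite mulN1r.
have [_ ->] := itv_Rintegral_lin c (-1) (within_continuous_integrable t1 cu) (itv_integrableS t1 if0).
have [_ ->] := ints t01; have [h1 h2 h3 h4] := eqs t01.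
have aN0 : a != 0 by rewrite gt_eqF.
by rewrite -/(Phi t) /du /comb h1 h2 h3 h4 -a2 Neumann_algebra_du.
Qed.

Let du0 : du 0 = 0.
Proof. by rewrite duE ?lexx ?ler01// set_itv1 Rintegral_set1. Qed.

Let du1 : du 1 = 0.
Proof.
have D0 : E a 1 - E (- a) 1 != 0.
  by rewrite subr_eq0 gt_eqF// /E !mulr1 ltr_expR (@lt_trans _ _ 0) ?oppr_lt0.
have aN0 : a != 0 by rewrite gt_eqF.
by rewrite /du /comb /P opprK /K Neumann_algebra_du1.
Qed.

Let ddu t := c * u t - f0 t.

Let iddu : lam.-integrable `[0, 1] (EFin \o ddu).
Proof.
have [+ _] := itv_Rintegral_lin c (-1) (within_continuous_integrable (lexx 1) cu) if0.
by rewrite (_ : (fun t => _) = ddu)//; apply/funext => t; rewrite /ddu; ring.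
Qed.

Let L2ddu : L2 lam I01 ddu.
Proof.
by apply: L2_sub => //; apply: L2_scale => //; exact: within_continuous_L2.
Qed.

Let bdry01 t : bdry I01 t -> t = 0 \/ t = 1.
Proof.
move=> [ct it]; have : closure (`[0, 1]%classic : set R) t.
  by apply: closureS ct => s /=; rewrite !in_itv/= => /andP[/ltW-> /ltW->].
rewrite -(closure_id _).1; last exact: itv_closed.
rewrite /= in_itv/= => /andP[t0 t1].
have [/eqP t0'|t0'] := boolP (t == 0); first by left.
have [/eqP t1'|t1'] := boolP (t == 1); first by right.
exfalso; apply: it; have /interior_id -> : open I01 by exact: itv_open.
by rewrite /= in_itv/= !lt_def t0' t0 eq_sym t1' t1.
Qed.

(** Two extra facts prepare the sequel. The bound on increments of u' is Cauchy-Schwarz on u'' over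
    [s, t] and feeds the polynomial approximation. The weak form holds for all C^1 functions,
    vanishing at the ends or not, because u' is 0 there: slices of test functions of the thin domain
    do not vanish at the ends. *)
Lemma Neumann_solvable : exists u du : R -> R,
  [/\ {within `[0, 1], continuous u}, {within `[0, 1], continuous du},
      in_H1_01 u du, neumann_solution c f u &
  [/\ (forall t, 0 <= t <= 1 -> u t = u 0 + (\int[lam]_(s in `[0, t]) du s)%R),
      du 0 = 0, du 1 = 0,
      (exists2 K, 0 <= K & forall s t, 0 <= s <= 1 -> 0 <= t <= 1 ->
         (du t - du s) ^+ 2 <= K * `|t - s|) &
      (forall psi : R -> R, C1 psi ->
        \int[lam]_(t in I01) (du t * 'D_1 psi t + (c * u t - f t) * psi t) = 0)%R]].
Proof.
have H1u : in_H1_01 u du.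
  apply: (primitive_H1 cu) => //; last exact: within_continuous_L2.
  exact: within_continuous_integrable (lexx 1) cdu.
have duE' t : 0 <= t <= 1 -> du t = du 0 + (\int[lam]_(s in `[0, t]) ddu s)%R.
  by move=> t01; rewrite du0 add0r duE.
exists u, du; split; [exact: cu|exact: cdu|exact: H1u| |].
  exists du, ddu; split; [exact: H1u| |exact: cdu| |].
  - by apply: (primitive_H1 cdu) => //; exact: duE'.
  - by move=> t /bdry01[->|->]; [exact: du0|exact: du1].
  - apply: aeW => t tI; rewrite /ddu /f0 patchE ifT ?inE//.
    by rewrite opprB subrK.
split; [exact: uE|exact: du0|exact: du1| |].
  exists (nrm lam I01 ddu ^+ 2); first exact: sqr_ge0.
  suff wlg s t : 0 <= s -> s <= t -> t <= 1 -> (du t - du s) ^+ 2 <= nrm lam I01 ddu ^+ 2 * (t - s).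
    move=> s t /andP[s0 s1] /andP[t0 t1]; have [st|ts] := leP s t.
      by rewrite ger0_norm ?subr_ge0//; exact: wlg.
    rewrite ltr0_norm ?subr_lt0// opprB -sqrrN opprB; apply: wlg => //; exact: ltW.
  move=> s0 st t1; have s01 : 0 <= s <= 1 by rewrite s0 (le_trans st).
  have t01 : 0 <= t <= 1 by rewrite (le_trans s0 st).
  pose D := `]s, t[%classic : set (measurableTypeR R).
  have mD : measurable D by exact: measurable_itv.
  have DI : D `<=` I01.
    by move=> x; rewrite /D/= !in_itv/= => /andP[sx xt]; rewrite (le_lt_trans s0 sx) (lt_le_trans xt t1).
  have E1 : du t - du s = (\int[lam]_(x in D) (1 * ddu x))%R.
    rewrite (duE t01) (duE s01) Rintegral_itvB//; last exact (@itv_integrableS R ddu t t1 iddu).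
    have i1 : lam.-integrable `]s, t] (EFin \o ddu).
      by apply: integrableS iddu => // x /=; rewrite !in_itv/= => /andP[/ltW sx xt]; rewrite (le_trans s0 sx) (le_trans xt).
    rewrite -Rintegral_itv_bndo_bndc//; last first.
      by apply: integrableS i1 => // x /=; rewrite !in_itv/= => /andP[-> /ltW].
    by apply: eq_lebesgue_Rintegral => x _; rewrite mul1r.
  have lD : lam D = (t - s)%:E := measure_itvoo st.
  have fD : (lam D < +oo)%E by rewrite lD ltry.
  have L1 : L2 lam D (fun=> 1 : R).
    apply: (@bounded_L2 _ _ _ lam D mD _ 1) => //; last by move=> x _; rewrite normr1.
  have Ld : L2 lam D ddu.
    case: L2ddu => md id; split; first exact: measurable_funS md.
    by apply: integrableS id => //; exact: measurable_itv.
  have CS : `|du t - du s| <= nrm lam D (fun=> 1) * nrm lam D ddu.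
    by rewrite E1; exact (@L2_CauchySchwarz _ _ _ lam D mD _ _ L1 Ld).
  have n1 : nrm lam D (fun=> 1) ^+ 2 = t - s.
    rewrite sqr_nrm expr1n Rintegral_cst// mul1r.
    exact: (congr1 fine lD).
  have n2 : nrm lam D ddu ^+ 2 <= nrm lam I01 ddu ^+ 2.
    have [_ h] := @nrm_subset _ _ _ lam D I01 ddu mD measurable_I01 DI L2ddu.
    by rewrite lerXn2r ?nnegrE ?nrm_ge0.
  rewrite -real_normK ?num_real//; apply: (@le_trans _ _ ((nrm lam D (fun=> 1) * nrm lam D ddu) ^+ 2)).
    by rewrite lerXn2r ?nnegrE ?mulr_ge0 ?nrm_ge0.
  by rewrite exprMn n1 mulrC ler_wpM2r// subr_ge0.
move=> psi p1.
have idu := within_continuous_integrable (lexx 1) cdu.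
have cp : {within `[0, 1], continuous psi} by apply: continuous_subspaceT; exact: C1_continuous.
have cD : {within `[0, 1], continuous ('D_1 psi)}.
  by apply: continuous_subspaceT; exact: C1_derive_continuous.
have i1 : lam.-integrable `[0, 1] (EFin \o (fun t => du t * 'D_1 psi t)).
  by apply: within_continuous_integrable => //; exact: within_continuousM.
have [C C0 pC] := within_continuous_bounded cp.
have i2 : lam.-integrable `[0, 1] (EFin \o (fun t => ddu t * psi t)).
  apply: (le_integrable _ _ _ (integrableZl _ C (integrable_abse iddu))) => //.
    apply/measurable_EFinP; apply: measurable_funM.
      by apply/measurable_EFinP; exact: measurable_int iddu.
    by apply/measurable_EFinP; exact: measurable_int (within_continuous_integrable (lexx 1) cp).
  move=> t /=; rewrite in_itv/= => t01; rewrite lee_fin normrM [leRHS]ger0_norm ?mulr_ge0//.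
  by rewrite mulrC ler_wpM2r// pC.
have [i3 e3] := itv_Rintegral_lin 1 1 i1 i2.
rewrite (eq_lebesgue_Rintegral (g := fun t => 1 * (du t * 'D_1 psi t) + 1 * (ddu t * psi t))); last first.
  by move=> t tI; rewrite /ddu /f0 patchE tI; ring.
rewrite integral_I01// e3 (primitive_parts cdu iddu duE' p1) du0 du1; ring.
Qed.

End Neumann_problem.

(** * The lattice of holes *)

Section boundary.
Context {R : realType} {n : nat}.
Implicit Types (x y : 'rV[R]_n) (Omega : set 'rV[R]_n).

Lemma enorm_distC x y : enorm (x - y) = enorm (y - x).
Proof. by rewrite -enormN opprB. Qed.

(** If the segment avoided the boundary, the parameters landing in [Omega] would form an open and
    closed subset of [0, 1] that contains 0 but not 1. *)
Lemma segment_bdry Omega x y : open Omega -> Omega x -> ~ Omega y ->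
  exists2 t, 0 <= t <= 1 & bdry Omega (t *: (y - x) + x).
Proof.
move=> oO Ox Oy; apply: contrapT => H.
pose l (t : R) := t *: (y - x) + x.
have cl : continuous l.
  by move=> t; apply: cvgD; [apply: cvgZ; [exact: cvg_id|exact: cvg_cst]|exact: cvg_cst].
have nb t : 0 <= t <= 1 -> closure Omega (l t) -> Omega (l t).
  move=> t01 ct; apply: contrapT => Ot; apply: H; exists t => //; split => //.
  by move=> /interior_subset.
have : `[0, 1]%classic `&` (l @^-1` Omega) = `[0, 1]%classic.
  apply: (@segment_connected R 0 1).
  - by exists 0; split; rewrite /= ?in_itv/= ?lexx ?ler01// /l scale0r add0r.
  - by exists (l @^-1` Omega) => //; apply: open_comp => // t _; exact: cl.
  - exists (l @^-1` closure Omega).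
      by apply: preimage_closed => //; exact: closed_closure.
    apply/seteqP; split => t /= [t01 Ot]; split => //; first exact: subset_closure.
    by apply: nb => //; move: t01; rewrite in_itv.
move/seteqP => -[_ /(_ 1)] /=; rewrite in_itv/= ler01 lexx => /(_ isT) [_].
by rewrite /l scale1r subrK.
Qed.

Lemma edist_le x y (A : set 'rV[R]_n) : A y -> Defs.edist x A <= enorm (x - y).
Proof.
move=> Ay; apply: ge_inf; last by exists y.
by exists 0 => _ [z _ <-]; exact: enorm_ge0.
Qed.

Lemma le_edist x (A : set 'rV[R]_n) (rho : R) : A !=set0 ->
  (forall y, A y -> rho <= enorm (x - y)) -> rho <= Defs.edist x A.
Proof.
move=> [a Aa] H; apply: lb_le_inf; first by exists (enorm (x - a)), a.
by move=> _ [y Ay <-]; exact: H.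
Qed.

(** [centers] asks only for distance to the boundary, so it also contains lattice points outside the
    domain. A cell ball misses the boundary and therefore lies entirely on one side. *)
Lemma edist_bdry_iff Omega c (delta : R) x : open Omega ->
  delta < Defs.edist c (bdry Omega) -> enorm (x - c) <= delta -> (Omega x <-> Omega c).
Proof.
move=> oO dc xc.
have bd t : 0 <= t <= 1 -> bdry Omega (t *: (x - c) + c) -> False.
  move=> /andP[t0 t1] /(edist_le c).
  rewrite enorm_distC addrK enormZ ger0_norm// => h.
  have := lt_le_trans dc h; apply/negP; rewrite -leNgt (le_trans _ xc)//.
  by rewrite ler_piMl// enorm_ge0.
split=> [Ox|Oc]; apply: contrapT => H.
  have [t /andP[t0 t1] b] := segment_bdry oO Ox H.
  apply: (bd (1 - t)); first by rewrite subr_ge0 t1 lerBlDr lerDl.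
  rewrite (_ : _ + _ = t *: (c - x) + x)//.
  by apply/rowP => i; rewrite !mxE; ring.
by have [t t01] := segment_bdry oO Oc H; exact: bd.
Qed.

(** Needed because the distance to an empty boundary would be 0, the default value of [inf]. A point
    with all coordinates |M| + 1 is outside the bounded set. *)
Lemma bdry_nonempty Omega : (0 < n)%N -> open Omega -> Omega !=set0 ->
  bounded_set Omega -> bdry Omega !=set0.
Proof.
move=> n0 oO [x Ox] [M [_ bM]].
pose y : 'rV[R]_n := const_mx (`|M| + 1).
have Oy : ~ Omega y.
  move=> Oy; have M1 : M < `|M| + 2^-1 by rewrite (le_lt_trans (ler_norm M))// ltrDl.
  have := le_trans (coord_le_norm y (Ordinal n0)) (bM _ M1 _ Oy).
  rewrite mxE ger0_norm ?addr_ge0//; lra.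
by have [t _ b] := segment_bdry oO Ox Oy; exists (t *: (y - x) + x).
Qed.

Lemma edist_bdry_gt Omega c (delta rho : R) : open Omega -> bdry Omega !=set0 ->
  delta < rho -> (forall y, enorm (y - c) <= rho -> Omega y) ->
  delta < Defs.edist c (bdry Omega).
Proof.
move=> oO b0 dr H; apply: lt_le_trans dr _; apply: le_edist => // y [_ iy].
rewrite enorm_distC leNgt; apply/negP => h; apply: iy.
by move/interior_id : oO => ->; apply: H; exact: ltW.
Qed.

End boundary.

Section lattice.
Context {R : realType} {n : nat}.
Variable (delta : R).
Hypothesis delta0 : 0 < delta.
Implicit Types (x y c : 'rV[R]_n).

Definition lattice : set 'rV[R]_n :=
  [set c | forall k, exists m : int, c 0 k = 2 * delta * m%:~R].

Lemma lattice_separated c c' x : lattice c -> lattice c' ->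
  cube delta (x - c) -> cube delta (x - c') -> c = c'.
Proof.
move=> lc lc' /cubeP xc /cubeP xc'; apply/rowP => k.
have [m mE] := lc k; have [m' mE'] := lc' k.
have := xc k; have := xc' k; rewrite !mxE mE mE' => /andP[a1 a2] /andP[b1 b2].
congr (_ * _%:~R); apply/eqP; rewrite eq_le -!ltzD1 -!(ltr_int R) !intrD.
apply/andP; split; rewrite -(ltr_pM2l delta0); lra.
Qed.

Lemma lattice_cover x : exists2 c, lattice c & cube delta (x - c).
Proof.
(* Rounding to the nearest lattice point; the shift by [delta] before the floor places x - c in the
   half-open cube. *)
exists (\row_k (2 * delta * (Num.floor ((x 0 k + delta) / (2 * delta)))%:~R)).
  by move=> k; eexists; rewrite mxE.
apply/cubeP => k; rewrite !mxE.
have d2 : 0 < 2 * delta by rewrite mulr_gt0.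
set t := (_ / _); have tE : x 0 k = t * (2 * delta) - delta.
  by rewrite /t divfK ?gt_eqF// addrK.
have /andP[h1 h2] := floor_itv t.
rewrite -(ler_pM2l d2) in h1; rewrite -(ltr_pM2l d2) intrD in h2.
by rewrite tE; apply/andP; split; lra.
Qed.

Lemma lattice_finite M : finite_set (lattice `&` [set c | `|c| <= M]).
Proof.
pose K : nat := (Num.truncn (`|M| / (2 * delta))).+1.
(* Integers between -K and K are coded by ordinals with offset [K]. *)
pose g (f : {ffun 'I_n -> 'I_(2 * K).+1}) : 'rV[R]_n :=
  \row_k (2 * delta * ((f k)%:Z - K%:Z)%:~R).
apply: (@sub_finite_set _ _ (g @` setT)); last exact/finite_image/finite_finset.
have d2 : 0 < 2 * delta by rewrite mulr_gt0.
move=> c [lc /= cM].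
have mK k (m : int) : c 0 k = 2 * delta * m%:~R -> `|m| <= K%:Z.
  move=> ck; rewrite -(ler_int R) intr_norm.
  have h : `|M| / (2 * delta) < K%:R.
    by rewrite /K truncnS_gt.
  have : `|c 0 k| <= `|M| by rewrite (le_trans (coord_le_norm c k))// (le_trans cM)// ler_norm.
  rewrite ck normrM gtr0_norm// => h2; apply/ltW/(le_lt_trans _ h).
  by rewrite ler_pdivlMr// mulrC.
have /choice [f fP] : forall k, exists m : 'I_(2 * K).+1, c 0 k = 2 * delta * ((m : nat)%:Z - K%:Z)%:~R.
  move=> k; have [m mE] := lc k; have := mK k m mE; rewrite ler_norml => /andP[m1 m2].
  have h0 : 0 <= m + K%:Z by rewrite -lerBlDr sub0r.
  have hl : (absz (m + K%:Z)%R < (2 * K).+1)%N.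
    rewrite ltnS -lez_nat gez0_abs// mul2n -addnn PoszD lerD2r//.
  by exists (Ordinal hl); rewrite /= gez0_abs// addrK.
by exists (finfun f) => //; apply/rowP => k; rewrite mxE ffunE fP.
Qed.

Lemma lattice_seq (P : set 'rV[R]_n) M : exists s : seq 'rV[R]_n,
  uniq s /\ forall c, c \in s <-> [/\ lattice c, P c & `|c| <= M].
Proof.
have : finite_set ((lattice `&` [set c | `|c| <= M]) `&` P).
  by apply: finite_setIl; exact: lattice_finite.
move=> /finite_seqP[s sE]; exists (undup s); split; first exact: undup_uniq.
move=> c; rewrite mem_undup; split=> [cs|[lc Pc cM]].
  have : [set` s] c by [].
  by rewrite -sE => -[[]].
by have : [set` s] c by rewrite -sE.
Qed.

End lattice.

(** * The corrector near one hole *)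

Lemma Bernoulli_inequality (R : realDomainType) (x : R) k :
  0 <= x <= 1 -> 1 - k%:R * x <= (1 - x) ^+ k.
Proof.
move=> /andP[x0 x1]; elim: k => [|k IH]; first by rewrite mul0r subr0 expr0.
rewrite exprS; apply: (@le_trans _ _ ((1 - x) * (1 - k%:R * x))); last first.
  by rewrite ler_wpM2l// subr_ge0.
rewrite -subr_ge0 (_ : _ - _ = k%:R * x ^+ 2); last by rewrite -[k.+1]addn1 natrD; ring.
by rewrite mulr_ge0// sqr_ge0.
Qed.

Section profile.
Context {R : realType}.
Variables (m : nat) (delta eta : R).
Local Notation r := (delta `^ (m.+2%:R / (m.+2%:R - 2))).
Local Notation r1 := (r / (1 - 2 * eta)).
Hypotheses (m0 : (0 < m)%N) (d0 : 0 < delta) (eta0 : 0 < eta) (eta4 : eta < 4^-1).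
Hypotheses (r1d : r1 < delta / 2) (dsmall : 2 ^+ m * delta ^+ 2 <= 2^-1).

Let d0' : 0 <= delta. Proof. exact: ltW. Qed.
Let d20 : 0 <= delta / 2. Proof. by rewrite divr_ge0. Qed.
Let e : R := - (m%:R / 2).

Let r0 : 0 < r. Proof. exact: powR_gt0. Qed.

Let mR0 : 0 < m%:R :> R. Proof. by rewrite ltr0n. Qed.

(** Here m = N - 2. This is the critical scaling, in which the capacity of a hole is comparable to
    the volume of its cell. *)
Lemma hole_radius_expr : r ^+ m = delta ^+ m.+2.
Proof.
have mE : m.+2%:R - 2 = m%:R :> R by rewrite -addn2 natrD addrK.
rewrite mE -powR_mulrn ?powR_ge0// -powRrM divfK ?gt_eqF//.
by rewrite powR_mulrn// ltW.
Qed.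

Let et0 : 0 < 1 - 2 * eta. Proof. by move: eta4; lra. Qed.
Let r_r1 : r < r1.
Proof. by rewrite ltr_pdivlMr// gtr_pMr//; move: eta0; lra. Qed.
Let rd : r < delta / 2. Proof. exact: lt_trans r_r1 r1d. Qed.

Let sqr_powR (rho : R) : 0 < rho -> (rho ^+ 2) `^ e = rho ^- m.
Proof.
move=> rho0; rewrite -powR_mulrn ?ltW// -powRrM /e.
have -> : 2 * - (m%:R / 2) = - m%:R :> R by rewrite mulrN mulrC divfK.
by rewrite powRN powR_mulrn// ltW.
Qed.

Let theta (s : R) : R := 1 - smooth_step (4 * s / delta ^+ 2).
Let H (s : R) : R := delta ^+ m.+2 * s `^ e * theta s.
Let Psi (t : R) : R := t * smooth_step (t / eta).

(* With [s = |y|^2], [H] is the potential [delta^N |y|^(2-N)], equal to 1 on the sphere of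
   radius [r], truncated by [theta] at distance about [delta]; [Psi] flattens it smoothly to
   the constant 1 on a neighbourhood of the hole. *)
Definition profile (s : R) : R := if 0 < s then 1 - Psi (1 - H s) else 1.

Let theta1 s : s <= delta ^+ 2 / 4 -> theta s = 1.
Proof.
move=> sd; rewrite /theta smooth_step0 ?subr0//.
by rewrite ler_pdivrMr ?exprn_gt0//; move: sd; lra.
Qed.

Let theta0 s : delta ^+ 2 / 2 <= s -> theta s = 0.
Proof.
move=> sd; rewrite /theta smooth_step1 ?subrr//.
by rewrite ler_pdivlMr ?exprn_gt0//; move: sd; lra.
Qed.

Let theta_ge0 s : 0 <= theta s. Proof. by rewrite subr_ge0 smooth_step_le1. Qed.
Let theta_le1 s : theta s <= 1. Proof. by rewrite lerBlDr lerDl smooth_step_ge0. Qed.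

Let H_ge0 s : 0 <= H s.
Proof. by rewrite /H mulr_ge0// mulr_ge0 ?powR_ge0 ?exprn_ge0. Qed.

Let HE rho : 0 < rho -> rho <= delta / 2 -> H (rho ^+ 2) = (r / rho) ^+ m.
Proof.
move=> rho0 rd2; have rho0' := ltW rho0; rewrite /H theta1 ?mulr1; last first.
  rewrite (_ : _ / 4 = (delta / 2) ^+ 2); last by rewrite expr_div_n -natrX.
  by rewrite lerXn2r ?nnegrE.
by rewrite sqr_powR// -hole_radius_expr expr_div_n.
Qed.

Let Hle rho : 0 < rho -> H (rho ^+ 2) <= delta ^+ m.+2 * rho ^- m.
Proof.
move=> rho0; rewrite /H sqr_powR// -[leRHS]mulr1 ler_wpM2l//.
by rewrite mulr_ge0 ?invr_ge0 ?exprn_ge0// ltW.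
Qed.

(** At |y| = delta / 2 the untruncated potential is 2^m delta^2. Thus [dsmall], with eta < 1/4,
    keeps the zone where [theta] varies inside the region where [Psi] is the identity. *)
Let Hfar s : delta ^+ 2 / 4 <= s -> H s <= 2^-1.
Proof.
move=> sd; have s0 : 0 < s by apply: lt_le_trans sd; rewrite divr_gt0 ?exprn_gt0.
have [rho rho0 sE] : exists2 rho, 0 < rho & s = rho ^+ 2.
  by exists (Num.sqrt s); rewrite ?sqrtr_gt0// sqr_sqrtr// ltW.
apply: le_trans dsmall; rewrite sE; apply: le_trans (Hle rho0) _.
have rho0' := ltW rho0.
have h : delta / 2 <= rho.
  by rewrite -(@ler_pXn2r _ 2) ?nnegrE// -sE expr_div_n -natrX.
have -> : 2 ^+ m * delta ^+ 2 = delta ^+ m.+2 * (delta / 2) ^- m.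
  have dm : delta ^+ m != 0 by rewrite expf_neq0 ?gt_eqF.
  have -> : delta ^+ m.+2 = delta ^+ m * delta ^+ 2 by rewrite -exprD addn2.
  rewrite -exprVn invf_div expr_div_n.
  by move: (2 ^+ m) (delta ^+ m) dm => a b b0; field.
rewrite ler_wpM2l ?exprn_ge0// lef_pV2 ?posrE ?exprn_gt0 ?divr_gt0//.
by rewrite lerXn2r ?nnegrE.
Qed.

Let Psi_id t : 2 * eta <= t -> Psi t = t.
Proof. by move=> h; rewrite /Psi smooth_step1 ?mulr1// ler_pdivlMr. Qed.

Let Psi_0 t : t <= eta -> Psi t = 0.
Proof. by move=> h; rewrite /Psi smooth_step0 ?mulr0// ler_pdivrMr// mul1r. Qed.

Let Psi01 t : t <= 1 -> 0 <= Psi t <= 1.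
Proof.
move=> t1; have [h|h] := leP t eta; first by rewrite Psi_0// lexx ler01.
have t0 : 0 <= t by rewrite ltW// (lt_trans eta0).
rewrite /Psi mulr_ge0 ?smooth_step_ge0//= mulr_ile1 ?smooth_step_ge0 ?smooth_step_le1//.
Qed.

Lemma profile01 s : 0 <= profile s <= 1.
Proof.
rewrite /profile; case: ifP => _; last by rewrite ler01 lexx.
have /andP[h1 h2] : 0 <= Psi (1 - H s) <= 1 by apply: Psi01; rewrite lerBlDr lerDl H_ge0.
by rewrite subr_ge0 h2 lerBlDr lerDl.
Qed.

Let eps := eta / m%:R.
Let eps01 : 0 < eps < 1.
Proof.
rewrite /eps divr_gt0//= ltr_pdivrMr// mul1r (lt_le_trans eta4)//.
by rewrite (@le_trans _ _ 1)// ?invf_le1// ler1n.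
Qed.

(** By Bernoulli's inequality (1 - eta/m)^m >= 1 - eta, so up to this radius 1 - H is at most eta
    and [Psi] vanishes. It is strictly larger than [r], hence the corrector vanishes on a
    neighbourhood of the closed hole. The minimum keeps it where [H] is a pure power. *)
Definition core_radius : R := Num.min (r / (1 - eps)) (delta / 2).
Local Notation r' := core_radius.

Lemma core_radius_gt : r < r'.
Proof.
rewrite lt_min rd andbT; have /andP[h1 h2] := eps01.
by rewrite ltr_pdivlMr ?subr_gt0// gtr_pMr// ltrBlDr ltrDl.
Qed.

Let H_core s : 0 < s -> s <= r' ^+ 2 -> 1 - H s <= eta.
Proof.
move=> s0 sr; have [rho rho0 sE] : exists2 rho, 0 < rho & s = rho ^+ 2.
  by exists (Num.sqrt s); rewrite ?sqrtr_gt0// sqr_sqrtr// ltW.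
have /andP[h1 h2] := eps01; have r'0 := lt_trans r0 core_radius_gt.
have : rho <= r' by rewrite -(@ler_pXn2r _ 2) ?nnegrE ?(ltW rho0) ?(ltW r'0)// -sE.
rewrite le_min => /andP[a b]; rewrite sE HE//.
have : (1 - eps) ^+ m <= (r / rho) ^+ m.
  rewrite lerXn2r ?nnegrE ?subr_ge0 ?divr_ge0 ?(ltW h2) ?(ltW r0) ?(ltW rho0)//.
  by rewrite ler_pdivlMr// mulrC -ler_pdivlMr// subr_gt0.
have := @Bernoulli_inequality R eps m; rewrite (ltW h1) (ltW h2) => /(_ isT).
have -> : m%:R * eps = eta by rewrite /eps mulrC divfK ?gt_eqF.
by move=> A B; have := le_trans A B; lra.
Qed.

Lemma profile_core s : s <= r' ^+ 2 -> profile s = 1.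
Proof. by move=> h; rewrite /profile; case: ifPn => // s0; rewrite Psi_0 ?subr0// H_core. Qed.

Lemma profile_outer s : delta ^+ 2 / 2 <= s -> profile s = 0.
Proof.
move=> sd; rewrite /profile ifT; last by apply: lt_le_trans sd; rewrite divr_gt0 ?exprn_gt0.
by rewrite /H theta0// mulr0 subr0 Psi_id ?subrr//; move: eta4; lra.
Qed.

(** For rho <= delta / 2, H is (r / rho)^m <= r / rho < 1 - 2 eta, which explains the choice of
    [r1]; beyond, [Hfar] applies. *)
Let H_mid rho : r1 < rho -> 2 * eta < 1 - H (rho ^+ 2).
Proof.
move=> r1rho; have rho0 : 0 < rho by apply: lt_trans r1rho; rewrite divr_gt0.
have [h|h] := leP rho (delta / 2).
  rewrite HE// ltrBrDr addrC -ltrBrDr.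
  have q : r / rho < 1 - 2 * eta.
    by move: r1rho; rewrite ltr_pdivrMr// => q; rewrite ltr_pdivrMr// [_ * rho]mulrC.
  apply: le_lt_trans q; apply: ler_iXnr => //; first by rewrite divr_ge0 ?(ltW r0) ?(ltW rho0).
  by rewrite ler_pdivrMr// mul1r ltW// (lt_trans r_r1).
have : H (rho ^+ 2) <= 2^-1.
  apply: Hfar; rewrite (_ : _ / 4 = (delta / 2) ^+ 2); last by rewrite expr_div_n -natrX.
  by rewrite lerXn2r ?nnegrE ?(ltW rho0) ?(ltW h).
by move: eta4; lra.
Qed.

Lemma profile_le rho : r1 < rho -> profile (rho ^+ 2) <= delta ^+ m.+2 * rho ^- m.
Proof.
move=> h; have rho0 : 0 < rho by apply: lt_trans h; rewrite divr_gt0.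
rewrite /profile exprn_gt0// Psi_id ?(ltW (H_mid h))//.
by rewrite opprB addrC subrK Hle.
Qed.

Let Ck_theta k : Ck_on k setT theta.
Proof.
have o := @openT R; apply: Ck_onB => //; first exact: Ck_on_cst.
apply: (@Ck_on_comp R R k setT setT smooth_step (fun s => 4 * s / delta ^+ 2)) => //.
  exact: Ck_on_smooth_step.
apply: Ck_onM => //; last exact: Ck_on_cst.
by apply: Ck_onZ => //; exact: Ck_on_id.
Qed.

Let Ck_H k : Ck_on k [set s : R | 0 < s] H.
Proof.
apply: Ck_onM => //; last by apply: (@Ck_on_sub _ _ k setT).
by apply: Ck_onZ => //; exact: Ck_on_powR.
Qed.

Let Ck_Psi k : Ck_on k setT Psi.
Proof.
have o := @openT R; apply: Ck_onM => //; first exact: Ck_on_id.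
apply: (@Ck_on_comp R R k setT setT smooth_step (fun s => s / eta)) => //.
  exact: Ck_on_smooth_step.
by apply: Ck_onM => //; [exact: Ck_on_id|exact: Ck_on_cst].
Qed.

(** The power of s is smooth only for s > 0; on the overlapping set s < r'^2 the profile is the
    constant 1. *)
Lemma Ck_on_profile k : Ck_on k setT profile.
Proof.
have r'0 := lt_trans r0 core_radius_gt.
have -> : [set: R] = [set s | 0 < s] `|` [set s | s < r' ^+ 2].
  apply/seteqP; split => // s _ /=; have [s0|s0] := ltP 0 s; first by left.
  by right; rewrite (le_lt_trans s0)// exprn_gt0.
apply: Ck_on_cup.
  apply: (@Ck_on_eq _ _ k _ (fun s => 1 - Psi (1 - H s))) => //.
    by move=> s /= s0; rewrite /profile s0.
  apply: Ck_onB => //; first exact: Ck_on_cst.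
  apply: (@Ck_on_comp R R k setT _ Psi (fun s => 1 - H s)) => //; first exact: openT.
  by apply: Ck_onB => //; exact: Ck_on_cst.
apply: (@Ck_on_eq R R k _ (fun=> 1)).
- exact: open_lt.
- by move=> s /= h; rewrite profile_core// ltW.
- exact: Ck_on_cst.
Qed.

Let D_cst s (c : R) : (\near s, c = profile s) -> 'D_1 profile s = 0.
Proof. by move=> h; rewrite -(@near_eq_derive R R R (cst c) profile s 1 h) derive_cst. Qed.

Lemma profile_derive_core s : s < r' ^+ 2 -> 'D_1 profile s = 0.
Proof.
move=> h; apply: (D_cst (c := 1)); near=> x; rewrite profile_core// ltW//.
by near: x; exact: lt_nbhsl.
Unshelve. all: by end_near. Qed.

Lemma profile_derive_outer s : delta ^+ 2 / 2 < s -> 'D_1 profile s = 0.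
Proof.
move=> h; apply: (D_cst (c := 0)); near=> x; rewrite profile_outer// ltW//.
by near: x; exact: lt_nbhsr.
Unshelve. all: by end_near. Qed.

Let cH s : 0 < s -> {for s, continuous H}.
Proof. by move=> s0; exact: (Ck_on_cont (Ck_H 0)). Qed.

Let D_mid (s : R) : 0 < s -> 2 * eta < 1 - H s -> 'D_1 profile s = 'D_1 H s.
Proof.
move=> s0 h; apply: near_eq_derive.
have h' : H s < 1 - 2 * eta by move: h; lra.
have A : \forall x \near s, H x < 1 - 2 * eta.
  by have := cH s0 => /(_ [set y | y < 1 - 2 * eta]); apply; exact: lt_nbhsl.
near=> x; rewrite /profile ifT; last by near: x; exact: lt_nbhsr.
have : H x < 1 - 2 * eta by near: x.
by move=> q; rewrite Psi_id; lra.
Unshelve. all: by end_near. Qed.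

Let dH (s : R) : 0 < s -> is_derive s (1 : R) H
  (delta ^+ m.+2 * (s `^ e * 'D_1 theta s + theta s * (e * s `^ (e - 1)))).
Proof.
move=> s0; have d1 := is_derive1_powR e s0.
have d2 : is_derive s 1 theta ('D_1 theta s).
  by apply: DeriveDef => //; have [_ [D _]] := Ck_theta 1; exact: D.
rewrite (_ : H = delta ^+ m.+2 *: ((fun s => s `^ e) * theta)); last first.
  by apply/funext => t; rewrite /H -mulrA.
by have := is_deriveZ (delta ^+ m.+2) (is_deriveM d1 d2).
Qed.

Let D_theta0 (s : R) : s < delta ^+ 2 / 4 -> 'D_1 theta s = 0.
Proof.
move=> h; rewrite -(@near_eq_derive R R R (cst 1) theta s 1) ?derive_cst//.
near=> x; rewrite theta1// ltW//; near: x; exact: lt_nbhsl.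
Unshelve. all: by end_near. Qed.

Let sqr4 : delta ^+ 2 / 4 = (delta / 2) ^+ 2.
Proof. by rewrite expr_div_n -natrX. Qed.

Let dH_in rho : 0 < rho -> rho < delta / 2 ->
  2 * 'D_1 H (rho ^+ 2) = - (m%:R * delta ^+ m.+2 / rho ^+ m.+2).
Proof.
move=> rho0 h; have s0 : 0 < rho ^+ 2 by rewrite exprn_gt0.
have [_ ->] := dH s0; have hs : rho ^+ 2 < delta ^+ 2 / 4.
  by rewrite sqr4 ltrXn2r ?nnegrE ?divr_ge0 ?ltW.
rewrite D_theta0// mulr0 add0r theta1 ?ltW// mul1r.
have -> : (rho ^+ 2) `^ (e - 1) = rho ^- m.+2.
  rewrite powRD; last by rewrite (gt_eqF s0)/= ?implybT.
  by rewrite sqr_powR// powRN powRr1 ?ltW// -invfM -exprD addn2.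
rewrite /e; set q := rho ^- _; set p := delta ^+ _; by field.
Qed.

(** Twice the derivative at |y|^2 is the factor of y_k in the gradient of the bump. Between both
    cutoffs it is exactly the Newtonian field, so the flux identity applies without error there. *)
Lemma profile_derive_mid rho : r1 < rho -> rho < delta / 2 ->
  2 * 'D_1 profile (rho ^+ 2) = - (m%:R * delta ^+ m.+2 / rho ^+ m.+2).
Proof.
move=> h1 h2; have rho0 : 0 < rho by apply: lt_trans h1; rewrite divr_gt0.
by rewrite D_mid ?exprn_gt0// ?H_mid// dH_in.
Qed.

Variable C : R.
Hypotheses (C0 : 0 <= C) (stepC : forall t : R, `|'D_1 smooth_step t| <= C).

(** Where the derivative of the step at t / eta does not vanish, t / eta is at most 2; so the bound
    is independent of eta. *)
Let dPsi t : `|'D_1 Psi t| <= 1 + 2 * C.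
Proof.
have d1 : is_derive t 1 (fun t : R => t / eta) (eta^-1).
  have := is_deriveZ eta^-1 (is_derive_id t (1 : R)).
  rewrite /GRing.scale/= mulr1 (_ : (fun t : R => t / eta) = eta^-1 \*: id)//.
  by apply/funext => x; rewrite mulrC.
have ds (u : R) : is_derive u (1 : R) smooth_step ('D_1 smooth_step u).
  by apply: DeriveDef => //; have [_ [D _]] := @Ck_on_smooth_step R 1; exact: D.
have d2 := @is_derive1_comp _ smooth_step (fun t => t / eta) t _ _ (ds _) d1.
have [_ E] : is_derive t 1 Psi (t * ('D_1 smooth_step (t / eta) * eta^-1) + smooth_step (t / eta) * 1).
  exact: (is_deriveM (is_derive_id t 1) d2).
rewrite E; have [h|h] := leP t (2 * eta); last first.
  have -> : 'D_1 smooth_step (t / eta) = 0.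
    rewrite -(@near_eq_derive R R R (cst 1) smooth_step (t / eta) 1) ?derive_cst//.
    near=> x; rewrite smooth_step1// ltW//; near: x.
    by apply: lt_nbhsr; rewrite ltr_pdivlMr.
  rewrite mul0r mulr0 add0r mulr1 ger0_norm ?smooth_step_ge0//.
  by rewrite (le_trans (smooth_step_le1 _))// lerDl mulr_ge0.
have [h'|h'] := leP t 0.
  have -> : 'D_1 smooth_step (t / eta) = 0.
    rewrite -(@near_eq_derive R R R (cst 0) smooth_step (t / eta) 1) ?derive_cst//.
    near=> x; rewrite smooth_step0// ltW//; near: x.
    by apply: lt_nbhsl; rewrite ltr_pdivrMr// mul1r (le_lt_trans h').
  rewrite mul0r mulr0 add0r mulr1 ger0_norm ?smooth_step_ge0//.
  by rewrite (le_trans (smooth_step_le1 _))// lerDl mulr_ge0.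
rewrite (le_trans (ler_normD _ _))// addrC lerD//.
  by rewrite mulr1 ger0_norm ?smooth_step_ge0// smooth_step_le1.
rewrite mulrCA normrM mulrC ler_pM//.
by rewrite ger0_norm ?ler_pdivrMr// divr_ge0// ltW.
Unshelve. all: by end_near. Qed.

(** By [hole_radius_expr], the field factor m delta^N / rho^N is at most m / r^2. This is large;
    only the small volume of the annulus compensates it. *)
Lemma profile_derive_transition rho : r <= rho -> rho <= r1 ->
  `|2 * 'D_1 profile (rho ^+ 2)| <= (1 + 2 * C) * (m%:R / r ^+ 2).
Proof.
move=> h1 h2; have rho0 := lt_le_trans r0 h1.
have s0 : 0 < rho ^+ 2 by rewrite exprn_gt0.
have h3 := le_lt_trans h2 r1d.
have dHs : is_derive (rho ^+ 2) (1 : R) H ('D_1 H (rho ^+ 2)).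
  by apply: DeriveDef => //; have [D _] := dH s0.
have -> : 'D_1 profile (rho ^+ 2) = 'D_1 Psi (1 - H (rho ^+ 2)) * 'D_1 H (rho ^+ 2).
  rewrite -(@near_eq_derive R R R (fun s => 1 - Psi (1 - H s)) profile); last first.
    by near=> x; rewrite /profile ifT//; near: x; exact: lt_nbhsr.
  have dP : is_derive (1 - H (rho ^+ 2)) (1 : R) Psi ('D_1 Psi (1 - H (rho ^+ 2))).
    by apply: DeriveDef => //; have [_ [D _]] := Ck_Psi 1; exact: D.
  have d1 : is_derive (rho ^+ 2) (1 : R) (fun s => 1 - H s) (0 - 'D_1 H (rho ^+ 2)).
    exact: (is_deriveB (is_derive_cst (1 : R) (rho ^+ 2) (1 : R)) dHs).
  have d2 := @is_derive1_comp _ Psi (fun s => 1 - H s) _ _ _ dP d1.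
  have [_ ->] := is_deriveB (is_derive_cst (1 : R) (rho ^+ 2) (1 : R)) d2.
  by rewrite !sub0r mulrN opprK.
rewrite mulrCA dH_in// normrM; apply: ler_pM; [by []|by []|exact: dPsi|].
rewrite normrN ger0_norm; last first.
  by apply: divr_ge0; [apply: mulr_ge0; [by []|exact: exprn_ge0]|apply: exprn_ge0; exact: ltW].
rewrite -hole_radius_expr -mulrA ler_wpM2l//.
have -> : rho ^- m.+2 = rho ^- m * rho ^- 2 by rewrite -invfM -exprD addn2.
rewrite mulrA -[leRHS]mul1r; apply: ler_pM.
- by rewrite divr_ge0 ?exprn_ge0 ?(ltW r0) ?(ltW rho0).
- by rewrite invr_ge0 exprn_ge0 ?(ltW rho0).
- by rewrite ler_pdivrMr ?exprn_gt0// mul1r lerXn2r ?nnegrE ?(ltW r0) ?(ltW rho0).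
- by rewrite lef_pV2 ?posrE ?exprn_gt0// lerXn2r ?nnegrE ?(ltW r0) ?(ltW rho0).
Unshelve. all: by end_near. Qed.

(** Both terms of the derivative carry (delta / rho)^N <= 2^N. The derivative of [theta] is of order
    delta^(-2), lives where rho^2 <= delta^2 / 2 and is multiplied by rho^2. The bound is free of
    delta, so the gradient is of order delta there. *)
Lemma profile_derive_far rho : delta / 2 <= rho ->
  `|2 * 'D_1 profile (rho ^+ 2)| <= 2 ^+ m.+2 * (m%:R + 8 * C).
Proof.
move=> h3; have rho0 : 0 < rho by apply: lt_le_trans h3; rewrite divr_gt0.
have s0 : 0 < rho ^+ 2 by rewrite exprn_gt0.
have sd : delta ^+ 2 / 4 <= rho ^+ 2.
  by rewrite sqr4 lerXn2r ?nnegrE ?(ltW rho0).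
rewrite D_mid//; last by have := Hfar sd; move: eta4; lra.
have [_ ->] := dH s0.
have -> : (rho ^+ 2) `^ (e - 1) = rho ^- m.+2.
  rewrite powRD; last by rewrite (gt_eqF s0)/= ?implybT.
  by rewrite sqr_powR// powRN powRr1 ?ltW// -invfM -exprD addn2.
have dT : `|'D_1 theta (rho ^+ 2)| <= C * (4 / delta ^+ 2).
  have d1 : is_derive (rho ^+ 2) (1 : R) (fun t : R => 4 * t / delta ^+ 2) (4 / delta ^+ 2).
    have := is_deriveZ (4 / delta ^+ 2) (is_derive_id (rho ^+ 2) (1 : R)).
    rewrite /GRing.scale/= mulr1 (_ : (fun t : R => 4 * t / delta ^+ 2) = (4 / delta ^+ 2) \*: id)//.
    by apply/funext => x; rewrite mulrAC.
  have ds (u : R) : is_derive u (1 : R) smooth_step ('D_1 smooth_step u).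
    by apply: DeriveDef => //; have [_ [D _]] := @Ck_on_smooth_step R 1; exact: D.
  have d2 := @is_derive1_comp _ smooth_step (fun t => 4 * t / delta ^+ 2) _ _ _ (ds _) d1.
  have [_ ->] := is_deriveB (is_derive_cst (1 : R) (rho ^+ 2) (1 : R)) d2.
  rewrite sub0r normrN normrM ler_pM// ger0_norm// divr_ge0// exprn_ge0//.
rewrite sqr_powR//.
have E : 2 * (delta ^+ m.+2 * (rho ^- m * 'D_1 theta (rho ^+ 2) + theta (rho ^+ 2) * (e / rho ^+ m.+2)))
   = delta ^+ m.+2 * rho ^- m.+2 * (2 * rho ^+ 2 * 'D_1 theta (rho ^+ 2) - m%:R * theta (rho ^+ 2)).
  have -> : rho ^- m.+2 = rho ^- m * rho ^- 2 by rewrite -invfM -exprD addn2.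
  move: ('D_1 theta _) (theta _) => a b.
  have rN : rho != 0 by rewrite gt_eqF.
  have -> : m%:R = - 2 * e :> R by rewrite /e; field.
  move: rN; generalize (delta ^+ m.+2) (rho ^- m) e rho => p q k w w0.
  by field; rewrite ?expf_neq0 ?w0.
rewrite E normrM ler_pM//.
  rewrite ger0_norm; last by apply: divr_ge0; apply: exprn_ge0 => //; exact: ltW.
  rewrite ler_pdivrMr ?exprn_gt0// -exprMn lerXn2r ?nnegrE ?mulr_ge0 ?(ltW rho0)//.
  by rewrite -ler_pdivrMl// mulrC.
have [h|h] := leP (rho ^+ 2) (delta ^+ 2 / 2); last first.
  rewrite theta0 ?(ltW h)// mulr0 subr0.
  have -> : 'D_1 theta (rho ^+ 2) = 0.
    rewrite -(@near_eq_derive R R R (cst 0) theta (rho ^+ 2) 1) ?derive_cst//.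
    by near=> x; rewrite theta0// ltW//; near: x; exact: lt_nbhsr.
  by rewrite mulr0 normr0 addr_ge0// mulr_ge0.
rewrite (le_trans (ler_normB _ _))// addrC lerD//.
  by rewrite normrM !ger0_norm// ler_piMr.
rewrite normrM ger0_norm ?mulr_ge0 ?exprn_ge0 ?(ltW rho0)//.
apply: (@le_trans _ _ (delta ^+ 2 * (C * (4 / delta ^+ 2)))).
  by rewrite ler_pM// ?mulr_ge0 ?exprn_ge0 ?(ltW rho0)//; move: h; lra.
have -> : delta ^+ 2 * (C * (4 / delta ^+ 2)) = 4 * C by field; rewrite gt_eqF.
by rewrite ler_wpM2r//; lra.
Unshelve. all: by end_near. Qed.

End profile.

Section coordinates.
Context {R : realType} {n : nat}.

Lemma is_derive_coord (i : 'I_n) (x v : 'rV[R]_n) :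
  is_derive x v (fun x : 'rV[R]_n => x 0 i) (v 0 i).
Proof.
apply: line_is_derive.
have d : is_derive (0 : R) (1 : R) (fun s => v 0 i * s + x 0 i) (v 0 i).
  have := is_deriveD (is_deriveZ (v 0 i) (is_derive_id (0 : R) (1 : R))) (is_derive_cst (x 0 i) (0 : R) (1 : R)).
  by rewrite addr0 /GRing.scale/= mulr1.
rewrite (_ : (fun s : R => _) = (fun s => v 0 i * s + x 0 i))//.
by apply/funext => s; rewrite !mxE mulrC.
Qed.

Lemma Ck_on_coord k (i : 'I_n) : Ck_on k setT (fun x : 'rV[R]_n => x 0 i).
Proof.
have c : continuous (fun x : 'rV[R]_n => x 0 i) by exact: coord_continuous.
case: k => [|k]; first by split=> // x _; exact: c.
split; first by move=> x _; exact: c.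
split; first by move=> x v _; have [] := is_derive_coord i x v.
move=> v; rewrite (_ : 'D_v _ = cst (v 0 i)); first exact: Ck_on_cst.
by apply/funext => x; have [_ ->] := is_derive_coord i x v.
Qed.

Lemma C1_is_derive (f : 'rV[R]_n -> R) x v : C1 f -> is_derive x v f ('D_v f x).
Proof. by move=> [_ [D _]]; apply: DeriveDef => //; exact: D. Qed.

Lemma C1M (f g : 'rV[R]_n -> R) : C1 f -> C1 g -> C1 (fun x => f x * g x).
Proof. by move=> f1 g1; apply: Ck_onM => //; exact: openT. Qed.

Lemma partialM (f g : 'rV[R]_n -> R) k x : C1 f -> C1 g ->
  partial k (fun x => f x * g x) x = f x * partial k g x + partial k f x * g x.
Proof.
move=> f1 g1; rewrite /partial.
have [_ ->] := is_deriveM (C1_is_derive x (delta_mx 0 k) f1) (C1_is_derive x (delta_mx 0 k) g1).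
by rewrite /GRing.scale/= [g x * _]mulrC.
Qed.

Lemma Ck_on_shift k (f : 'rV[R]_n -> R) (c : 'rV[R]_n) :
  Ck_on k setT f -> Ck_on k setT (fun x => f (x + c)).
Proof.
have cs : continuous (fun x : 'rV[R]_n => x + c).
  by move=> x; apply: (@continuousD _ _ _ id (cst c)); [exact: cvg_id|exact: cst_continuous].
have D (h : 'rV[R]_n -> R) x v : derivable h (x + c) v ->
    is_derive x v (fun x => h (x + c)) ('D_v h (x + c)).
  move=> d; have d' : is_derive (x + c) v h ('D_v h (x + c)) by exact: DeriveDef.
  apply: line_is_derive.
  have : is_derive ((0 : R) *: v + (x + c)) v h ('D_v h (x + c)) by rewrite scale0r add0r.
  move/is_derive_line; congr (is_derive _ _ _ _).
  by apply/funext => s; rewrite addrA.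
elim: k f => [|k IH] f.
  by move=> [cf _]; split=> // x _; apply: continuous_comp; [exact: cs|exact: cf].
move=> [cf [df Df]]; split.
  by move=> x _; apply: continuous_comp; [exact: cs|exact: cf].
split; first by move=> x v _; have [] := D f x v (df _ _ I).
move=> v; have -> : 'D_v (fun x => f (x + c)) = (fun x => 'D_v f (x + c)).
  by apply/funext => x; have [_ ->] := D f x v (df _ _ I).
exact (IH _ (Df v)).
Qed.

Lemma derive_translate (f : 'rV[R]_n -> R) (c x v : 'rV[R]_n) :
  'D_v (fun x => f (x + c)) x = 'D_v f (x + c).
Proof.
rewrite /derive (_ : (fun h => h^-1 *: (((fun x => f (x + c)) \o shift x) (h *: v) - f (x + c))) =
    (fun h => h^-1 *: ((f \o shift (x + c)) (h *: v) - f (x + c))))//.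
by apply/funext => h /=; rewrite addrA.
Qed.

Lemma Ck_on_sqr_enorm k : Ck_on k setT (fun x : 'rV[R]_n => enorm x ^+ 2).
Proof.
rewrite (_ : (fun x : 'rV[R]_n => enorm x ^+ 2) = (fun x => \sum_i x 0 i ^+ 2)); last first.
  by apply/funext => x; rewrite sqr_enorm.
apply: Ck_on_sum => [|i]; first exact: openT.
by apply: Ck_onX; [exact: openT|exact: Ck_on_coord].
Qed.

Lemma is_derive_sqr_enorm (x : 'rV[R]_n) k :
  is_derive x (delta_mx 0 k) (fun x : 'rV[R]_n => enorm x ^+ 2) (2 * x 0 k).
Proof.
apply: line_is_derive.
have d : is_derive (0 : R) (1 : R) (fun s => s ^+ 2 + (2 * x 0 k) * s + enorm x ^+ 2) (2 * x 0 k).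
  have := is_deriveD (is_deriveD (is_deriveX 2 (is_derive_id (0 : R) (1 : R)))
    (is_deriveZ (2 * x 0 k) (is_derive_id (0 : R) (1 : R))))
    (is_derive_cst (enorm x ^+ 2) (0 : R) (1 : R)).
  by rewrite addr0 /GRing.scale/= expr1 mulr0 mul0r add0r mulr1.
rewrite (_ : (fun s : R => _) = (fun s => s ^+ 2 + (2 * x 0 k) * s + enorm x ^+ 2))//.
apply/funext => s; rewrite !sqr_enorm (bigD1 k)//= [in RHS](bigD1 k)//= !mxE !eqxx mulr1.
rewrite (eq_bigr (fun i => x 0 i ^+ 2)); first by ring.
by move=> i ik; rewrite !mxE (negbTE ik) andbF mulr0 add0r.
Qed.

End coordinates.

Section hole_bump.
Context {R : realType}.
Variables (m : nat) (delta eta C : R).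
Local Notation r := (@hole_radius R m.+1 delta).
Local Notation r1 := (r / (1 - 2 * eta)).
Hypotheses (m0 : (0 < m)%N) (d0 : 0 < delta) (eta0 : 0 < eta) (eta4 : eta < 4^-1).
Hypotheses (r1d : r1 < delta / 2) (dsmall : 2 ^+ m * delta ^+ 2 <= 2^-1).
Hypotheses (C0 : 0 <= C) (stepC : forall t : R, `|'D_1 smooth_step t| <= C).
Implicit Types (x y : 'rV[R]_m.+2).

Definition hole_bump x : R := profile m delta eta (enorm x ^+ 2).

Let r0 : 0 < r. Proof. exact: powR_gt0. Qed.
Let et0 : 0 < 1 - 2 * eta. Proof. by move: eta4; lra. Qed.

Lemma Ck_on_bump k : Ck_on k setT hole_bump.
Proof.
apply: (@Ck_on_comp R _ k setT setT (profile m delta eta) (fun x => enorm x ^+ 2)) => //.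
- exact: openT.
- exact: openT.
- exact: Ck_on_profile.
- exact: Ck_on_sqr_enorm.
Qed.

Lemma bump01 x : 0 <= hole_bump x <= 1. Proof. exact: profile01. Qed.

Lemma bump_core : exists2 r', r < r' & forall x, enorm x <= r' -> hole_bump x = 1.
Proof.
exists (core_radius m delta eta); first exact: core_radius_gt.
move=> x xr; apply: profile_core => //.
have r'0 : 0 < core_radius m delta eta by apply: lt_trans r0 _; exact: core_radius_gt.
by rewrite lerXn2r ?nnegrE ?enorm_ge0 ?(ltW r'0).
Qed.

Lemma bump_outer x : delta <= enorm x -> hole_bump x = 0.
Proof.
move=> dx; apply: profile_outer => //.
apply: (@le_trans _ _ (delta ^+ 2)); last by rewrite lerXn2r ?nnegrE ?enorm_ge0 ?(ltW d0).
by rewrite ler_pdivrMr// ler_peMr ?exprn_ge0 ?(ltW d0)// ler1n.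
Qed.

Lemma bump_le x : r1 < enorm x -> hole_bump x <= delta ^+ m.+2 * enorm x ^- m.
Proof. exact: profile_le. Qed.

Lemma partial_bump x k : partial k hole_bump x = x 0 k * (2 * 'D_1 (profile m delta eta) (enorm x ^+ 2)).
Proof.
have dP : is_derive (enorm x ^+ 2) (1 : R) (profile m delta eta) ('D_1 (profile m delta eta) (enorm x ^+ 2)).
  apply: DeriveDef => //.
  by have [_ [D _]] := @Ck_on_profile R m delta eta m0 d0 eta0 eta4 r1d 1; exact: D.
have [_ E] := is_derive_comp_dir (f := fun x : 'rV[R]_m.+2 => enorm x ^+ 2) (x := x) dP (is_derive_sqr_enorm x k).
by rewrite /partial E; ring.
Qed.

Lemma bump_partial_outer x k : delta <= enorm x -> partial k hole_bump x = 0.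
Proof.
move=> dx; rewrite partial_bump profile_derive_outer ?mulr0//.
apply: (@lt_le_trans _ _ (delta ^+ 2)); last by rewrite lerXn2r ?nnegrE ?enorm_ge0 ?(ltW d0).
by rewrite ltr_pdivrMr// ltr_pMr ?exprn_gt0// ltr1n.
Qed.

(* In the cell, [- grad hole_bump] is the field [m delta^N y / |y|^N - m y] of the flux identity
   up to [bump_err], which is of order [delta] except on the annulus where [Psi] bends. *)
Definition bump_err k y : R := - partial k hole_bump y -
  (if r <= enorm y then m%:R * delta ^+ m.+2 * y 0 k / enorm y ^+ m.+2 else 0) + m%:R * y 0 k.

Definition annulus : set 'rV[R]_m.+2 := [set y | r <= enorm y <= r1].

(** On the annulus |y| <= r1 <= 2 r, so the bump contributes 2 r (1 + 2 C) m / r^2 and the singular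
    field m / r. In [err_cell] the three terms bound, for |y| >= delta / 2, the gradient of the bump
    and the singular field, and everywhere the linear field m y. *)
Definition err_annulus : R := (3 + 4 * C) * m%:R / r.
Definition err_cell : R :=
  (2 ^+ m.+2 * (m%:R + 8 * C) + m%:R * 2 ^+ m.+1 + m%:R) * delta.

Lemma err_annulus_ge0 : 0 <= err_annulus.
Proof. by rewrite divr_ge0 ?(ltW r0)// mulr_ge0// addr_ge0// mulr_ge0. Qed.

Let cell0 : 0 <= 2 ^+ m.+2 * (m%:R + 8 * C) :> R.
Proof. by rewrite mulr_ge0 ?exprn_ge0// addr_ge0// mulr_ge0. Qed.

Lemma err_cell_ge0 : 0 <= err_cell.
Proof. by rewrite mulr_ge0 ?(ltW d0)// !addr_ge0// ?mulr_ge0 ?exprn_ge0. Qed.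

(** For |y| < r the bump is constant and the singular field is cut off; for r1 < |y| < delta / 2
    they cancel exactly. In both zones only m y_k remains. The annulus and the outer zone are left
    to crude bounds. *)
Lemma bump_err_le k y : enorm y < delta ->
  `|bump_err k y| <= err_cell + err_annulus * \1_annulus y.
Proof.
move=> yd; have yk : `|y 0 k| <= enorm y by exact: coord_le_enorm.
have yk' : `|y 0 k| <= delta by rewrite (le_trans yk)// ltW.
have mk : `|m%:R * y 0 k| <= m%:R * delta by rewrite normrM normr_nat ler_wpM2l.
have cellm : m%:R * delta <= err_cell.
  by rewrite /err_cell ler_wpM2r ?(ltW d0)// lerDr addr_ge0// mulr_ge0// exprn_ge0.
have ann0 : 0 <= err_annulus * \1_annulus y by rewrite mulr_ge0 ?err_annulus_ge0// indicE.
have short (e : R) : e = m%:R * y 0 k -> `|e| <= err_cell + err_annulus * \1_annulus y.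
  by move=> ->; rewrite (le_trans mk)// (le_trans cellm)// lerDl.
rewrite /bump_err partial_bump.
have [ry|ry] := ltP (enorm y) r.
  apply: short; rewrite profile_derive_core//; first by ring.
  have := core_radius_gt m0 d0 eta0 eta4 r1d => h.
  by rewrite ltrXn2r ?nnegrE ?enorm_ge0 ?(lt_trans ry h)// ltW// (lt_trans r0 h).
have y0 : 0 < enorm y := lt_le_trans r0 ry.
have yN : enorm y != 0 by rewrite gt_eqF.
have [hd|hd] := leP (delta / 2) (enorm y).
  have F := profile_derive_far d0 eta0 eta4 dsmall C0 stepC hd.
  rewrite (@le_trans _ _ err_cell)// ?lerDl//.
  apply: le_trans (ler_normD _ _) _; rewrite /err_cell [leRHS]mulrDl; apply: lerD => //.
  apply: le_trans (ler_normB _ _) _; rewrite [leRHS]mulrDl; apply: lerD.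
    by rewrite normrN normrM mulrC; apply: ler_pM.
  rewrite (_ : _ / _ = m%:R * ((delta / enorm y) ^+ m.+1 * (delta * (y 0 k / enorm y)))); last first.
    rewrite expr_div_n !exprSr; set p := delta ^+ m; set q := enorm y ^+ m.
    have qN : q != 0 by rewrite expf_neq0.
    move: yN qN; generalize (enorm y) q p (m%:R : R) (y 0 k) => a b c d e a0 b0.
    by field; rewrite a0 b0.
  rewrite normrM normr_nat -mulrA ler_wpM2l// normrM ler_pM//.
    rewrite ger0_norm; last by apply: exprn_ge0; rewrite divr_ge0 ?(ltW d0) ?enorm_ge0.
    rewrite lerXn2r ?nnegrE ?divr_ge0 ?(ltW d0) ?enorm_ge0//.
    by rewrite ler_pdivrMr// mulrC -ler_pdivrMr.
  rewrite normrM gtr0_norm// ler_piMr ?(ltW d0)// normrM normfV [`|enorm y|]gtr0_norm//.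
  by rewrite ler_pdivrMr// mul1r.
have [h1|h1] := ltP r1 (enorm y).
  apply: short; rewrite profile_derive_mid//.
  set q := enorm y ^+ _; set p := delta ^+ _; have qN : q != 0 by rewrite expf_neq0.
  by field.
have T := profile_derive_transition m0 d0 eta0 r1d C0 stepC ry h1.
have -> : \1_annulus y = 1 :> R by rewrite indicE mem_set//= /annulus/= ry h1.
rewrite mulr1 [leRHS]addrC; apply: le_trans (ler_normD _ _) _.
apply: lerD; last exact: le_trans mk cellm.
apply: le_trans (ler_normB _ _) _; rewrite /err_annulus.
have -> : (3 + 4 * C) * m%:R / r = 2 * r * ((1 + 2 * C) * (m%:R / r ^+ 2)) + m%:R / r.
  by field; rewrite gt_eqF.
apply: lerD.
  rewrite normrN normrM ler_pM// (le_trans yk)// (le_trans h1)//.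
  rewrite ler_pdivrMr// -mulrA mulrCA ler_peMr ?(ltW r0)//; move: eta4; lra.
rewrite -(@hole_radius_expr R m delta m0 d0) -/r.
rewrite (_ : m%:R * r ^+ m * y 0 k / enorm y ^+ m.+2 = m%:R / r * ((r / enorm y) ^+ m.+1 * (y 0 k / enorm y))); last first.
  rewrite expr_div_n !exprSr; set p := r ^+ m; set q := enorm y ^+ m.
  have qN : q != 0 by rewrite expf_neq0.
  have rN : r != 0 by rewrite gt_eqF.
  rewrite -!mulrA; congr (_ * _).
  move: yN qN rN; generalize (enorm y) q p (y 0 k) r => a b c e f a0 b0 f0.
  by field; rewrite a0 b0 f0.
rewrite normrM ger0_norm ?divr_ge0 ?(ltW r0)// ler_piMr ?divr_ge0 ?(ltW r0)//.
rewrite normrM mulr_ile1//.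
  rewrite ger0_norm; last by apply: exprn_ge0; rewrite divr_ge0 ?(ltW r0) ?enorm_ge0.
  by apply: exprn_ile1; rewrite ?divr_ge0 ?(ltW r0) ?enorm_ge0// ler_pdivrMr// mul1r.
by rewrite normrM normfV [`|enorm y|]gtr0_norm// ler_pdivrMr// mul1r.
Qed.

End hole_bump.

(** * The flux of the corrector *)

Section Rintegral_tools.
Context d (T : measurableType d) {R : realType}.
Variable mu : {measure set T -> \bar R}.
Implicit Types (D S : set T) (f g : T -> R).

Lemma Rintegral_subset_ge0 D S f : measurable D -> measurable S -> S `<=` D ->
  mu.-integrable D (EFin \o f) -> (forall x, D x -> 0 <= f x) ->
  (\int[mu]_(x in S) f x <= \int[mu]_(x in D) f x)%R.
Proof.
move=> mD mS SD iF f0; rewrite /Rintegral fine_le//.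
- by apply: integrable_fin_num => //; exact: integrableS iF.
- exact: integrable_fin_num.
by apply: ge0_subset_integral => //; exact: measurable_int iF.
Qed.

Lemma Rintegral_abs_le D f g : measurable D -> mu.-integrable D (EFin \o f) ->
  mu.-integrable D (EFin \o g) -> (forall x, D x -> `|f x| <= g x) ->
  `|(\int[mu]_(x in D) f x)%R| <= (\int[mu]_(x in D) g x)%R.
Proof.
move=> mD iF iG fg; apply: le_trans (le_normr_Rintegral mD iF) _.
by apply: le_Rintegral => //; exact: (integrable_abse iF).
Qed.

Lemma integrable_normr D f : mu.-integrable D (EFin \o f) ->
  mu.-integrable D (EFin \o (fun x => `|f x|)).
Proof. exact: integrable_abse. Qed.

Lemma Rintegral_setI_diff D S L f : measurable D -> measurable S -> measurable L ->
  S `<=` D -> L `<=` D -> (forall x, D x -> ~ S x -> f x != 0 -> L x) ->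
  mu.-integrable D (EFin \o f) ->
  `|(\int[mu]_(x in D) f x - \int[mu]_(x in S) f x)%R| <= (\int[mu]_(x in L) `|f x|)%R.
Proof.
move=> mD mS mL SD LD DSL iF.
have mDS : measurable (D `\` S) by exact: measurableD.
have iDS : mu.-integrable (D `\` S) (EFin \o f) by apply: integrableS iF => // x [].
have E : (\int[mu]_(x in D) f x = \int[mu]_(x in S) f x + \int[mu]_(x in D `\` S) f x)%R.
  have DU : S `|` (D `\` S) = D.
    apply/seteqP; split => [x [/SD//|[]//]|x Dx].
    by have [Sx|Sx] := pselect (S x); [left|right].
  rewrite -Rintegral_setU//; first by rewrite DU.
    by rewrite DU.
  by apply/disj_setPS => x [? []].
rewrite E addrC addKr; apply: le_trans (le_normr_Rintegral mDS iDS) _.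
have E2 : (\int[mu]_(x in D `\` S) `|f x| = \int[mu]_(x in (D `\` S) `&` L) `|f x|)%R.
  rewrite Rintegral_mkcondr; apply: eq_Rintegral => x; rewrite inE => -[Dx Sx].
  rewrite patchE; case: ifPn => // /negP; rewrite inE => Lx.
  by apply/eqP/negPn/negP; rewrite normr_eq0 => /(DSL _ Dx Sx).
rewrite E2; apply: Rintegral_subset_ge0 => //; first exact: measurableI.
by apply/integrable_normr/(integrableS mD).
Qed.

End Rintegral_tools.

Section partial_sum.
Context {R : realType} {n : nat}.

Lemma partial_sum (I : Type) (s : seq I) (F : I -> 'rV[R]_n -> R) k x :
  (forall i, C1 (F i)) ->
  partial k (fun x => \sum_(i <- s) F i x) x = \sum_(i <- s) partial k (F i) x.
Proof.
move=> F1; elim: s => [|a s IH].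
  by rewrite big_nil; under eq_fun do rewrite big_nil; rewrite /partial derive_cst.
rewrite big_cons -IH; have S1 : C1 (fun x => \sum_(i <- s) F i x).
  by apply: Ck_on_sum => //; exact: openT.
have [_ E] := is_deriveD (C1_is_derive x (delta_mx 0 k) (F1 a)) (C1_is_derive x (delta_mx 0 k) S1).
rewrite /partial -E (_ : (fun x => \sum_(i <- a :: s) F i x) = F a + (fun x => \sum_(i <- s) F i x))//.
by apply/funext => y; rewrite big_cons.
Qed.

End partial_sum.

Section cell_flux.
Context {R : realType}.
Variables (m : nat) (delta eta C Cg : R) (ctr : seq 'rV[R]_m.+2) (g : 'rV[R]_m.+2 -> R).
Local Notation mu := (lebesgue_rV m.+2).
Local Notation r := (@hole_radius R m.+1 delta).
Local Notation r1 := (r / (1 - 2 * eta)).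
Hypotheses (m0 : (0 < m)%N) (d0 : 0 < delta) (eta0 : 0 < eta) (eta4 : eta < 4^-1).
Hypotheses (r1d : r1 < delta / 2) (dsmall : 2 ^+ m * delta ^+ 2 <= 2^-1).
Hypotheses (C0 : 0 <= C) (stepC : forall t : R, `|'D_1 smooth_step t| <= C).
Hypotheses (uctr : uniq ctr) (disj : forall c c' x, c \in ctr -> c' \in ctr ->
  cube delta (x - c) -> cube delta (x - c') -> c = c').
Hypotheses (g1 : C1 g) (gC : forall x, `|g x| <= Cg)
  (DC : forall k x, `|partial k g x| <= Cg).
Hypothesis g0 : forall c x, c \in ctr -> enorm (x - c) < r -> g x = 0.

Local Notation b := (@err_cell R m delta C).
Local Notation a := (@err_annulus R m delta C).
Local Notation B := (eball (0 : 'rV[R]_m.+2) delta).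
Local Notation A := (@annulus R m delta eta).
Local Notation gam := (@hole_bump R m delta eta).

Definition bumps (x : 'rV[R]_m.+2) : R := \sum_(c <- ctr) gam (x - c).

Let r0 : 0 < r. Proof. exact: powR_gt0. Qed.
Let et0 : 0 < 1 - 2 * eta. Proof. by move: eta4; lra. Qed.
Let rd : r < delta.
Proof.
apply: (@lt_trans _ _ r1); first by rewrite ltr_pdivlMr// gtr_pMr//; move: eta0; lra.
by apply: lt_trans r1d _; rewrite gtr_pMr// invf_lt1// ltr1n.
Qed.
Let mB : measurable B. Proof. exact: measurable_eball. Qed.
Let fB : (mu B < +oo)%E. Proof. exact: eball0_finite. Qed.
Let AB : A `<=` B.
Proof.
move=> y /andP[_ yr]; rewrite eball0E/= (le_lt_trans yr)// (lt_trans r1d)//.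
by rewrite gtr_pMr// invf_lt1// ltr1n.
Qed.
Lemma measurable_annulus : measurable A.
Proof.
rewrite (_ : A = (@enorm R m.+2) @^-1` `[r, r1]%classic); last first.
  by apply/seteqP; split => y; rewrite /= in_itv.
by rewrite -[X in measurable X]setTI; exact: measurable_enorm.
Qed.

Let bump1 : C1 gam. Proof. exact: Ck_on_bump. Qed.

Lemma Ck_on_bumps k : Ck_on k setT bumps.
Proof.
apply: Ck_on_sum => [|c]; first exact: openT.
by apply: (Ck_on_shift (- c)); exact: Ck_on_bump.
Qed.

(** Balls of radius [delta] around distinct centres lie in disjoint cubes, so inside a cell only one
    bump of the sum is seen. *)
Lemma other_far c c' y : c \in ctr -> c' \in ctr -> enorm y < delta -> c' != c ->
  delta <= enorm (y + c - c').
Proof.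
move=> cc cc' yd cN; rewrite leNgt; apply/negP => h; move/eqP: cN; apply.
apply: (disj (x := y + c)) => //; apply: eball_sub_cube; rewrite eball0E/=; first exact: h.
by rewrite addrK.
Qed.

Lemma bumps_cell c y : c \in ctr -> enorm y < delta -> bumps (y + c) = gam y.
Proof.
move=> cc yd; rewrite /bumps (bigD1_seq c)//= addrK big_seq_cond big1 ?addr0// => c' /andP[cc' cN].
by apply: bump_outer => //; exact: other_far.
Qed.

Lemma partial_bumps k x : partial k bumps x = \sum_(c <- ctr) partial k gam (x - c).
Proof.
rewrite /bumps partial_sum; last by move=> c; apply: (Ck_on_shift (- c)); exact: bump1.
by apply: eq_bigr => c _; exact (@derive_translate R m.+2 gam (- c) x _).
Qed.

Lemma partial_bumps_cell c y k : c \in ctr -> enorm y < delta ->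
  partial k bumps (y + c) = partial k gam y.
Proof.
move=> cc yd; rewrite partial_bumps (bigD1_seq c)//= addrK big_seq_cond big1 ?addr0//.
by move=> c' /andP[cc' cN]; apply: bump_partial_outer => //; exact: other_far.
Qed.

Lemma bumps_out x : (forall c, c \in ctr -> delta <= enorm (x - c)) ->
  bumps x = 0 /\ forall k, partial k bumps x = 0.
Proof.
move=> H; split; first by rewrite /bumps big_seq big1// => c /H; exact: bump_outer.
by move=> k; rewrite partial_bumps big_seq big1// => c /H; exact: bump_partial_outer.
Qed.

Let G x := \sum_k `|partial k g x|.
Let cG : continuous G.
Proof.
apply: continuous_sumr => k x; apply: (@continuous_comp _ _ _ (partial k g) Num.norm).
  exact: C1_derive_continuous.
exact: norm_continuous.
Qed.
Let mG : measurable_fun setT G. Proof. exact: continuous_measurable_rV. Qed.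
Let GC x : `|G x| <= m.+2%:R * Cg.
Proof.
rewrite ger0_norm ?sumr_ge0// mulr_natl -[X in _ *+ X]card_ord -sumr_const.
by apply: ler_sum => k _; exact: DC.
Qed.

Let integrable_G (D : set 'rV[R]_m.+2) : measurable D -> (mu D < +oo)%E ->
  mu.-integrable D (EFin \o G).
Proof.
by move=> mD fD; apply: (bounded_integrable mD fD) (fun x _ => GC x); exact: measurable_funTS.
Qed.

Let integrable_g (D : set 'rV[R]_m.+2) : measurable D -> (mu D < +oo)%E ->
  mu.-integrable D (EFin \o g).
Proof.
move=> mD fD; apply: (bounded_integrable mD fD) (fun x _ => gC x); apply: measurable_funTS.
by apply: continuous_measurable_rV; exact: C1_continuous.
Qed.

Let dflux x := - \sum_k partial k bumps x * partial k g x.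

Let cdflux : continuous dflux.
Proof.
move=> x; apply: (@continuousN _ _ _ (fun x => \sum_k partial k bumps x * partial k g x)).
apply: continuous_sumr => k {}x.
apply: (@continuousM _ _ (partial k bumps) (partial k g)); apply: C1_derive_continuous => //.
exact: Ck_on_bumps.
Qed.

Lemma partial_bump_bounded : exists K : 'I_m.+2 -> R, forall k y, `|partial k gam y| <= K k.
Proof.
suff /choice [K HK] : forall k : 'I_m.+2, exists K, forall y, `|partial k gam y| <= K by exists K.
move=> k.
have cb : continuous (partial k gam) by exact: C1_derive_continuous.
have bs : bsupp delta (partial k gam).
  by move=> y yd; apply: bump_partial_outer => //; exact: le_trans (norm_le_enorm y).
by have [K _ HK] := bsupp_bounded cb bs; exists K.
Qed.

Section one_cell.
Variables (c : 'rV[R]_m.+2) (cc : c \in ctr).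
Let gc y := g (y + c).
Let gc1 : C1 gc. Proof. exact: Ck_on_shift. Qed.
Let gcE k y : partial k gc y = partial k g (y + c).
Proof. exact (@derive_translate R m.+2 g c y _). Qed.

Let E y := \sum_k @bump_err R m delta eta k y * partial k gc y.
Let X y := m%:R * (((delta / enorm y) ^+ m.+2 - 1) * 'D_y gc y).
Let Z y := - \sum_k partial k gam y * partial k gc y.

(** For |y| < r the singular field is cut off in [bump_err] but not in [X]; the identity survives
    because the gradient of [g] vanishes on the hole. *)
Let ZE y : Z y = E y + X y.
Proof.
rewrite /X derive_partial// /Z /E -sumrN mulr_sumr mulr_sumr -big_split/=.
have [ry|ry] := leP r (enorm y); last first.
  apply: eq_bigr => k _; rewrite /bump_err leNgt ry/=.
  have -> : partial k gc y = 0.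
    rewrite /partial -(@near_eq_derive R _ R (cst 0) gc y) ?derive_cst//.
    have : \forall x \near y, eball 0 r x.
      by apply: open_nbhs_nbhs; split; [exact: open_eball|rewrite eball0E].
    apply: filterS => x; rewrite eball0E/= => xr; rewrite /gc (g0 cc)// addrK//.
  by rewrite !mulr0 addr0 oppr0.
have yN : enorm y ^+ m.+2 != 0 by rewrite expf_neq0// gt_eqF// (lt_le_trans r0).
apply: eq_bigr => k _; rewrite /bump_err ry.
have -> : (delta / enorm y) ^+ m.+2 = delta ^+ m.+2 / enorm y ^+ m.+2 by exact: expr_div_n.
move: yN.
generalize (partial k gam y) (partial k gc y) (delta ^+ m.+2) (enorm y ^+ m.+2) (y 0 k) (m%:R : R).
by move=> p q s t u v t0; field.
Qed.

Let iZ : mu.-integrable B (EFin \o Z).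
Proof.
have cZ : continuous (fun y : 'rV[R]_m.+2 => dflux (y + c)).
  move=> y; apply: (@continuous_comp _ _ _ (fun y : 'rV[R]_m.+2 => y + c) dflux); last exact: cdflux.
  by apply: (@continuousD _ _ _ id (cst c)); [exact: cvg_id|exact: cst_continuous].
have mZ : measurable_fun B Z.
  apply: (@eq_measurable_fun _ _ _ _ _ (fun y : 'rV[R]_m.+2 => dflux (y + c))).
    move=> y; rewrite inE eball0E/= => yd; congr (- _); apply: eq_bigr => k _.
    by rewrite partial_bumps_cell// gcE.
  by apply: measurable_funTS; exact: continuous_measurable_rV.
have [K HK] := partial_bump_bounded.
apply: (bounded_integrable (C := \sum_k K k * Cg) mB fB mZ) => y _.
rewrite normrN (le_trans (ler_norm_sum _ _ _))// ler_sum// => k _.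
by rewrite normrM ler_pM// gcE.
Qed.

Let errE y : B y -> `|E y| <= b * G (y + c) + a * (\1_A y * G (y + c)).
Proof.
rewrite eball0E/= => yd; rewrite mulrA -mulrDl /G mulr_sumr.
rewrite (le_trans (ler_norm_sum _ _ _))// ler_sum// => k _.
by rewrite normrM gcE ler_wpM2r// bump_err_le.
Qed.

Let mGc : measurable_fun setT (fun y : 'rV[R]_m.+2 => G (y + c)).
Proof. by apply: (measurableT_comp mG); exact: measurable_shift. Qed.

Let iGc (D : set 'rV[R]_m.+2) : measurable D -> (mu D < +oo)%E ->
  mu.-integrable D (EFin \o (fun y : 'rV[R]_m.+2 => G (y + c))).
Proof.
by move=> mD fD; apply: (bounded_integrable mD fD) (fun x _ => GC (x + c)); exact: measurable_funTS.
Qed.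

Let mE : measurable_fun B E.
Proof.
apply: measurable_sum => k; apply: measurable_funM; last first.
  by apply: measurable_funTS; apply: continuous_measurable_rV; exact: C1_derive_continuous.
apply: measurable_funTS; apply: measurable_funD.
  apply: measurable_funB.
    apply: measurableT_comp => //; apply: continuous_measurable_rV; exact: C1_derive_continuous.
  apply: measurable_fun_ifT => //.
    by apply: measurable_fun_ler => //; exact: measurable_enorm.
  apply: measurable_funM; first by apply: measurable_funM => //; exact: measurable_coord.
  by apply: (measurableT_comp measurable_inv); apply: measurable_funX; exact: measurable_enorm.
by apply: measurable_funM => //; exact: measurable_coord.
Qed.

Let iEb : mu.-integrable B (EFin \o (fun y => b * G (y + c) + a * (\1_A y * G (y + c)))) /\
  (\int[mu]_(y in B) (b * G (y + c) + a * (\1_A y * G (y + c))) =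
   b * (\int[mu]_(y in B) G (y + c)) + a * (\int[mu]_(y in A) G (y + c)))%R.
Proof.
have i1 := iGc mB fB.
have E1 : (fun y : 'rV[R]_m.+2 => \1_A y * G (y + c)) = (fun y => G (y + c)) \_ A.
  by apply/funext => y; rewrite patchE indicE; case: ifP => _; rewrite ?mul1r ?mul0r.
have i2 : mu.-integrable B (EFin \o (fun y => \1_A y * G (y + c))).
  apply: (le_integrable mB _ _ i1).
    apply/measurable_EFinP; apply: measurable_funM; last exact: measurable_funTS.
    by apply: measurable_funTS; apply: measurable_indic; exact: measurable_annulus.
  move=> y _; rewrite /= lee_fin normrM ler_piMl// indicE.
  by case: (_ \in _); rewrite ?normr1 ?normr0.
have [j e] := Rintegral_lin mB b a i1 i2; split => //.
rewrite e; congr (_ + _ * _); rewrite E1 -Rintegral_mkcondr.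
by congr (Rintegral _ _ _); apply/seteqP; split => [y []//|y Ay]; split => //; exact: AB.
Qed.

Let iE : mu.-integrable B (EFin \o E).
Proof.
have [j _] := iEb; apply: (le_integrable mB _ _ j); first exact/measurable_EFinP.
by move=> y By; rewrite /= lee_fin (le_trans (errE By))// ler_norm.
Qed.

(** The exact field contributes, by [flux_identity], m N times the integral of [g], with m = N - 2
    and N the dimension. The rest is [bump_err] against the gradient of [g]. *)
Lemma cell_flux :
  `|(\int[mu]_(y in B) dflux (y + c))%R - m%:R * m.+2%:R * (\int[mu]_(y in B) g (y + c))%R| <=
  b * (\int[mu]_(y in B) G (y + c))%R + a * (\int[mu]_(y in A) G (y + c))%R.
Proof.
have -> : (\int[mu]_(y in B) dflux (y + c) = \int[mu]_(y in B) Z y)%R.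
  apply: eq_Rintegral => y; rewrite inE eball0E/= => yd; congr (- _); apply: eq_bigr => k _.
  by rewrite partial_bumps_cell// gcE.
have iX : mu.-integrable B (EFin \o X).
  have := integrableB mB iZ iE; congr (_.-integrable _ _); apply/funext => y.
  by rewrite /= -EFinB ZE addrAC subrr add0r.
have F : m.+2%:R * (\int[mu]_(y in B) g (y + c))%R =
    (\int[mu]_(y in B) (((delta / enorm y) ^+ m.+2 - 1) * 'D_y gc y))%R.
  apply: (flux_identity (C := Cg)) r0 rd _ _ => //.
  - by move=> y yr; rewrite /gc (g0 cc)// addrK.
  - by move=> k y; rewrite gcE.
have iX' : mu.-integrable B (EFin \o (fun y => ((delta / enorm y) ^+ m.+2 - 1) * 'D_y gc y)).
  have mN : m%:R != 0 :> R by rewrite pnatr_eq0 -lt0n.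
  have := integrableZl mB m%:R^-1 iX; congr (_.-integrable _ _); apply/funext => y.
  by rewrite /= -EFinM mulKf.
have eX : (\int[mu]_(y in B) X y =
    m%:R * \int[mu]_(y in B) (((delta / enorm y) ^+ m.+2 - 1) * 'D_y gc y))%R.
  by rewrite RintegralZl.
rewrite -mulrA F -eX -RintegralB//.
have [j e] := iEb; rewrite -e; apply: Rintegral_abs_le => //.
  by have := integrableB mB iZ iX.
by move=> y By; rewrite ZE addrK errE.
Qed.

End one_cell.

Lemma tiles_flux : (mu (tiles ctr B) < +oo)%E ->
  `|(\int[mu]_(x in tiles ctr B) dflux x)%R -
    m%:R * m.+2%:R * (\int[mu]_(x in tiles ctr B) g x)%R| <=
  b * (\int[mu]_(x in tiles ctr B) G x)%R + a * (\int[mu]_(x in tiles ctr A) G x)%R.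
Proof.
move=> fT; have mT := measurable_tiles ctr mB; have mA := measurable_annulus.
have mTA := measurable_tiles ctr mA.
have TAB : tiles ctr A `<=` tiles ctr B.
  by move=> x /tilesP[c cc Ax]; apply/tilesP; exists c => //; exact: AB.
have fTA : (mu (tiles ctr A) < +oo)%E by apply: le_lt_trans fT; rewrite le_measure ?inE.
have BQ : B `<=` cube delta by exact: eball_sub_cube.
have AQ : A `<=` cube delta by exact: subset_trans AB BQ.
have mdf : measurable_fun setT dflux by exact: continuous_measurable_rV.
have mg : measurable_fun setT g by apply: continuous_measurable_rV; exact: C1_continuous.
have idf : mu.-integrable (tiles ctr B) (EFin \o dflux).
  have [K HK] := partial_bump_bounded.
  apply: (bounded_integrable (C := \sum_k K k * Cg) mT fT); first exact: measurable_funTS.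
  move=> x /tilesP[c cc]; rewrite eball0E/= => xc; rewrite -(subrK c x).
  rewrite normrN (le_trans (ler_norm_sum _ _ _))// ler_sum// => k _.
  by rewrite normrM ler_pM// partial_bumps_cell.
rewrite (Rintegral_tiles uctr disj mB BQ mdf idf).
rewrite (Rintegral_tiles uctr disj mB BQ mg (integrable_g mT fT)).
rewrite (Rintegral_tiles uctr disj mB BQ mG (integrable_G mT fT)).
rewrite (Rintegral_tiles uctr disj mA AQ mG (integrable_G mTA fTA)).
rewrite !mulr_sumr -sumrB -big_split/= (le_trans (ler_norm_sum _ _ _))//.
by rewrite big_seq [leRHS]big_seq ler_sum// => c cc; exact: cell_flux.
Qed.

End cell_flux.

(** * The area of the sphere and the constant mu *)

Section sphere.
Context {R : realType} {n : nat}.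
Local Notation mu := (lebesgue_rV n).

(** The dilation by 2 fixes the origin and scales its finite measure by 2^(-n). *)
Lemma measure_origin : (0 < n)%N -> mu [set (0 : 'rV[R]_n)] = 0%E.
Proof.
move=> n0; have m1 : measurable [set (0 : 'rV[R]_n)].
  rewrite (_ : [set 0] = ~` [set x : 'rV[R]_n | 0 < `|x|]); last first.
    by apply/seteqP; split => x /=; [move=> ->; rewrite normr0 ltxx|rewrite normr_gt0 => /negP/negPn/eqP].
  apply: measurableC; apply: measurable_open_rV.
  apply: (@open_comp _ _ (fun x : 'rV[R]_n => `|x|) [set t | 0 < t]); last exact: open_gt.
  by move=> x _; exact: norm_continuous.
have h2 : 0 < 2 :> R by [].
have := lebesgue_rV_dilate h2 m1.
rewrite (_ : _ @^-1` _ = [set 0]); last first.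
  by apply/seteqP; split => x /=; [move/eqP; rewrite scaler_eq0 pnatr_eq0 => /eqP|move=> ->; rewrite scaler0].
have f1 : (mu [set (0%R : 'rV[R]_n)] < +oo)%E.
  by apply: (@bounded_measure_finite _ _ _ 0) => // x ->; rewrite normr0.
have : (0 <= mu [set (0%R : 'rV[R]_n)])%E by [].
case: (mu _) f1 => // x _; rewrite lee_fin -EFinM => x0 [] E.
have : x * (1 - 2 ^- n) = 0 by rewrite mulrBr mulr1 [x * _]mulrC -E subrr.
move/eqP; rewrite mulf_eq0 subr_eq0 => /orP[/eqP->//|]; rewrite eq_sym => /eqP h.
have : 2 ^- n < 1 :> R by rewrite invf_lt1 ?exprn_gt0// exprn_egt1// -?lt0n// ltr1n.
by rewrite h ltxx.
Qed.

(** The cone over the whole sphere is the unit ball without its centre. *)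
Lemma sphere_areaE : (0 < n)%N ->
  sphere_area n = n%:R * fine (mu (eball (0 : 'rV[R]_n) 1)).
Proof.
move=> n0; rewrite /sphere_area /sphere_measure.
have m0 : measurable [set (0 : 'rV[R]_n)].
  rewrite (_ : [set 0] = ~` [set x : 'rV[R]_n | 0 < `|x|]); last first.
    by apply/seteqP; split => x /=; [move=> ->; rewrite normr0 ltxx|rewrite normr_gt0 => /negP/negPn/eqP].
  apply: measurableC; apply: measurable_open_rV.
  apply: (@open_comp _ _ (fun x : 'rV[R]_n => `|x|) [set t | 0 < t]); last exact: open_gt.
  by move=> x _; exact: norm_continuous.
have e0 (x : 'rV[R]_n) : enorm x = 0 -> x = 0.
  by move=> h; apply/eqP; rewrite -normr_le0 -h norm_le_enorm.
rewrite (_ : [set x | _] = eball (0 : 'rV[R]_n) 1 `\` [set 0]); last first.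
  apply/seteqP; split => x; rewrite eball0E/=.
    move=> [/andP[h1 h2] _]; split=> // x0; move: h1.
    by rewrite x0 -(scale0r (0 : 'rV[R]_n)) enormZ normr0 mul0r ltxx.
  move=> [h1 h2]; have h0 : 0 < enorm x.
    by rewrite lt_neqAle enorm_ge0 andbT eq_sym; apply/eqP => /e0.
  by rewrite h0 h1; split => //; rewrite enormZ gtr0_norm ?invr_gt0// mulVf ?gt_eqF.
have mB := measurable_eball (0 : 'rV[R]_n) 1.
have -> : mu (eball (0 : 'rV[R]_n) 1 `\` [set 0]) = mu (eball (0 : 'rV[R]_n) 1).
  rewrite measureD//; last exact: eball0_finite.
  rewrite (_ : _ `&` _ = [set 0]); last first.
    apply/seteqP; split => x /=; first by case.
    move=> ->; split => //; rewrite eball0E/= -(scale0r (0 : 'rV[R]_n)) enormZ normr0 mul0r.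
    exact: ltr01.
  by rewrite -[RHS]sube0; congr (_ - _)%E; exact: measure_origin.
rewrite fineM// ge0_fin_numE//; exact: eball0_finite.
Qed.

Lemma fine_measure_eball (r : R) : 0 < r ->
  fine (mu (eball (0 : 'rV[R]_n) r)) = r ^+ n * fine (mu (eball (0 : 'rV[R]_n) 1)).
Proof.
move=> r0; have f1 : mu (eball (0 : 'rV[R]_n) 1%R) \is a fin_num.
  by rewrite ge0_fin_numE//; exact: eball0_finite.
by rewrite measure_eball// fineM.
Qed.

(* Volume fraction of a ball of radius [h] in a cube of side [2 h]. *)
Definition ball_density : R := fine (mu (eball (0 : 'rV[R]_n) 1)) / 2 ^+ n.

Lemma ball_density_ge0 : 0 <= ball_density.
Proof. by rewrite divr_ge0 ?exprn_ge0// fine_ge0. Qed.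

Lemma fine_measure_cube (h : R) : 0 < h -> fine (mu (cube h)) = (2 * h) ^+ n.
Proof. by move=> h0; rewrite measure_cube. Qed.

Lemma ball_densityE (h : R) : 0 < h ->
  fine (mu (eball (0 : 'rV[R]_n) h)) = ball_density * (2 * h) ^+ n.
Proof.
move=> h0; rewrite fine_measure_eball// /ball_density exprMn mulrA divfK ?expf_neq0//.
exact: mulrC.
Qed.

Lemma ball_density_le1 : ball_density <= 1.
Proof.
have h : fine (mu (eball (0 : 'rV[R]_n) 1)) <= fine (mu (cube 1)).
  rewrite fine_le ?ge0_fin_numE//; [exact: eball0_finite|exact: cube_finite|].
  by rewrite le_measure ?inE//; [exact: measurable_eball|exact: measurable_cube|exact: eball_sub_cube].
by move: h; rewrite ball_densityE// fine_measure_cube// ger_pMl// exprn_gt0.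
Qed.

Lemma strange_muE : (0 < n)%N -> strange_mu n = (n%:R - 2) * n%:R * ball_density :> R.
Proof.
move=> n0; rewrite /strange_mu sphere_areaE// /ball_density.
by rewrite mulrC [2 ^- n * _]mulrC !mulrA.
Qed.

Lemma tiling_density (delta C : R) (ctr : seq 'rV[R]_n) (Omega : set 'rV[R]_n)
    (f : 'rV[R]_n -> R) : 0 < delta -> uniq ctr -> measurable Omega -> (mu Omega < +oo)%E ->
  (forall c c' x, c \in ctr -> c' \in ctr ->
    cube delta (x - c) -> cube delta (x - c') -> c = c') ->
  C1 f -> (forall x, `|f x| <= C) -> (forall k x, `|partial k f x| <= C) ->
  (forall c y, c \in ctr -> `|y - c| <= 2 * delta -> Omega y) ->
  `|(\int[mu]_(x in tiles ctr (eball (0 : 'rV[R]_n) delta)) f x)%R -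
    ball_density * (\int[mu]_(x in tiles ctr (cube delta)) f x)%R| <=
  2 * (delta * \sum_k (\int[mu]_(x in Omega) `|partial k f x|)%R).
Proof.
move=> d0 uctr mO fO disj f1 fC DC inO.
have T := tiling_estimate d0 uctr mO fO disj f1 fC DC inO.
have q0 : 0 < (2 * delta) ^+ n by rewrite exprn_gt0// mulr_gt0.
rewrite fine_measure_cube// ball_densityE// in T.
move: T q0 ball_density_ge0 ball_density_le1.
set E := \sum_k _; have E0 : 0 <= E by apply: sumr_ge0 => k _; exact: Rintegral_ge0.
move: E0; generalize E ((2 * delta) ^+ n) ball_density
  (\int[mu]_(x in tiles ctr (eball (0 : 'rV[R]_n) delta)) f x)%R
  (\int[mu]_(x in tiles ctr (cube delta)) f x)%R => {E}E q be tB tQ E0 T q0 b0 b1.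
rewrite -(ler_pM2l q0) -[q in leLHS]gtr0_norm// -normrM mulrBr [q * (be * tQ)]mulrCA [be * (q * tQ)]mulrA.
apply: le_trans T _; rewrite [leRHS]mulrA; apply: ler_wpM2r; first by rewrite mulr_ge0// ltW.
by rewrite mulr_natr mulr2n lerD2l ler_piMl// ltW.
Qed.

End sphere.

(** The chain of replacements behind mu: the flux [F], the integral [tB] of g over all balls, [tB']
    over the inner balls, [tQ] over the inner cubes, [gO] over the domain. The second and fourth
    passages cost the boundary layer [lg], the third a tiling error. *)
Lemma flux_arithmetic (R : realType) (k b a be d F tB tB' tQ gO lg GO GB GA : R) :
  0 <= k -> 0 <= b -> 0 <= be -> be <= 1 ->
  `|F - k * tB| <= b * GB + a * GA -> `|tB' - be * tQ| <= 2 * (d * GO) ->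
  `|tB - tB'| <= lg -> `|gO - tQ| <= lg -> GB <= GO ->
  `|F - k * be * gO| <= (b + k * (2 * d)) * GO + a * GA + k * (2 * lg).
Proof.
move=> k0 b0 be0 be1 T1 T2 T3 T4 GBO.
have -> : F - k * be * gO = (F - k * tB) + k * ((tB - tB') + (tB' - be * tQ) - be * (gO - tQ)) by ring.
apply: le_trans (ler_normD _ _) _.
have T5 : `|(tB - tB') + (tB' - be * tQ) - be * (gO - tQ)| <= lg + 2 * (d * GO) + lg.
  apply: le_trans (ler_normB _ _) _; apply: lerD; first exact: le_trans (ler_normD _ _) (lerD T3 T2).
  by rewrite normrM ger0_norm// (le_trans _ T4)// ler_piMl.
have T6 : `|k * ((tB - tB') + (tB' - be * tQ) - be * (gO - tQ))| <= k * (lg + 2 * (d * GO) + lg).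
  by rewrite normrM ger0_norm// ler_wpM2l.
apply: le_trans (lerD T1 T6) _.
have : b * GB <= b * GO by rewrite ler_wpM2l.
by move=> h; rewrite -subr_ge0; move: h; rewrite -subr_ge0; congr (0 <= _); ring.
Qed.

Section corrector_flux.
Context {R : realType}.
Variables (m : nat) (delta eta C Cg : R) (ctr ctr' : seq 'rV[R]_m.+2) (g : 'rV[R]_m.+2 -> R).
Variables Omega L : set 'rV[R]_m.+2.
Local Notation mu := (lebesgue_rV m.+2).
Local Notation r := (@hole_radius R m.+1 delta).
Local Notation r1 := (r / (1 - 2 * eta)).
Hypotheses (m0 : (0 < m)%N) (d0 : 0 < delta) (eta0 : 0 < eta) (eta4 : eta < 4^-1).
Hypotheses (r1d : r1 < delta / 2) (dsmall : 2 ^+ m * delta ^+ 2 <= 2^-1).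
Hypotheses (C0 : 0 <= C) (stepC : forall t : R, `|'D_1 smooth_step t| <= C).
Hypotheses (uctr : uniq ctr) (disj : forall c c' x, c \in ctr -> c' \in ctr ->
  cube delta (x - c) -> cube delta (x - c') -> c = c').
Hypotheses (g1 : C1 g) (gC : forall x, `|g x| <= Cg)
  (DC : forall k x, `|partial k g x| <= Cg).
Hypothesis g0 : forall c x, c \in ctr -> enorm (x - c) < r -> g x = 0.
Hypotheses (mO : measurable Omega) (fO : (mu Omega < +oo)%E)
  (mL : measurable L) (LO : L `<=` Omega).
Hypothesis ballO : forall c x, c \in ctr -> enorm (x - c) < delta -> Omega x.
Hypotheses (uctr' : uniq ctr') (ctr'P : {subset ctr' <= ctr}).
Hypothesis bigO : forall c x, c \in ctr' -> `|x - c| <= 2 * delta -> Omega x.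
Hypothesis Lcube : forall x, Omega x -> ~ tiles ctr' (cube delta) x -> L x.
Hypothesis Lball : forall c x, c \in ctr -> c \notin ctr' -> enorm (x - c) < delta -> L x.

Local Notation b := (@err_cell R m delta C).
Local Notation a := (@err_annulus R m delta C).
Local Notation B := (eball (0 : 'rV[R]_m.+2) delta).
Local Notation Q := (cube delta : set 'rV[R]_m.+2).
Local Notation A := (@annulus R m delta eta).
Local Notation N := (m.+2%:R : R).
Local Notation G := (fun x => \sum_k `|partial k g x|).
Local Notation dflux := (fun x => - \sum_k partial k (bumps delta eta ctr) x * partial k g x).

(** Two families of centres: [ctr] carries the bumps, while the smaller [ctr'] has room around each
    cell for the translations of the tiling estimate. The cells of [ctr] outside [ctr'], and the
    points of the domain not covered by the cubes of [ctr'], all lie in [L]. *)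
Lemma corrector_flux :
  `|(\int[mu]_(x in Omega) dflux x)%R - strange_mu m.+2 * (\int[mu]_(x in Omega) g x)%R| <=
  (b + m%:R * N * (2 * delta)) * (\int[mu]_(x in Omega) G x)%R +
  a * (\int[mu]_(x in tiles ctr A) G x)%R +
  m%:R * N * (2 * (\int[mu]_(x in L) `|g x|)%R).
Proof.
have mB : measurable B by exact: measurable_eball.
have mQ : measurable Q by exact: measurable_cube.
have mTB := measurable_tiles ctr mB; have mTB' := measurable_tiles ctr' mB.
have mTQ' := measurable_tiles ctr' mQ.
have BQ : B `<=` Q by exact: eball_sub_cube.
have TBO : tiles ctr B `<=` Omega.
  by move=> x /tilesP[c cc]; rewrite eball0E/=; exact: ballO.
have TBB : tiles ctr' B `<=` tiles ctr B.
  by move=> x /tilesP[c cc Bx]; apply/tilesP; exists c => //; exact: ctr'P.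
have TQO : tiles ctr' Q `<=` Omega.
  move=> x /tilesP[c cc Bx]; apply: (bigO cc).
  by rewrite (le_trans (cube_norm_le (ltW d0) Bx))// ler_peMl ?(ltW d0)// ler1n.
have fTB : (mu (tiles ctr B) < +oo)%E by apply: le_lt_trans fO; rewrite le_measure ?inE.
have cg : continuous g by exact: C1_continuous.
have mg : measurable_fun setT g by exact: continuous_measurable_rV.
have ig : mu.-integrable Omega (EFin \o g).
  by apply: (bounded_integrable mO fO) (fun x _ => gC x); exact: measurable_funTS.
have mD k : measurable_fun setT (partial k g).
  by apply: continuous_measurable_rV; exact: C1_derive_continuous.
have iDk k : mu.-integrable Omega (EFin \o (fun x => `|partial k g x|)).
  apply: integrable_normr; apply: (bounded_integrable mO fO) (fun x _ => DC k x).
  exact: measurable_funTS.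
have [iG EG] := Rintegral_sum (index_enum 'I_m.+2) mO iDk.
have T1 := tiles_flux m0 d0 eta0 eta4 r1d dsmall C0 stepC uctr disj g1 gC DC g0 fTB.
have E1 : (\int[mu]_(x in tiles ctr B) dflux x = \int[mu]_(x in Omega) dflux x)%R.
  rewrite -[in LHS](setIidr TBO) Rintegral_mkcondr; apply: eq_Rintegral => x _.
  rewrite patchE; case: ifPn => // /negP; rewrite inE => nT.
  have [_ H] : bumps delta eta ctr x = 0 /\ forall k, partial k (bumps delta eta ctr) x = 0.
    apply: bumps_out => // c cc; rewrite leNgt; apply/negP => h.
    by apply: nT; apply/tilesP; exists c => //; rewrite eball0E.
  by rewrite big1 ?oppr0// => k _; rewrite H mul0r.
rewrite E1 in T1.
have iTB : mu.-integrable (tiles ctr B) (EFin \o g) by exact: integrableS ig.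
have T2 := @tiling_density R m.+2 delta Cg ctr' Omega g d0 uctr' mO fO
  (fun c c' x h h' => disj (ctr'P h) (ctr'P h')) g1 gC DC bigO.
have T3 : `|(\int[mu]_(x in tiles ctr B) g x - \int[mu]_(x in tiles ctr' B) g x)%R| <= (\int[mu]_(x in L) `|g x|)%R.
  apply: (@le_trans _ _ (\int[mu]_(x in L `&` tiles ctr B) `|g x|)%R); last first.
    apply: Rintegral_subset_ge0 => //; first exact: measurableI.
    by apply: integrable_normr; exact: integrableS ig.
  apply: Rintegral_setI_diff => //; first exact: measurableI.
  move=> x xB xB' _; split => //; have [c cc Bx] := (tilesP _ _ _).1 xB.
  apply: (Lball cc); last by move: Bx; rewrite eball0E.
  by apply/negP => cc'; apply: xB'; apply/tilesP; exists c.
have T4 : `|(\int[mu]_(x in Omega) g x - \int[mu]_(x in tiles ctr' Q) g x)%R| <= (\int[mu]_(x in L) `|g x|)%R.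
  by apply: Rintegral_setI_diff => // x Ox xQ _; exact: Lcube.
have GO : (\int[mu]_(x in tiles ctr B) G x <= \int[mu]_(x in Omega) G x)%R.
  by apply: Rintegral_subset_ge0 => // x _; exact: sumr_ge0.
rewrite -EG in T2.
have muE : strange_mu m.+2 = m%:R * N * @ball_density R m.+2.
  rewrite strange_muE//; congr (_ * _ * _).
  by rewrite -addn2 natrD addrK.
rewrite muE.
have k0 : 0 <= m%:R * N by rewrite mulr_ge0.
exact: (flux_arithmetic k0 (err_cell_ge0 m d0 C0) ball_density_ge0 ball_density_le1 T1 T2 T3 T4 GO).
Qed.

End corrector_flux.

(** * Approximation of the limit by polynomials *)

Section polynomial_approximation.
Context {R : realType}.
Local Notation lam := (@lebesgue_measure R).

(** If d > eta then d <= d^4 / eta^3, and d^4 <= K^2 h^2. This turns a Holder bound of exponent 1/2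
    into the modulus required by [Bernstein_approx]. *)
Lemma Holder_quadratic (K eta d h : R) : 0 <= K -> 0 < eta -> 0 <= d -> 0 <= h ->
  d ^+ 2 <= K * h -> d <= eta + K ^+ 2 / eta ^+ 3 * h ^+ 2.
Proof.
move=> K0 e0 d0 h0 dK; have [de|ed] := leP d eta.
  by rewrite (le_trans de)// lerDl mulr_ge0 ?sqr_ge0// divr_ge0 ?sqr_ge0// exprn_ge0// ltW.
have d4 : d ^+ 4 <= K ^+ 2 * h ^+ 2.
  by rewrite -exprMn (_ : 4 = 2 * 2)%N// exprM lerXn2r ?nnegrE ?sqr_ge0 ?mulr_ge0.
apply: (@le_trans _ _ (K ^+ 2 / eta ^+ 3 * h ^+ 2)); last by rewrite lerDr ltW.
rewrite mulrAC ler_pdivlMr ?exprn_gt0//; apply: le_trans d4.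
by rewrite [leRHS]exprS ler_wpM2l// lerXn2r ?nnegrE ?(ltW e0) ?(ltW ed).
Qed.

(** The Bernstein polynomial approximates [du], and q is its primitive with q(0) = u(0); integration
    over [0, t] with t <= 1 does not increase the error. *)
Lemma polynomial_C1_approx (u du : R -> R) (K tol : R) :
  {within `[0, 1], continuous du} -> 0 <= K -> 0 < tol ->
  (forall t, 0 <= t <= 1 -> u t = u 0 + (\int[lam]_(s in `[0, t]) du s)%R) ->
  (forall s t, 0 <= s <= 1 -> 0 <= t <= 1 -> (du t - du s) ^+ 2 <= K * `|t - s|) ->
  exists q : {poly R}, forall t, 0 <= t <= 1 ->
    `|u t - q.[t]| <= tol /\ `|du t - q^`().[t]| <= tol.
Proof.
move=> cdu K0 tol0 uE duK.
have t2 : 0 < tol / 2 by rewrite divr_gt0.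
have [p [_ _ pE]] : exists p : {poly R}, [/\ p.[0] = du 0, p.[1] = du 1 &
    forall t, 0 <= t <= 1 -> `|du t - p.[t]| <= (tol / 2) *+ 2].
  apply: (@Bernstein_approx _ du (tol / 2) (K ^+ 2 / (tol / 2) ^+ 3)) => //.
    by rewrite divr_ge0 ?sqr_ge0// exprn_ge0// ltW.
  move=> s t s01 t01; rewrite -[(t - s) ^+ 2]real_normK ?num_real//.
  by apply: Holder_quadratic => //; rewrite real_normK ?num_real// duK.
have tolE : tol / 2 *+ 2 = tol by rewrite -mulr_natr divfK.
have [P PE] := poly_antiderivative p.
exists (P - P.[0]%:P + (u 0)%:P) => t t01.
rewrite derivD derivB !derivC subr0 addr0 PE; split; last by rewrite -tolE pE.
have /andP[t0 t1] := t01.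
have P1 : C1 (fun x : R => P.[x]) by exact: Ck_on_horner.
have ip : (\int[lam]_(s in `[0, t]) p.[s] = P.[t] - P.[0])%R.
  rewrite -(C1_FTC_R P1 t0); apply: eq_lebesgue_Rintegral => s _.
  by have [_ ->] := is_derive_poly P s; rewrite PE.
have cp : {within `[0, 1], continuous (fun x : R => p.[x])}.
  by apply: continuous_subspaceT; apply: C1_continuous; exact: Ck_on_horner.
have i1 := within_continuous_integrable t1 cdu.
have i2 := within_continuous_integrable t1 cp.
have [i3 e3] := itv_Rintegral_lin 1 (-1) i1 i2.
rewrite !hornerE uE// -ip.
have -> : u 0 + (\int[lam]_(s in `[0, t]) du s)%R - ((\int[lam]_(s in `[0, t]) p.[s])%R + u 0) =
    (\int[lam]_(s in `[0, t]) (1 * du s + -1 * p.[s]))%R.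
  by rewrite e3; ring.
have it : lam.-integrable `[0, t] (EFin \o (fun=> tol : R)).
  by apply: within_continuous_integrable => //; apply: continuous_subspaceT => x; exact: cst_continuous.
apply: (@le_trans _ _ (\int[lam]_(s in `[0, t]) tol)%R).
  apply: Rintegral_abs_le => // s; rewrite /= in_itv/= => /andP[s0 st].
  by rewrite mul1r mulN1r -tolE pE// s0 (le_trans st).
have m : measurable (`[0, t]%classic : set (measurableTypeR R)) by exact: measurable_itv.
rewrite Rintegral_cst//.
have -> : fine (lam `[0, t]%classic) = t.
  rewrite lebesgue_measure_itv/= lte_fin; case: ltP => [_|h]; first by rewrite oppr0 addr0.
  by apply/eqP; rewrite eq_le t0 h.
by rewrite ler_piMr// ltW.
Qed.

End polynomial_approximation.

(** * Thin domains and boundary layers *)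

Section thin_measure.
Context {R : realType}.
Variables (n : nat) (Omega0 : set 'rV[R]_n) (e : R).
Hypotheses (n0 : (0 < n)%N) (oO : open Omega0) (bO : bounded_set Omega0) (e0 : 0 < e).
Local Notation mu k := (lebesgue_rV k).
Local Notation lam := (@lebesgue_measure R).
Local Notation S := (scaled e Omega0).
Local Notation Om := (thin Omega0 e).

Lemma scaledE : S = (fun x => e^-1 *: x) @^-1` Omega0.
Proof.
apply/seteqP; split => x /=; first by move=> [y Oy <-]; rewrite scalerA mulVf ?gt_eqF// scale1r.
by move=> h; exists (e^-1 *: x) => //; rewrite scalerA divff ?gt_eqF// scale1r.
Qed.

Lemma measurable_base : measurable Omega0. Proof. exact: measurable_open_rV. Qed.

Lemma measure_base_finite : (mu n Omega0 < +oo)%E.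
Proof.
have [M [_ bM]] := bO.
apply: (@bounded_measure_finite _ _ _ (`|M| + 1)); first exact: measurable_base.
by move=> x Ox; apply: bM => //; rewrite (le_lt_trans (ler_norm M))// ltrDl.
Qed.

Lemma measurable_scaled : measurable S.
Proof.
rewrite scaledE -[X in measurable X]setTI; apply: measurable_dilate => //; exact: measurable_base.
Qed.

Lemma measure_scaled (A : set 'rV[R]_n) : measurable A ->
  mu n (scaled e A) = ((e ^+ n)%:E * mu n A)%E.
Proof.
move=> mA; have -> : scaled e A = (fun x => e^-1 *: x) @^-1` A.
  apply/seteqP; split => x /=; first by move=> [y Oy <-]; rewrite scalerA mulVf ?gt_eqF// scale1r.
  by move=> h; exists (e^-1 *: x) => //; rewrite scalerA divff ?gt_eqF// scale1r.
have ei : 0 < e^-1 by rewrite invr_gt0.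
by have -> := lebesgue_rV_dilate ei mA; rewrite exprVn invrK.
Qed.

Definition base_measure : R := fine (mu n S).

Lemma base_measureE : mu n S = base_measure%:E.
Proof.
rewrite /base_measure fineK// ge0_fin_numE// measure_scaled//; last exact: measurable_base.
by rewrite lte_mul_pinfty// ?lee_fin ?exprn_ge0 ?(ltW e0)//; exact: measure_base_finite.
Qed.

Lemma measurable_thin : measurable Om.
Proof.
rewrite (_ : Om = (@xbar R n) @^-1` S `&` (@xlast R n) @^-1` `]0, 1[%classic); last first.
  by apply/seteqP; split => x; rewrite /thin/= in_itv.
apply: measurableI; rewrite -[X in measurable X]setTI.
  by apply: measurable_xbar => //; exact: measurable_scaled.
by apply: measurable_xlast => //; exact: measurable_itv.
Qed.

Lemma thin_snoc (y : 'rV[R]_n) (t : R) : Om (rV_snoc (y, t)) <-> S y /\ 0 < t < 1.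
Proof. by rewrite /thin/= xbar_snoc xlast_snoc. Qed.

(** The hypothesis on every slice keeps the real-valued inner integrals meaningful, an infinite one
    being read as 0. *)
Lemma integral_thin (F : 'rV[R]_n.+1 -> R) :
  (mu n.+1).-integrable Om (EFin \o F) ->
  (forall y, lam.-integrable `]0, 1[ (fun t => (F (rV_snoc (y, t)))%:E)) ->
  (\int[mu n.+1]_(x in Om) F x =
   \int[mu n]_(y in S) (\int[lam]_(t in `]0, 1[) F (rV_snoc (y, t))))%R.
Proof.
move=> iF isl.
have iF' : (mu n.+1).-integrable setT ((EFin \o F) \_ Om).
  exact/(integrable_mkcond _ measurable_thin).
have H := integral_snoc (measurable_int _ iF') iF'.
rewrite /Rintegral integral_mkcond H; apply: (f_equal fine).
rewrite [RHS]integral_mkcond; apply: eq_integral => y _.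
rewrite patchE; case: ifPn => [/set_mem yS|/negP yS].
  rewrite fineK; last exact: integrable_fin_num (isl y).
  rewrite [RHS]integral_mkcond; apply: eq_integral => t _; rewrite !patchE.
  case: ifPn => [/set_mem/thin_snoc[_ h]|/negP h].
    by rewrite mem_set//= in_itv.
  rewrite ifF//; apply/negP => /set_mem; rewrite /= in_itv/= => h'.
  by apply: h; rewrite inE; apply/thin_snoc.
rewrite integral0_eq// => t _; rewrite patchE ifF//; apply/negP => /set_mem/thin_snoc[h _].
by apply: yS; rewrite inE.
Qed.

Lemma ge0_integral_thin (F : 'rV[R]_n.+1 -> \bar R) :
  measurable_fun setT F -> (forall x, 0 <= F x)%E ->
  (\int[mu n.+1]_(x in Om) F x =
   \int[mu n]_(y in S) \int[lam]_(t in `]0%R, 1%R[) F (rV_snoc (y, t)))%E.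
Proof.
move=> mF F0; rewrite integral_mkcond ge0_integral_snoc; last 2 first.
- by apply/(measurable_restrictT _ measurable_thin); exact: measurable_funTS.
- by move=> x; rewrite patchE; case: ifP.
rewrite [RHS]integral_mkcond; apply: eq_integral => y _.
rewrite patchE; case: ifPn => [/set_mem yS|/negP yS].
  rewrite [RHS]integral_mkcond; apply: eq_integral => t _; rewrite !patchE.
  case: ifPn => [/set_mem/thin_snoc[_ h]|/negP h].
    by rewrite mem_set//= in_itv.
  rewrite ifF//; apply/negP => /set_mem; rewrite /= in_itv/= => h'.
  by apply: h; rewrite inE; apply/thin_snoc.
rewrite integral0_eq// => t _; rewrite patchE ifF//; apply/negP => /set_mem/thin_snoc[h _].
by apply: yS; rewrite inE.
Qed.

Lemma ge0_integral_thin_last (h : R -> \bar R) : 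
  measurable_fun setT (h : measurableTypeR R -> \bar R) -> (forall t, 0 <= h t)%E ->
  (\int[mu n.+1]_(x in Om) h (xlast x) =
   base_measure%:E * \int[lam]_(t in `]0%R, 1%R[) h t)%E.
Proof.
move=> mh h0; rewrite ge0_integral_thin//; last first.
  by apply: (measurableT_comp mh); exact: measurable_xlast.
under eq_integral do under eq_integral do rewrite xlast_snoc.
rewrite (_ : (fun _ : 'rV[R]_n => _) = cst (\int[lam]_(t in `]0%R, 1%R[) h t)%E)//.
rewrite integral_cst//; last exact: measurable_scaled.
by rewrite muleC; congr (_ * _)%E; exact: base_measureE.
Qed.

Lemma measure_thin : mu n.+1 Om = base_measure%:E.
Proof.
rewrite -[LHS]mul1e -integral_cst ?(_ : measurable Om); last exact: measurable_thin.
  rewrite (@ge0_integral_thin_last (cst 1%E))// integral_cst//.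
  rewrite mul1e; have l1 : lam (`]0, 1[%classic : set R) = 1%E.
    by rewrite lebesgue_measure_itv/= lte_fin ltr01 -EFinB subr0.
  by apply: etrans (mule1 _); congr (_ * _)%E.
Qed.

End thin_measure.

Section layer.
Context {R : realType}.

Definition layer k (A : set 'rV[R]_k) (h : R) : set 'rV[R]_k :=
  A `&` \bigcup_(y in ~` A) [set x | `|x - y| < h].

Lemma open_layer_cut k (A : set 'rV[R]_k) h :
  open (\bigcup_(y in ~` A) [set x : 'rV[R]_k | `|x - y| < h]).
Proof.
apply: bigcup_open => y _.
apply: (@open_comp _ _ (fun x : 'rV[R]_k => `|x - y|) [set t | t < h]); last exact: open_lt.
move=> x _; apply: (@continuous_comp _ _ _ (fun x : 'rV[R]_k => x - y) Num.norm); last exact: norm_continuous.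
by apply: (@continuousD _ _ _ id (cst (- y))); [exact: cvg_id|exact: cst_continuous].
Qed.

Lemma open_layer k (A : set 'rV[R]_k) h : open A -> open (layer A h).
Proof. by move=> oA; apply: openI => //; exact: open_layer_cut. Qed.

Lemma measurable_layer k (A : set 'rV[R]_k) h : measurable A -> measurable (layer A h).
Proof.
move=> mA; apply: measurableI => //; apply: measurable_open_rV; exact: open_layer_cut.
Qed.

Lemma layer_sub k (A : set 'rV[R]_k) h : layer A h `<=` A. Proof. by move=> x []. Qed.

Lemma layer_le k (A : set 'rV[R]_k) h h' : h <= h' -> layer A h `<=` layer A h'.
Proof. by move=> hh x [Ax [y Ay /= xy]]; split=> //; exists y => //=; exact: lt_le_trans xy hh. Qed.

Lemma measure_open_gt0 k (A : set 'rV[R]_k) : open A -> A !=set0 -> (0 < lebesgue_rV k A)%E.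
Proof.
move=> oA [a Aa]; have /nbhs_ballP[rho /= rho0 H] : nbhs a A by exact: open_nbhs_nbhs.
pose h := rho / 2; have h0 : 0 < h by rewrite divr_gt0.
apply: (@lt_le_trans _ _ (lebesgue_rV k [set x | cube h (x - a)])).
  rewrite measure_shift_set; last exact: measurable_cube.
  by rewrite measure_cube// lte_fin exprn_gt0// mulr_gt0.
rewrite le_measure ?inE.
- by [].
- by apply: (measurable_shift_set (- a)); exact: measurable_cube.
- exact: measurable_open_rV.
move=> x /= /(cube_norm_le (ltW h0)) xh; apply: H; rewrite -ball_normE/= distrC.
by rewrite (le_lt_trans xh)// /h ltr_pdivrMr// ltr_pMr// ltr1n.
Qed.

(** Continuity of the measure from above: the layers of width 1/(i+1) decrease, and their
    intersection is empty because each point of an open set has a ball inside it. *)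
Lemma layer_cvg0 k (A : set 'rV[R]_k) (tau : R) : open A -> (lebesgue_rV k A < +oo)%E ->
  0 < tau -> exists2 s, 0 < s & (lebesgue_rV k (layer A s) <= tau%:E)%E.
Proof.
move=> oA fA tau0; pose F (i : nat) := layer A i.+1%:R^-1.
have mF i : measurable (F i) by apply: measurable_open_rV; exact: open_layer.
have F0 : \bigcap_i F i = set0.
  rewrite -subset0 => x H; have [Ax _] := H 0%N I.
  have /nbhs_ballP[rho /= rho0 B] : nbhs x A by exact: open_nbhs_nbhs.
  have [_ [y Ay /= xy]] := H (Num.truncn rho^-1) I.
  apply: Ay; apply: B; rewrite -ball_normE/=; apply: lt_trans xy _.
  by rewrite invf_plt ?posrE// truncnS_gt.
have := @nonincreasing_cvg_mu _ _ _ (lebesgue_rV k) F _ mF _ _.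
rewrite F0 measure0 => cvgF.
have {}cvgF : lebesgue_rV k \o F @ \oo --> 0%E.
  apply: cvgF.
  - by apply: le_lt_trans fA; rewrite le_measure ?inE//; [exact: measurable_open_rV|exact: layer_sub].
  - exact: measurable0.
  - move=> i j ij; apply/subsetPset/layer_le.
    by rewrite lef_pV2 ?posrE// ler_nat.
have /cvgF : nbhs (0%E : \bar R) [set x | (x < tau%:E)%E].
  by apply: open_nbhs_nbhs; split; [exact: open_ereal_lt_ereal|rewrite /= lte_fin].
move=> [i _ /(_ i (leqnn i))] /= h.
by exists i.+1%:R^-1; rewrite ?invr_gt0// ltW.
Qed.

Section thin_layer.
Variables (n : nat) (Omega0 : set 'rV[R]_n) (e : R).
Hypotheses (n0 : (0 < n)%N) (oO : open Omega0) (bO : bounded_set Omega0) (e0 : 0 < e).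
Local Notation Om := (thin Omega0 e).

Lemma xbar_norm (x : 'rV[R]_n.+1) (h : R) : 0 < h -> `|x| < h -> `|xbar x| < h /\ `|xlast x| < h.
Proof.
move=> h0 /(norm_ltP _ h0) H; split; last exact: H.
by apply/norm_ltP => // i; rewrite mxE; exact: H.
Qed.

Let ends h : set 'rV[R]_n.+1 := [set x | xlast x < h \/ 1 - h < xlast x].

Lemma measure_thin_ends h : 0 < h ->
  (lebesgue_rV n.+1 (Om `&` ends h) <= (2 * h)%:E * (base_measure Omega0 e)%:E)%E.
Proof.
move=> h0; pose E : set (measurableTypeR R) := `]-oo, h[ `|` `]1 - h, +oo[.
have mE : measurable E by apply: measurableU; exact: measurable_itv.
have endsE : ends h = (@xlast R n) @^-1` E.
  by apply/seteqP; split => x; rewrite /ends /E /= !in_itv/= andbT.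
have mends : measurable (ends h).
  by rewrite endsE -[X in measurable X]setTI; exact: measurable_xlast.
have mO := measurable_thin oO e0.
have -> : lebesgue_rV n.+1 (Om `&` ends h) = (\int[lebesgue_rV n.+1]_(x in Om) (\1_E (xlast x))%:E)%E.
  transitivity (\int[lebesgue_rV n.+1]_(x in Om) (\1_(ends h) x)%:E)%E.
    by rewrite integral_indic// setIC.
  by apply: eq_integral => x _; rewrite endsE.
rewrite (@ge0_integral_thin_last R n Omega0 e oO bO e0 (fun t => (\1_E t)%:E)); last 2 first.
- by apply/measurable_EFinP; exact: measurable_indic.
- by move=> t; rewrite lee_fin.
rewrite muleC; apply: lee_pmul => //.
- by apply: integral_ge0 => t _; rewrite lee_fin.
- by rewrite lee_fin fine_ge0.
rewrite integral_indic//.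
pose A1 : set (measurableTypeR R) := `]0, h[%classic.
pose A2 : set (measurableTypeR R) := `]1 - h, 1[%classic.
have mA1 : measurable A1 by exact: measurable_itv.
have mA2 : measurable A2 by exact: measurable_itv.
have mA : measurable (E `&` `]0, 1[%classic) by apply: measurableI => //; exact: measurable_itv.
have l1 : lebesgue_measure A1 = h%:E.
  by rewrite lebesgue_measure_itv/= lte_fin h0 -EFinB subr0.
have l2 : lebesgue_measure A2 = h%:E.
  rewrite lebesgue_measure_itv/= lte_fin ltrBlDr ltrDl h0 -EFinB; congr (_%:E); ring.
have EA : E `&` `]0, 1[%classic `<=` A1 `|` A2.
  move=> t [+ +]; rewrite /E /A1 /A2 /= !in_itv/= andbT => -[c|c] /andP[p q].
    by left; rewrite p c.
  by right; rewrite c q.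
apply: (@le_trans _ _ (lebesgue_measure (A1 `|` A2))).
  by rewrite le_measure ?inE//; exact: measurableU.
apply: le_trans (measureU2 _ mA1 mA2) _.
by rewrite [X in (X + _)%E]l1 [X in (_ + X)%E]l2 -EFinD lee_fin; lra.
Qed.

(** The nearby outside point leaves the cylinder either through an end or through the side; in the
    second case, rescaling the base by 1/e turns the width h into h / e. *)
Lemma layer_thin h : 0 < h -> layer Om h `<=` thin (layer Omega0 (h / e)) e `|` (Om `&` ends h).
Proof.
move=> h0 x [Ox [y Oy /= xy]]; have [b l] := xbar_norm h0 xy.
have [[[w Ow wx] xt]] : (scaled e Omega0 (xbar x) /\ 0 < xlast x < 1) /\ True by [].
move=> _; have /andP[x0 x1] := xt.
have yl : xlast (x - y) = xlast x - xlast y by rewrite /xlast !mxE.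
rewrite yl in l; have yb : xbar (x - y) = xbar x - xbar y by apply/rowP => i; rewrite !mxE.
rewrite yb in b.
have [yt|yt] := boolP (0 < xlast y < 1); last first.
  right; split=> //; rewrite /ends /=; move: l; rewrite ltr_norml => /andP[l1 l2].
  by move: yt; rewrite negb_and -!leNgt => /orP[y0|y1]; [left|right]; lra.
left; split=> //; exists w => //; split => //; exists (e^-1 *: xbar y).
  move=> H; apply: Oy; split => //; exists (e^-1 *: xbar y) => //.
  by rewrite scalerA divff ?gt_eqF// scale1r.
have -> : w = e^-1 *: xbar x by rewrite -wx scalerA mulVf ?gt_eqF// scale1r.
rewrite /= -scalerBr normrZ gtr0_norm ?invr_gt0// mulrC.
by rewrite ltr_pM2r ?invr_gt0.
Qed.

(** The width [s] refers to the fixed base and the condition h <= s e to the thin domain. With h = 4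
    delta this is where delta / epsilon -> 0 enters. *)
Lemma measure_layer_thin h s sigma : 0 < h -> h <= s * e -> 0 < s -> 
  (lebesgue_rV n (layer Omega0 s) <= (sigma * fine (lebesgue_rV n Omega0))%:E)%E ->
  fine (lebesgue_rV n.+1 (layer Om h)) <= (sigma + 2 * h) * base_measure Omega0 e.
Proof.
move=> h0 hs s0 Ls.
set L := layer Omega0 (h / e); have oL : open L by exact: open_layer.
have bL : bounded_set L.
  by have [M [Mr bM]] := bO; exists M; split => // y My x /layer_sub; exact: bM.
have mO := measurable_thin oO e0; have mL := measurable_thin oL e0.
have LL : (lebesgue_rV n L <= (sigma * fine (lebesgue_rV n Omega0))%:E)%E.
  apply: le_trans Ls; rewrite le_measure ?inE.
  - by [].
  - exact: measurable_open_rV.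
  - by apply: measurable_open_rV; exact: open_layer.
  by apply: layer_le; rewrite ler_pdivrMr.
have mE : measurable (Om `&` ends h).
  apply: measurableI => //; rewrite (_ : ends h = (@xlast R n) @^-1` (`]-oo, h[ `|` `]1 - h, +oo[ : set (measurableTypeR R))).
    by rewrite -[X in measurable X]setTI; apply: measurable_xlast => //; apply: measurableU; exact: measurable_itv.
  by apply/seteqP; split => x; rewrite /ends /= !in_itv/= andbT.
have H : (lebesgue_rV n.+1 (layer Om h) <= ((sigma + 2 * h) * base_measure Omega0 e)%:E)%E.
  apply: (@le_trans _ _ (lebesgue_rV n.+1 (thin L e) + lebesgue_rV n.+1 (Om `&` ends h))%E).
    apply: (@le_trans _ _ (lebesgue_rV n.+1 (thin L e `|` (Om `&` ends h)))); last exact: measureU2.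
    rewrite le_measure ?inE//; [exact: measurable_layer|exact: measurableU|exact: layer_thin].
  rewrite mulrDl EFinD; apply: leeD; last by rewrite EFinM; exact: measure_thin_ends.
  rewrite measure_thin// -base_measureE// measure_scaled//; last exact: measurable_open_rV.
  have mB : measurable Omega0 by exact: measurable_open_rV.
  apply: (@le_trans _ _ ((e ^+ n)%:E * (sigma * fine (lebesgue_rV n Omega0))%:E)%E).
    by apply: lee_wpmul2l => //; rewrite lee_fin exprn_ge0// ltW.
  rewrite -EFinM lee_fin mulrCA /base_measure measure_scaled// fineM//.
  by rewrite ge0_fin_numE//; exact: measure_base_finite.
by have := fine_le _ _ H; apply => //; rewrite ge0_fin_numE// (le_lt_trans H)// ltry.
Qed.

End thin_layer.
End layer.

(** * The corrector on the domain *)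

Section fine_measure.
Context d (T : measurableType d) {R : realType}.
Variable mu : {measure set T -> \bar R}.

Lemma fine_measure_ge0 (A : set T) : 0 <= fine (mu A).
Proof. exact: fine_ge0. Qed.

Lemma fine_measure_le (A B : set T) : measurable A -> measurable B -> A `<=` B ->
  (mu B < +oo)%E -> (mu A < +oo)%E /\ fine (mu A) <= fine (mu B).
Proof.
move=> mA mB AB fB; have H : (mu A <= mu B)%E by rewrite le_measure ?inE.
have fA : (mu A < +oo)%E := le_lt_trans H fB.
by split=> //; apply: fine_le => //; rewrite ge0_fin_numE.
Qed.

Lemma fine_measureD (A B : set T) : measurable A -> measurable B -> B `<=` A ->
  (mu A < +oo)%E -> fine (mu (A `\` B)) = fine (mu A) - fine (mu B).
Proof.
move=> mA mB BA fA; have [fB _] := fine_measure_le mB mA BA fA.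
by rewrite measureD// (setIidr BA) fineB// ge0_fin_numE.
Qed.

End fine_measure.

Lemma measure_tilesE (R : realType) n (delta : R) (ctr : seq 'rV[R]_n) (S : set 'rV[R]_n) :
  uniq ctr -> (forall c c' x, c \in ctr -> c' \in ctr ->
    cube delta (x - c) -> cube delta (x - c') -> c = c') ->
  measurable S -> S `<=` cube delta -> (lebesgue_rV n (tiles ctr S) < +oo)%E ->
  fine (lebesgue_rV n (tiles ctr S)) = (size ctr)%:R * fine (lebesgue_rV n S).
Proof.
move=> uctr disj mS SQ fT; have mT := measurable_tiles ctr mS.
have i1 : (lebesgue_rV n).-integrable (tiles ctr S) (EFin \o cst (1 : R)).
  by apply: (bounded_integrable (C := 1) mT fT) => // x _; rewrite normr1.
have H := Rintegral_tiles uctr disj mS SQ (measurable_cst (1 : R)) i1.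
have e1 : (\int[lebesgue_rV n]_(x in tiles ctr S) cst (1 : R) x = fine (lebesgue_rV n (tiles ctr S)))%R.
  by rewrite Rintegral_cst// mul1r.
have e2 : (\int[lebesgue_rV n]_(x in S) (1 : R) = fine (lebesgue_rV n S))%R.
  by rewrite Rintegral_cst// mul1r.
rewrite -e1 H -e2; elim: (ctr) => [|c s IH]; first by rewrite big_nil mul0r.
by rewrite big_cons IH /= -natr1 mulrDl mul1r addrC.
Qed.

Section ratio_arithmetic.
Context {R : realType}.
Implicit Types t o : R.

Lemma eqW t o : t = o -> t <= o. Proof. by move=> ->. Qed.

Lemma count_arithmetic (t s o t' b k : R) : t = k * s -> t' = k * b -> t' <= o -> 0 <= s ->
  t * b <= o * s.
Proof. by move=> -> -> h s0; rewrite mulrAC; apply: ler_wpM2r. Qed.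

Lemma ratio_arithmetic (t o bd ba d b k : R) : bd = d * b -> ba <= k * d * b ->
  0 < d -> 0 < b -> 0 <= o -> t * bd <= o * ba -> t <= k * o.
Proof.
move=> -> Ha d0 b0 o0 h; rewrite -(ler_pM2r (mulr_gt0 d0 b0)); apply: le_trans h _.
by apply: le_trans (ler_wpM2l o0 Ha) _; rewrite le_eqVlt; apply/orP; left; apply/eqP; ring.
Qed.

End ratio_arithmetic.

Section centers.
Context {R : realType}.
Variables (m : nat) (Om : set 'rV[R]_m.+2) (delta : R).
Hypotheses (oO : open Om) (bO : bounded_set Om) (neO : Om !=set0) (d0 : 0 < delta).
Local Notation mu := (lebesgue_rV m.+2).

Lemma centers_lattice c : centers Om delta c -> lattice delta c.
Proof. by case. Qed.

Lemma center_ball c x : centers Om delta c -> enorm (x - c) <= delta -> (Om x <-> Om c).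
Proof. by move=> [_ h]; exact: edist_bdry_iff. Qed.

(** The sup-norm ball of radius 2 delta contains the Euclidean one, so the boundary is at distance
    at least 2 delta > delta. *)
Lemma center_of_ball c : lattice delta c -> (forall y, `|y - c| <= 2 * delta -> Om y) ->
  centers Om delta c /\ Om c.
Proof.
move=> lc H; split; last by apply: H; rewrite subrr normr0 mulr_ge0// ltW.
split=> //; apply: (@edist_bdry_gt _ _ _ _ _ (2 * delta)) => //.
- exact: bdry_nonempty.
- by rewrite ltr_pMl// ltr1n.
- by move=> y yc; apply: H; exact: le_trans (norm_le_enorm _) yc.
Qed.

Lemma center_seq : exists ctr : seq 'rV[R]_m.+2,
  uniq ctr /\ forall c, c \in ctr <-> centers Om delta c /\ Om c.
Proof.
have [M [_ bM]] := bO.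
have [s [us sP]] := lattice_seq d0 (centers Om delta `&` Om) (`|M| + 1).
exists s; split => // c; split=> [/sP[_ [] //]|[cc Oc]]; apply/sP; split => //.
  exact: centers_lattice.
by apply: bM => //; rewrite (le_lt_trans (ler_norm M))// ltrDl.
Qed.

Variable ctr : seq 'rV[R]_m.+2.
Hypotheses (uctr : uniq ctr) (ctrP : forall c, c \in ctr <-> centers Om delta c /\ Om c).

Lemma center_disjoint c c' x : c \in ctr -> c' \in ctr ->
  cube delta (x - c) -> cube delta (x - c') -> c = c'.
Proof.
by move=> /ctrP[cc _] /ctrP[cc' _]; apply: lattice_separated => //; exact: centers_lattice.
Qed.

Lemma center_ball_sub c x : c \in ctr -> enorm (x - c) < delta -> Om x.
Proof. by move=> /ctrP[cc Oc] xc; apply/(center_ball cc) => //; exact: ltW. Qed.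

Definition inner_centers : seq 'rV[R]_m.+2 :=
  [seq c <- ctr | `[< forall y, `|y - c| <= 2 * delta -> Om y >]].

Lemma inner_centers_sub c y : c \in inner_centers -> `|y - c| <= 2 * delta -> Om y.
Proof. by rewrite mem_filter => /andP[/asboolP H _]; exact: H. Qed.

(** A point outside [Om] within 2 delta of c is within 3 delta of x; the width 4 delta leaves the
    strict inequality in the definition of [layer]. *)
Let near_out c x : `|x - c| <= delta -> Om x ->
  ~ (forall y, `|y - c| <= 2 * delta -> Om y) -> layer Om (4 * delta) x.
Proof.
move=> xc Ox /existsNP[y /not_implyP[yc Oy]]; split => //; exists y => //=.
rewrite -(subrK c x) -addrA (le_lt_trans (ler_normD _ _))//.
by rewrite distrC in yc; rewrite (le_lt_trans (lerD xc yc))//; move: d0; lra.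
Qed.

Lemma layer_cube x : Om x -> ~ tiles inner_centers (cube delta) x -> layer Om (4 * delta) x.
Proof.
move=> Ox nT; have [c lc xc] := lattice_cover d0 x.
apply: (near_out (c := c)) => //; first exact: cube_norm_le (ltW d0) xc.
move=> H; apply: nT; apply/tilesP; exists c => //; rewrite mem_filter; apply/andP; split.
  exact/asboolP.
by apply/ctrP; exact: center_of_ball.
Qed.

Lemma layer_ball c x : c \in ctr -> c \notin inner_centers -> enorm (x - c) < delta ->
  layer Om (4 * delta) x.
Proof.
move=> cc cN xc; apply: (near_out (c := c)).
- exact: le_trans (norm_le_enorm _) (ltW xc).
- exact: center_ball_sub xc.
- by move=> H; move: cN; rewrite mem_filter cc andbT => /asboolP.
Qed.

Variable mO : measurable Om.

Lemma Om_finite : (mu Om < +oo)%E.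
Proof.
have [M [_ bM]] := bO; apply: (@bounded_measure_finite _ _ _ (`|M| + 1)) => //.
by move=> x Ox; apply: bM => //; rewrite (le_lt_trans (ler_norm M))// ltrDl.
Qed.

Lemma tiles_sub_Om S : S `<=` eball (0 : 'rV[R]_m.+2) delta -> tiles ctr S `<=` Om.
Proof.
move=> SB x /tilesP[c cc Sx]; apply: (center_ball_sub cc).
by have := SB _ Sx; rewrite eball0E.
Qed.

Let tilesE S : measurable S -> S `<=` eball (0 : 'rV[R]_m.+2) delta ->
  fine (mu (tiles ctr S)) = (size ctr)%:R * fine (mu S).
Proof.
move=> mS SB; apply: (measure_tilesE uctr center_disjoint mS).
  by apply: subset_trans SB _; exact: eball_sub_cube.
apply: le_lt_trans Om_finite; rewrite le_measure ?inE//.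
  exact: measurable_tiles.
exact: tiles_sub_Om.
Qed.

(** Both sides count cells: the disjoint balls of radius [delta] fit into the domain, which bounds
    the number of centres by a quotient of volumes. *)
Lemma measure_tiles_le S : measurable S -> S `<=` eball (0 : 'rV[R]_m.+2) delta ->
  fine (mu (tiles ctr S)) * fine (mu (eball (0 : 'rV[R]_m.+2) delta)) <=
  fine (mu Om) * fine (mu S).
Proof.
move=> mS SB; have mB := measurable_eball (0 : 'rV[R]_m.+2) delta.
have TO : tiles ctr (eball (0 : 'rV[R]_m.+2) delta) `<=` Om by exact: tiles_sub_Om.
have mT := measurable_tiles ctr mB.
have [_ Hf] := @fine_measure_le _ _ _ mu _ _ mT mO TO Om_finite.
have e1 := tilesE mS SB; have e2 := tilesE mB (@subset_refl _ _).
have s0 := @fine_measure_ge0 _ _ _ mu S.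
exact: (count_arithmetic e1 e2 Hf s0).
Qed.

Lemma ball1_gt0 : 0 < fine (mu (eball (0 : 'rV[R]_m.+2) 1)).
Proof.
rewrite fine_gt0//; apply/andP; split; last exact: eball0_finite.
apply: measure_open_gt0; first exact: open_eball.
exists 0; rewrite /eball/= subrr -(scale0r (0 : 'rV[R]_m.+2)) enormZ normr0 mul0r.
exact: ltr01.
Qed.

Lemma measure_tiles_ball (kappa : R) : 0 < kappa <= 1 ->
  fine (mu (tiles ctr (eball (0 : 'rV[R]_m.+2) (kappa * delta)))) <= kappa ^+ m.+2 * fine (mu Om).
Proof.
move=> /andP[k0 k1]; have kd : 0 < kappa * delta by rewrite mulr_gt0.
have SB : eball (0 : 'rV[R]_m.+2) (kappa * delta) `<=` eball (0 : 'rV[R]_m.+2) delta.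
  by move=> x; rewrite !eball0E/= => /lt_le_trans; apply; rewrite ger_pMl.
have h := measure_tiles_le (measurable_eball (0 : 'rV[R]_m.+2) (kappa * delta)) SB.
have dN : 0 < delta ^+ m.+2 by rewrite exprn_gt0.
have e1 := @fine_measure_eball R m.+2 delta d0.
have e2 := @fine_measure_eball R m.+2 _ kd; rewrite exprMn in e2.
have o0 := @fine_measure_ge0 _ _ _ mu Om.
exact: (ratio_arithmetic e1 (eqW e2) dN ball1_gt0 o0 h).
Qed.

(** The decisive factor is r^2: it cancels the square of the factor 1/r in [err_annulus], and the
    other factor tends to 0 with eta. *)
Lemma measure_tiles_annulus (eta : R) : (0 < m)%N -> 0 < eta -> eta < 4^-1 ->
  hole_radius (n := m.+1) delta / (1 - 2 * eta) < delta / 2 ->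
  fine (mu (tiles ctr (@annulus R m delta eta))) <=
  (hole_radius (n := m.+1) delta) ^+ 2 * ((1 - 2 * eta) ^- 2 ^+ m.+2 - 1) * fine (mu Om).
Proof.
move=> m0 eta0 eta4; set r := hole_radius _ => r1d.
have r0 : 0 < r by exact: powR_gt0.
have et0 : 0 < 1 - 2 * eta by lra.
have et1 : 2^-1 < 1 - 2 * eta by move: eta4; lra.
have e2 : 1 < (1 - 2 * eta)^-1 by rewrite invf_gt1//; lra.
(* A radius strictly above [r1], so that the closed annulus fits into an open ball. It stays below
   [delta] because r1 < delta / 2 and 1 / (1 - 2 eta) <= 2. *)
pose rho := r * (1 - 2 * eta) ^- 2.
have rho1 : r / (1 - 2 * eta) < rho.
  by rewrite /rho expr2 invfM mulrA ltr_pMr// divr_gt0.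
have rho0 : 0 < rho by rewrite mulr_gt0// invr_gt0 exprn_gt0.
have rhod : rho <= delta.
  rewrite /rho expr2 invfM mulrA ler_pdivrMr// (le_trans (ltW r1d))//.
  by rewrite ler_pM2l//; exact: ltW.
have mA := @measurable_annulus R m delta eta.
have AB : @annulus R m delta eta `<=` eball (0 : 'rV[R]_m.+2) delta.
  move=> y /andP[_ yr]; rewrite eball0E/= (le_lt_trans yr)// (lt_trans r1d)//.
  by rewrite gtr_pMr// invf_lt1// ltr1n.
have h := measure_tiles_le mA AB.
have mr := measurable_eball (0 : 'rV[R]_m.+2) r.
have mrho := measurable_eball (0 : 'rV[R]_m.+2) rho.
have rrho : eball (0 : 'rV[R]_m.+2) r `<=` eball (0 : 'rV[R]_m.+2) rho.
  move=> x; rewrite !eball0E/= => /lt_trans; apply; apply: lt_trans rho1.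
  by rewrite ltr_pMr.
have Hf : fine (mu (@annulus R m delta eta)) <=
    (rho ^+ m.+2 - r ^+ m.+2) * fine (mu (eball (0 : 'rV[R]_m.+2) 1)).
  have mD := measurableD mrho mr.
  have AD : @annulus R m delta eta `<=` eball (0 : 'rV[R]_m.+2) rho `\` eball (0 : 'rV[R]_m.+2) r.
    move=> y /andP[ry yr]; rewrite !eball0E/=; split; first exact: le_lt_trans yr rho1.
    by apply/negP; rewrite -leNgt.
  have DS : eball (0 : 'rV[R]_m.+2) rho `\` eball (0 : 'rV[R]_m.+2) r `<=` eball (0 : 'rV[R]_m.+2) rho.
    by move=> y [].
  have [fD _] := @fine_measure_le _ _ _ mu _ _ mD mrho DS (eball0_finite rho).
  have [_ H] := @fine_measure_le _ _ _ mu _ _ mA mD AD fD.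
  have E := @fine_measureD _ _ _ mu _ _ mrho mr rrho (eball0_finite rho).
  have e3 := @fine_measure_eball R m.+2 _ rho0; have e4 := @fine_measure_eball R m.+2 _ r0.
  by apply: (le_trans H); rewrite mulrBl -e3 -e4; exact: (eqW E).
(* The critical scaling once more: relative to its cell, a hole has volume of order r^2. *)
have rN : r ^+ m.+2 = r ^+ 2 * delta ^+ m.+2.
  have -> : r ^+ m.+2 = r ^+ 2 * r ^+ m by rewrite -exprD.
  by congr (_ * _); exact: hole_radius_expr.
have rhoN : rho ^+ m.+2 = r ^+ m.+2 * (1 - 2 * eta) ^- 2 ^+ m.+2 by exact: exprMn.
have dN : 0 < delta ^+ m.+2 by rewrite exprn_gt0.
have o0 := @fine_measure_ge0 _ _ _ mu Om.
have e1 := @fine_measure_eball R m.+2 delta d0.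
have E : rho ^+ m.+2 - r ^+ m.+2 = r ^+ 2 * ((1 - 2 * eta) ^- 2 ^+ m.+2 - 1) * delta ^+ m.+2.
  rewrite rhoN rN; generalize (r ^+ 2) ((1 - 2 * eta) ^- 2 ^+ m.+2) (delta ^+ m.+2) => a b c; ring.
rewrite E in Hf.
exact: (ratio_arithmetic e1 Hf dN ball1_gt0 o0 h).
Qed.

End centers.

Section test_functions.
Context {R : realType} {n : nat}.
Implicit Types (f : 'rV[R]_n -> R) (T : set 'rV[R]_n).

Lemma compact_closed_nball (M : R) : compact [set x : 'rV[R]_n | `|x| <= M].
Proof.
apply: bounded_closed_compact.
  by exists M; split => [|y My x /= xM]; [exact: num_real|exact: le_trans xM (ltW My)].
apply: (@closed_comp _ _ (fun x : 'rV[R]_n => `|x|) [set t | t <= M]); last exact: closed_le.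
by move=> x _; exact: norm_continuous.
Qed.

Lemma test_fun_intro T f (M : R) : (forall k, Ck_on k setT f) ->
  (forall x, M <= `|x| -> f x = 0) ->
  (forall x, T x -> \forall y \near x, f y = 0) -> test_fun (~` T) f.
Proof.
move=> Cf fM fT; split; first exact/Cinfty_Ck_on.
  have cl : closed [set x : 'rV[R]_n | `|x| <= M].
    apply: (@closed_comp _ _ (fun x : 'rV[R]_n => `|x|) [set t | t <= M]); last exact: closed_le.
    by move=> x _; exact: norm_continuous.
  have sub : closure [set x | f x != 0] `<=` [set x : 'rV[R]_n | `|x| <= M].
    rewrite [X in _ `<=` X](closure_id _).1//; apply: closureS => x /= fx.
    by rewrite leNgt; apply/negP => /ltW/fM fx0; rewrite fx0 eqxx in fx.
  have cc : closed (closure [set x | f x != 0]) by exact: closed_closure.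
  have cM := @compact_closed_nball M.
  by apply: (@subclosed_compact _ _ [set x : 'rV[R]_n | `|x| <= M]).
move=> x cx Tx; have [y [/= fy0 fy1]] := cx _ (fT x Tx).
by rewrite fy1 eqxx in fy0.
Qed.

Lemma test_fun_elim T f : test_fun (~` T) f ->
  [/\ forall k, Ck_on k setT f, exists M, bsupp M f,
      (forall x, T x -> f x = 0) & (forall x k, T x -> partial k f x = 0)].
Proof.
move=> [/Cinfty_Ck_on Cf /compact_bounded[M [_ bM]] sT].
have z x : T x -> \forall y \near x, 0 = f y.
  move=> Tx; have nc : ~ closure [set x | f x != 0] x by move=> /sT.
  have o : open (~` closure [set x | f x != 0]) by rewrite openC; exact: closed_closure.
  have : nbhs x (~` closure [set x | f x != 0]) by exact: open_nbhs_nbhs.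
  apply: filterS => y ny; apply/esym/eqP/negPn/negP => fy; apply: ny.
  exact: subset_closure.
split => //.
- exists (`|M| + 2) => x xM; apply/eqP/negPn/negP => fx.
  have M1 : M < `|M| + 1 by rewrite (le_lt_trans (ler_norm M))// ltrDl.
  have cx : closure [set x | f x != 0] x by exact: subset_closure.
  have := bM _ M1 x cx; rewrite /= => h.
  by have := le_trans xM h; rewrite lerD2l; lra.
- by move=> x /z/nbhs_singleton.
- by move=> x k /z h; rewrite /partial -(@near_eq_derive _ _ R (cst 0) f x _ h) derive_cst.
Qed.

End test_functions.

Section corrector.
Context {R : realType}.
Variables (m : nat) (Om : set 'rV[R]_m.+2) (delta eta rho : R) (ctr ctrW : seq 'rV[R]_m.+2)
  (v : 'rV[R]_m.+2 -> R).
Local Notation r := (@hole_radius R m.+1 delta).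
Local Notation r1 := (r / (1 - 2 * eta)).
Hypotheses (m0 : (0 < m)%N) (d0 : 0 < delta) (eta0 : 0 < eta) (eta4 : eta < 4^-1).
Hypotheses (r1d : r1 < delta / 2) (rho0 : 0 < rho).
Hypotheses (oO : open Om) (Orho : forall x, Om x -> enorm x <= rho).
Hypotheses (uctr : uniq ctr) (ctrP : forall c, c \in ctr <-> centers Om delta c /\ Om c).
Hypotheses (uctrW : uniq ctrW)
  (ctrWP : forall c, c \in ctrW <-> centers Om delta c /\ `|c| <= 2 * rho + delta).
Hypothesis Cv : forall k, Ck_on k setT v.

(* The cutoff only makes the corrector compactly supported, as [test_fun] requires: it is 1 on
   [Om], where [ctrW] and [ctr] give the same bumps. *)
Definition cutoff (x : 'rV[R]_m.+2) : R := 1 - smooth_step (enorm x ^+ 2 / rho ^+ 2).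

(** [ctrW] lists all elements of [centers] in a large ball, including those outside the domain: an
    admissible test function must vanish near those holes as well. *)
Definition corrector (x : 'rV[R]_m.+2) : R :=
  cutoff x * ((1 - bumps delta eta ctrW x) * v x).

Lemma cutoff1 x : enorm x <= rho -> cutoff x = 1.
Proof.
move=> xr; rewrite /cutoff smooth_step0 ?subr0// ler_pdivrMr ?exprn_gt0// mul1r.
by rewrite lerXn2r ?nnegrE ?enorm_ge0 ?(ltW rho0).
Qed.

Lemma cutoff0 x : 2 * rho <= `|x| -> cutoff x = 0.
Proof.
move=> xr; rewrite /cutoff smooth_step1 ?subrr// ler_pdivlMr ?exprn_gt0//.
apply: (@le_trans _ _ ((2 * rho) ^+ 2)).
  by rewrite exprMn ler_wpM2r ?exprn_ge0 ?(ltW rho0)//; lra.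
rewrite lerXn2r ?nnegrE ?enorm_ge0 ?mulr_ge0 ?(ltW rho0)//.
exact: le_trans xr (norm_le_enorm x).
Qed.

Lemma Ck_on_corrector k : Ck_on k setT corrector.
Proof.
have o := @openT 'rV[R]_m.+2; apply: Ck_onM => //; last first.
  apply: Ck_onM => //; apply: Ck_onB => //; first exact: Ck_on_cst.
  exact: Ck_on_bumps.
apply: Ck_onB => //; first exact: Ck_on_cst.
apply: (@Ck_on_comp R _ k setT setT smooth_step (fun x : 'rV[R]_m.+2 => enorm x ^+ 2 / rho ^+ 2)) => //.
- exact: openT.
- exact: Ck_on_smooth_step.
- by apply: Ck_onM => //; [exact: Ck_on_sqr_enorm|exact: Ck_on_cst].
Qed.

Lemma disjointW c c' x : c \in ctrW -> c' \in ctrW ->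
  cube delta (x - c) -> cube delta (x - c') -> c = c'.
Proof.
by move=> /ctrWP[cc _] /ctrWP[cc' _]; exact: (lattice_separated d0 (centers_lattice cc) (centers_lattice cc')).
Qed.

Lemma corrector_test_fun : test_fun (~` holes Om delta) corrector.
Proof.
have [r' rr' core] := @bump_core R m delta eta m0 d0 eta0 eta4 r1d.
pose s := Num.min r' delta.
have rs : r < s.
  rewrite lt_min rr'/=; apply: lt_trans (_ : r1 < delta).
    by rewrite ltr_pdivlMr ?gtr_pMr ?powR_gt0//; move: eta0 eta4; lra.
  by apply: lt_trans r1d _; rewrite gtr_pMr// invf_lt1// ltr1n.
apply: (@test_fun_intro _ _ _ _ (2 * rho)); first exact: Ck_on_corrector.
  by move=> x xr; rewrite /corrector cutoff0// mul0r.
move=> x [c cc]; rewrite /closed_eball/= => xc.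
have : \forall y \near x, eball c s y.
  by apply: open_nbhs_nbhs; split; [exact: open_eball|exact: le_lt_trans rs].
apply: filterS => y; rewrite /eball/= lt_min => /andP[yr' yd].
(* A hole of [ctrW] is covered by the core of its own bump. A more distant centre has its cell ball
   in the region where the cutoff vanishes. *)
have [cM|cM] := leP `|c| (2 * rho + delta).
  have cW : c \in ctrW by apply/ctrWP.
  rewrite /corrector -(subrK c y) bumps_cell//; first by rewrite core ?subrr ?mul0r ?mulr0// ltW.
  exact: disjointW.
rewrite /corrector cutoff0 ?mul0r//.
have : `|c| <= `|y| + `|y - c| by rewrite -{1}(subKr y c) (le_trans (ler_normB _ _)).
have := le_lt_trans (norm_le_enorm (y - c)) yd; move: cM; lra.
Qed.

(** By [center_ball], the cell ball of a centre outside the domain contains no point of the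
    domain. *)
Lemma bumps_eq x : Om x -> bumps delta eta ctrW x = bumps delta eta ctr x.
Proof.
move=> Ox; have disj := center_disjoint d0 ctrP.
have [[c cc xc]|H] := pselect (exists2 c, c \in ctr & enorm (x - c) < delta).
  have [cc' Oc] := (ctrP c).1 cc.
  have cW : c \in ctrW.
    apply/ctrWP; split => //; have := Orho Oc; have := norm_le_enorm c.
    by move: rho0 d0; lra.
  by rewrite -(subrK c x) !bumps_cell//; exact: disjointW.
have far c : c \in ctr -> delta <= enorm (x - c).
  by move=> cc; rewrite leNgt; apply/negP => xc; apply: H; exists c.
have farW c : c \in ctrW -> delta <= enorm (x - c).
  move=> /ctrWP[cc _]; rewrite leNgt; apply/negP => xc; apply: H; exists c => //.
  by apply/ctrP; split=> //; apply/(center_ball oO cc (ltW xc)).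
have [-> _] : bumps delta eta ctrW x = 0 /\ forall k, partial k (bumps delta eta ctrW) x = 0.
  exact: bumps_out.
by have [-> _] : bumps delta eta ctr x = 0 /\ forall k, partial k (bumps delta eta ctr) x = 0
  by exact: bumps_out.
Qed.

Lemma correctorE x : Om x -> corrector x = (1 - bumps delta eta ctr x) * v x.
Proof. by move=> Ox; rewrite /corrector cutoff1 ?mul1r ?bumps_eq// Orho. Qed.

Lemma partial_corrector k x : Om x ->
  partial k corrector x =
  (1 - bumps delta eta ctr x) * partial k v x - partial k (bumps delta eta ctr) x * v x.
Proof.
move=> Ox; pose f x := (1 - bumps delta eta ctr x) * v x.
have B1 : C1 (bumps delta eta ctr) by exact: Ck_on_bumps.
have u1 : C1 (fun x => 1 - bumps delta eta ctr x).
  by apply: Ck_onB; [exact: openT|exact: Ck_on_cst|exact: B1].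
have -> : partial k corrector x = partial k f x.
  apply: near_eq_derive; have : \forall y \near x, Om y by exact: open_nbhs_nbhs.
  by apply: filterS => y; exact: correctorE.
rewrite partialM//; last exact: Cv.
congr (_ + _); rewrite -mulNr; congr (_ * _).
have [_] := is_deriveB (is_derive_cst (1 : R) x (delta_mx 0 k)) (C1_is_derive x (delta_mx 0 k) B1).
by rewrite /partial sub0r.
Qed.

End corrector.

(** * Estimates relative to the volume of the domain *)

Section small_sets.
Context d (T : measurableType d) {R : realType}.
Variables (mu : {measure set T -> \bar R}) (Om : set T) (alpha : R).
Hypotheses (mO : measurable Om) (fO : (mu Om < +oo)%E) (alpha0 : 0 <= alpha)
  (alphaE : alpha ^+ 2 * fine (mu Om) = 1).

(** Cauchy-Schwarz on [D]: the normalisation of [alpha] makes alpha |D|^(1/2) at most [t]. Every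
    smallness of a set enters through the square root of its relative volume. *)
Lemma small_set_integral (D : set T) (g : T -> R) (t : R) : measurable D -> D `<=` Om ->
  L2 mu Om g -> 0 <= t -> fine (mu D) <= t ^+ 2 * fine (mu Om) ->
  alpha * (\int[mu]_(x in D) `|g x|)%R <= t * nrm mu Om g.
Proof.
move=> mD DO g2 t0 Dt; have [gD gnD] := nrm_subset mD mO DO g2.
have [fD _] := fine_measure_le mD mO DO fO.
have L1 : L2 mu D (fun=> 1 : R).
  by apply: (@bounded_L2 _ _ _ mu D mD _ 1) => //; move=> x _; rewrite normr1.
have gA : L2 mu D (fun x => `|g x|).
  case: gD => mg ig; split; first exact: measurableT_comp.
  by apply: eq_integrable ig => // x _; rewrite real_normK ?num_real.
have nA : nrm mu D (fun x => `|g x|) = nrm mu D g.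
  by congr Num.sqrt; apply: eq_Rintegral => x _; rewrite real_normK ?num_real.
have := L2_CauchySchwarz mD L1 gA; rewrite nA.
rewrite (@eq_Rintegral _ _ _ mu D (fun x => `|g x|)); last by move=> x _; rewrite mul1r.
rewrite ger0_norm; last exact: Rintegral_ge0.
have n1 : nrm mu D (fun=> 1) ^+ 2 = fine (mu D) by rewrite sqr_nrm expr1n Rintegral_cst// mul1r.
have a1 : alpha * nrm mu D (fun=> 1) <= t.
  rewrite -(@ler_pXn2r _ 2) ?nnegrE ?mulr_ge0 ?nrm_ge0// exprMn n1.
  apply: le_trans (ler_wpM2l (sqr_ge0 _) Dt) _.
  by rewrite mulrCA alphaE mulr1.
move=> h; apply: le_trans (ler_wpM2l alpha0 h) _.
rewrite mulrA; apply: ler_pM => //; rewrite ?nrm_ge0 ?mulr_ge0 ?nrm_ge0//.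
Qed.

Lemma whole_set_integral (g : T -> R) : L2 mu Om g ->
  alpha * (\int[mu]_(x in Om) `|g x|)%R <= nrm mu Om g.
Proof.
move=> g2; have := @small_set_integral Om g 1 mO (@subset_refl _ _) g2 ler01.
by rewrite expr1n !mul1r; apply.
Qed.

End small_sets.

Section compact_support.
Context {R : realType} {n : nat}.
Local Notation mu := (lebesgue_rV n).
Implicit Types (f F : 'rV[R]_n -> R).

(** Continuous functions of compact support, the class in which all integrability conditions below
    are automatic. *)
Definition ccs F := continuous F /\ exists M, bsupp M F.

Lemma ccs_mull f F : continuous f -> ccs F -> ccs (fun x => f x * F x).
Proof.
move=> cf [cF [M F0]]; split; first by move=> x; apply: continuousM; [exact: cf|exact: cF].
by exists M => x /F0 ->; rewrite mulr0.
Qed.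

Lemma ccsD F F' : ccs F -> ccs F' -> ccs (fun x => F x + F' x).
Proof.
move=> [cF [M F0]] [cF' [M' F0']]; split.
  by move=> x; apply: (@continuousD _ _ _ F F'); [exact: cF|exact: cF'].
by exists (Num.max M M') => x; rewrite ge_max => /andP[/F0 -> /F0' ->]; rewrite addr0.
Qed.

Lemma ccs_sum (I : Type) (s : seq I) (F : I -> 'rV[R]_n -> R) : (forall i, ccs (F i)) ->
  ccs (fun x => \sum_(i <- s) F i x).
Proof.
move=> cF; elim: s => [|a s IH].
  split; first by apply: continuous_sumr => i; have [] := cF i.
  by exists 0 => x _; rewrite big_nil.
have [c M] := ccsD (cF a) IH; split; first by apply: continuous_sumr => i; have [] := cF i.
by have [K HK] := M; exists K => x /HK h; rewrite big_cons.
Qed.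

Lemma ccs_norm F : ccs F -> ccs (fun x => `|F x|).
Proof.
move=> [cF [M F0]]; split.
  by move=> x; apply: (@continuous_comp _ _ _ F Num.norm); [exact: cF|exact: norm_continuous].
by exists M => x /F0 ->; rewrite normr0.
Qed.

Lemma ccs_integrable F D : measurable D -> ccs F -> mu.-integrable D (EFin \o F).
Proof.
move=> mD [cF [M F0]]; have i := bsupp_integrable cF F0.
by apply: integrableS i => //; exact: measurableT.
Qed.

Lemma ccs_bounded F : ccs F -> exists2 C, 0 <= C & forall x, `|F x| <= C.
Proof. by move=> [cF [M F0]]; exact: bsupp_bounded cF F0. Qed.

Lemma ccs_L2 F D : measurable D -> (mu D < +oo)%E -> ccs F -> L2 mu D F.
Proof.
move=> mD fD sF; have [C C0 FC] := ccs_bounded sF.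
apply: (bounded_L2 mD fD) (fun x _ => FC x).
by apply: measurable_funTS; apply: continuous_measurable_rV; have [] := sF.
Qed.

Lemma ccs_partial F k : C1 F -> ccs F -> ccs (partial k F).
Proof.
move=> F1 [cF [M F0]]; split; first exact: C1_derive_continuous.
by exists (M + 1); exact: bsupp_derive.
Qed.

End compact_support.

Section last_coordinate.
Context {R : realType} {n : nat}.
Implicit Types (q : {poly R}) (x : 'rV[R]_n.+1).

Lemma Ck_on_xlast_poly q k : Ck_on k setT (fun x : 'rV[R]_n.+1 => q.[xlast x]).
Proof.
apply: (@Ck_on_comp R _ k setT setT (fun t => q.[t]) (@xlast R n)) => //; try exact: openT.
- exact: Ck_on_horner.
- exact: Ck_on_coord.
Qed.

Lemma partial_xlast_poly q k x :
  partial k (fun x : 'rV[R]_n.+1 => q.[xlast x]) x = q^`().[xlast x] *+ (k == ord_max).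
Proof.
have [_ E] := is_derive_comp_dir (f := @xlast R n) (x := x) (is_derive_poly q (xlast x))
  (is_derive_coord ord_max x (delta_mx 0 k)).
rewrite /partial E mxE eqxx eq_sym.
by case: (_ == _); rewrite ?mulr1 ?mulr0.
Qed.

End last_coordinate.

Lemma three_term_estimate (R : realDomainType) (a b c d e e' : R) :
  `|b - d| <= e -> `|c| <= e' -> `|a + b - c - (a + d)| <= e + e'.
Proof.
move=> T1 T2; rewrite (_ : a + b - c - (a + d) = (b - d) - c); last by ring.
by apply: le_trans (ler_normB _ _) _; apply: lerD.
Qed.

Lemma flux_terms (R : realDomainType) (a b k tA tL h I1 I2 I3 : R) :
  0 <= a -> 0 <= b -> 0 <= k -> I1 <= 1 * h -> I2 <= tA * h -> I3 <= tL * h ->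
  b * I1 + a * I2 + k * (2 * I3) <= (b + a * tA + k * (2 * tL)) * h.
Proof.
move=> a0 b0 k0 /(ler_wpM2l b0) H1 /(ler_wpM2l a0) H2 /(ler_wpM2l k0) H3.
by move: H1 H2 H3; lra.
Qed.

Lemma rest_terms (R : realDomainType) (alpha Q z t tK h a b : R) :
  0 <= z -> 0 <= Q -> 0 <= t -> alpha * a <= tK * h -> alpha * b <= h ->
  z * (alpha * Q) * (a + t * b) <= (tK + t) * (z * (Q * h)).
Proof.
move=> z0 Q0 t0 H1 H2.
rewrite (_ : z * (alpha * Q) * (a + t * b) = z * Q * (alpha * a + t * (alpha * b))); last by ring.
rewrite (_ : (tK + t) * (z * (Q * h)) = z * Q * (tK * h + t * h)); last by ring.
by apply: ler_wpM2l; [rewrite mulr_ge0|apply: lerD => //; apply: ler_wpM2l].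
Qed.

(** * The energy form of the corrector *)

Section main_estimate.
Context {R : realType}.
Variables (m : nat) (Om : set 'rV[R]_m.+2) (delta eta rho C z alpha Q kappa tA tL tK : R)
  (ctr ctrW : seq 'rV[R]_m.+2) (q : {poly R}) (phi : 'rV[R]_m.+2 -> R).
Local Notation mu := (lebesgue_rV m.+2).
Local Notation r := (@hole_radius R m.+1 delta).
Local Notation r1 := (r / (1 - 2 * eta)).
Local Notation N := (m.+2%:R : R).
Hypotheses (m0 : (0 < m)%N) (d0 : 0 < delta) (eta0 : 0 < eta) (eta4 : eta < 4^-1).
Hypotheses (r1d : r1 < delta / 2) (dsmall : 2 ^+ m * delta ^+ 2 <= 2^-1) (rho0 : 0 < rho).
Hypotheses (C0 : 0 <= C) (stepC : forall t : R, `|'D_1 smooth_step t| <= C).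
Hypotheses (oO : open Om) (bO : bounded_set Om) (neO : Om !=set0)
  (Orho : forall x, Om x -> enorm x <= rho) (Olast : forall x, Om x -> 0 <= xlast x <= 1).
Hypotheses (uctr : uniq ctr) (ctrP : forall c, c \in ctr <-> centers Om delta c /\ Om c).
Hypotheses (uctrW : uniq ctrW)
  (ctrWP : forall c, c \in ctrW <-> centers Om delta c /\ `|c| <= 2 * rho + delta).
Hypotheses (alpha0 : 0 <= alpha) (alphaE : alpha ^+ 2 * fine (mu Om) = 1) (z0 : 0 <= z).
Hypothesis qQ : forall t, 0 <= t <= 1 -> [/\ `|q.[t]| <= Q, `|q^`().[t]| <= Q & `|q^`()^`().[t]| <= Q].
Hypothesis phiT : test_fun (~` holes Om delta) phi.
Hypotheses (kappa0 : 0 < kappa) (kappa1 : kappa <= 1) (r1kappa : r1 < kappa * delta).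
Hypotheses (tA0 : 0 <= tA) (tL0 : 0 <= tL) (tK0 : 0 <= tK).
Hypotheses (tAE : fine (mu (tiles ctr (@annulus R m delta eta))) <= tA ^+ 2 * fine (mu Om))
  (tLE : fine (mu (layer Om (4 * delta))) <= tL ^+ 2 * fine (mu Om))
  (tKE : fine (mu (tiles ctr (eball (0 : 'rV[R]_m.+2) (kappa * delta)))) <= tK ^+ 2 * fine (mu Om)).

Let mO : measurable Om. Proof. exact: measurable_open_rV. Qed.
Let fO : (mu Om < +oo)%E. Proof. exact: Om_finite. Qed.

Local Notation Gam := (bumps delta eta ctr).
Local Notation v := (fun x : 'rV[R]_m.+2 => alpha * q.[xlast x]).
Local Notation v1 := (fun x : 'rV[R]_m.+2 => alpha * q^`().[xlast x]).
Local Notation v2 := (fun x : 'rV[R]_m.+2 => alpha * q^`()^`().[xlast x]).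
Local Notation W := (corrector delta eta rho ctrW v).
Local Notation dN := (partial (ord_max : 'I_m.+2)).
Local Notation g := (fun x => v x * phi x).
Local Notation dflux := (fun x => - \sum_k partial k Gam x * partial k g x).

Definition h1norm (f : 'rV[R]_m.+2 -> R) : R :=
  nrm mu Om f + \sum_k nrm mu Om (partial k f).

Let Cphi : forall k, Ck_on k setT phi. Proof. by have [] := test_fun_elim phiT. Qed.
Let phi1 : C1 phi. Proof. exact: Cphi. Qed.
Let sphi : ccs phi.
Proof. by have [_ H _ _] := test_fun_elim phiT; split => //; exact: C1_continuous. Qed.
Let sDphi k : ccs (partial k phi). Proof. exact: ccs_partial. Qed.

Let poly_C p k : Ck_on k setT (fun x : 'rV[R]_m.+2 => alpha * p.[xlast x]).
Proof. by apply: Ck_onZ; [exact: openT|exact: Ck_on_xlast_poly]. Qed.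
Let poly_c p : continuous (fun x : 'rV[R]_m.+2 => alpha * p.[xlast x]).
Proof. by apply: C1_continuous; exact: poly_C. Qed.
Let partial_poly p k x : partial k (fun x : 'rV[R]_m.+2 => alpha * p.[xlast x]) x =
  alpha * p^`().[xlast x] *+ (k == ord_max).
Proof.
have d := C1_is_derive x (delta_mx 0 k) (Ck_on_xlast_poly p 1).
have [_ E] := is_deriveZ alpha d.
rewrite /partial -mulrnAr -partial_xlast_poly -[RHS]E.
by congr ('D_ _ _ _).
Qed.

Let CGam k : Ck_on k setT Gam. Proof. exact: Ck_on_bumps. Qed.
Let cGam : continuous Gam. Proof. by apply: C1_continuous; exact: CGam. Qed.
Let Gam1 : C1 Gam. Proof. exact: CGam. Qed.
Let g1 : C1 g. Proof. exact: (C1M (poly_C q 1) phi1). Qed.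
Let sg : ccs g. Proof. by apply: ccs_mull. Qed.
Let sdflux : ccs dflux.
Proof.
have s : ccs (fun x => \sum_k partial k Gam x * partial k g x).
  apply: ccs_sum => k; apply: ccs_mull; first exact: C1_derive_continuous.
  exact: ccs_partial.
have := ccs_mull (@cst_continuous _ _ (-1 : R)) s.
by congr ccs; apply/funext => x; rewrite mulN1r.
Qed.

Let Fp x := Gam x * (v1 x * phi x).
Let Fp1 : C1 Fp. Proof. exact: (C1M Gam1 (C1M (poly_C q^`() 1) phi1)). Qed.
Let sFp : ccs Fp. Proof. by apply: ccs_mull => //; exact: ccs_mull. Qed.

Let partialFp x : dN Fp x =
  dN Gam x * (v1 x * phi x) + Gam x * (v1 x * dN phi x + v2 x * phi x).
Proof.
have p1 : C1 (fun x => v1 x * phi x) := C1M (poly_C q^`() 1) phi1.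
rewrite /Fp (partialM _ _ Gam1 p1) (partialM _ _ (poly_C _ 1) phi1) partial_poly eqxx mulr1n.
by rewrite addrC.
Qed.

Let bumps_off x : ~ Om x -> Gam x = 0 /\ forall k, partial k Gam x = 0.
Proof.
move=> nO; apply: bumps_out => // c cc; rewrite leNgt; apply/negP => xc.
by apply: nO; exact: (center_ball_sub oO ctrP cc xc).
Qed.

(** [phi] need not vanish on the outer boundary, but the bumps of centres inside the domain do, so
    [Fp] extends by zero and there is no boundary term. *)
Let intFp : (\int[mu]_(x in Om) dN Fp x = 0)%R.
Proof.
have [_ [M FM]] := sFp; rewrite -(integral_derive0 (delta_mx 0 ord_max) Fp1 FM).
rewrite Rintegral_mkcond; apply: eq_Rintegral => x _; rewrite patchE.
case: ifPn => // /negP; rewrite inE => /bumps_off[g0 dg0].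
by rewrite -/(partial _ _ _) partialFp g0 dg0 !mul0r addr0.
Qed.

Local Notation A0 := (fun x => v1 x * dN phi x + z * (v x * phi x)).
Local Notation B0 := (fun x => Gam x * (2 * (v1 x * dN phi x) + (z * v x + v2 x) * phi x)).

Let sA0 : ccs A0.
Proof.
apply: ccsD; first exact: ccs_mull.
by apply: (ccs_mull (@cst_continuous _ _ z)); exact: ccs_mull.
Qed.

Let sB0 : ccs B0.
Proof.
apply: ccs_mull => //; apply: ccsD.
  by apply: (ccs_mull (@cst_continuous _ _ (2 : R))); exact: ccs_mull.
apply: ccs_mull => // x; apply: (@continuousD _ _ _ (fun x => z * v x) v2); last exact: poly_c.
by apply: (@continuousM _ _ (cst z) v); [exact: cst_continuous|exact: poly_c].
Qed.

(** [A0] is the form without holes and [dflux] produces mu. Moving v under the gradient of phi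
    leaves the term [dN Gam] times [v1 phi]; subtracting the derivative of [Fp] replaces it by terms
    in [Gam] itself, which are small. This is why the second derivative of q appears in [B0]. *)
Lemma corrector_energy :
  (\int[mu]_(x in Om) (\sum_k partial k W x * partial k phi x + z * W x * phi x) =
   \int[mu]_(x in Om) A0 x + \int[mu]_(x in Om) dflux x - \int[mu]_(x in Om) B0 x)%R.
Proof.
have pw x : Om x -> \sum_k partial k W x * partial k phi x + z * W x * phi x =
    (A0 x + dflux x) - (B0 x - dN Fp x).
  move=> Ox; rewrite (@correctorE R m Om delta eta rho ctr ctrW v m0 d0 eta0 eta4 r1d rho0 oO Orho uctr ctrP uctrW ctrWP x Ox).
  have E k : partial k W x = (1 - Gam x) * (v1 x *+ (k == ord_max)) - partial k Gam x * v x.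
    rewrite (@partial_corrector R m Om delta eta rho ctr ctrW v m0 d0 eta0 eta4 r1d rho0 oO Orho uctr ctrP uctrW ctrWP (poly_C q) k x Ox).
    by rewrite partial_poly.
  have S1 : \sum_k partial k W x * partial k phi x =
      (1 - Gam x) * (v1 x * dN phi x) - v x * (\sum_k partial k Gam x * partial k phi x).
    under eq_bigr do rewrite E mulrBl.
    rewrite sumrB; congr (_ - _); last by rewrite mulr_sumr; apply: eq_bigr => k _; ring.
    rewrite (bigD1 ord_max)//= eqxx mulr1n big1 ?addr0 -?mulrA//.
    by move=> k kN; rewrite (negbTE kN) mulr0n mulr0 mul0r.
  have S2 : \sum_k partial k Gam x * partial k g x =
      v x * (\sum_k partial k Gam x * partial k phi x) + dN Gam x * (v1 x * phi x).
    rewrite mulr_sumr (eq_bigr (fun k => v x * (partial k Gam x * partial k phi x) +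
        partial k Gam x * (v1 x *+ (k == ord_max) * phi x))).
      rewrite big_split/=; congr (_ + _); rewrite (bigD1 ord_max)//= eqxx mulr1n big1 ?addr0//.
      by move=> k kN; rewrite (negbTE kN) mulr0n mul0r mulr0.
    by move=> k _; rewrite (partialM k x (poly_C q 1) phi1) partial_poly; ring.
  rewrite S1 S2 partialFp.
  generalize (\sum_k partial k Gam x * partial k phi x) (Gam x) (dN Gam x) (v x) (v1 x) (v2 x) (phi x) (dN phi x).
  by move=> a b c d e f g h; ring.
rewrite (@eq_Rintegral _ _ _ mu Om (fun x => (A0 x + dflux x) - (B0 x - dN Fp x))); last first.
  by move=> x; rewrite inE => /pw.
have iA := ccs_integrable mO sA0; have iD := ccs_integrable mO sdflux.
have iB := ccs_integrable mO sB0; have iF := ccs_integrable mO (ccs_partial (ord_max) Fp1 sFp).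
rewrite RintegralB//; last 2 first.
- exact: (integrableD mO iA iD).
- exact: (integrableB mO iB iF).
by rewrite RintegralD// [X in _ - X]RintegralB// intFp subr0.
Qed.

Let L2phi : L2 mu Om phi. Proof. exact: ccs_L2. Qed.
Let L2D k : L2 mu Om (partial k phi). Proof. exact: ccs_L2. Qed.

Let Q0 : 0 <= Q.
Proof.
have t01 : 0 <= (0 : R) <= 1 by rewrite lexx ler01.
by have [h _ _] := qQ t01; exact: le_trans h.
Qed.

Let P1 x := (\sum_k `|partial k phi x|) + `|phi x|.
Let sP1 : ccs P1.
Proof. by apply: ccsD; [apply: ccs_sum => k; exact: ccs_norm|exact: ccs_norm]. Qed.
Let P10 x : 0 <= P1 x. Proof. by rewrite addr_ge0// sumr_ge0. Qed.

Let P1_small (D : set 'rV[R]_m.+2) (t : R) : measurable D -> D `<=` Om -> 0 <= t ->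
  fine (mu D) <= t ^+ 2 * fine (mu Om) ->
  alpha * (\int[mu]_(x in D) P1 x)%R <= t * h1norm phi.
Proof.
move=> mD DO t0 Dt.
have iD k : mu.-integrable D (EFin \o (fun x => `|partial k phi x|)).
  by apply: ccs_integrable => //; exact: ccs_norm.
have [iS ES] := Rintegral_sum (index_enum 'I_m.+2) mD iD.
have iP : mu.-integrable D (EFin \o (fun x => `|phi x|)) by apply: ccs_integrable => //; exact: ccs_norm.
rewrite /P1 RintegralD// ES mulrDr mulr_sumr addrC /h1norm mulrDr mulr_sumr.
apply: lerD; first exact: (small_set_integral mO fO alpha0 alphaE mD DO L2phi t0 Dt).
by apply: ler_sum => k _; exact: (small_set_integral mO fO alpha0 alphaE mD DO (L2D k) t0 Dt).
Qed.

Let P1_whole : alpha * (\int[mu]_(x in Om) P1 x)%R <= h1norm phi.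
Proof.
rewrite -[leRHS]mul1r; by apply: P1_small => //; rewrite expr1n mul1r.
Qed.

Let vle p x : Om x -> `|p.[xlast x]| <= Q -> `|alpha * p.[xlast x]| <= alpha * Q.
Proof. by move=> Ox h; rewrite normrM ger0_norm// ler_wpM2l. Qed.

Let Gg x := \sum_k `|partial k g x|.
Let sGg : ccs Gg. Proof. by apply: ccs_sum => k; apply: ccs_norm; exact: ccs_partial. Qed.

Let GgP x : Om x -> Gg x <= alpha * Q * P1 x.
Proof.
move=> Ox; have [h0 h1 h2] := qQ (Olast Ox).
rewrite /P1 mulrDr mulr_sumr /Gg.
apply: (@le_trans _ _ (\sum_k (alpha * Q * `|partial k phi x| + (alpha * Q * `|phi x|) *+ (k == ord_max)))).
  apply: ler_sum => k _; rewrite (partialM k x (poly_C q 1) phi1) partial_poly.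
  apply: le_trans (ler_normD _ _) _; apply: lerD.
    by rewrite normrM; apply: ler_wpM2r => //; exact: vle.
  case: (k == ord_max); rewrite ?mulr1n ?mulr0n ?mul0r ?normr0//.
  by rewrite normrM; apply: ler_wpM2r => //; exact: vle.
rewrite big_split/= lerD2l (bigD1 ord_max)//= eqxx mulr1n big1 ?addr0//.
by move=> k kN; rewrite (negbTE kN) mulr0n.
Qed.

Let Gg_small (D : set 'rV[R]_m.+2) (t : R) : measurable D -> D `<=` Om -> 0 <= t ->
  fine (mu D) <= t ^+ 2 * fine (mu Om) -> (\int[mu]_(x in D) Gg x)%R <= t * (Q * h1norm phi).
Proof.
move=> mD DO t0 Dt; have iP := ccs_integrable mD sP1; have iG := ccs_integrable mD sGg.
apply: (@le_trans _ _ (Q * (alpha * (\int[mu]_(x in D) P1 x)%R))).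
  rewrite mulrA [Q * alpha]mulrC -RintegralZl//.
  apply: le_Rintegral => //; first by apply: (integrableZl mD (alpha * Q) iP).
  by move=> x Dx; apply: GgP; exact: DO.
by rewrite [leRHS]mulrCA; apply: ler_wpM2l => //; exact: P1_small.
Qed.

(** The gradient of g = v phi is at most alpha Q times [P1]. The integrals over the domain, the
    annuli and the boundary layer are then Cauchy-Schwarz estimates with relative volumes 1, tA^2
    and tL^2. *)
Lemma corrector_flux_estimate :
  `|(\int[mu]_(x in Om) dflux x)%R - strange_mu m.+2 * (\int[mu]_(x in Om) g x)%R| <=
  (@err_cell R m delta C + m%:R * N * (2 * delta) + @err_annulus R m delta C * tA + m%:R * N * (2 * tL)) *
  (Q * h1norm phi).
Proof.
have [Cg0 Cg00 gC] := ccs_bounded sg.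
have /choice[K HK] : forall k : 'I_m.+2, exists K, forall x, `|partial k g x| <= K.
  by move=> k; have [K _ HK] := ccs_bounded (ccs_partial k g1 sg); exists K.
pose Cg := Cg0 + \sum_k `|K k|.
have gC' x : `|g x| <= Cg by rewrite (le_trans (gC x))// lerDl sumr_ge0.
have DC' k x : `|partial k g x| <= Cg.
  rewrite (le_trans (HK k x))// (le_trans (ler_norm _))// /Cg (bigD1 k)//= addrCA lerDl.
  by rewrite addr_ge0// sumr_ge0.
have g0 c x : c \in ctr -> enorm (x - c) < r -> g x = 0.
  move=> cc xc; have [_ _ H _] := test_fun_elim phiT; rewrite H ?mulr0//.
  by exists c => /=; [exact: ((ctrP c).1 cc).1|exact: ltW].
have mL := @measurable_layer R m.+2 Om (4 * delta) mO.
have disj := center_disjoint d0 ctrP.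
have F := @corrector_flux R m delta eta C Cg ctr (inner_centers Om delta ctr) g Om (layer Om (4 * delta))
  m0 d0 eta0 eta4 r1d dsmall C0 stepC uctr disj g1 gC' DC' g0 mO fO mL (@layer_sub R m.+2 Om (4 * delta))
  (fun c x => @center_ball_sub R m Om delta oO ctr ctrP c x) (filter_uniq _ uctr) (mem_subseq (filter_subseq _ _))
  (@inner_centers_sub R m Om delta ctr) _ _.
apply: le_trans (F _ _) _.
- by move=> x; exact: (layer_cube oO bO neO d0 ctrP).
- by move=> c x; exact: (layer_ball oO d0 ctrP).
have mA : measurable (tiles ctr (@annulus R m delta eta)).
  by apply: measurable_tiles; exact: measurable_annulus.
have AO : tiles ctr (@annulus R m delta eta) `<=` Om.
  apply: (tiles_sub_Om oO ctrP) => y /andP[_ yr]; rewrite eball0E/= (le_lt_trans yr)// (lt_trans r1d)//.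
  by rewrite gtr_pMr// invf_lt1// ltr1n.
have T1 := @Gg_small Om 1 mO (@subset_refl _ _) ler01.
have T2 := Gg_small mA AO tA0 tAE.
have T3 : (\int[mu]_(x in layer Om (4 * delta)) `|g x|)%R <= tL * (Q * h1norm phi).
  have LO := @layer_sub R m.+2 Om (4 * delta).
  have iP := ccs_integrable mL sP1.
  apply: (@le_trans _ _ (Q * (alpha * (\int[mu]_(x in layer Om (4 * delta)) P1 x)%R))).
    rewrite mulrA [Q * alpha]mulrC -RintegralZl//.
    apply: le_Rintegral => //.
    - by apply: ccs_integrable => //; exact: ccs_norm.
    - by apply: (integrableZl mL (alpha * Q) iP).
    move=> x /LO Ox; have [h0 h1 h2] := qQ (Olast Ox); rewrite normrM.
    apply: ler_pM => //; first exact: vle.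
    by rewrite /P1 lerDr sumr_ge0.
  by rewrite [leRHS]mulrCA; apply: ler_wpM2l => //; exact: P1_small.
have k0 : 0 <= m%:R * N by rewrite mulr_ge0.
have b0 : 0 <= @err_cell R m delta C + m%:R * N * (2 * delta).
  by rewrite addr_ge0 ?(err_cell_ge0 m d0 C0)// mulr_ge0// mulr_ge0// ltW.
have a0 := err_annulus_ge0 m d0 C0.
apply: flux_terms => //; apply: T1.
by rewrite expr1n mul1r.
Qed.

(* The value of [delta^N |y|^(2-N)] at [|y| = kappa delta]. *)
Definition bump_tail : R := delta ^+ m.+2 * (kappa * delta) ^- m.

Let tail0 : 0 <= bump_tail.
Proof. by rewrite mulr_ge0 ?invr_ge0 ?exprn_ge0 ?mulr_ge0// ltW. Qed.

(** Near the centres the bump is at most 1 on a set of small volume; beyond kappa delta it is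
    bounded by its Newtonian value there. *)
Lemma bumps_le x : `|Gam x| <= \1_(tiles ctr (eball (0 : 'rV[R]_m.+2) (kappa * delta))) x + bump_tail.
Proof.
have disj := center_disjoint d0 ctrP.
have [[c cc xc]|H] := pselect (exists2 c, c \in ctr & enorm (x - c) < delta); last first.
  have [-> _] : Gam x = 0 /\ forall k, partial k Gam x = 0.
    by apply: bumps_out => // c cc; rewrite leNgt; apply/negP => xc; apply: H; exists c.
  by rewrite normr0 addr_ge0// indicE.
have -> : Gam x = @hole_bump R m delta eta (x - c) by rewrite -{1}(subrK c x) bumps_cell.
have /andP[b0 b1] := @bump01 R m delta eta d0 eta0 (x - c).
rewrite ger0_norm//; have [h|h] := ltP (enorm (x - c)) (kappa * delta).
  rewrite indicE mem_set; first by rewrite (le_trans b1)// lerDl.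
  by apply/tilesP; exists c => //; rewrite eball0E.
apply: (@le_trans _ _ bump_tail); last by rewrite lerDr indicE.
have h' := lt_le_trans r1kappa h.
apply: le_trans (bump_le m0 d0 eta0 eta4 dsmall h') _.
have kd : 0 < kappa * delta by rewrite mulr_gt0.
rewrite /bump_tail; apply: ler_wpM2l; first by rewrite exprn_ge0// ltW.
rewrite lef_pV2 ?posrE ?exprn_gt0//; last exact: lt_le_trans h.
by rewrite lerXn2r ?nnegrE ?enorm_ge0// ltW.
Qed.

Let K := tiles ctr (eball (0 : 'rV[R]_m.+2) (kappa * delta)).
Let mK : measurable K. Proof. by apply: measurable_tiles; exact: measurable_eball. Qed.
Let KO : K `<=` Om.
Proof.
apply: (tiles_sub_Om oO ctrP) => y; rewrite !eball0E/= => /lt_le_trans; apply.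
by rewrite ler_piMl// ltW.
Qed.

Lemma corrector_rest_estimate :
  `|(\int[mu]_(x in Om) B0 x)%R| <= (tK + bump_tail) * ((z + 3) * (Q * h1norm phi)).
Proof.
have iP := ccs_integrable mO sP1; have iPK := ccs_integrable mK sP1.
have z3 : 0 <= z + 3 by rewrite addr_ge0.
have pw x : Om x -> `|B0 x| <= (z + 3) * (alpha * Q) * (\1_K x * P1 x + bump_tail * P1 x).
  move=> Ox; have [h0 h1 h2] := qQ (Olast Ox).
  rewrite normrM (_ : (z + 3) * (alpha * Q) * (\1_K x * P1 x + bump_tail * P1 x) =
    (\1_K x + bump_tail) * ((z + 3) * (alpha * Q) * P1 x)); last by ring.
  apply: ler_pM => //; first exact: bumps_le.
  apply: le_trans (ler_normD _ _) _.
  have p1 : `|dN phi x| <= P1 x.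
    by rewrite /P1 (bigD1 ord_max)//= -addrA lerDl addr_ge0// sumr_ge0.
  have p2 : `|phi x| <= P1 x by rewrite /P1 lerDr sumr_ge0.
  have aQ : 0 <= alpha * Q by rewrite mulr_ge0.
  have e1 : `|2 * (v1 x * dN phi x)| <= 2 * (alpha * Q * P1 x).
    rewrite normrM normr_nat; apply: ler_wpM2l => //.
    by rewrite normrM; apply: ler_pM => //; exact: vle.
  have e2 : `|(z * v x + v2 x) * phi x| <= (z + 1) * (alpha * Q) * P1 x.
    rewrite normrM; apply: ler_pM => //; apply: le_trans (ler_normD _ _) _.
    rewrite mulrDl mul1r; apply: lerD; last exact: vle.
    by rewrite normrM ger0_norm//; apply: ler_wpM2l => //; exact: vle.
  apply: le_trans (lerD e1 e2) _; rewrite le_eqVlt; apply/orP; left; apply/eqP; ring.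
have E1 : (fun x => \1_K x * P1 x) = P1 \_ K.
  by apply/funext => x; rewrite patchE indicE; case: ifP => _; rewrite ?mul1r ?mul0r.
have i1 : mu.-integrable Om (EFin \o (fun x => \1_K x * P1 x)).
  apply: (le_integrable mO _ _ iP).
    apply/measurable_EFinP; apply: measurable_funM.
      by apply: measurable_funTS; apply: measurable_indic.
    by apply: measurable_funTS; apply: continuous_measurable_rV; have [] := sP1.
  move=> x _; rewrite /= lee_fin normrM ler_piMl// indicE.
  by case: (_ \in _); rewrite ?normr1 ?normr0.
have i2 : mu.-integrable Om (EFin \o (fun x => bump_tail * P1 x)) := integrableZl mO bump_tail iP.
have i3 : mu.-integrable Om (EFin \o (fun x => \1_K x * P1 x + bump_tail * P1 x)) := integrableD mO i1 i2.
apply: le_trans (Rintegral_abs_le mO (ccs_integrable mO sB0) (integrableZl mO _ i3) pw) _.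
rewrite RintegralZl// RintegralD// RintegralZl// E1 -Rintegral_mkcondr (setIidr KO).
have T1 := P1_small mK KO tK0 tKE.
exact: (rest_terms z3 Q0 tail0 T1 P1_whole).
Qed.

(** In this order: error in the cells, translations of the tiling, annuli, boundary layer, and the
    terms in which the bumps stand undifferentiated. *)
Definition main_error : R :=
  @err_cell R m delta C + m%:R * N * (2 * delta) + @err_annulus R m delta C * tA +
  m%:R * N * (2 * tL) + (tK + bump_tail) * (z + 3).

(* The flux of the bumps produces the term [strange_mu]; the rest is small because the bumps
   are small outside balls of radius [kappa delta]. *)
Lemma main_estimate :
  `|(\int[mu]_(x in Om) (\sum_k partial k W x * partial k phi x + z * W x * phi x))%R -
    ((\int[mu]_(x in Om) A0 x)%R + strange_mu m.+2 * (\int[mu]_(x in Om) g x)%R)| <=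
  main_error * (Q * h1norm phi).
Proof.
rewrite corrector_energy.
have T := @three_term_estimate R (\int[mu]_(x in Om) A0 x)%R _ _ _ _ _
  corrector_flux_estimate corrector_rest_estimate.
apply: (le_trans T).
by rewrite /main_error [leRHS]mulrDl -[X in _ <= _ + X]mulrA.
Qed.

End main_estimate.

(** * The limit equation on the thin domain *)

Section h1norm.
Context {R : realType} (m : nat) (Om : set 'rV[R]_m.+2) (f : 'rV[R]_m.+2 -> R).

Lemma nrm_le_h1norm : nrm (lebesgue_rV m.+2) Om f <= h1norm Om f.
Proof. by rewrite lerDl sumr_ge0// => k _; exact: nrm_ge0. Qed.

Lemma partial_le_h1norm k : nrm (lebesgue_rV m.+2) Om (partial k f) <= h1norm Om f.
Proof.
rewrite /h1norm (bigD1 k)//= addrCA lerDl addr_ge0 ?nrm_ge0// sumr_ge0// => j _.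
exact: nrm_ge0.
Qed.

End h1norm.

Section weak_form_thin.
Context {R : realType}.
Variables (m : nat) (Omega0 : set 'rV[R]_m.+1) (e : R).
Hypotheses (oO : open Omega0) (bO : bounded_set Omega0) (e0 : 0 < e).
Local Notation mu := (lebesgue_rV m.+2).
Local Notation lam := (@lebesgue_measure R).
Local Notation I01 := (`]0, 1[%classic : set R).
Local Notation Om := (thin Omega0 e).
Local Notation dN := (partial (ord_max : 'I_m.+2)).

Let mO : measurable Om := measurable_thin oO e0.

Lemma thin_finite : (mu Om < +oo)%E.
Proof. by rewrite measure_thin// ltry. Qed.

Let thin_xlast x : Om x -> I01 (xlast x).
Proof. by move=> [_]; rewrite /= in_itv. Qed.

Lemma xlast_L2 (g : R -> R) : L2 lam I01 g ->
  L2 mu Om (fun x => g (xlast x)) /\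
  nrm mu Om (fun x => g (xlast x)) = Num.sqrt (base_measure Omega0 e) * nrm lam I01 g.
Proof.
move=> [mg ig]; pose h := (g : measurableTypeR R -> R) \_ I01.
have mh : measurable_fun setT h by apply/(measurable_restrictT _ measurable_I01).
have hE x : Om x -> h (xlast x) = g (xlast x).
  by move=> /thin_xlast Ix; rewrite /h patchE mem_set.
have mhx : measurable_fun setT (fun x : 'rV[R]_m.+2 => h (xlast x)).
  by apply: (measurableT_comp mh); exact: measurable_xlast.
have E : (\int[mu]_(x in Om) (g (xlast x) ^+ 2)%:E = (base_measure Omega0 e)%:E * \int[lam]_(t in I01) (g t ^+ 2)%:E)%E.
  have := @ge0_integral_thin_last R _ Omega0 e oO bO e0 (fun t => (h t ^+ 2)%:E) _ _.
  rewrite (@eq_integral _ _ _ mu Om (fun x => (g (xlast x) ^+ 2)%:E)); last first.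
    by move=> x /set_mem Ox; rewrite hE.
  rewrite (@eq_integral _ _ _ lam I01 (fun t => (g t ^+ 2)%:E) (fun t => (h t ^+ 2)%:E)); last first.
    by move=> t It; rewrite /h patchE It.
  apply; last by move=> t; rewrite lee_fin sqr_ge0.
  by apply/measurable_EFinP; exact: measurable_funX.
have fin : (\int[lam]_(t in I01) (g t ^+ 2)%:E)%E \is a fin_num by exact: integrable_fin_num.
have L : L2 mu Om (fun x => g (xlast x)).
  split.
    apply: (@eq_measurable_fun _ _ _ _ Om (fun x => h (xlast x))); last exact: measurable_funTS.
    by move=> x /set_mem; exact: hE.
  apply/integrableP; split.
    apply/measurable_EFinP; apply: measurable_funX.
    apply: (@eq_measurable_fun _ _ _ _ Om (fun x => h (xlast x))); last exact: measurable_funTS.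
    by move=> x /set_mem; exact: hE.
  under eq_integral do rewrite gee0_abs ?lee_fin ?sqr_ge0//.
  by rewrite E -(fineK fin) -EFinM ltry.
split=> //; rewrite /nrm -sqrtrM ?fine_measure_ge0//; congr Num.sqrt.
by rewrite /Rintegral E -(fineK fin) -EFinM.
Qed.

Variables (phi : 'rV[R]_m.+2 -> R).
Hypotheses (phi1 : C1 phi) (sphi : ccs phi).

Let snocE (y : 'rV[R]_m.+1) (t : R) :
  rV_snoc (y, t) = t *: delta_mx 0 ord_max + rV_snoc (y, 0 : R).
Proof.
apply/rowP => i; rewrite !mxE eqxx/=.
have [j ->|->] := unliftP ord_max i.
  by rewrite /= eq_sym (negbTE (neq_lift _ _)) mulr0 add0r.
by rewrite /= eqxx mulr1 addr0.
Qed.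

Let slice y (t : R) := phi (t *: delta_mx 0 ord_max + rV_snoc (y, 0 : R)).

Let slice_derive y (t : R) : is_derive t 1 (slice y) (dN phi (rV_snoc (y, t))).
Proof. by rewrite snocE; exact: C1_line. Qed.

Let slice_C1 y : C1 (slice y).
Proof.
have c0 : continuous (slice y) by exact: C1_line_continuous.
split; first by move=> t _; exact: c0.
split=> [t v _|v].
  have : is_derive t (v *: 1) (slice y) (v * dN phi (rV_snoc (y, t))) by exact: is_deriveZdir.
  by rewrite /GRing.scale/= mulr1 => -[].
have -> : 'D_v (slice y) = fun t => v * dN phi (t *: delta_mx 0 ord_max + rV_snoc (y, 0 : R)).
  apply/funext => t; have : is_derive t (v *: 1) (slice y) (v * dN phi (rV_snoc (y, t))) by exact: is_deriveZdir.
  by rewrite /GRing.scale/= mulr1 snocE => -[].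
split=> // t _; apply: (@continuousM _ _ (cst v)); first exact: cst_continuous.
by apply: (@continuous_line R _ (dN phi)); exact: C1_derive_continuous.
Qed.

(** The one-dimensional weak form is applied to each slice t -> phi(y, t), which is C^1 with no
    prescribed values at the ends, and then integrated over the base. *)
Lemma weak_form_thin (k du : R -> R) : L2 lam I01 k -> {within `[0, 1], continuous du} ->
  (forall psi : R -> R, C1 psi ->
    \int[lam]_(t in I01) (du t * 'D_1 psi t + k t * psi t) = 0)%R ->
  mu.-integrable Om (EFin \o (fun x => du (xlast x) * dN phi x + k (xlast x) * phi x)) /\
  (\int[mu]_(x in Om) (du (xlast x) * dN phi x + k (xlast x) * phi x) = 0)%R.
Proof.
move=> k2 cdu wf; have du2 := within_continuous_L2 cdu.
have [kx _] := xlast_L2 k2; have [dux _] := xlast_L2 du2.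
have p2 : L2 mu Om phi by apply: ccs_L2 => //; exact: thin_finite.
have dp2 : L2 mu Om (dN phi) by apply: ccs_L2 => //; [exact: thin_finite|exact: ccs_partial].
have i1 : mu.-integrable Om (EFin \o (fun x => du (xlast x) * dN phi x)) by exact: L2M.
have i2 : mu.-integrable Om (EFin \o (fun x => k (xlast x) * phi x)) by exact: L2M.
have iF : mu.-integrable Om (EFin \o (fun x => du (xlast x) * dN phi x + k (xlast x) * phi x)).
  exact: (integrableD mO i1 i2).
split => //.
have cont_L2 (g : R -> R) : continuous g -> L2 lam I01 g.
  by move=> cg; apply: within_continuous_L2; exact: continuous_subspaceT.
have slE y t : dN phi (rV_snoc (y, t)) = 'D_1 (slice y) t by have [_ ->] := slice_derive y t.
rewrite (integral_thin oO e0 iF); last first.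
  move=> y.
  have j1 : lam.-integrable I01 (EFin \o (fun t => du t * 'D_1 (slice y) t)).
    by apply: (L2M measurable_I01 du2 (cont_L2 _ _)); apply: C1_derive_continuous; exact: slice_C1.
  have j2 : lam.-integrable I01 (EFin \o (fun t => k t * slice y t)).
    by apply: (L2M measurable_I01 k2 (cont_L2 _ _)); apply: C1_continuous; exact: slice_C1.
  have := integrableD measurable_I01 j1 j2.
  apply: eq_integrable; first exact: measurable_I01.
  by move=> t _; rewrite /= xlast_snoc/= slE /slice -snocE.
rewrite (_ : (fun y : 'rV[R]_m.+1 => _) = cst 0); first by rewrite Rintegral_cst ?mul0r//; exact: measurable_scaled.
apply/funext => y; rewrite -[RHS](wf _ (slice_C1 y)).
by apply: eq_lebesgue_Rintegral => t _; rewrite xlast_snoc/= slE /slice -snocE.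
Qed.

Variables (u du f : R -> R) (q : {poly R}) (alpha z c0 tau : R).
Hypotheses (cu : {within `[0, 1], continuous u}) (cdu : {within `[0, 1], continuous du}).
Hypotheses (f2 : L2 lam I01 f) (z0 : 0 <= z) (c00 : 0 <= c0) (alpha0 : 0 <= alpha)
  (alphaE : alpha ^+ 2 * fine (mu Om) = 1) (tau0 : 0 <= tau).
Hypothesis wf : forall psi : R -> R, C1 psi ->
  (\int[lam]_(t in I01) (du t * 'D_1 psi t + ((z + c0) * u t - f t) * psi t) = 0)%R.
Hypothesis uq : forall t, 0 <= t <= 1 -> `|u t - q.[t]| <= tau /\ `|du t - q^`().[t]| <= tau.

Local Notation v := (fun x : 'rV[R]_m.+2 => alpha * q.[xlast x]).
Local Notation v1 := (fun x : 'rV[R]_m.+2 => alpha * q^`().[xlast x]).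

(** The exact identity for u and u', multiplied by alpha, is subtracted: pointwise only q - u and q'
    - u' remain, both at most tau. *)
Lemma weak_form_error :
  `|(\int[mu]_(x in Om) (v1 x * dN phi x + z * (v x * phi x)))%R +
    c0 * (\int[mu]_(x in Om) (v x * phi x))%R -
    (\int[mu]_(x in Om) (alpha * f (xlast x) * phi x))%R| <=
  tau * (1 + z + c0) * h1norm Om phi.
Proof.
have k2 : L2 lam I01 (fun t => (z + c0) * u t - f t).
  exact: (L2_sub measurable_I01 (L2_scale measurable_I01 (z + c0) (within_continuous_L2 cu)) f2).
have [iF EF] := weak_form_thin k2 cdu wf.
have [fx _] := xlast_L2 f2.
have p2 : L2 mu Om phi by apply: ccs_L2 => //; exact: thin_finite.
have sd : ccs (dN phi) by exact: ccs_partial.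
have dp2 : L2 mu Om (dN phi) by apply: ccs_L2 => //; exact: thin_finite.
have cp (p : {poly R}) : continuous (fun x : 'rV[R]_m.+2 => alpha * p.[xlast x]).
  by apply: C1_continuous; apply: Ck_onZ; [exact: openT|exact: Ck_on_xlast_poly].
have iA : mu.-integrable Om (EFin \o (fun x => v1 x * dN phi x + z * (v x * phi x))).
  apply: ccs_integrable => //; apply: ccsD; first exact: ccs_mull.
  by apply: (ccs_mull (@cst_continuous _ _ z)); exact: ccs_mull.
have iv : mu.-integrable Om (EFin \o (fun x => v x * phi x)).
  by apply: ccs_integrable => //; exact: ccs_mull.
have icv : mu.-integrable Om (EFin \o (fun x => c0 * (v x * phi x))) := integrableZl mO c0 iv.
have iAv := integrableD mO iA icv.
have iff : mu.-integrable Om (EFin \o (fun x => alpha * f (xlast x) * phi x)).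
  by apply: (L2M mO (L2_scale mO alpha fx) p2).
have iL : mu.-integrable Om (EFin \o (fun x => v1 x * dN phi x + z * (v x * phi x) +
    c0 * (v x * phi x) - alpha * f (xlast x) * phi x)).
  exact: (integrableB mO iAv iff).
have iaF : mu.-integrable Om (EFin \o (fun x => alpha * (du (xlast x) * dN phi x +
    ((z + c0) * u (xlast x) - f (xlast x)) * phi x))) := integrableZl mO alpha iF.
have isum : mu.-integrable Om (EFin \o (fun x => tau * (alpha * `|dN phi x|) + tau * (z + c0) * (alpha * `|phi x|))).
  apply: ccs_integrable => //; apply: ccsD; apply: (ccs_mull (@cst_continuous _ _ _));
    apply: (ccs_mull (@cst_continuous _ _ _)); exact: ccs_norm.
have -> : (\int[mu]_(x in Om) (v1 x * dN phi x + z * (v x * phi x)))%R +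
    c0 * (\int[mu]_(x in Om) (v x * phi x))%R -
    (\int[mu]_(x in Om) (alpha * f (xlast x) * phi x))%R =
  (\int[mu]_(x in Om) ((v1 x * dN phi x + z * (v x * phi x) +
    c0 * (v x * phi x) - alpha * f (xlast x) * phi x) - alpha * (du (xlast x) * dN phi x +
    ((z + c0) * u (xlast x) - f (xlast x)) * phi x)))%R.
  have EaF : (\int[mu]_(x in Om) (alpha * (du (xlast x) * dN phi x +
      ((z + c0) * u (xlast x) - f (xlast x)) * phi x)))%R = 0.
    by rewrite RintegralZl// EF mulr0.
  rewrite [RHS]RintegralB// EaF subr0.
  by rewrite [RHS]RintegralB// [X in _ = X - _]RintegralD// [X in _ = _ + X - _]RintegralZl.
apply: le_trans (Rintegral_abs_le mO (integrableB mO iL iaF) isum _) _.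
  move=> x Ox; have h := thin_xlast Ox; rewrite /= in_itv/= in h; case/andP: h => x0 x1.
  have x01 : 0 <= xlast x <= 1 by rewrite (ltW x0) (ltW x1).
  have [h0 h1] := uq x01.
  move: (u (xlast x)) (du (xlast x)) (f (xlast x)) q.[xlast x] q^`().[xlast x] (dN phi x) (phi x) h0 h1.
  move=> U D F Q Q1 P1 P h0 h1.
  rewrite (_ : _ - _ = (Q1 - D) * (alpha * P1) + (z + c0) * ((Q - U) * (alpha * P))); last by ring.
  apply: le_trans (ler_normD _ _) _; apply: lerD.
    rewrite normrM distrC (normrM alpha) (ger0_norm alpha0); apply: ler_wpM2r => //.
    by rewrite mulr_ge0.
  rewrite normrM (ger0_norm (addr_ge0 z0 c00)) (mulrC tau) -[leRHS]mulrA.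
  apply: ler_wpM2l; first exact: addr_ge0.
  rewrite normrM distrC (normrM alpha) (ger0_norm alpha0); apply: ler_wpM2r => //.
  by rewrite mulr_ge0.
have id : mu.-integrable Om (EFin \o (fun x => `|dN phi x|)) by apply: ccs_integrable => //; exact: ccs_norm.
have ip : mu.-integrable Om (EFin \o (fun x => `|phi x|)) by apply: ccs_integrable => //; exact: ccs_norm.
have E : (\int[mu]_(x in Om) (tau * (alpha * `|dN phi x|) + tau * (z + c0) * (alpha * `|phi x|)))%R =
  tau * (alpha * (\int[mu]_(x in Om) `|dN phi x|)%R) +
  tau * (z + c0) * (alpha * (\int[mu]_(x in Om) `|phi x|)%R).
  have J1 : mu.-integrable Om (EFin \o (fun x => alpha * `|dN phi x|)) := integrableZl mO alpha id.
  have J2 : mu.-integrable Om (EFin \o (fun x => alpha * `|phi x|)) := integrableZl mO alpha ip.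
  have [_ ->] := Rintegral_lin mO tau (tau * (z + c0)) J1 J2.
  by rewrite !RintegralZl.
rewrite E; have F1 := whole_set_integral mO thin_finite alpha0 alphaE dp2.
have F2 := whole_set_integral mO thin_finite alpha0 alphaE p2.
have N1 := partial_le_h1norm Om phi ord_max; have N2 := nrm_le_h1norm Om phi.
rewrite (_ : tau * (1 + z + c0) * h1norm Om phi = tau * h1norm Om phi + tau * (z + c0) * h1norm Om phi); last by ring.
apply: lerD; first by apply: ler_wpM2l => //; exact: le_trans F1 N1.
apply: ler_wpM2l; last exact: le_trans F2 N2.
by rewrite mulr_ge0// addr_ge0.
Qed.

End weak_form_thin.

(** * Energy estimate and convergence *)

(** Each of the n + 1 norms is at most (err h / c)^(1/2) with c = min(1, z). Summing and squaring
    gives a bound of h^2 linear in h, and one factor h is cancelled. *)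
Lemma energy_absorption (R : realType) (n : nat) (z a h err : R) (b : 'I_n -> R) :
  0 < z -> 0 <= a -> (forall k, 0 <= b k) -> h = a + \sum_k b k -> 0 <= err ->
  \sum_k b k ^+ 2 + z * a ^+ 2 <= err * h ->
  h <= n.+1%:R ^+ 2 / Num.min 1 z * err.
Proof.
move=> z0 a0 b0 hE err0 H; set c := Num.min 1 z.
have c0 : 0 < c by rewrite lt_min ltr01.
have [c1 cz] : c <= 1 /\ c <= z by rewrite !ge_min !lexx orbT.
have h0 : 0 <= h by rewrite hE addr_ge0// sumr_ge0.
pose s := Num.sqrt (err * h / c).
have X0 : 0 <= err * h / c by rewrite divr_ge0 ?mulr_ge0// ltW.
have le_s x : 0 <= x -> c * x ^+ 2 <= err * h -> x <= s.
  move=> x0 hx.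
  by rewrite -(ger0_norm x0) -sqrtr_sqr ler_wsqrtr// ler_pdivlMr// mulrC.
have bs k : b k <= s.
  apply: le_s => //; apply: le_trans H; rewrite (bigD1 k)//= -addrA.
  apply: (@le_trans _ _ (b k ^+ 2)); first by rewrite ler_piMl// sqr_ge0.
  by rewrite lerDl addr_ge0 ?mulr_ge0 ?sqr_ge0 ?(ltW z0)// sumr_ge0// => j _; exact: sqr_ge0.
have as_ : a <= s.
  apply: le_s => //; apply: le_trans H.
  apply: (@le_trans _ _ (z * a ^+ 2)); first by rewrite ler_wpM2r ?sqr_ge0.
  by rewrite lerDr sumr_ge0// => j _; exact: sqr_ge0.
have hs : h <= n.+1%:R * s.
  rewrite hE mulrS mulrDl mul1r; apply: lerD => //.
  apply: le_trans (ler_sum _ (fun k _ => bs k)) _.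
  by rewrite sumr_const card_ord mulr_natl.
have [->|hn] := eqVneq h 0; first by rewrite mulr_ge0// divr_ge0 ?sqr_ge0 ?(ltW c0).
have hp : 0 < h by rewrite lt_def hn.
have : h ^+ 2 <= n.+1%:R ^+ 2 * (err * h / c).
  by rewrite -(sqr_sqrtr X0) -exprMn lerXn2r ?nnegrE ?mulr_ge0 ?sqrtr_ge0.
rewrite expr2 (_ : n.+1%:R ^+ 2 * (err * h / c) = n.+1%:R ^+ 2 / c * err * h); last by ring.
by rewrite ler_pM2r.
Qed.

Section energy.
Context d (T : measurableType d) {R : realType}.
Variables (mu : {measure set T -> \bar R}) (D : set T) (n : nat).
Hypothesis mD : measurable D.
Local Notation ip f g := (\int[mu]_(x in D) (f x * g x))%R.
Local Notation nrm := (nrm mu D).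
Local Notation L2 := (L2 mu D).
Implicit Types f g h : T -> R.

Lemma ip_sub f g h : L2 f -> L2 g -> L2 h -> ip (fun x => f x - g x) h = ip f h - ip g h.
Proof.
move=> f2 g2 h2.
rewrite (@eq_Rintegral _ _ _ mu D (fun x => f x * h x - g x * h x)); last by move=> x _; rewrite mulrBl.
by rewrite RintegralB//; exact: L2M.
Qed.

Lemma energy_formE (z : R) (a b : T -> R) (A B : 'I_n -> T -> R) : L2 a -> L2 b ->
  (forall k, L2 (A k)) -> (forall k, L2 (B k)) ->
  (\int[mu]_(x in D) (\sum_k A k x * B k x + z * a x * b x))%R =
  \sum_k ip (A k) (B k) + z * ip a b.
Proof.
move=> a2 b2 A2 B2.
have iS k : mu.-integrable D (EFin \o (fun x => A k x * B k x)) by exact: L2M.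
have [iSS ES] := Rintegral_sum (index_enum 'I_n) mD iS.
have i2 : mu.-integrable D (EFin \o (fun x => z * (a x * b x))) := integrableZl mD z (L2M mD a2 b2).
rewrite (@eq_Rintegral _ _ _ mu D (fun x => \sum_k A k x * B k x + z * (a x * b x))); last first.
  by move=> x _; rewrite mulrA.
by rewrite RintegralD// ES RintegralZl//; exact: L2M.
Qed.

Variables (z t E fe : R) (u psi w F G : T -> R) (Du Dpsi Dw : 'I_n -> T -> R).
Hypotheses (z0 : 0 < z) (t0 : 0 <= t) (E0 : 0 <= E) (fe0 : 0 <= fe).
Hypotheses (u2 : L2 u) (psi2 : L2 psi) (w2 : L2 w) (F2 : L2 F) (G2 : L2 G)
  (Du2 : forall k, L2 (Du k)) (Dpsi2 : forall k, L2 (Dpsi k)) (Dw2 : forall k, L2 (Dw k)).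

Let phi x := psi x - w x.
Let Dphi k x := Dpsi k x - Dw k x.
Let h := nrm phi + \sum_k nrm (Dphi k).

Hypotheses (ue : \sum_k ip (Du k) (Dphi k) + z * ip u phi = ip F phi)
  (we : `|\sum_k ip (Dw k) (Dphi k) + z * ip w phi - ip G phi| <= E * h)
  (ut : nrm (fun x => u x - psi x) <= t) (Dut : forall k, nrm (fun x => Du k x - Dpsi k x) <= t)
  (FG : nrm (fun x => F x - G x) <= fe).

(* Test with [psi - w], where [psi] is a smooth approximation of [u]: [u] itself is not smooth. *)
Lemma energy_estimate :
  nrm (fun x => u x - w x) <= t + n.+1%:R ^+ 2 / Num.min 1 z * (t * (1 + z) + E + fe).
Proof.
have phi2 : L2 phi by exact: L2_sub.
have Dphi2 k : L2 (Dphi k) by exact: L2_sub.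
have n_le : nrm phi <= h by rewrite lerDl sumr_ge0// => k _; exact: nrm_ge0.
have S_le : \sum_k nrm (Dphi k) <= h by rewrite lerDr nrm_ge0.
have h0 : 0 <= h by exact: le_trans (nrm_ge0 _ _ phi) n_le.
have B : \sum_k nrm (Dphi k) ^+ 2 + z * nrm phi ^+ 2 =
    (\sum_k ip (Dpsi k) (Dphi k) + z * ip psi phi) - (\sum_k ip (Dw k) (Dphi k) + z * ip w phi).
  rewrite (eq_bigr (fun k => ip (Dpsi k) (Dphi k) - ip (Dw k) (Dphi k))); last first.
    by move=> k _; rewrite sqr_nrm -ip_sub//; apply: eq_Rintegral => x _; rewrite expr2.
  rewrite sumrB sqr_nrm (@eq_Rintegral _ _ _ mu D (fun x => (psi x - w x) * phi x)); last first.
    by move=> x _; rewrite expr2.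
  by rewrite ip_sub//; ring.
have S1 : \sum_k ip (Dpsi k) (Dphi k) = \sum_k ip (Du k) (Dphi k) - \sum_k ip (fun x => Du k x - Dpsi k x) (Dphi k).
  by rewrite -sumrB; apply: eq_bigr => k _; rewrite ip_sub// subKr.
have S2 : ip psi phi = ip u phi - ip (fun x => u x - psi x) phi by rewrite ip_sub// subKr.
have S3 : ip F phi = ip G phi + ip (fun x => F x - G x) phi by rewrite ip_sub// subrKC.
have A1 : `|\sum_k ip (fun x => Du k x - Dpsi k x) (Dphi k)| <= t * h.
  apply: le_trans (ler_norm_sum _ _ _) _; apply: le_trans (ler_wpM2l t0 S_le).
  rewrite mulr_sumr; apply: ler_sum => k _.
  apply: le_trans (L2_CauchySchwarz mD (L2_sub mD (Du2 k) (Dpsi2 k)) (Dphi2 k)) _.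
  by apply: ler_wpM2r => //; exact: nrm_ge0.
have A2 : `|ip (fun x => u x - psi x) phi| <= t * h.
  apply: le_trans (L2_CauchySchwarz mD (L2_sub mD u2 psi2) phi2) _.
  by apply: ler_pM => //; exact: nrm_ge0.
have A3 : `|ip (fun x => F x - G x) phi| <= fe * h.
  apply: le_trans (L2_CauchySchwarz mD (L2_sub mD F2 G2) phi2) _.
  by apply: ler_pM => //; exact: nrm_ge0.
have key : \sum_k nrm (Dphi k) ^+ 2 + z * nrm phi ^+ 2 <= (t * (1 + z) + E + fe) * h.
  rewrite B S1 S2; move: ue we A1 A2 A3; rewrite S3.
  generalize (\sum_k ip (fun x => Du k x - Dpsi k x) (Dphi k)) (ip (fun x => u x - psi x) phi)
   (ip (fun x => F x - G x) phi) (\sum_k ip (Du k) (Dphi k)) (ip u phi) (ip G phi)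
   (\sum_k ip (Dw k) (Dphi k)) (ip w phi).
  move: h => H a b c x1 x2 x3 x4 x5 e1 /ler_normlP[e2 _] /ler_normlP[e3 _] /ler_normlP[e4 _] /ler_normlP[_ e5].
  have := ler_wpM2l (ltW z0) e4; nra.
have hE := energy_absorption z0 (nrm_ge0 _ _ phi) (fun k => nrm_ge0 _ _ (Dphi k)) (erefl h) _ key.
have err0 : 0 <= t * (1 + z) + E + fe.
  by rewrite !addr_ge0// mulr_ge0// addr_ge0// ltW.
have -> : nrm (fun x => u x - w x) = nrm (fun x => (u x - psi x) + phi x).
  by apply: eq_nrm => x _; rewrite /phi addrA subrK.
apply: le_trans (nrm_triangle mD (L2_sub mD u2 psi2) phi2) _.
apply: lerD => //; exact: le_trans n_le (hE err0).
Qed.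

End energy.

Section small_sets_norm.
Context d (T : measurableType d) {R : realType}.
Variables (mu : {measure set T -> \bar R}) (D : set T).
Hypotheses (mD : measurable D) (fD : (mu D < +oo)%E).

Lemma nrm_le (f g : T -> R) : L2 mu D f -> L2 mu D g -> (forall x, D x -> `|f x| <= g x) ->
  nrm mu D f <= nrm mu D g.
Proof.
move=> [_ if_] [_ ig] fg; rewrite ler_wsqrtr//; apply: le_Rintegral => // x Dx.
by rewrite -[leLHS]real_normK ?num_real// lerXn2r ?nnegrE ?fg// (le_trans _ (fg x Dx)).
Qed.

Lemma nrm_indic (K : set T) (c a t : R) : measurable K -> K `<=` D -> 0 <= c -> 0 <= a -> 0 <= t ->
  a ^+ 2 * fine (mu D) = 1 -> fine (mu K) <= t ^+ 2 * fine (mu D) ->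
  L2 mu D (fun x => a * c * \1_K x) /\ nrm mu D (fun x => a * c * \1_K x) <= t * c.
Proof.
move=> mK KD c0 a0 t0 aE Kt.
have m1 : measurable_fun D (\1_K : T -> R) by apply: measurable_funTS; exact: measurable_indic.
have L : L2 mu D (\1_K : T -> R).
  apply: (bounded_L2 mD (M := 1)) => // x _; rewrite indicE.
  by case: (_ \in _); rewrite ?normr1 ?normr0.
have nE : nrm mu D (\1_K : T -> R) ^+ 2 = fine (mu K).
  rewrite sqr_nrm (@eq_Rintegral _ _ _ mu D (\1_K : T -> R)); last first.
    by move=> x _; rewrite indicE; case: (_ \in _); rewrite ?expr1n ?expr0n.
  by rewrite /Rintegral integral_indic// (setIidl KD).
split; first exact: L2_scale.
rewrite nrm_scale// ger0_norm ?mulr_ge0// mulrAC ler_wpM2r//.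
rewrite -(@ler_pXn2r _ 2) ?nnegrE ?mulr_ge0 ?nrm_ge0// exprMn nE.
apply: le_trans (ler_wpM2l (sqr_ge0 _) Kt) _.
by rewrite mulrCA aE mulr1.
Qed.

End small_sets_norm.

Section sobolev_test.
Context {R : realType} {n : nat}.
Variables (Om T : set 'rV[R]_n).
Local Notation mu := (lebesgue_rV n).
Hypotheses (oO : open Om) (fO : (mu Om < +oo)%E).
Let mO : measurable Om. Proof. exact: measurable_open_rV. Qed.
Implicit Types (u f g : 'rV[R]_n -> R).

Lemma test_fun_ccs f : test_fun (~` T) f -> C1 f /\ ccs f.
Proof.
move=> /test_fun_elim[Cf bf _ _]; split; first exact: Cf.
by split => //; apply: C1_continuous; exact: Cf.
Qed.

Lemma test_fun_near0 f x : test_fun (~` T) f -> T x -> \forall y \near x, f y = 0.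
Proof.
move=> [_ _ sT] Tx; have nc : ~ closure [set x | f x != 0] x by move=> /sT.
have o : open (~` closure [set x | f x != 0]) by rewrite openC; exact: closed_closure.
have : nbhs x (~` closure [set x | f x != 0]) by exact: open_nbhs_nbhs.
apply: filterS => y ny; apply/eqP/negPn/negP => fy; apply: ny.
exact: subset_closure.
Qed.

Lemma test_funB f g : test_fun (~` T) f -> test_fun (~` T) g ->
  test_fun (~` T) (fun x => f x - g x).
Proof.
move=> tf tg; have [Cf [M fM] _ _] := test_fun_elim tf; have [Cg [M' gM] _ _] := test_fun_elim tg.
apply: (@test_fun_intro _ _ _ _ (Num.max M M')).
- by move=> k; apply: Ck_onB; [exact: openT|exact: Cf|exact: Cg].
- by move=> x; rewrite ge_max => /andP[/fM -> /gM ->]; rewrite subrr.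
- move=> x Tx; have nf := test_fun_near0 tf Tx; have ng := test_fun_near0 tg Tx.
  by near=> y; rewrite (near nf y)// (near ng y)// subrr.
Unshelve. all: by end_near.
Qed.

Lemma H1norm_nrm u (Du : 'I_n -> 'rV[R]_n -> R) : L2 mu Om u -> (forall i, L2 mu Om (Du i)) ->
  H1norm Om u Du = (Num.sqrt (nrm mu Om u ^+ 2 + \sum_i nrm mu Om (Du i) ^+ 2))%:E.
Proof.
move=> u2 Du2; rewrite /H1norm L2norm_nrm//.
under eq_bigr do rewrite L2norm_nrm// poweR_EFin powR_mulrn ?nrm_ge0//.
rewrite poweR_EFin powR_mulrn ?nrm_ge0// sumEFin -EFinD poweR_EFin powR12_sqrt//.
by rewrite addr_ge0 ?sqr_ge0// sumr_ge0// => i _; exact: sqr_ge0.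
Qed.

Lemma H1norm_lt u (Du : 'I_n -> 'rV[R]_n -> R) (t : R) : L2 mu Om u -> (forall i, L2 mu Om (Du i)) ->
  (H1norm Om u Du < t%:E)%E -> nrm mu Om u <= t /\ forall i, nrm mu Om (Du i) <= t.
Proof.
move=> u2 Du2; rewrite H1norm_nrm// lte_fin => /ltW h.
have S0 : 0 <= \sum_i nrm mu Om (Du i) ^+ 2 by rewrite sumr_ge0// => i _; exact: sqr_ge0.
have le x : 0 <= x -> x ^+ 2 <= nrm mu Om u ^+ 2 + \sum_i nrm mu Om (Du i) ^+ 2 -> x <= t.
  move=> x0 hx; apply: le_trans h; rewrite -(ger0_norm x0) -sqrtr_sqr; exact: ler_wsqrtr.
split=> [|i]; apply: le; rewrite ?nrm_ge0//; first by rewrite lerDl.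
rewrite (bigD1 i)//= addrCA lerDl addr_ge0 ?sqr_ge0// sumr_ge0// => j _; exact: sqr_ge0.
Qed.

(** The product with a test function of [Om] has compact support, so the integral of its derivative
    is 0; this is the weak gradient identity. The approximating function is f itself. *)
Lemma test_fun_in_H0 f : test_fun (~` T) f -> in_H0 Om T f (fun i => partial i f).
Proof.
move=> tf; have [f1 sf] := test_fun_ccs tf.
have f2 : L2 mu Om f by exact: ccs_L2.
have Df2 i : L2 mu Om (partial i f) by apply: ccs_L2 => //; exact: ccs_partial.
split.
  split; first exact: (in_L2P mu mO f).2.
  move=> i; split; first exact: (in_L2P mu mO _).2.
  move=> psi tpsi; have tpsi' : test_fun (~` ~` Om) psi by rewrite setCK.
  have [Cp [M pM] p0 dp0] := test_fun_elim tpsi'.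
  have p1 : C1 psi by exact: Cp.
  have sp : ccs psi by split; [exact: C1_continuous|exists M].
  have fp1 : C1 (fun x => f x * psi x) by exact: C1M.
  have fpM : bsupp M (fun x => f x * psi x) by move=> x /pM ->; rewrite mulr0.
  have := integral_derive0 (delta_mx 0 i) fp1 fpM.
  have -> : (\int[mu]_x 'D_(delta_mx 0 i) (fun x => f x * psi x) x)%R =
      (\int[mu]_(x in Om) (f x * partial i psi x + partial i f x * psi x))%R.
    rewrite [RHS]Rintegral_mkcond; apply: eq_Rintegral => x _; rewrite patchE.
    rewrite -/(partial i _ x) (partialM i x f1 p1).
    case: ifPn => // /negP; rewrite inE => nO.
    by rewrite p0// dp0// !mulr0 addr0.
  rewrite RintegralD//; last 2 first.
  - by apply: ccs_integrable => //; apply: ccs_mull; [case: sf|exact: ccs_partial].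
  - by apply: ccs_integrable => //; apply: ccs_mull => //; exact: C1_derive_continuous.
  by move/eqP; rewrite addr_eq0 => /eqP.
move=> eta eta0; exists f => //.
have -> : f \- f = cst 0 by apply/funext => x /=; rewrite subrr.
have -> : (fun i => partial i f \- partial i f) = fun=> cst 0.
  by apply/funext => i; apply/funext => x /=; rewrite subrr.
have z2 : L2 mu Om (cst 0 : 'rV[R]_n -> R) by apply: (bounded_L2 mO (M := 0)) => // x _; rewrite normr0.
rewrite H1norm_nrm//.
have n0 : nrm mu Om (cst 0) = 0.
  by rewrite /nrm (_ : (fun x => _) = cst 0) ?Rintegral_cst// ?mul0r ?sqrtr0//; apply/funext => x; rewrite /= expr0n.
by rewrite n0 expr0n big1// addr0 sqrtr0 lte_fin.
Qed.

(** The test function and its partial derivatives vanish on the holes, so both integrands do; the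
    estimates can then be done on the whole domain. *)
Lemma weak_solution_test z f u Du phi : test_fun (~` T) phi ->
  (\int[mu]_(x in Om `\` T) (\sum_i Du i x * partial i phi x + z * u x * phi x) =
   \int[mu]_(x in Om `\` T) (f x * phi x))%R ->
  (\int[mu]_(x in Om) (\sum_i Du i x * partial i phi x + z * u x * phi x) =
   \int[mu]_(x in Om) (f x * phi x))%R.
Proof.
move=> tphi; have [_ _ p0 dp0] := test_fun_elim tphi.
have K g : (forall x, T x -> g x = 0) -> (\int[mu]_(x in Om `\` T) g x = \int[mu]_(x in Om) g x)%R.
  move=> g0; rewrite Rintegral_mkcond [RHS]Rintegral_mkcond; apply: eq_Rintegral => x _.
  rewrite !patchE; have [Ox|nO] := pselect (Om x); last first.
    by rewrite !memNset// => -[].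
  have [Tx|nT] := pselect (T x).
    by rewrite (mem_set Ox) memNset ?g0// => -[].
  by rewrite (mem_set Ox) mem_set.
rewrite !K// => x Tx; first by rewrite p0// mulr0.
rewrite p0// mulr0 addr0 big1// => i _; by rewrite dp0// mulr0.
Qed.

End sobolev_test.

Lemma strange_mu_ge0 (R : realType) (m : nat) : 0 <= strange_mu m.+2 :> R.
Proof.
rewrite strange_muE//; have -> : m.+2%:R - 2 = m%:R :> R by rewrite -addn2 natrD addrK.
exact: (mulr_ge0 (mulr_ge0 (ler0n _ _) (ler0n _ _)) ball_density_ge0).
Qed.

Lemma partialB (R : realType) (n : nat) (f g : 'rV[R]_n -> R) k : C1 f -> C1 g ->
  partial k (fun x => f x - g x) = fun x => partial k f x - partial k g x.
Proof.
move=> f1 g1; apply/funext => x.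
by have [_] := is_deriveB (C1_is_derive x (delta_mx 0 k) f1) (C1_is_derive x (delta_mx 0 k) g1).
Qed.

Lemma sum_estimates (R : realDomainType) (a b c d e1 e2 h Q : R) :
  `|a - (b + c)| <= e1 * (Q * h) -> `|b + c - d| <= e2 * h -> `|a - d| <= (e1 * Q + e2) * h.
Proof.
move=> H1 H2; rewrite (_ : a - d = (a - (b + c)) + (b + c - d)); last by ring.
by apply: le_trans (ler_normD _ _) _; rewrite mulrDl -mulrA; apply: lerD.
Qed.

Lemma main_error_ge0 (R : realType) (m : nat) (delta C z kappa tA tL tK : R) : (0 < m)%N ->
  0 < delta -> 0 <= C -> 0 <= z -> 0 < kappa -> 0 <= tA -> 0 <= tL -> 0 <= tK ->
  0 <= main_error m delta C z kappa tA tL tK.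
Proof.
move=> m0 d0 C0 z0 k0 tA0 tL0 tK0.
have h1 := err_cell_ge0 m d0 C0; have h2 := err_annulus_ge0 m d0 C0.
have h3 : 0 <= (m%:R * m.+2%:R : R) by rewrite mulr_ge0.
have h4 : 0 <= bump_tail m delta kappa.
  by rewrite mulr_ge0 ?invr_ge0 ?exprn_ge0 ?mulr_ge0// ltW.
rewrite /main_error; apply: addr_ge0; last by rewrite mulr_ge0// addr_ge0.
apply: addr_ge0; last by rewrite mulr_ge0// mulr_ge0.
apply: addr_ge0; last by rewrite mulr_ge0.
by apply: addr_ge0 => //; rewrite mulr_ge0// mulr_ge0// ltW.
Qed.

Lemma thin_bound (R : realType) (n : nat) (Omega0 : set 'rV[R]_n) (e : R) :
  bounded_set Omega0 -> 0 < e -> exists2 K, 0 < K & forall x, thin Omega0 e x -> `|x| <= K.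
Proof.
move=> [M [_ bM]] e0; pose K := e * (`|M| + 1) + 1.
have bM1 : M < `|M| + 1 by rewrite (le_lt_trans (ler_norm M))// ltrDl.
have K0 : 0 < K by rewrite ltr_wpDl// mulr_ge0 ?addr_ge0// ltW.
exists K => // x [[x' Ox' xE] /andP[x0 x1]].
rewrite [leLHS]/Num.norm/= mx_normrE; apply/bigmax_leP; split; first exact: ltW.
move=> [i j] _ /=; rewrite (ord1 i) -(snoc_xbar_xlast x) mxE.
case: unliftP => [j' _|_] /=.
  rewrite -xE mxE normrM (ger0_norm (ltW e0)).
  have := le_trans (coord_le_norm x' j') (bM _ bM1 x' Ox').
  by move=> h; have := ler_wpM2l (ltW e0) h; rewrite /K; lra.
rewrite ger0_norm ?(ltW x0)//; apply: (le_trans (ltW x1)).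
by rewrite /K lerDr mulr_ge0 ?addr_ge0// ltW.
Qed.

(** * The error estimate for fixed epsilon *)

Section thin_estimate.
Context {R : realType}.
Variables (m : nat) (Omega0 : set 'rV[R]_m.+1) (e delta eta kappa C z Q tau tL fe : R)
  (u0 du f : R -> R) (q : {poly R}) (F u : 'rV[R]_m.+2 -> R).
Local Notation mu := (lebesgue_rV m.+2).
Local Notation lam := (@lebesgue_measure R).
Local Notation I01 := (`]0, 1[%classic : set R).
Local Notation Om := (thin Omega0 e).
Local Notation r := (@hole_radius R m.+1 delta).
Local Notation r1 := (r / (1 - 2 * eta)).
Local Notation c0 := (@strange_mu R m.+2).
Hypotheses (m0 : (0 < m)%N) (oO : open Omega0) (bO : bounded_set Omega0) (e0 : 0 < e)
  (domO : domain Om).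
Hypotheses (d0 : 0 < delta) (eta0 : 0 < eta) (eta4 : eta < 4^-1) (kappa0 : 0 < kappa) (kappa1 : kappa <= 1).
Hypotheses (r1d : r1 < delta / 2) (r1kappa : r1 < kappa * delta) (dsmall : 2 ^+ m * delta ^+ 2 <= 2^-1).
Hypotheses (C0 : 0 <= C) (stepC : forall t : R, `|'D_1 smooth_step t| <= C).
Hypotheses (z0 : 0 < z) (tau0 : 0 < tau) (tL0 : 0 <= tL) (fe0 : 0 <= fe).
Hypotheses (cu : {within `[0, 1], continuous u0}) (cdu : {within `[0, 1], continuous du}).
Hypothesis (f2 : L2 lam I01 f).
Hypothesis wf : forall psi : R -> R, C1 psi ->
  (\int[lam]_(t in I01) (du t * 'D_1 psi t + ((z + c0) * u0 t - f t) * psi t) = 0)%R.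
Hypothesis uq : forall t, 0 <= t <= 1 -> `|u0 t - q.[t]| <= tau /\ `|du t - q^`().[t]| <= tau.
Hypothesis qQ : forall t, 0 <= t <= 1 -> [/\ `|q.[t]| <= Q, `|q^`().[t]| <= Q & `|q^`()^`().[t]| <= Q].
Hypothesis tLE : fine (mu (layer Om (4 * delta))) <= tL ^+ 2 * base_measure Omega0 e.
Hypotheses (F2 : L2 mu Om F) (Ffe : nrm mu Om (fun x => F x - U_eps Omega0 e f x) <= fe).
Hypothesis usol : weak_solution Om (holes Om delta) z F u.

Let oOm : open Om. Proof. by have [] := domO. Qed.
Let neOm : Om !=set0. Proof. by have [] := domO. Qed.
Let mOm : measurable Om := measurable_thin oO e0.
Let fOm : (mu Om < +oo)%E := thin_finite oO bO e0.
Let bOm : bounded_set Om.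
Proof.
have [K _ HK] := thin_bound bO e0; exists K; split; first exact: num_real.
by move=> y Ky x /HK h; exact: le_trans h (ltW Ky).
Qed.

Local Notation alpha := (base_measure Omega0 e `^ (- 2^-1)).

Lemma base_measure_gt0 : 0 < base_measure Omega0 e.
Proof.
have := measure_open_gt0 oOm neOm; rewrite measure_thin//.
Qed.

Lemma U_eps_normalised : alpha ^+ 2 * fine (mu Om) = 1.
Proof.
have B0 := base_measure_gt0; have Bn : base_measure Omega0 e != 0 by rewrite gt_eqF.
rewrite measure_thin//= expr2 -powRD ?Bn ?implybT//.
by rewrite -opprD -[X in X + X]div1r -splitr powRN powRr1 ?ltW// mulVf.
Qed.

Let alpha0 : 0 <= alpha. Proof. exact: powR_ge0. Qed.

Let c00 : 0 <= c0.
Proof. exact: strange_mu_ge0. Qed.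

Let Q0 : 0 <= Q.
Proof.
have t01 : 0 <= (0 : R) <= 1 by rewrite lexx ler01.
by have [h _ _] := qQ t01; exact: le_trans h.
Qed.

Definition annulus_ratio : R := Num.sqrt ((1 - 2 * eta) ^- 2 ^+ m.+2 - 1).

Let ratio_ge0 : 0 <= (1 - 2 * eta) ^- 2 ^+ m.+2 - 1.
Proof.
rewrite subr_ge0 exprn_ege1// invf_ge1 ?exprn_gt0 ?exprn_ile1//; move: eta0 eta4; lra.
Qed.

Local Notation err := (main_error m delta C z kappa (r * annulus_ratio) tL kappa).
Local Notation Kz := (m.+3%:R ^+ 2 / Num.min 1 z).

(** The triangle inequality through the corrector. The first two summands come from the energy
    estimate; the last bracket measures the corrector against [U_eps] of the limit: bumps on the
    small balls, bumps elsewhere, and q against u. *)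
Lemma thin_estimate : L2 mu Om u /\
  nrm mu Om (fun x => u x - U_eps Omega0 e u0 x) <=
  tau + Kz * (tau * (1 + z) + (err * Q + tau * (1 + z + c0)) + fe) +
  (kappa * Q + bump_tail m delta kappa * Q + tau).
Proof.
have [K0' K0'p xK] := thin_bound bO e0.
pose rho := m.+2%:R * K0'.
have rho0 : 0 < rho by rewrite mulr_gt0.
have Orho x : Om x -> enorm x <= rho.
  by move=> /xK h; apply: le_trans (enorm_le x) _; rewrite ler_wpM2l.
have Olast x : Om x -> 0 <= xlast x <= 1 by move=> [_ /andP[h1 h2]]; rewrite !ltW.
have [ctr [uctr ctrP]] := center_seq bOm d0.
have [ctrW [uctrW ctrWP']] := lattice_seq d0 (centers Om delta) (2 * rho + delta).
have ctrWP c : c \in ctrW <-> centers Om delta c /\ `|c| <= 2 * rho + delta.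
  split=> [/ctrWP'[] //|[h1 h2]]; apply/ctrWP'; split=> //; exact: centers_lattice h1.
have alphaE := U_eps_normalised.
have r0 : 0 < r by exact: powR_gt0.
have tA0 : 0 <= r * annulus_ratio by rewrite mulr_ge0 ?sqrtr_ge0 ?ltW.
have tAE : fine (mu (tiles ctr (@annulus R m delta eta))) <= (r * annulus_ratio) ^+ 2 * fine (mu Om).
  rewrite exprMn (sqr_sqrtr ratio_ge0).
  exact: (measure_tiles_annulus oOm bOm d0 uctr ctrP mOm m0 eta0 eta4 r1d).
(* The relative volume is at most kappa^N <= kappa^2, so [kappa] itself serves as [tK]. *)
have tKE : fine (mu (tiles ctr (eball (0 : 'rV[R]_m.+2) (kappa * delta)))) <= kappa ^+ 2 * fine (mu Om).
  have k01 : 0 < kappa <= 1 by rewrite kappa0.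
  apply: le_trans (measure_tiles_ball oOm bOm d0 uctr ctrP mOm k01) _.
  apply: ler_wpM2r; first exact: fine_measure_ge0.
  by rewrite -addn2 exprD ler_piMl ?sqr_ge0// exprn_ile1// ltW.
have tLE' : fine (mu (layer Om (4 * delta))) <= tL ^+ 2 * fine (mu Om).
  by apply: le_trans tLE _; rewrite measure_thin.
pose v (x : 'rV[R]_m.+2) := alpha * q.[xlast x].
have Cv k : Ck_on k setT v by apply: Ck_onZ; [exact: openT|exact: Ck_on_xlast_poly].
pose W := corrector delta eta rho ctrW v.
have tW : test_fun (~` holes Om delta) W.
  exact: (@corrector_test_fun R m Om delta eta rho ctrW v m0 d0 eta0 eta4 r1d rho0 uctrW ctrWP Cv).
have [W1 sW] := test_fun_ccs tW.
have W2 : L2 mu Om W by exact: ccs_L2.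
have DW2 k : L2 mu Om (partial k W) by apply: ccs_L2 => //; exact: ccs_partial.
have [Du [[uL2 DuL2] uH0] ueq] := usol.
have u2 : L2 mu Om u by apply: (in_L2P mu mOm u).1.
have Du2 k : L2 mu Om (Du k) by apply: (in_L2P mu mOm _).1; have [] := DuL2 k.
have [psi tpsi psiu] := uH0 tau tau0.
have [psi1 spsi] := test_fun_ccs tpsi.
have psi2 : L2 mu Om psi by exact: ccs_L2.
have Dpsi2 k : L2 mu Om (partial k psi) by apply: ccs_L2 => //; exact: ccs_partial.
have [ut Dut] := H1norm_lt oOm (L2_sub mOm u2 psi2) (fun k => L2_sub mOm (Du2 k) (Dpsi2 k)) psiu.
pose phi x := psi x - W x.
have tphi : test_fun (~` holes Om delta) phi by exact: test_funB.
have [phi1 sphi] := test_fun_ccs tphi.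
have DphiE k : partial k phi = fun x => partial k psi x - partial k W x by exact: partialB.
have phi2 : L2 mu Om phi by exact: ccs_L2.
have Dphi2 k : L2 mu Om (partial k phi) by apply: ccs_L2 => //; exact: ccs_partial.
have [fx2 _] := xlast_L2 oO bO e0 f2.
have [ux2 _] := xlast_L2 oO bO e0 (within_continuous_L2 cu).
have G2 : L2 mu Om (fun x => alpha * f (xlast x)) by exact: L2_scale.
have U2 : L2 mu Om (fun x => alpha * u0 (xlast x)) by exact: L2_scale.
have ue := weak_solution_test tphi (ueq phi _ (test_fun_in_H0 oOm fOm tphi)).
rewrite energy_formE// in ue.
have we := sum_estimates
  (@main_estimate R m Om delta eta rho C z alpha Q kappa (r * annulus_ratio) tL kappa ctr ctrW q phi
   m0 d0 eta0 eta4 r1d dsmall rho0 C0 stepC oOm bOm neOm Orho Olast uctr ctrP uctrW ctrWP alpha0 alphaE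
   (ltW z0) qQ tphi kappa0 kappa1 r1kappa tA0 tL0 (ltW kappa0) tAE tLE' tKE)
  (weak_form_error oO bO e0 phi1 sphi cu cdu f2 (ltW z0) c00 alpha0 alphaE (ltW tau0) wf uq).
rewrite energy_formE// in we.
have hE : h1norm Om phi = nrm mu Om (fun x => psi x - W x) +
    \sum_k nrm mu Om (fun x => partial k psi x - partial k W x).
  by congr (_ + _); apply: eq_bigr => k _; rewrite DphiE.
rewrite hE in we.
have subD (A : 'I_m.+2 -> 'rV[R]_m.+2 -> R) :
    \sum_k (\int[mu]_(x in Om) (A k x * partial k phi x))%R =
    \sum_k (\int[mu]_(x in Om) (A k x * (partial k psi x - partial k W x)))%R.
  by apply: eq_bigr => k _; rewrite DphiE.
rewrite subD in ue; rewrite subD in we.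
have E0 : 0 <= err * Q + tau * (1 + z + c0).
  have me0 : 0 <= err by exact: main_error_ge0 (ltW z0) _ _ _ (ltW kappa0).
  exact: (addr_ge0 (mulr_ge0 me0 Q0) (mulr_ge0 (ltW tau0) (addr_ge0 (addr_ge0 ler01 (ltW z0)) c00))).
have Est := energy_estimate mOm z0 (ltW tau0) E0 fe0 u2 psi2 W2 F2 G2 Du2 Dpsi2 DW2 ue we ut Dut Ffe.
split => //.
pose Kset := tiles ctr (eball (0 : 'rV[R]_m.+2) (kappa * delta)).
have mK : measurable Kset by apply: measurable_tiles; exact: measurable_eball.
have KO : Kset `<=` Om.
  apply: (tiles_sub_Om oOm ctrP) => y; rewrite !eball0E/= => /lt_le_trans; apply.
  by rewrite ler_piMl// ltW.
have tail0 : 0 <= bump_tail m delta kappa.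
  by rewrite mulr_ge0 ?invr_ge0 ?exprn_ge0 ?mulr_ge0// ltW.
have Om1 : fine (mu Om) <= 1 ^+ 2 * fine (mu Om) by rewrite expr1n mul1r.
have [L1 N1] := nrm_indic mOm fOm mK KO Q0 alpha0 (ltW kappa0) alphaE tKE.
have [L2' N2] := nrm_indic mOm fOm mOm (@subset_refl _ Om) (mulr_ge0 tail0 Q0) alpha0 ler01 alphaE Om1.
have [L3 N3] := nrm_indic mOm fOm mOm (@subset_refl _ Om) (ltW tau0) alpha0 ler01 alphaE Om1.
have WU : nrm mu Om (fun x => W x - alpha * u0 (xlast x)) <= kappa * Q + bump_tail m delta kappa * Q + tau.
  apply: le_trans (nrm_le mOm (L2_sub mOm W2 U2) (L2_sum mOm (L2_sum mOm L1 L2') L3) _) _.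
    move=> x Ox; rewrite /W (@correctorE R m Om delta eta rho ctr ctrW v m0 d0 eta0 eta4 r1d rho0 oOm Orho uctr ctrP uctrW ctrWP x Ox).
    rewrite (_ : _ - _ = - (bumps delta eta ctr x * v x) + alpha * (q.[xlast x] - u0 (xlast x))); last by rewrite /v; ring.
    have [h0 _] := uq (Olast x Ox); have [h1 _ _] := qQ (Olast x Ox).
    have hb := @bumps_le R m Om delta eta kappa ctr m0 d0 eta0 eta4 r1d dsmall uctr ctrP kappa0 r1kappa x.
    have -> : \1_Om x = 1 :> R by rewrite indicE mem_set.
    rewrite !mulr1.
    apply: le_trans (ler_normD _ _) _; apply: lerD.
      rewrite normrN normrM /v normrM (ger0_norm alpha0).
      rewrite (_ : _ + _ = (\1_Kset x + bump_tail m delta kappa) * (alpha * Q)); last by rewrite /Kset; ring.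
      by apply: ler_pM => //; [rewrite mulr_ge0|rewrite ler_wpM2l].
    by rewrite normrM (ger0_norm alpha0) distrC ler_wpM2l.
  apply: le_trans (nrm_triangle mOm (L2_sum mOm L1 L2') L3) _; rewrite mul1r in N3; apply: lerD => //.
  apply: le_trans (nrm_triangle mOm L1 L2') _; rewrite mul1r in N2; exact: lerD.
apply: le_trans (lerD Est WU).
apply: le_trans (nrm_triangle mOm (L2_sub mOm u2 W2) (L2_sub mOm W2 U2)).
rewrite le_eqVlt; apply/orP; left; apply/eqP; apply: eq_nrm => x _.
by rewrite addrA subrK.
Qed.

End thin_estimate.

Lemma error_terms (R : realDomainType) (a k b w d x s t : R) :
  0 <= a -> 0 <= k -> 0 <= b -> 0 <= w -> d <= s -> x <= s -> t <= s ->
  a * d + k * (2 * d) + b * x + k * (2 * s) + (s + t) * w <= (a + k * 2 + b + k * 2 + 2 * w) * s.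
Proof.
move=> a0 k0 b0 w0 ds xs ts.
have h1 := ler_wpM2l a0 ds; have h2 := ler_wpM2l k0 ds; have h3 := ler_wpM2l b0 xs.
by have h4 := ler_wpM2l w0 ts; move: h1 h2 h3 h4; lra.
Qed.

(** * Choice of the parameters *)

Section small_parameters.
Context {R : realType} (m : nat).
Hypothesis m0 : (0 < m)%N.

Lemma annulus_small (s : R) : 0 < s ->
  exists2 eta : R, 0 < eta < 4^-1 & annulus_ratio m eta <= s.
Proof.
(* [y] solves 1/(1 - y) - 1 = s^2, and [k] = 2 N is the exponent in [annulus_ratio]. With 2 k eta =
   y / 2, Bernoulli's inequality gives (1 - 2 eta)^k >= 1 - y. *)
move=> s0; pose k := (2 * m.+2)%N; pose y := s ^+ 2 / (1 + s ^+ 2).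
have s2 : 0 < s ^+ 2 by rewrite exprn_gt0.
have s21 : 0 < 1 + s ^+ 2 by rewrite addr_gt0.
have k0 : 0 < k%:R :> R by rewrite ltr0n.
have k2 : 2 <= k%:R :> R by rewrite ler_nat /k -[X in (X <= _)%N]muln1 leq_mul2l.
have y0 : 0 < y by rewrite divr_gt0.
have y1 : y < 1 by rewrite ltr_pdivrMr// mul1r ltrDr.
pose eta := y / (4 * k%:R).
have eta0 : 0 < eta by rewrite divr_gt0// mulr_gt0.
have keta : k%:R * (2 * eta) = y / 2.
  by rewrite /eta; field; rewrite gt_eqF.
have eta4 : eta < 4^-1.
  have h : 2 * (2 * eta) <= y / 2 by rewrite -keta ler_wpM2r// mulr_ge0// ltW.
  by move: y1 h; lra.
exists eta; first by rewrite eta0.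
have e01 : 0 <= 2 * eta <= 1 by apply/andP; split; move: eta0 eta4; lra.
have B := Bernoulli_inequality k e01; rewrite keta in B.
have lo : 1 - y <= (1 - 2 * eta) ^+ k by apply: le_trans B; move: y0; lra.
have y1p : 0 < 1 - y by rewrite subr_gt0.
rewrite /annulus_ratio -(ger0_norm (ltW s0)) -sqrtr_sqr ler_wsqrtr//.
rewrite lerBlDl -exprVn -exprM exprVn.
have yE : 1 - y = (1 + s ^+ 2)^-1 by rewrite /y; field; rewrite gt_eqF.
rewrite -[leRHS]invrK -yE.
by rewrite lef_pV2 ?posrE// (lt_le_trans y1p lo).
Qed.

Lemma hole_small (s : R) : 0 < s <= 1 -> exists2 X : R, 0 < X & forall delta, 0 < delta -> delta < X ->
  2 ^+ m * delta ^+ 2 <= 2^-1 /\ bump_tail m delta s <= s /\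
  forall eta, 0 < eta < 4^-1 ->
    @hole_radius R m.+1 delta / (1 - 2 * eta) < delta / 2 /\
    @hole_radius R m.+1 delta / (1 - 2 * eta) < s * delta.
Proof.
move=> /andP[s0 s1]; pose c := s / 4.
have c0 : 0 < c by rewrite divr_gt0.
(* Three thresholds for delta^2: [a1] for the truncation zone, [a2] for [bump_tail], which equals
   delta^2 / s^m, and [a3] for r < c delta, by r^m = delta^m delta^2. *)
pose a1 : R := 2^-1 / 2 ^+ m; pose a2 := s * s ^+ m; pose a3 := c ^+ m.
have p1 : 0 < a1 by rewrite divr_gt0 ?exprn_gt0.
have p2 : 0 < a2 by rewrite mulr_gt0 ?exprn_gt0.
have p3 : 0 < a3 by rewrite exprn_gt0.
pose Y := Num.min a1 (Num.min a2 a3).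
have Y0 : 0 < Y by rewrite !lt_min p1 p2.
exists (Num.sqrt Y); first by rewrite sqrtr_gt0.
move=> delta d0 dX; have : delta ^+ 2 < Y.
  by rewrite -(sqr_sqrtr (ltW Y0)) ltrXn2r// ?nnegrE ?ltW.
rewrite !lt_min => /andP[d1 /andP[d2 d3]].
split; first by rewrite mulrC -ler_pdivlMr ?exprn_gt0// ltW.
split.
  rewrite /bump_tail exprMn invfM mulrA -[m.+2]addn2 exprD.
  rewrite (_ : _ / _ / _ = delta ^+ 2 / s ^+ m); last by field; rewrite !expf_neq0// gt_eqF.
  by rewrite ler_pdivrMr ?exprn_gt0// ltW.
move=> eta /andP[e0 e4].
have w0 : 0 < 1 - 2 * eta by move: e4; lra.
set r := hole_radius delta; have r0 : 0 < r by exact: powR_gt0.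
have rd : r < c * delta.
  rewrite ltNge; apply/negP => h.
  have := @lerXn2r R m (c * delta) r; rewrite !nnegrE => /(_ _ _ h) h'.
  have := h' (mulr_ge0 (ltW c0) (ltW d0)) (ltW r0).
  rewrite exprMn /r /hole_radius (hole_radius_expr m0 d0) -[m.+2]add2n exprD.
  by rewrite ler_pM2r ?exprn_gt0// leNgt d3.
have r1 : r / (1 - 2 * eta) < 2 * (c * delta).
  by rewrite ltr_pdivrMr// (lt_le_trans rd)// ; have := mulr_gt0 c0 d0; nra.
have cd : 2 * (c * delta) = s * delta / 2 by rewrite /c; field.
have sd : 0 < s * delta by rewrite mulr_gt0.
split; apply: (lt_le_trans r1); rewrite cd; last by move: sd; lra.
by rewrite ler_wpM2r// ger_pMl.
Qed.

Definition error_rate (C z : R) : R :=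
  (2 ^+ m.+2 * (m%:R + 8 * C) + m%:R * 2 ^+ m.+1 + m%:R) + m%:R * m.+2%:R * 2 +
  (3 + 4 * C) * m%:R + m%:R * m.+2%:R * 2 + 2 * (z + 3).

Lemma error_rate_ge0 C z : 0 <= C -> 0 <= z -> 0 <= error_rate C z.
Proof.
move=> C0 z0; have h1 := err_cell_ge0 m (@ltr01 R) C0; rewrite /err_cell mulr1 in h1.
have h2 : 0 <= (m%:R * m.+2%:R * 2 : R) by rewrite !mulr_ge0.
have h3 : 0 <= (3 + 4 * C) * m%:R by rewrite mulr_ge0// addr_ge0// mulr_ge0.
have h4 : 0 <= 2 * (z + 3) by rewrite mulr_ge0// addr_ge0.
exact: (addr_ge0 (addr_ge0 (addr_ge0 (addr_ge0 h1 h2) h3) h2) h4).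
Qed.

(** The factor 1/r of [err_annulus] cancels the r of the annulus volume; what is left is controlled
    by eta, not by delta. *)
Lemma main_error_le (delta C z eta s : R) : 0 <= C -> 0 <= z -> 0 < delta <= s ->
  annulus_ratio m eta <= s -> bump_tail m delta s <= s ->
  main_error m delta C z s (@hole_radius R m.+1 delta * annulus_ratio m eta) s s <= error_rate C z * s.
Proof.
move=> C0 z0 /andP[d0 ds] As bs; have r0 : 0 < @hole_radius R m.+1 delta by exact: powR_gt0.
rewrite /main_error /err_cell /err_annulus /error_rate.
rewrite (_ : _ / _ * (_ * _) = (3 + 4 * C) * m%:R * annulus_ratio m eta); last by field; rewrite gt_eqF.
have h1 := err_cell_ge0 m (@ltr01 R) C0; rewrite /err_cell mulr1 in h1.
have h2 : 0 <= (m%:R * m.+2%:R : R) by rewrite mulr_ge0.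
have h3 : 0 <= (3 + 4 * C) * m%:R by rewrite mulr_ge0// addr_ge0// mulr_ge0.
have h4 : 0 <= z + 3 by rewrite addr_ge0.
exact: error_terms.
Qed.

End small_parameters.

Lemma poly_bounded01 (R : realType) (q : {poly R}) :
  exists2 Q, 0 <= Q & forall t, 0 <= t <= 1 -> `|q.[t]| <= Q.
Proof.
apply: within_continuous_bounded; apply: continuous_subspaceT => t.
exact: continuous_horner.
Qed.

(** The coefficient of [tau] is free of [Q], while that of [s] contains it. As q, hence [Q], depends
    on [tau], one half of [eps] is spent on each, in that order. *)
Lemma total_error (R : realFieldType) (K A z c Q tau fe eps s bt err : R) :
  0 <= K -> 0 <= Q -> 0 <= A -> 0 < eps -> 0 <= z -> 0 <= c ->
  tau * (2 + K * (2 + 2 * z + c)) <= eps / 2 ->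
  s * (K * (A * Q + 1) + 2 * Q) <= eps / 2 ->
  err <= A * s -> fe <= s -> bt <= s ->
  tau + K * (tau * (1 + z) + (err * Q + tau * (1 + z + c)) + fe) + (s * Q + bt * Q + tau) <= eps.
Proof.
move=> K0 Q0 A0 eps0 z0 c0 Ht Hs He Hf Hb.
have h1 := ler_wpM2l K0 (ler_wpM2r Q0 He); have h2 := ler_wpM2l K0 Hf; have h3 := ler_wpM2r Q0 Hb.
rewrite (_ : tau + _ + _ = tau * (2 + K * (2 + 2 * z + c)) + (K * (err * Q) + K * fe + s * Q + bt * Q)); last by ring.
rewrite (splitr eps); apply: lerD => //; apply: le_trans Hs.
rewrite [leRHS](_ : _ = K * (A * s * Q) + K * s + s * Q + s * Q); last by ring.
by rewrite lerD// lerD2r lerD.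
Qed.

Lemma exists_small (R : realFieldType) (a eps : R) : 0 <= a -> 0 < eps ->
  exists2 s, 0 < s <= 1 & s * a <= eps / 2.
Proof.
move=> a0 eps0; have a1 : 0 < a + 1 by rewrite ltr_wpDl.
exists (Num.min 1 (eps / 2 / (a + 1))).
  by rewrite lt_min ltr01 ge_min lexx !divr_gt0.
have h : Num.min 1 (eps / 2 / (a + 1)) <= eps / 2 / (a + 1) by rewrite ge_min lexx orbT.
apply: le_trans (ler_wpM2r a0 h) _.
rewrite mulrAC ler_pdivrMr// ler_wpM2l// ?lerDl//.
by rewrite divr_ge0// ltW.
Qed.

Section convergence.
Context {R : realType}.
Variables (m : nat) (Omega0 : set 'rV[R]_m.+1) (delta : R -> R) (z : R) (f : R -> R)
  (f_ u_ : R -> 'rV[R]_m.+2 -> R).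
Local Notation mu := (lebesgue_rV m.+2).
Local Notation lam := (@lebesgue_measure R).
Local Notation I01 := (`]0, 1[%classic : set R).
Local Notation Om e := (thin Omega0 e).
Local Notation c0 := (@strange_mu R m.+2).
Hypotheses (m0 : (0 < m)%N) (oO : open Omega0) (bO : bounded_set Omega0)
  (domO : forall e : R, 0 < e -> domain (Om e)).
Hypotheses (delta_itv : forall e : R, 0 < e -> 0 < delta e < e)
  (delta_small : delta e / e @[e --> 0^'+] --> (0 : R)).
Hypotheses (z0 : 0 < z) (f2 : in_L2 lam I01 f)
  (f_2 : forall e : R, 0 < e -> in_L2 mu (Om e) (f_ e))
  (f_cvg : L2norm mu (Om e) (f_ e \- U_eps Omega0 e f) @[e --> (0 : R)^'+] --> 0%E)
  (u_sol : forall e : R, 0 < e ->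
    weak_solution (Om e) (holes (Om e) (delta e)) z (f_ e) (u_ e)).

Let mI : measurable (I01 : set (measurableTypeR R)) := measurable_I01.
Let f2' : L2 lam I01 f. Proof. exact: (in_L2P lam mI f).1. Qed.
Let L2f_ e : 0 < e -> L2 mu (Om e) (f_ e).
Proof. by move=> e0; apply: (in_L2P mu (measurable_thin oO e0) _).1; exact: f_2. Qed.
Let L2Uf e (g : R -> R) : 0 < e -> L2 lam I01 g -> L2 mu (Om e) (U_eps Omega0 e g).
Proof.
move=> e0 g2; have [h _] := xlast_L2 oO bO e0 g2.
exact: (L2_scale (measurable_thin oO e0) _ h).
Qed.

Lemma near0_lt (a : R) : 0 < a -> \forall e \near (0 : R)^'+, e < a.
Proof. by move=> a0; exact: nbhs_right_lt. Qed.

Lemma near_data (s : R) : 0 < s ->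
  \forall e \near (0 : R)^'+, nrm mu (Om e) (fun x => f_ e x - U_eps Omega0 e f x) <= s.
Proof.
move=> s0; have /fine_cvgP[_ /cvgrPdist_le/(_ s s0) H] := f_cvg.
near=> e; have e0 : 0 < e by near: e; exact: nbhs_right_gt.
have En := @L2norm_nrm _ _ _ mu (Om e) (measurable_thin oO e0) _
  (L2_sub (measurable_thin oO e0) (L2f_ e0) (L2Uf e0 f2')).
have h : `|0 - fine (L2norm mu (Om e) (f_ e \- U_eps Omega0 e f))| <= s by near: e; exact: H.
by move: h; rewrite En sub0r normrN ger0_norm ?nrm_ge0.
Unshelve. all: by end_near.
Qed.

Lemma near_layer (s : R) : 0 < s <= 1 ->
  \forall e \near (0 : R)^'+,
    fine (mu (layer (Om e) (4 * delta e))) <= s ^+ 2 * base_measure Omega0 e.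
Proof.
move=> /andP[s0 s1]; have s2 : 0 < s ^+ 2 by rewrite exprn_gt0.
have ne : Omega0 !=set0.
  by have [_ [x [[y Oy _] _]] _] := domO (ltr01 : 0 < (1 : R)); exists y.
have fO := measure_base_finite oO bO.
have M0 : 0 < fine (lebesgue_rV m.+1 Omega0).
  by rewrite fine_gt0// fO andbT; exact: measure_open_gt0.
(* Half of s^2 goes to the layer of the base. The two ends cost 8 delta < 8 e < s^2 / 2, whence the
   threshold s^2 / 16 for e. *)
pose sigma := s ^+ 2 / 2.
have sM : 0 < sigma * fine (lebesgue_rV m.+1 Omega0) by rewrite mulr_gt0// divr_gt0.
have [s' s'0 Hs'] := layer_cvg0 oO fO sM.
have s'4 : 0 < s' / 4 by rewrite divr_gt0.
have /cvgrPdist_lt/(_ _ s'4) D := delta_small.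
near=> e; have e0 : 0 < e by near: e; exact: nbhs_right_gt.
have /andP[d0 de] := delta_itv e0.
have es : e < s ^+ 2 / 16 by near: e; apply: near0_lt; rewrite divr_gt0.
have dr : delta e / e < s' / 4.
  have : `|0 - delta e / e| < s' / 4 by near: e; exact: D.
  by rewrite sub0r normrN ger0_norm// divr_ge0// ltW.
have h0 : 0 < 4 * delta e by rewrite mulr_gt0.
have hs : 4 * delta e <= s' * e.
  by move: dr; rewrite ltr_pdivrMr//; lra.
apply: le_trans (measure_layer_thin oO bO e0 h0 hs s'0 Hs') _.
apply: ler_wpM2r; first exact: fine_measure_ge0.
rewrite /sigma; move: es de d0; lra.
Unshelve. all: by end_near.
Qed.

(** For each tolerance, [tau] is chosen from the equation alone, then q and [Q], then s together
    with eta and the threshold for delta. All remaining conditions hold for small e: delta < e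
    bounds delta, and delta / e -> 0 controls the layer. *)
Lemma homogenized_limit : exists u : R -> R,
  [/\ exists u' : R -> R, in_H1_01 u u',
      L2norm mu (Om e) (u_ e \- U_eps Omega0 e u) @[e --> (0 : R)^'+] --> 0%E
    & neumann_solution (z + c0) f u].
Proof.
have c00 : 0 <= c0 by exact: strange_mu_ge0.
have zc : 0 < z + c0 by rewrite ltr_wpDr.
have [u [du [cu cdu H1u sol [uE _ _ [K K0 HK] wf]]]] := Neumann_solvable zc f2.
exists u; split => //; first by exists du.
have [C C0 stepC] := @smooth_step_derive_bound R.
have u2 := within_continuous_L2 cu.
pose Kz : R := m.+3%:R ^+ 2 / Num.min 1 z.
have Kz0 : 0 <= Kz by rewrite divr_ge0 ?sqr_ge0// le_min ler01 ltW.
pose A := error_rate m C z.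
have A0 : 0 <= A by apply: error_rate_ge0 => //; exact: ltW.
have key eps : 0 < eps -> \forall e \near (0 : R)^'+,
    L2 mu (Om e) (u_ e) /\ nrm mu (Om e) (fun x => u_ e x - U_eps Omega0 e u x) <= eps.
  move=> eps0.
  have a0 : 0 <= 2 + Kz * (2 + 2 * z + c0).
    by rewrite addr_ge0// mulr_ge0// !addr_ge0// mulr_ge0// ltW.
  have [tau /andP[tau0 _] Ht] := exists_small a0 eps0.
  have [q qu] := polynomial_C1_approx cdu K0 tau0 uE HK.
  have [Q0 Q00 HQ0] := poly_bounded01 q; have [Q1 Q10 HQ1] := poly_bounded01 q^`().
  have [Q2 Q20 HQ2] := poly_bounded01 q^`()^`().
  pose Q := Q0 + Q1 + Q2; have Qge : 0 <= Q by rewrite !addr_ge0.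
  have qQ t : 0 <= t <= 1 -> [/\ `|q.[t]| <= Q, `|q^`().[t]| <= Q & `|q^`()^`().[t]| <= Q].
    move=> t01; have := HQ0 t t01; have := HQ1 t t01; have := HQ2 t t01; rewrite /Q.
    by split; lra.
  have b0 : 0 <= Kz * (A * Q + 1) + 2 * Q.
    exact: (addr_ge0 (mulr_ge0 Kz0 (addr_ge0 (mulr_ge0 A0 Qge) ler01)) (mulr_ge0 (ler0n _ _) Qge)).
  have [s /andP[s0 s1] Hs] := exists_small b0 eps0.
  have s01 : 0 < s <= 1 by rewrite s0.
  have [eta /andP[eta0 eta4] He] := annulus_small m s0.
  have [X X0 HX] := hole_small m0 s01.
  near=> e; have e0 : 0 < e by near: e; exact: nbhs_right_gt.
  have /andP[d0 de] := delta_itv e0.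
  have dX : delta e < X by apply: (lt_trans de); near: e; exact: near0_lt.
  have ds : delta e <= s by apply: ltW; apply: (lt_trans de); near: e; exact: near0_lt.
  have [dsm [bt Hr]] := HX _ d0 dX.
  have eta04 : 0 < eta < 4^-1 by rewrite eta0.
  have [r1 r2] := Hr eta eta04.
  have fs : nrm mu (Om e) (fun x => f_ e x - U_eps Omega0 e f x) <= s by near: e; exact: near_data.
  have ls : fine (mu (layer (Om e) (4 * delta e))) <= s ^+ 2 * base_measure Omega0 e.
    by near: e; exact: near_layer.
  have [L T] := @thin_estimate R m Omega0 e (delta e) eta s C z Q tau s s u du f q (f_ e) (u_ e)
    m0 oO bO e0 (domO e0) d0 eta0 eta4 s0 s1 r1 r2 dsm C0 stepC z0 tau0 (ltW s0) (ltW s0) cu cdu f2' wf qu qQ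
    ls (L2f_ e0) fs (u_sol e0).
  split => //; apply: le_trans T _.
  have ds' : 0 < delta e <= s by rewrite d0.
  have me := main_error_le C0 (ltW z0) ds' He bt.
  exact: (total_error Kz0 Qge A0 eps0 (ltW z0) c00 Ht Hs me (lexx s) bt).
have E e : 0 < e -> L2 mu (Om e) (u_ e) -> L2norm mu (Om e) (u_ e \- U_eps Omega0 e u) =
    (nrm mu (Om e) (fun x => u_ e x - U_eps Omega0 e u x))%:E.
  move=> e0 L; rewrite (@L2norm_nrm _ _ _ mu (Om e) (measurable_thin oO e0))//.
  exact: (L2_sub (measurable_thin oO e0) L (L2Uf e0 u2)).
apply/fine_cvgP; split.
  have N := key 1 ltr01; near=> e; have e0 : 0 < e by near: e; exact: nbhs_right_gt.
  have [L _] : L2 mu (Om e) (u_ e) /\ nrm mu (Om e) (fun x => u_ e x - U_eps Omega0 e u x) <= 1.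
    by near: e; exact: N.
  by rewrite E.
apply/cvgrPdist_le => eps eps0; have N := key eps eps0.
near=> e; have e0 : 0 < e by near: e; exact: nbhs_right_gt.
have [L h] : L2 mu (Om e) (u_ e) /\ nrm mu (Om e) (fun x => u_ e x - U_eps Omega0 e u x) <= eps.
  by near: e; exact: N.
by rewrite /= E//= sub0r normrN ger0_norm ?nrm_ge0.
Unshelve. all: by end_near.
Qed.

End convergence.

Theorem theorem3p1 (R : realType) (n : nat) (hN : (3 <= n.+1)%N)
    (Omega0 : set 'rV[R]_n)
    (Omega0_open : open Omega0) (Omega0_bounded : bounded_set Omega0)
    (Omega0_C2 : C2_boundary Omega0)
    (Omega_domain : forall e : R, 0 < e -> domain (thin Omega0 e))
    (delta : R -> R)
    (delta_itv : forall e : R, 0 < e -> 0 < delta e < e)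
    (delta_small : delta e / e @[e --> 0^'+] --> (0 : R))
    (z : R) (z_gt0 : 0 < z)
    (f : R -> R) (f_L2 : in_L2 lebesgue_measure `]0, 1[ f)
    (f_ : R -> 'rV[R]_n.+1 -> R)
    (f__L2 : forall e : R, 0 < e ->
      in_L2 (lebesgue_rV n.+1) (thin Omega0 e) (f_ e))
    (f__cvg :
      L2norm (lebesgue_rV n.+1) (thin Omega0 e) (f_ e \- U_eps Omega0 e f)
        @[e --> (0 : R)^'+] --> 0%E)
    (u_ : R -> 'rV[R]_n.+1 -> R)
    (u__sol : forall e : R, 0 < e ->
      weak_solution (thin Omega0 e) (holes (thin Omega0 e) (delta e)) z
        (f_ e) (u_ e)) :
  exists u : R -> R,
    [/\ exists u' : R -> R, in_H1_01 u u',
        L2norm (lebesgue_rV n.+1) (thin Omega0 e) (u_ e \- U_eps Omega0 e u)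
          @[e --> (0 : R)^'+] --> 0%E
      & neumann_solution (z + strange_mu n.+1) f u].
Proof.
(* The base has dimension m + 1 and the domain m + 2, so N >= 3 becomes 0 < m. *)
case: n hN Omega0 Omega0_open Omega0_bounded Omega0_C2 Omega_domain f_ f__L2 f__cvg u_ u__sol => [//|m] hN
  Omega0 oO bO _ domO f_ f_2 f_cvg u_ u_sol.
have m0 : (0 < m)%N by [].
exact: (homogenized_limit m0 oO bO domO delta_itv delta_small z_gt0 f_L2 f_2 f_cvg u_sol).
Qed.
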